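(* Let $M=\overline I$ (with $I\subset\mathbf R$ a bounded open interval) or $M=\mathbf T=\mathbf R/\mathbf Z$, and let $\sigma\ge0$. Let $F:\mathbf R\to\mathbf R$ be continuous and nonnegative, with $F(v)=0$ if and only if $v=1$, and with $\liminf_{|v|\to\infty}F(v)>0$. Then the following hold. (i) (liminf inequality) Let $\{v_\varepsilon\}_{0<\varepsilon<1}\subset H^1(M)\subset C(M)$ satisfy $v_\varepsilon\xrightarrow{g}\Xi\in\mathcal B$ as $\varepsilon\to0$, and let $\{u_\varepsilon\}\subset L^1(M)$ satisfy $u_\varepsilon\to u$ in $L^1(\mathring M)$ as $\varepsilon\to0$. Then $$E^0_{\mathrm{KWC}}(u,\Xi,M)\le\liminf_{\varepsilon\to0}E^\varepsilon_{\mathrm{KWC}}(u_\varepsilon,v_\varepsilon).$$ (ii) (limsup inequality) For any $\Xi\in\mathcal A_0$ and $u\in BV(\mathring M)$ there exist $\{w_\varepsilon\}_{0<\varepsilon<1}\subset H^1(\mathring M)\subset C(M)$ and $\{u_\varepsilon\}_{0<\varepsilon<1}\subset L^1(M)$ such that $w_\varepsilon\xrightarrow{g}\Xi$ and $u_\varepsilon\to u$ in $L^1$ as $\varepsilon\to0$, and $$E^0_{\mathrm{KWC}}(u,\Xi,M)=\lim_{\varepsilon\to0}E^\varepsilon_{\mathrm{KWC}}(u_\varepsilon,w_\varepsilon).$$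
   Context: $\mathring M$ is the interior of $M$: $\mathring M=I$ if $M=\overline I$, and $\mathring M=\mathbf T$ if $M=\mathbf T$. Elements of $H^1$ are identified with their continuous representatives. Set-valued functions and graph convergence. A set-valued function $\Gamma$ on $M$ assigns to each $x\in M$ a compact set $\Gamma(x)\subset\mathbf R$; $\operatorname{graph}\Gamma=\{(x,y)\in M\times\mathbf R: y\in\Gamma(x)\}$. $\mathcal B$ is the set of all $\Gamma$ such that $\operatorname{graph}\Gamma$ is compact, with metric $d_g(\Gamma_1,\Gamma_2)=d_H(\operatorname{graph}\Gamma_1,\operatorname{graph}\Gamma_2)$, where $d_H$ is the Hausdorff distance on $M\times\mathbf R$ (product metric $(d_M(z_1,w_1)^2+|z_2-w_2|^2)^{1/2}$). A function $v\in C(M)$ is identified with $\Gamma_v$, $\Gamma_v(x)=\{v(x)\}$, and $v_\varepsilon\xrightarrow{g}\Xi$ means $d_g(\Gamma_{v_\varepsilon},\Xi)\to0$ as $\varepsilon\to0$. $\mathcal A_0$ is the set of $\Xi\in\mathcal B$ such that $\Xi(x)$ is a closed interval (possibly a point) for every $x\in M$ and there is an at most countable (possibly finite) set $\Sigma=\{x_i\}\subset M$ (the exceptional points of $\Xi$) with $\Xi(x)=\{1\}$ for $x\notin\Sigma$ and $\Xi(x_i)=[\xi_i^-,\xi_i^+]$, $\xi_i^-<\xi_i^+$, $\xi_i^-\le1\le\xi_i^+$, for $x_i\in\Sigma$. Functionals. For $\varepsilon>0$, $u\in L^1(\mathring M)$, $v\in H^1(M)$, $$E^\varepsilon_{\mathrm{KWC}}(u,v)=\sigma\int_{\mathring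 M}v^2\left|\frac{du}{dx}\right|+E^\varepsilon_{\mathrm{sMM}}(v),\qquad E^{\varepsilon}_{\mathrm{sMM}}(v)=\frac{\varepsilon}{2}\int_M\left|\frac{dv}{dx}\right|^2dx+\frac1{2\varepsilon}\int_MF(v)\,dx,$$ where the weighted total variation is $$\int_{\mathring M}v^2\left|\frac{du}{dx}\right|=\sup\left\{\int_{\mathring M}\varphi_x\,u\,dx:\ \varphi\in C^1_c(\mathring M),\ |\varphi(x)|\le v(x)^2\right\}\in[0,\infty],$$ and $0\cdot\infty=0$. Let $G(v)=\left|\int_1^v\sqrt{F(\tau)}\,d\tau\right|$. For $\Xi\in\mathcal A_0$, $$E^0_{\mathrm{sMM}}(\Xi,\mathbf T)=2\sum_i\{G(\xi_i^-)+G(\xi_i^+)\},$$ $$E^0_{\mathrm{sMM}}(\Xi,\overline I)=\sum_i\left\{2(G(\xi_i^-)+G(\xi_i^+))-\kappa_i\max(G(\xi_i^-),G(\xi_i^+))\right\},$$ with $\kappa_i=0$ if $x_i\in I$ and $\kappa_i=1$ if $x_i\in\partial I$. For $u\in BV(\mathring M)$ let $d(x)=|u(x+0)-u(x-0)|$ for $x\in\mathring M$, where $u(x\pm0)$ are the traces from the right and left, and $J_u=\{x\in\mathring M: d(x)>0\}$. For $(u,\Xi)\in L^1(\mathring M)\times\mathcal B$, $$E^0_{\mathrm{KWC}}(u,\Xi,M)=\sigma\int_{\mathring M\setminus(J_u\cap\Sigma)}\left|\frac{du}{dx}\right|+\sigma\sum_id_i(\xi_i^-)^2+E^0_{\mathrm{sMM}}(\Xi,M)$$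 if $u\in BV(\mathring M)$ and $\Xi\in\mathcal A_0$, and $E^0_{\mathrm{KWC}}(u,\Xi,M)=\infty$ otherwise. Here $d_i=d(x_i)$ for $x_i\in\Sigma\cap\mathring M$ and $d_i=0$ for $x_i\in\Sigma\cap\partial M$, and $\int_A|du/dx|$ is the total variation measure of $u$ evaluated on $A$.
   Formalization: In (i) two assumptions are added, as it fails otherwise: if σ=0, u is in BV; if σ>0, u∈BV and Ξ∈A_0, then ξ_i^-≥0 at every exceptional point where u jumps (else v_ε crosses 0 and u_ε can jump there at no cost). *)

(* Defs.v *)
From mathcomp Require Import all_boot all_order all_algebra.
From mathcomp Require Import all_classical all_reals all_analysis.

Set Implicit Arguments.
Unset Strict Implicit.
Unset Printing Implicit Defensive.

Import Order.TTheory GRing.Theory Num.Theory.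
Import numFieldNormedType.Exports.

Local Open Scope classical_set_scope.
Local Open Scope ring_scope.

(* The one-dimensional spaces M: the closure [a, b] of a nonempty bounded open
   interval, and the circle T = R / Z.  Points of T are represented by reals,
   so objects living on T (functions, sets, set-valued functions) are
   1-periodic objects on R.  On a segment, objects are also given on R, and
   their values outside [a, b] are irrelevant. *)
Inductive domain (R : realType) : Type :=
| Segment (a b : R) of a < b
| Torus.
Arguments Torus {R}.

Section space.
Context {R : realType}.
Implicit Type M : domain R.

Definition on_domain M (Y : Type) (f : R -> Y) : Prop :=
  if M is Torus then forall x, f (x + 1) = f x else True.

Definition carrier M : set R :=
  if M is @Segment _ a b _ then `[a, b] else setT.

Definition interior_dom M : set R :=
  if M is @Segment _ a b _ then `]a, b[ else setT.

(* Closed fundamental cell.  It is used for integrals over M or over its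
   interior (they differ by null sets), and for graphs: for T, a subset of
   T * R is compact iff its part above [0, 1] is compact in R * R. *)
Definition cell M : set R :=
  if M is @Segment _ a b _ then `[a, b] else `[0, 1].

(* Each point of M has exactly one representative here; used to index sums. *)
Definition reps M : set R :=
  if M is @Segment _ a b _ then `[a, b] else `[0, 1[.

Definition is_endpoint M (x : R) : bool :=
  if M is @Segment _ a b _ then (x == a) || (x == b) else false.

Definition dist_dom M (x y : R) : R :=
  match M with
  | Segment _ _ _ => `|x - y|
  | Torus => inf [set `|x - y - k%:~R| | k in [set: int]]
  end.

End space.

Section set_valued.
Context {R : realType}.
Implicit Types (M : domain R) (Gam Xi : R -> set R).

Definition graph M Gam : set (R * R) := [set p | cell M p.1 /\ Gam p.1 p.2].

Definition dist_prod M (z w : R * R) : R :=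
  Num.sqrt (dist_dom M z.1 w.1 ^+ 2 + `|z.2 - w.2| ^+ 2).

Definition hausdorff_dist M (A B : set (R * R)) : \bar R :=
  maxe
    (ereal_sup [set ereal_inf [set (dist_prod M z w)%:E | w in B] | z in A])
    (ereal_sup [set ereal_inf [set (dist_prod M z w)%:E | z in A] | w in B]).

Definition dist_graph M Gam1 Gam2 : \bar R :=
  hausdorff_dist M (graph M Gam1) (graph M Gam2).

(* The class B. *)
Definition compact_graph M Gam : Prop :=
  [/\ on_domain M Gam,
      forall x, carrier M x -> compact (Gam x) &
      compact (graph M Gam)].

Definition graph_of (v : R -> R) : R -> set R := fun x => [set v x].

Definition graph_cvg M (v : R -> R -> R) Xi : Prop :=
  dist_graph M (graph_of (v eps)) Xi @[eps --> 0^'+] --> 0%E.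

(* The class A_0. *)
Definition A0 M Xi : Prop :=
  compact_graph M Xi /\
  exists Sigma : set R,
    [/\ countable (Sigma `&` reps M),
        on_domain M Sigma, Sigma `<=` carrier M,
        forall x, carrier M x -> ~ Sigma x -> Xi x = [set 1] &
        forall x, Sigma x -> exists xm xp : R,
          [/\ xm < xp, xm <= 1 <= xp & Xi x = `[xm, xp]%classic]].

(* For Xi in A_0 the set Sigma and the endpoints xi^-, xi^+ are determined by
   Xi, and are given by the next three definitions. *)
Definition exceptional M Xi : set R :=
  [set x | carrier M x /\ Xi x <> [set 1]].

Definition xi_minus Xi (x : R) : R := inf (Xi x).

Definition xi_plus Xi (x : R) : R := sup (Xi x).

End set_valued.

Section function_spaces.
Context {R : realType}.
Local Notation mu := (@lebesgue_measure R).
Implicit Types (M : domain R) (u v w g phi : R -> R) (U A : set R).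

Definition L1 M u : Prop :=
  on_domain M u /\ mu.-integrable (cell M) (EFin \o u).

Definition L2 M u : Prop :=
  [/\ on_domain M u, measurable_fun (cell M) u &
      (\int[mu]_(x in cell M) ((u x) ^+ 2)%:E < +oo)%E].

Definition L1_cvg M (us : R -> R -> R) u : Prop :=
  (\int[mu]_(x in cell M) `|us eps x - u x|%:E)%E @[eps --> 0^'+] --> 0%E.

(* C^1 functions with compact support in an open subset U of the interior
   of M.  A closed subset of a bounded interval is compact, and so is, in T,
   any closed (periodic) set; hence only the inclusion is required. *)
Definition C1c M U phi : Prop :=
  [/\ on_domain M phi,
      forall x, derivable phi x 1, continuous (derive1 phi) &
      closure [set x | phi x != 0] `<=` U].

Definition weak_derivative M v g : Prop :=
  L2 M g /\
  forall phi, C1c M (interior_dom M) phi ->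
    \int[mu]_(x in cell M) (v x * derive1 phi x) =
    - \int[mu]_(x in cell M) (g x * phi x).

(* Elements of H^1(M), as continuous functions on M. *)
Definition H1 M v : Prop :=
  [/\ L2 M v, {within carrier M, continuous v} &
      exists g, weak_derivative M v g].

(* dv/dx; it is unique up to a null set. *)
Definition wderiv M v : R -> R :=
  xget (fun=> 0) [set g | weak_derivative M v g].

(* int_U w |du/dx| *)
Definition weighted_tv M U w u : \bar R :=
  ereal_sup [set (\int[mu]_(x in cell M) (derive1 phi x * u x)%:E)%E
            | phi in [set phi | C1c M U phi /\
                                forall x, U x -> `|phi x| <= w x]].

Definition BV M u : Prop :=
  L1 M u /\ (weighted_tv M (interior_dom M) (fun=> 1%R) u < +oo)%E.

(* The total variation measure |du/dx| of a Borel set A, by outer regularity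
   from its values on open sets. *)
Definition tv_measure M u A : \bar R :=
  ereal_inf [set weighted_tv M U (fun=> 1%R) u
            | U in [set U | [/\ open U, on_domain M U, A `<=` U &
                                U `<=` interior_dom M]]].

(* The traces u(x+0) and u(x-0); they depend only on the a.e. class of u. *)
Definition right_trace u (x : R) : R :=
  get [set l : R |
    r^-1 * \int[mu]_(y in `]x, x + r[) `|u y - l| @[r --> 0^'+] --> (0 : R)].

Definition left_trace u (x : R) : R :=
  get [set l : R |
    r^-1 * \int[mu]_(y in `]x - r, x[) `|u y - l| @[r --> 0^'+] --> (0 : R)].

(* d(x) for x in the interior, 0 at the endpoints. *)
Definition jump M u (x : R) : R :=
  if x \in interior_dom M then `|right_trace u x - left_trace u x| else 0.

Definition jump_set M u : set R := [set x | 0 < jump M u x].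

End function_spaces.

Section functionals.
Context {R : realType}.
Local Notation mu := (@lebesgue_measure R).
Implicit Types (M : domain R) (F u v : R -> R) (Xi : R -> set R).

(* The filter of |t| -> oo. *)
Definition norm_infty : set (set R) :=
  [set A | exists r : R, forall t, r < `|t| -> A t].

Definition E_sMM M F (eps : R) v : \bar R :=
  ((eps / 2)%:E * \int[mu]_(x in cell M) (`|wderiv M v x| ^+ 2)%:E
   + (2 * eps)^-1%:E * \int[mu]_(x in cell M) (F (v x))%:E)%E.

Definition E_KWC M (sigma : R) F (eps : R) u v : \bar R :=
  (sigma%:E * weighted_tv M (interior_dom M) (fun x => (v x ^+ 2)%R) u
   + E_sMM M F eps v)%E.

(* |int_1^v sqrt F|, as an integral over the segment joining 1 and v; the
   integrand is nonnegative. *)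
Definition G F (v : R) : R :=
  \int[mu]_(t in `[Num.min 1 v, Num.max 1 v]) Num.sqrt (F t).

Definition E0_sMM M F Xi : \bar R :=
  match M with
  | Torus =>
    (2%:E * esum (exceptional M Xi `&` reps M)
              (fun x => (G F (xi_minus Xi x) + G F (xi_plus Xi x))%:E))%E
  | Segment _ _ _ =>
    esum (exceptional M Xi `&` reps M)
      (fun x =>
        (2 * (G F (xi_minus Xi x) + G F (xi_plus Xi x))
         - (is_endpoint M x)%:R
           * Num.max (G F (xi_minus Xi x)) (G F (xi_plus Xi x)))%:E)
  end.

Definition E0_KWC M (sigma : R) F u Xi : \bar R :=
  if `[< BV M u /\ A0 M Xi >] then
    (sigma%:E *
       tv_measure M u
         (interior_dom M `\` (jump_set M u `&` exceptional M Xi))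
     + sigma%:E *
       esum (exceptional M Xi `&` reps M)
         (fun x => (jump M u x * xi_minus Xi x ^+ 2)%:E)
     + E0_sMM M F Xi)%E
  else +oo%E.

End functionals.

(* Main.v *)
(* Lower bound: by AM-GM the density eps/2 v'^2 + F(v)/(2 eps) dominates |(H o v)'|, where
   H(t) = int_1^t sqrt F, so that the energy of v on an interval is at least the variation of
   H o v.  Graph convergence forces v_eps to visit both xi^- and xi^+ near an exceptional point,
   and the potential term forces it to be close to 1 somewhere on each side of that point which
   lies in M.  The weighted total variation is estimated by duality: away from finitely many
   points v_eps is almost at least 1 and near such a point x it is almost at least xi^-(x), so
   that a test function bounded by the corresponding step weight is admissible, and
   u |-> int phi' u is continuous in L^1.  Splitting a test function into its parts near and away
   from the points turns |Du| into the sum of the jumps and the variation off them.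

   Upper bound: u_eps = u, and w_eps = 1 except near finitely many exceptional points, where it
   follows profiles that cross from 1 to xi^-, to xi^+ and back to 1 at almost optimal cost, with
   w_eps = xi^- at the point itself.  The finite set carries almost all of the jumps and of the
   cost, and contains a net of the graph of Xi; a diagonal argument concludes. *)

Require Import Defs.
From mathcomp Require Import all_boot all_order all_algebra.
From mathcomp Require Import ring lra zify.
From mathcomp Require Import all_classical all_reals all_analysis.
From mathcomp Require Import measurable_realfun.
Set Implicit Arguments.
Unset Strict Implicit.
Unset Printing Implicit Defensive.
Import Order.TTheory GRing.Theory Num.Theory.
Import numFieldNormedType.Exports.

Local Open Scope classical_set_scope.
Local Open Scope ring_scope.

(* [lra] reifies the whole context, which is slow, and fails on hypotheses about integrals or
   extended reals. *)
Ltac rlra :=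
  repeat match goal with
  | H : ?T |- _ =>
    lazymatch T with
    | context [@Rintegral] => idtac
    | context [@extended] => idtac
    | context [@EFin] => idtac
    | is_true (Order.le _ _) => fail
    | is_true (Order.lt _ _) => fail
    | is_true (_ && _) => fail
    | _ = _ => fail
    | _ => idtac
    end; clear H
  end; lra.

(** * C^1 functions and cutoffs *)

Section C1.
Context {R : realType}.
Implicit Types f g : R -> R.

(** The traces are limits picked by a choice operator, while [BV] only bounds a supremum of
    pairings, so the existence of traces must be extracted from test functions: near a point, once
    the point itself is removed, the variation tends to 0, and this controls the oscillation of [u]
    over its Lebesgue points. The argument uses finite variation off a finite set only, which is how
    a bound on the energies puts [u] in BV: the weight can degenerate near finitely many points
    only. Compactness enters through an alternative: the energies eventually exceed a given level,
    or they stay bounded for arbitrarily small [eps]. In the second case every cost threshold is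
    reached at finitely many points, whence [A0]. [tv_measure] is an infimum over open sets. For the
    lower estimate one competitor suffices, the complement of finitely many points; the recovery
    sequence needs that no open set does better, which is a compactness argument on supports.
    [E0_sMM] may be infinite on [A0]. The lower estimates of the first part then force the energies
    of the recovery sequence to diverge. *)

Definition C1 f : Prop := (forall x, derivable f x 1) /\ continuous (derive1 f).

Lemma C1_cont f : C1 f -> continuous f.
Proof.
move=> [df _] x; apply: differentiable_continuous.
exact/derivable1_diffP/df.
Qed.

Arguments C1_cont {f} _ _.

Lemma C1_near f : (forall x : R, exists g, C1 g /\ \forall y \near x, f y = g y) ->
  C1 f.
Proof.
have d1 g h (x : R) : (\forall y \near x, g y = h y) -> (derive1 g) x = (derive1 h) x.
  by move=> gh; rewrite !derive1E; exact: near_eq_derive.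
move=> H; split=> x; have [g [[dg cg] fg]] := H x.
- by apply: near_eq_derivable (dg x); apply: filterS fg => y ->.
- have e : \forall y \near x, (derive1 f) y = (derive1 g) y.
    by apply: filterS (near_join fg) => y; exact: d1.
  rewrite /continuous_at (d1 _ _ _ fg).
  have := cg x; rewrite /continuous_at; apply: cvg_trans.
  apply: (@near_eq_cvg _ _ (nbhs x)).
  by apply: filterS e => y ->.
Unshelve. all: by end_near. Qed.

Lemma derive1_near g h (x : R) : (\forall y \near x, g y = h y) -> (derive1 g) x = (derive1 h) x.
Proof. by move=> gh; rewrite !derive1E; exact: near_eq_derive. Qed.

Lemma is_derive1E f (x a : R) : is_derive x 1 f a -> derivable f x 1 /\ (derive1 f) x = a.
Proof. by move=> [h <-]; rewrite derive1E. Qed.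

Lemma C1_is_derive f (x : R) : C1 f -> is_derive x 1 f ((derive1 f) x).
Proof. by move=> [h _]; rewrite derive1E; exact/derivableP. Qed.

Lemma C1_intro f g : (forall x : R, is_derive x 1 f (g x)) -> continuous g ->
  C1 f /\ (derive1 f) = g.
Proof.
move=> h cg; have e : (derive1 f) = g.
  by apply/funext => x; have [_ ->] := is_derive1E (h x).
by split => //; split; [move=> x; have [] := is_derive1E (h x)|rewrite e].
Qed.

Lemma C1D f g : C1 f -> C1 g ->
  C1 (fun x => f x + g x) /\
  derive1 (fun x => f x + g x) = (fun x => (derive1 f) x + (derive1 g) x).
Proof.
move=> cf cg; apply: C1_intro => [x|x].
- by apply: is_deriveD; exact: C1_is_derive.
- by apply: cvgD; [exact: (cf.2 x)|exact: (cg.2 x)].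
Qed.

Lemma C1N f : C1 f ->
  C1 (fun x => - f x) /\ derive1 (fun x => - f x) = (fun x => - (derive1 f) x).
Proof.
move=> cf; apply: C1_intro => [x|x].
- by apply: is_deriveN; exact: C1_is_derive.
- by apply: cvgN; exact: (cf.2 x).
Qed.

Lemma C1B f g : C1 f -> C1 g ->
  C1 (fun x => f x - g x) /\
  derive1 (fun x => f x - g x) = (fun x => (derive1 f) x - (derive1 g) x).
Proof.
move=> cf cg; have [cn en] := C1N cg; have [c e] := C1D cf cn.
by split => //; rewrite e en.
Qed.

Lemma C1M f g : C1 f -> C1 g ->
  C1 (fun x => f x * g x) /\
  derive1 (fun x => f x * g x) = (fun x => (derive1 f) x * g x + f x * (derive1 g) x).
Proof.
move=> cf cg; apply: C1_intro => [x|x].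
- apply: is_derive_eq.
    by apply: is_deriveM; exact: C1_is_derive.
  by rewrite /GRing.scale /= addrC mulrC.
- apply: cvgD.
    by apply: cvgM; [exact: (cf.2 x)|exact: (C1_cont cg x)].
  by apply: cvgM; [exact: (C1_cont cf x)|exact: (cg.2 x)].
Qed.

Lemma C1_cst (c : R) : C1 (fun=> c) /\ derive1 (fun _ : R => c) = fun=> 0.
Proof. by apply: C1_intro => x; exact: cvg_cst. Qed.

Lemma C1Z c f : C1 f ->
  C1 (fun x => c * f x) /\ derive1 (fun x => c * f x) = (fun x => c * (derive1 f) x).
Proof.
move=> cf; have [k ek] := C1_cst c; have [h eh] := C1M k cf.
by split => //; rewrite eh ek; apply/funext => x; rewrite mul0r add0r.
Qed.

Lemma C1_affine f (c d : R) : C1 f ->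
  C1 (fun x => f (c * x + d)) /\
  derive1 (fun x => f (c * x + d)) = (fun x => c * (derive1 f) (c * x + d)).
Proof.
move=> cf; apply: C1_intro => [x|x].
- have h : is_derive x 1 (fun x : R => c * x + d) c.
    apply: is_derive_eq.
    rewrite /GRing.scale/= ?mulr0 mulr1 ?add0r addr0//.
  have := @is_derive1_comp _ f (fun x => c * x + d) x _ _
     (C1_is_derive (c * x + d) cf) h.
  by rewrite mulrC.
- apply: cvgM; first exact: cvg_cst.
  apply: (@continuous_comp _ _ _ (fun x => c * x + d) (derive1 f) x); last exact: (cf.2 (c * x + d)).
  by apply: cvgD; [apply: cvgM; [exact: cvg_cst|]|exact: cvg_cst].
Qed.

Lemma C1_sum (I : Type) (s : seq I) (P : I -> R -> R) :
  (forall i, C1 (P i)) ->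
  C1 (fun x => \sum_(i <- s) P i x) /\
  derive1 (fun x => \sum_(i <- s) P i x) = (fun x => \sum_(i <- s) (derive1 (P i)) x).
Proof.
move=> h; elim: s => [|i s [ih1 ih2]].
  have -> : (fun x => \sum_(i <- [::]) P i x) = fun=> 0.
    by apply/funext => x; rewrite big_nil.
  have [a b] := C1_cst (0:R); split => //; rewrite b.
  by apply/funext => x; rewrite big_nil.
have -> : (fun x => \sum_(j <- i :: s) P j x) =
          (fun x => P i x + \sum_(j <- s) P j x).
  by apply/funext => x; rewrite big_cons.
have [a b] := C1D (h i) ih1; split => //; rewrite b ih2.
by apply/funext => x; rewrite big_cons.
Qed.

(** Translates of the squared positive part generate the C1 quadratic splines: their derivatives are
    piecewise linear, so a trapezoid can be prescribed as a derivative. *)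
Definition sqpos (t : R) : R := Num.max t 0 ^+ 2.

Lemma C1_sqpos : C1 sqpos /\ derive1 sqpos = fun t => 2 * Num.max t 0.
Proof.
have c : continuous (fun t : R => 2 * Num.max t 0).
  move=> x; apply: cvgM; first exact: cvg_cst.
  have i : {for x, continuous (@idfun R)} by exact: cvg_id. have k: {for x, continuous (fun=> 0 : R)} by exact: cvg_cst. exact: (continuous_max i k).
apply: C1_intro => // x.
have [x0|x0|->] := ltgtP x 0.
- have h : is_derive x 1 (fun _ : R => 0 : R) (2 * 0).
    by rewrite mulr0; exact: is_derive_cst.
  suff H : \forall y \near x, 0 = sqpos y by exact: (near_eq_is_derive H h).
  near=> y.
  rewrite /sqpos max_r ?expr0n//=; near: y.
  by apply: filterS (lt_nbhsl x0) => y /ltW.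
- have h : is_derive x 1 (fun y : R => y ^+ 2 : R) (2 * x).
    apply: is_derive_eq.
    by rewrite /GRing.scale/= mulr1 ?expr1 ?mulr_natl ?mulr2n.
  suff H : \forall y \near x, y ^+ 2 = sqpos y by exact: (near_eq_is_derive H h).
  near=> y.
  rewrite /sqpos max_l//; near: y.
  by apply: filterS (lt_nbhsr x0) => y /ltW.
- rewrite mulr0.
  (* At the kink the difference quotient is at most [|h|] in absolute value. *)
  have h : h^-1 *: (sqpos (h *: 1 + 0) - sqpos 0) @[h --> (0:R)^'] --> (0:R).
    apply/cvgr0Pnorm_lt => e e0; near=> h.
    have h0 : h != 0 by near: h; exact: nbhs_dnbhs_neq.
    rewrite addr0 /sqpos maxxx expr0n/= subr0 /GRing.scale/= mulr1.
    rewrite normrM normfV; rewrite ltr_pdivrMl ?normr_gt0//.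
    have le : `|Num.max h 0| <= `|h|.
      by rewrite /Num.max; case: ifP => _ //; rewrite normr0.
    rewrite normrX expr2; apply: (@le_lt_trans _ _ (`|h| * `|h|)).
      by rewrite ler_pM.
    rewrite ltr_pM2l ?normr_gt0//.
    by near: h; apply: dnbhs0_lt.
  split; first by apply/cvg_ex; exists 0.
  exact/cvg_lim.
Unshelve. all: by end_near. Qed.

End C1.

Section calculus.
Context {R : realType}.
Local Notation mu := (@lebesgue_measure R).
Implicit Types f g : R -> R.

Lemma C1_nondecreasing f (a b : R) : C1 f ->
  (forall x, 0 <= derive1 f x) -> a <= b -> f a <= f b.
Proof.
move=> cf f0; rewrite le_eqVlt => /predU1P[->//|ab].
have [c _ e] : exists2 c, c \in `]a, b[%R & f b - f a = derive1 f c * (b - a).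
  apply: MVT => // [x _|]; first exact: C1_is_derive.
  by apply: continuous_subspaceT; exact: (C1_cont cf).
by rewrite -subr_ge0 e mulr_ge0// subr_ge0 ltW.
Qed.

(** The expression is a trapezoid on [0, 1]: it climbs to [k] on [0, k], stays there, and descends
    on [1 - k, 1]. The ramps do not overlap because [k] is at most 1/2. *)
Lemma trapezoid_bounds (k t : R) : 0 < k -> k <= 1 / 2 ->
  0 <= Num.max t 0 - Num.max (t - k) 0 - (Num.max (t + (k - 1)) 0 - Num.max (t - 1) 0) <= k.
Proof.
by move=> k0 k2; apply/andP; split; rewrite /Num.max; do 4 case: ifPn; rewrite -?leNgt; lra.
Qed.

(** Almost optimal profiles need a transition in unit time whose slope barely exceeds 1. The
    derivative is a normalized trapezoid with ramps of width [k]; its plateau is 1/(1 - k), which is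
    at most 1 + e as soon as [k] is at most e/(1 + e). *)
Lemma step_exists (e : R) : 0 < e -> exists S : R -> R,
  [/\ C1 S, (forall t, t <= 0 -> S t = 0 /\ derive1 S t = 0),
      (forall t, 1 <= t -> S t = 1 /\ derive1 S t = 0),
      (forall t, 0 <= S t <= 1) & forall t, 0 <= derive1 S t <= 1 + e].
Proof.
move=> e0; pose k := Num.min (1 / 2) (e / (1 + e)).
have e1 : 0 < 1 + e by rewrite addr_gt0.
have k0 : 0 < k by rewrite /k lt_min divr_gt0// divr_gt0.
have k2 : k <= 1 / 2 by rewrite /k ge_min lexx.
have ke : k * (1 + e) <= e.
  by rewrite -ler_pdivlMr// /k ge_min lexx orbT.
clearbody k; have k1 : 0 < 1 - k by rlra.
have c0 : 0 < k * (1 - k) by rewrite mulr_gt0.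
pose c := (2 * (k * (1 - k)))^-1.
pose q (d : R) t := sqpos (1 * t + d).
have qP d : C1 (q d) /\ derive1 (q d) = (fun t => 1 * (2 * Num.max (1 * t + d) 0)).
  have [h1 h2] := @C1_sqpos R.
  by have [] := C1_affine 1 d h1; rewrite h2.
pose P0 t := q 0 t - q (- k) t.
pose P1 t := q (k - 1) t - q (- 1) t.
have [c0P d0P] := C1B (qP 0).1 (qP (- k)).1.
have [c1P d1P] := C1B (qP (k - 1)).1 (qP (- 1)).1.
have [cP dP] := C1B c0P c1P.
have [cS dS] := C1Z c cP.
have dSE t : derive1 (fun t => c * (P0 t - P1 t)) t = (k * (1 - k))^-1 *
    (Num.max t 0 - Num.max (t - k) 0 - (Num.max (t + (k - 1)) 0 - Num.max (t - 1) 0)).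
  rewrite [in LHS]/P0 /P1 dS dP d0P d1P (qP _).2 (qP _).2 (qP _).2 (qP _).2.
  rewrite !mul1r addr0 /c invfM -mulrA mulrCA; congr (_ * _).
  by rewrite -!mulrBr mulrA mulVf// mul1r.
have dS01 t : 0 <= derive1 (fun t => c * (P0 t - P1 t)) t <= 1 + e.
  rewrite dSE; apply/andP; split.
    apply: mulr_ge0; first by rewrite invr_ge0 ltW.
    by have /andP[] := trapezoid_bounds t k0 k2.
  rewrite ler_pdivrMl//; apply: (@le_trans _ _ k); last by nra.
  by have /andP[] := trapezoid_bounds t k0 k2.
have S0 t : t <= 0 -> c * (P0 t - P1 t) = 0.
  move=> t0; rewrite /P0 /P1 /q /sqpos !max_r; [ring|rlra..].
have S1 t : 1 <= t -> c * (P0 t - P1 t) = 1.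
  move=> t1; rewrite /P0 /P1 /q /sqpos !max_l; [|rlra..].
  rewrite /c; have : k != 0 by rewrite gt_eqF.
  have : 1 - k != 0 by rewrite gt_eqF.
  by move=> *; field; apply/andP.
exists (fun t => c * (P0 t - P1 t)); split => // t.
- move=> t0; split; first exact: S0.
  rewrite dSE !max_r; [ring|rlra..].
- move=> t1; split; first exact: S1.
  rewrite dSE !max_l; [ring|rlra..].
- have mono := @C1_nondecreasing _ _ _ cS (fun x => (andP (dS01 x)).1).
  have [t0|t0] := leP t 0; first by rewrite S0// lexx ler01.
  have [t1|t1] := leP 1 t; first by rewrite S1// lexx ler01.
  by rewrite -[X in X <= _ <= _](S0 0)// -[X in _ <= _ <= X](S1 1)// !mono// ltW.
Qed.

End calculus.

(** * Distances on the domain *)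

Section shift.
Context {R : realType}.
Local Notation mu := (@lebesgue_measure R).

(** Lebesgue measure is determined by its values on half-open intervals, so it equals its image
    under a translation. Signed integrands are handled through their positive and negative parts. *)
Lemma integral_shift (D : set R) (f : R -> \bar R) (c : R) :
  measurable D -> measurable_fun D f ->
  (\int[mu]_(x in D) f x =
   \int[mu]_(x in (fun x : R => (x + c)%R) @^-1` D) f (x + c)%R)%E.
Proof.
move=> mD mf.
have ms : measurable_fun [set: measurableTypeR R] (fun x : R => x + c : measurableTypeR R).
  by apply: measurable_funD.
have E (A : set R) : measurable A ->
    pushforward mu (fun x : R => x + c : measurableTypeR R) A = mu A.
  move=> mA; apply/esym/lebesgue_measure_unique => //= _ [[a b]] _ <-.
  rewrite /pushforward.
  have -> : (fun x : R => x + c) @^-1` `]a, b] = `]a - c, b - c]%classic.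
    by apply/seteqP; split => x /=; rewrite !in_itv/= ltrBlDr lerBrDr.
  rewrite !lebesgue_measure_itv/= !lte_fin ltrD2r; case: ifP => // _.
  by rewrite -!EFinD; congr EFin; ring.
have G (g : R -> \bar R) : measurable_fun D g -> (forall x, 0 <= g x)%E ->
    (\int[mu]_(x in D) g x =
     \int[mu]_(x in (fun x : R => (x + c)%R) @^-1` D) g (x + c)%R)%E.
  move=> mg g0; rewrite -(ge0_integral_pushforward ms)//.
  apply: eq_measure_integral => A mA _; exact/esym/E.
rewrite integralE [RHS]integralE; congr (_ - _)%E.
- by rewrite (G _ (measurable_funepos mf) (funepos_ge0 f)); apply: eq_integral => x _; rewrite !funeposE.
- by rewrite (G _ (measurable_funeneg mf) (funeneg_ge0 f)); apply: eq_integral => x _; rewrite !funenegE.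
Qed.

Lemma shift_itvcc (a b c : R) :
  (fun x : R => x + c) @^-1` `[a + c, b + c]%classic = `[a, b]%classic.
Proof. by apply/seteqP; split => x /=; rewrite !in_itv/= !lerD2r. Qed.

Lemma measurable_fun_shift (D : set R) (f : R -> \bar R) (c : R) :
  measurable D -> measurable_fun D f ->
  measurable_fun ((fun x : R => x + c) @^-1` D) (fun x => f (x + c)).
Proof.
move=> mD mf; apply: (@measurable_comp _ _ _ _ _ _ D) => //.
  by move=> _ [x h <-].
by apply: measurable_funTS; apply: measurable_funD.
Qed.

End shift.

(** * The circle as a quotient of the line *)

Section geometry.
Context {R : realType}.
Local Notation mu := (@lebesgue_measure R).
Implicit Types (M : domain R) (f : R -> R) (p q r x y t : R).

(* The representative of [t] closest to [p]; on a segment, [t] itself. *)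
Definition rep M p t : R :=
  if M is Torus then t - (Num.floor (t - p + 1 / 2))%:~R else t.

Definition eqM M x y : Prop :=
  if M is Torus then exists k : int, y = x + k%:~R else y = x.

Definition Nb M p r : set R := [set t | `|rep M p t - p| < r].

(** Up to radius 1/2 a ball of the circle lifts to a single interval of the line. *)
Definition small_radius M r : Prop := if M is Torus then r <= 1 / 2 else True.

Lemma near_dist t (e : R) : 0 < e -> \forall s \near t, `|t - s| < e.
Proof. by move=> e0; apply: (@cvgr_dist_lt _ _ _ (nbhs t) _ id). Qed.

Lemma eqM_refl M x : eqM M x x.
Proof. by case: M => //=; exists 0; rewrite addr0. Qed.

Lemma eqM_sym M x y : eqM M x y -> eqM M y x.
Proof.
by case: M => [a b ab /= ->//|/= [k ->]]; exists (- k); rewrite intrN addrK.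
Qed.

Lemma eqM_rep M p t : eqM M t (rep M p t).
Proof.
by case: M => //=; exists (- Num.floor (t - p + 1 / 2)); rewrite intrN.
Qed.

Lemma on_domain_eqM M (Y : Type) (f : R -> Y) x y :
  on_domain M f -> eqM M x y -> f x = f y.
Proof.
case: M => [a b ab /= _ ->//|/= pf [k ->]].
have pn z (n : nat) : f (z + n%:R) = f z.
  by elim: n => [|n ih]; rewrite ?addr0// -natr1 addrA pf.
case: k => n; first by rewrite pn.
by rewrite NegzE intrN -{1}(subrK n.+1%:R x) pn.
Qed.

Lemma rep_eqM M p x y : eqM M x y -> rep M p x = rep M p y.
Proof.
case: M => [a b ab /= ->//|/= [k ->]].
have -> : x + k%:~R - p + 1 / 2 = x - p + 1 / 2 + k%:~R by ring.
rewrite (_ : Num.floor (x - p + 1 / 2 + k%:~R) = Num.floor (x - p + 1 / 2) + k).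
  by rewrite intrD; ring.
apply: floor_def; have := floor_itv (x - p + 1 / 2).
by rewrite !intrD => /andP[h1 h2]; apply/andP; split; rlra.
Qed.

Lemma rep_on_domain M (Y : Type) (Q : R -> Y) p : on_domain M (Q \o rep M p).
Proof.
have := @rep_eqM M p; case: M => //= H x.
by rewrite -(H x (x + 1))//; exists 1.
Qed.

Lemma near_rep M p t : `|t - p| < 1 / 2 -> rep M p t = t.
Proof.
case: M => //=; rewrite ltr_norml => /andP[h1 h2].
by rewrite (_ : Num.floor _ = 0) ?subr0//; apply: floor_def; apply/andP; split; rlra.
Qed.

Lemma rep_torus p t : p - 1 / 2 <= rep Torus p t < p + 1 / 2.
Proof.
rewrite /rep; have := floor_itv (t - p + 1 / 2); rewrite intrD.
by move=> /andP[h1 h2]; apply/andP; split; rlra.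
Qed.

Lemma rep_dist_le M p t y : eqM M t y -> `|rep M p t - p| <= `|y - p|.
Proof.
move=> ty; rewrite (rep_eqM p ty).
have [h|h] := ltP `|y - p| (1 / 2); first by rewrite near_rep.
case: M ty => //= _; apply: le_trans h.
have := rep_torus p y; rewrite ler_norml => /andP[h1 h2].
by apply/andP; split; rewrite /= in h1 h2; rlra.
Qed.

(** The representative closest to [p] attains the infimum over integer translates. *)
Lemma dist_domE M p t : dist_dom M p t = `|rep M p t - p|.
Proof.
case: M => [a b ab /=|]; first by rewrite distrC.
rewrite [LHS]/dist_dom; apply/eqP; rewrite eq_le; apply/andP; split.
- apply: ge_inf; first by exists 0 => _ [k _ <-].
  exists (- Num.floor (t - p + 1 / 2)) => //.
  by rewrite intrN distrC; congr (`|_|); rewrite /=; ring.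
- apply: lb_le_inf; first by exists `|p - t - 0%:~R|; exists 0.
  move=> _ [k _ <-].
  have := @rep_dist_le Torus p t (t + k%:~R).
  have -> : `|t + k%:~R - p| = `|p - t - k%:~R| by rewrite distrC; congr (`|_|); ring.
  by apply; exists k.
Qed.

Lemma dist_dom_le M p t y : eqM M t y -> dist_dom M p t <= `|y - p|.
Proof. by rewrite dist_domE; exact: rep_dist_le. Qed.

Lemma dist_dom_ge0 M x y : 0 <= dist_dom M x y.
Proof. by rewrite dist_domE. Qed.

Lemma dist_dom_sym M x y : dist_dom M x y = dist_dom M y x.
Proof.
have H u v : dist_dom M u v <= dist_dom M v u.
  rewrite [leRHS]dist_domE.
  have := eqM_rep M v u; case: M => [a b ab _|[k e]] //.
  rewrite e distrC.
  have -> : `|v - (u + k%:~R)| = `|(v + (- k)%:~R) - u| by rewrite intrN; congr (`|_|); ring.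
  by apply: dist_dom_le; exists (- k).
by apply/eqP; rewrite eq_le !H.
Qed.

Lemma dist_dom_eqM M p x y : eqM M x y -> dist_dom M p x = dist_dom M p y.
Proof. by move=> h; rewrite !dist_domE (rep_eqM p h). Qed.

(** The shift [rep M p t - t] is an integer, and zero on a segment, so any other point may be moved
    along with [t]. *)
Lemma eqM_shift M p t s : eqM M s (s + (rep M p t - t)).
Proof.
have := eqM_rep M p t; case: M => [a b ab _|[k e]]; first by rewrite /= subrr addr0.
by rewrite e; exists k; ring.
Qed.

Lemma dist_dom_lip M p x y : dist_dom M p x <= dist_dom M p y + `|x - y|.
Proof.
rewrite [X in _ <= X + _]dist_domE.
apply: le_trans (dist_dom_le p (eqM_shift M p y x)) _.
have -> : x + (rep M p y - y) - p = (rep M p y - p) + (x - y) by ring.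
exact: ler_normD.
Qed.

Lemma dist_dom_triangle M x y z : dist_dom M x z <= dist_dom M x y + dist_dom M y z.
Proof.
rewrite (dist_dom_eqM x (eqM_rep M y z)) [X in _ + X]dist_domE.
exact: dist_dom_lip.
Qed.

Lemma NbE M p r t : Nb M p r t <-> dist_dom M p t < r.
Proof. by rewrite /Nb dist_domE. Qed.

(** On the circle [rep M p] jumps only at the points antipodal to [p]; elsewhere it is locally a
    translation. *)
Lemma rep_local M p t : dist_dom M p t < 1 / 2 ->
  \forall s \near t, rep M p s = s + (rep M p t - t).
Proof.
move=> h; have h0 : 0 < 1 / 2 - dist_dom M p t by rewrite subr_gt0.
apply: filterS (near_dist t h0) => s ts.
rewrite (rep_eqM p (eqM_shift M p t s)) near_rep//.
have -> : s + (rep M p t - t) - p = (rep M p t - p) + (s - t) by ring.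
rewrite (le_lt_trans (ler_normD _ _))// -dist_domE -ltrBrDl distrC.
exact: ts.
Qed.

Lemma C1_lift M p (Q : R -> R) (d : R) : C1 Q ->
  (M = Torus -> d < 1 / 2 /\ forall s, d <= `|s - p| -> Q s = 0) ->
  C1 (Q \o rep M p) /\ derive1 (Q \o rep M p) = derive1 Q \o rep M p.
Proof.
case: M => [a b ab cQ _ //|cQ /(_ erefl)[d2 Q0]].
have key t : exists g, [/\ C1 g, \forall s \near t, (Q \o rep Torus p) s = g s &
    derive1 g t = derive1 Q (rep Torus p t)].
  have [h|h] := ltP (dist_dom Torus p t) (1 / 2).
  - pose k := rep Torus p t - t.
    have [c e] := C1_affine 1 k cQ.
    exists (fun s => Q (1 * s + k)); split => //.
      by apply: filterS (rep_local h) => s es; rewrite mul1r /k -es.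
    by rewrite e !mul1r /k addrC subrK.
  - have [c e] := C1_cst (0 : R).
    exists (fun=> 0); split => //.
    + have d0 : 0 < 1 / 2 - d by rewrite subr_gt0.
      apply: filterS (near_dist t d0) => s h4; apply: Q0; rewrite -dist_domE.
      by have := dist_dom_lip Torus p t s => h3; rlra.
    + rewrite e; apply/esym; rewrite (@derive1_near _ _ (fun=> 0)) ?e//.
      have d0 : 0 < 1 / 2 - d by rewrite subr_gt0.
      apply: filterS (near_dist (rep Torus p t) d0) => s h4; apply: Q0.
      rewrite dist_domE in h.
      have := ler_normD (rep Torus p t - s) (s - p).
      by rewrite addrA subrK => h3; rlra.
split.
- by apply: C1_near => t; have [g [cg fg _]] := key t; exists g.
- apply/funext => t; have [g [cg fg eg]] := key t.
  by rewrite (derive1_near fg) eg.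
Qed.

Lemma integral_itv_split (f : R -> \bar R) (a b c : R) :
  a <= b -> b <= c -> measurable_fun `[a, c] f ->
  (\int[mu]_(x in `[a, c]) f x = \int[mu]_(x in `[a, b]) f x + \int[mu]_(x in `[b, c]) f x)%E.
Proof.
move=> ab bc mf.
have e : `[a, c]%classic = `[a, b]%classic `|` `]b, c]%classic.
  by apply: itv_bndbnd_setU; rewrite bnd_simp.
rewrite e integral_setU//.
- rewrite -(@integral_itv_obnd_cbnd _ b (BRight c))//.
  apply: measurable_funS mf => //; rewrite e; exact: subsetUr.
- by rewrite -e.
- apply/disj_setPS => x [/=]; rewrite !in_itv/= => /andP[_ h] /andP[h2 _].
  by rewrite ltNge h in h2.
Qed.

(** An interval of length 1 is covered by two consecutive integer translates of the cell. *)
Lemma periodic_measurable (f : R -> \bar R) (c : R) : on_domain Torus f ->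
  measurable_fun `[0%R, 1%R : R] f -> measurable_fun `[c, c + 1 : R] f.
Proof.
move=> pf mf.
have mk (k : int) : measurable_fun `[k%:~R, k%:~R + 1 : R] f.
  have -> : f = (fun x => f (x + (- k)%:~R)).
    by apply/funext => x; apply: (on_domain_eqM pf); exists (- k).
  have -> : `[k%:~R, k%:~R + 1]%classic = (fun x : R => x + (- k)%:~R) @^-1` `[0, 1]%classic.
    by apply/seteqP; split => x /=; rewrite !in_itv/= intrN => /andP[? ?]; apply/andP; split; rlra.
  exact: measurable_fun_shift.
have /andP[h1 h2] := floor_itv c; set k := Num.floor c in h1 h2.
rewrite intrD in h2.
have mU : measurable_fun (`[k%:~R, k%:~R + 1] `|` `[(k + 1)%:~R, (k + 1)%:~R + 1 : R]) f.
  by apply/measurable_funU.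
apply: measurable_funS mU; first exact: measurableU.
move=> x /=; rewrite !in_itv/= intrD => /andP[h3 h4].
by have [h5|h5] := leP x (k%:~R + 1); [left|right]; apply/andP; split; rlra.
Qed.

(** After an integer translation the interval is [t, t + 1] with [t] in [0, 1); the part beyond 1 is
    moved back to [0, t] and completes the cell. *)
Lemma periodic_integral (f : R -> \bar R) (c : R) : on_domain Torus f ->
  measurable_fun `[0%R, 1%R : R] f ->
  (\int[mu]_(x in `[c, (c + 1)%R]) f x = \int[mu]_(x in `[0%R, 1%R]) f x)%E.
Proof.
move=> pf mf.
have sh (k : int) a b : measurable_fun `[a + k%:~R, b + k%:~R : R] f ->
    (\int[mu]_(x in `[(a + k%:~R)%R, (b + k%:~R)%R]) f x = \int[mu]_(x in `[a, b]) f x)%E.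
  move=> m; rewrite (integral_shift k%:~R)// shift_itvcc.
  by apply: eq_integral => x _; apply/esym; apply: (on_domain_eqM pf); exists k.
have /andP[h1 h2] := floor_itv c; set k := Num.floor c in h1 h2.
rewrite intrD in h2.
pose t := c - k%:~R.
have -> : c = t + k%:~R by rewrite /t subrK.
have -> : t + k%:~R + 1 = t + 1 + k%:~R by ring.
rewrite sh; last first.
  have -> : t + 1 + k%:~R = t + k%:~R + 1 by ring.
  exact: periodic_measurable.
have t0 : 0 <= t by rewrite /t; rlra.
have t1 : t <= 1 by rewrite /t; rlra.
rewrite (@integral_itv_split _ t 1 (t + 1))//; [|rlra|exact: periodic_measurable].
have -> : `[1, t + 1]%classic = `[0 + 1%:~R, t + 1%:~R]%classic by rewrite add0r.
rewrite sh; last first.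
  have m1 := @periodic_measurable f 1 pf mf.
  apply: measurable_funS m1 => //.
    by move=> x /=; rewrite !in_itv/= add0r => /andP[? ?]; apply/andP; split; rlra.
by rewrite addeC -integral_itv_split.
Qed.

Lemma cell_measurable M : measurable (cell M).
Proof. by case: M => [a b ab|]; exact: measurable_itv. Qed.

Lemma carrier_measurable M : measurable (carrier M).
Proof. by case: M => [a b ab|]; [exact: measurable_itv|exact: measurableT]. Qed.

Lemma cell_carrier M : cell M `<=` carrier M.
Proof. by case: M => [a b ab|] x. Qed.

Lemma Nb_measurable M p r : measurable (Nb M p r).
Proof.
have c : continuous (dist_dom M p).
  move=> t; apply/cvgrPdist_lt => e e0; apply: filterS (near_dist t e0) => s h.
  rewrite ltr_norml; have h1 := dist_dom_lip M p t s; have h2 := dist_dom_lip M p s t.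
  rewrite (distrC s t) in h2; apply/andP; split; rlra.
have -> : Nb M p r = setT `&` dist_dom M p @^-1` `]-oo, r[%classic.
  by rewrite setTI; apply/seteqP; split => t; rewrite /= in_itv/= dist_domE.
exact: (continuous_measurable_fun c).
Qed.

(** A ball of the circle may wrap around the ends of the cell [0, 1]. Integrating over the period
    centred at [p] instead turns it into one interval of the line, where calculus is available. *)
Lemma integral_Nb M p r (f : R -> \bar R) : on_domain M f ->
  measurable_fun (cell M) f -> small_radius M r ->
  (\int[mu]_(x in cell M `&` Nb M p r) f x =
   \int[mu]_(x in `](p - r)%R, (p + r)%R[ `&` carrier M) f x)%E.
Proof.
case: M => [a b ab _ _ _|pf mf r2].
  congr integral; rewrite setIC; congr (_ `&` _).
  by apply/seteqP; split => x; rewrite /Nb /= in_itv/= ltr_distl.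
rewrite integral_mkcondr -(periodic_integral (p - 1 / 2)).
- rewrite -integral_mkcondr /=; congr integral; rewrite setIT.
  apply/seteqP; split => x /=; rewrite !in_itv/=.
    move=> [/andP[h1 h2]]; rewrite /Nb /=.
    (* The right end of the period represents the antipode, whose representative is p - 1/2: its
       distance to [p] is exactly 1/2, so it is not in the ball. *)
    have [->|h] := eqVneq x (p + 1 / 2).
      rewrite (_ : Num.floor _ = 1); last first.
        by apply: floor_def; apply/andP; split; rewrite ?intrD; rlra.
      by rewrite ltr_norml => /andP[h3 h4]; simpl in r2; rlra.
    have h3 : x < p + 1 / 2 by rewrite lt_neqAle h/=; rlra.
    rewrite (_ : Num.floor _ = 0); last first.
      by apply: floor_def; apply/andP; split; rewrite ?intrD; rlra.
    by rewrite subr0 ltr_distl.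
  move=> /andP[h1 h2]; simpl in r2; split; first by apply/andP; split; rlra.
  have h : `|x - p| < r by rewrite ltr_distl h1 h2.
  rewrite /Nb /= -[X in X - p]/(rep Torus p x) near_rep//.
  exact: lt_le_trans h _.
- move=> x; rewrite /patch.
  have e : rep Torus p (x + 1) = rep Torus p x by exact: (@rep_on_domain Torus _ id p x).
  have -> : (x + 1 \in Nb Torus p r) = (x \in Nb Torus p r).
    by apply/idP/idP; rewrite !inE /Nb /= -/(rep Torus p x) -/(rep Torus p (x + 1)) e.
  by rewrite pf.
- apply/(measurable_restrict f) => //; first exact: Nb_measurable.
  apply: measurable_funS mf; first exact: cell_measurable.
  exact: subIsetl.
Qed.

End geometry.

(** * The pairing with test functions *)

Section pairing.
Context {R : realType}.
Local Notation mu := (@lebesgue_measure R).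
Local Notation intg D f := (mu.-integrable D (EFin \o f)).
Implicit Types (M : domain R) (f g u w phi psi : R -> R) (p q r x y t : R) (U : set R).

Lemma intgD (D : set (measurableTypeR R)) f g : measurable D ->
  intg D f -> intg D g -> intg D (fun x => f x + g x).
Proof. by move=> mD h1 h2; have := integrableD mD h1 h2; apply: eq_integrable. Qed.

Lemma intgB (D : set (measurableTypeR R)) f g : measurable D ->
  intg D f -> intg D g -> intg D (fun x => f x - g x).
Proof. by move=> mD h1 h2; have := integrableB mD h1 h2; apply: eq_integrable. Qed.

Lemma intgZ (D : set (measurableTypeR R)) (c : R) f : measurable D ->
  intg D f -> intg D (fun x => c * f x).
Proof. by move=> mD h1; have := integrableZl mD c h1; apply: eq_integrable. Qed.

Lemma intg_norm (D : set (measurableTypeR R)) f : intg D f -> intg D (fun x => `|f x|).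
Proof. exact: integrable_norm. Qed.

Lemma continuous_bound (a b : R) g : continuous g ->
  exists2 C : R, 0 < C & forall x : R, `[a, b]%classic x -> `|g x| <= C.
Proof.
move=> cg; have [ab|ab] := leP a b; last first.
  by exists 1 => // x /=; rewrite in_itv/= => /andP[h1 h2]; have := le_trans h1 h2; rlra.
have cn : continuous (fun x => `|g x|).
  by move=> x; apply: (continuous_comp (cg x)); exact: norm_continuous.
have [c _ h] := EVT_max ab (continuous_subspaceT cn).
exists (`|g c| + 1) => [|x /h]; first by rewrite ltr_wpDl.
by move=> /le_trans; apply; rewrite lerDl.
Qed.

Lemma integrable_continuous (a b : R) (D : set (measurableTypeR R)) g :
  measurable D -> D `<=` `[a, b] -> continuous g -> intg D g.
Proof.
move=> mD Dab cg; have h : intg `[a, b] g.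
  apply: continuous_compact_integrable; first exact: segment_compact.
  exact: continuous_subspaceT.
by apply: integrableS h.
Qed.

Lemma integrable_continuousM (a b : R) (D : set (measurableTypeR R)) g u :
  measurable D -> D `<=` `[a, b] -> continuous g -> intg D u ->
  intg D (fun x => g x * u x).
Proof.
move=> mD Dab cg iu.
have mg : measurable_fun D g by apply: measurable_funTS; exact: continuous_measurable_fun.
have [C C0 gC] := continuous_bound a b cg.
have bg : [bounded g x | x in D].
  exists C; split; first exact: num_real.
  by move=> y Cy x Dx; apply: le_trans (ltW Cy); exact/gC/Dab.
have := integrableMl mD iu mg bg; apply: eq_integrable => // x _.
by rewrite /= -EFinM mulrC.
Qed.

Lemma cell_bounded M : exists a b : R, cell M = `[a, b]%classic /\ a < b.
Proof. by case: M => [a b ab|]; [exists a, b|exists 0, 1]. Qed.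

(* The pairing of [phi] with the distribution [- du/dx]. *)
Definition pair M u phi : R := \int[mu]_(x in cell M) (derive1 phi x * u x).

Lemma pair_integrable M u phi : L1 M u -> C1 phi ->
  intg (cell M) (fun x => derive1 phi x * u x).
Proof.
move=> [_ iu] [_ cphi]; have [a [b [e _]]] := cell_bounded M.
by apply: (@integrable_continuousM a b); rewrite ?e//; rewrite e in iu.
Qed.

Lemma pair_EFin M u phi : L1 M u -> C1 phi ->
  (\int[mu]_(x in cell M) (derive1 phi x * u x)%:E)%E = (pair M u phi)%:E.
Proof.
move=> h1 h2; rewrite /pair /Rintegral fineK//.
apply: integrable_fin_num; first exact: cell_measurable.
exact: pair_integrable.
Qed.

Lemma pairD M u phi psi : L1 M u -> C1 phi -> C1 psi ->
  pair M u (fun x => phi x + psi x) = pair M u phi + pair M u psi.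
Proof.
move=> h h1 h2; rewrite /pair (C1D h1 h2).2 -RintegralD.
- by apply: eq_Rintegral => x _; rewrite mulrDl.
- exact: cell_measurable.
- exact: pair_integrable.
- exact: pair_integrable.
Qed.

Lemma pairZ M u c phi : L1 M u -> C1 phi ->
  pair M u (fun x => c * phi x) = c * pair M u phi.
Proof.
move=> h h1; rewrite /pair (C1Z c h1).2 -RintegralZl.
- by apply: eq_Rintegral => x _; rewrite mulrA.
- exact: cell_measurable.
- exact: pair_integrable.
Qed.

Lemma pair_cvg M (us : R -> R -> R) u phi :
  (forall eps : R, 0 < eps < 1 -> L1 M (us eps)) -> L1 M u -> L1_cvg M us u -> C1 phi ->
  pair M (us eps) phi @[eps --> 0^'+] --> pair M u phi.
Proof.
move=> hus hu cus cphi; have [a [b [e _]]] := cell_bounded M.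
have [C C0 hC] := continuous_bound a b cphi.2.
have mc : measurable (cell M : set (measurableTypeR R)) := @cell_measurable R M.
apply/cvgrPdist_lt => d d0.
have d' : (0 < (d / C)%:E)%E by rewrite lte_fin divr_gt0.
have := cus [set y | y < (d / C)%:E]%E => /(_ _) H.
have {}H : \forall eps \near 0^'+,
    (\int[mu]_(x in cell M) `|us eps x - u x|%:E < (d / C)%:E)%E.
  by apply: H; apply: open_nbhs_nbhs; split => //; exact: open_ereal_lt_ereal.
near=> eps.
have eps01 : 0 < eps < 1 by apply/andP; split; near: eps; [exact: nbhs_right_gt|exact: nbhs_right_lt].
have Le := hus _ eps01.
have iB : intg (cell M) (fun x => us eps x - u x).
  exact: (intgB mc Le.2 hu.2).
have iN : intg (cell M) (fun x => `|us eps x - u x|) by exact: intg_norm.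
have iP := pair_integrable Le cphi.
have iQ := pair_integrable hu cphi.
rewrite distrC /pair -RintegralB//.
apply: (@le_lt_trans _ _ (\int[mu]_(x in cell M) (C * `|us eps x - u x|))).
  apply: le_trans (le_normr_Rintegral mc _) _.
    exact: (intgB mc iP iQ).
  apply: le_Rintegral => //.
  - exact/intg_norm/(intgB mc iP iQ).
  - exact: intgZ.
  - move=> x; rewrite e => xab; rewrite -mulrBr normrM ler_wpM2r//.
    exact: hC.
rewrite RintegralZl// -ltr_pdivlMl// mulrC -lte_fin.
rewrite /Rintegral fineK; first by near: eps.
exact: integrable_fin_num iN.
Unshelve. all: by end_near. Qed.

End pairing.

(** * Test functions and the weighted total variation *)

Section test_functions.
Context {R : realType}.
Local Notation mu := (@lebesgue_measure R).
Implicit Types (M : domain R) (f g u w phi psi : R -> R) (p q r x y t : R) (U : set R).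

Lemma C1c_C1 M U phi : C1c M U phi -> C1 phi.
Proof. by move=> []. Qed.
Arguments C1c_C1 {M U phi} _.

Lemma C1c_supp M U phi t : C1c M U phi -> ~ U t -> phi t = 0.
Proof.
move=> [_ _ _ h] nU; apply/eqP; apply: contra_notT nU => pt.
by apply: h; exact: subset_closure.
Qed.

Lemma C1c_intro M U (C : set R) phi : on_domain M phi -> C1 phi -> closed C ->
  (forall t, phi t != 0 -> C t) -> C `<=` U -> C1c M U phi.
Proof.
move=> oD [d c] cC pC CU; split => // t.
move=> /(closure_subset pC); rewrite -(closure_id C).1//; exact: CU.
Qed.

Lemma C1c_sub M U U' phi : U `<=` U' -> C1c M U phi -> C1c M U' phi.
Proof. by move=> UU' [? ? ? h]; split => // t /h/UU'. Qed.

Lemma on_domain2 M (op : R -> R -> R) phi psi : on_domain M phi -> on_domain M psi ->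
  on_domain M (fun x => op (phi x) (psi x)).
Proof. by case: M => //= h1 h2 x; rewrite h1 h2. Qed.

Lemma C1cD M U phi psi : C1c M U phi -> C1c M U psi ->
  C1c M U (fun x => phi x + psi x).
Proof.
move=> h1 h2; apply: (@C1c_intro _ _ (closure [set x | phi x != 0] `|` closure [set x | psi x != 0])).
- by apply: on_domain2; [case: h1|case: h2].
- exact: (C1D (C1c_C1 h1) (C1c_C1 h2)).1.
- by apply: closedU; exact: closed_closure.
- move=> t h; have [e|ne] := eqVneq (phi t) 0.
    by right; apply: subset_closure => /=; rewrite e add0r in h.
  by left; apply: subset_closure.
- by case: h1 => _ _ _ h1; case: h2 => _ _ _ h2 t [/h1|/h2].
Qed.

Lemma C1cM M U phi g : C1c M U phi -> C1 g -> on_domain M g ->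
  C1c M U (fun x => phi x * g x).
Proof.
move=> h1 cg og; apply: (@C1c_intro _ _ (closure [set x | phi x != 0])).
- by apply: on_domain2 => //; case: h1.
- exact: (C1M (C1c_C1 h1) cg).1.
- exact: closed_closure.
- by move=> t h; apply: subset_closure => /=; apply: contra_neq h => ->; rewrite mul0r.
- by case: h1.
Qed.

Lemma C1cZ M U phi c : C1c M U phi -> C1c M U (fun x => c * phi x).
Proof.
move=> h; have [k _] := C1_cst c.
have -> : (fun x => c * phi x) = (fun x => phi x * c).
  by apply/funext => x; rewrite mulrC.
by apply: C1cM => //; case: M h.
Qed.

Lemma C1c0 M U : C1c M U (fun=> 0).
Proof.
apply: (@C1c_intro _ _ set0) => //; [by case: M|exact: (C1_cst 0).1|exact: closed0|].
by move=> t; rewrite eqxx.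
Qed.

Lemma weighted_tv_ge M U w u phi : L1 M u -> C1c M U phi ->
  (forall x, U x -> `|phi x| <= w x) ->
  ((pair M u phi)%:E <= weighted_tv M U w u)%E.
Proof.
move=> hu hphi hw; rewrite -pair_EFin//; last exact: C1c_C1 hphi.
by apply: ereal_sup_ubound; exists phi.
Qed.

Lemma weighted_tv_le M U w u (B : \bar R) : L1 M u ->
  (forall phi, C1c M U phi -> (forall x, U x -> `|phi x| <= w x) ->
    ((pair M u phi)%:E <= B)%E) ->
  (weighted_tv M U w u <= B)%E.
Proof.
move=> hu H; apply: ge_ereal_sup => _ [phi [hphi hw] <-].
by rewrite pair_EFin//; [exact: H|exact: C1c_C1 hphi].
Qed.

Lemma weighted_tv_ge0 M U w u : L1 M u -> (forall x, U x -> 0 <= w x) ->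
  (0 <= weighted_tv M U w u)%E.
Proof.
move=> hu hw; apply: le_trans (weighted_tv_ge hu (C1c0 M U) _).
  rewrite lee_fin /pair (C1_cst 0).2; apply: Rintegral_ge0 => x _.
  by rewrite mul0r.
by move=> x Ux; rewrite normr0; exact: hw.
Qed.

(** A test function supported in [U] vanishes on the rest of [U'], and there the constraint is just
    that the larger weight is nonnegative. *)
Lemma weighted_tv_mono M U U' w w' u : L1 M u -> U `<=` U' ->
  (forall x, U x -> w x <= w' x) -> (forall x, U' x -> 0 <= w' x) ->
  (weighted_tv M U w u <= weighted_tv M U' w' u)%E.
Proof.
move=> hu UU' ww' w0; apply: weighted_tv_le => // phi hphi hw.
apply: weighted_tv_ge => //; first exact: C1c_sub hphi.
move=> x U'x; have [Ux|nUx] := pselect (U x).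
  exact: le_trans (hw _ Ux) (ww' _ Ux).
by rewrite (C1c_supp hphi nUx) normr0; exact: w0.
Qed.

Lemma weighted_tv_gtP M U w u (l : R) : L1 M u ->
  (l%:E < weighted_tv M U w u)%E ->
  exists phi, [/\ C1c M U phi, forall x, U x -> `|phi x| <= w x & l < pair M u phi].
Proof.
move=> hu /ereal_sup_gt[_ [phi [hphi hw] <-]].
rewrite pair_EFin//; last exact: C1c_C1 hphi.
by rewrite lte_fin => h; exists phi.
Qed.

End test_functions.

(** * Cutoff functions and windows *)

Section bump.
Context {R : realType}.
Local Notation mu := (@lebesgue_measure R).
Local Notation intg D f := (mu.-integrable D (EFin \o f)).
Implicit Types (M : domain R) (f g u w phi psi : R -> R) (p q r x y t : R) (U : set R).

Lemma near_rightP (P : R -> Prop) :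
  (\forall r \near 0^'+, P r) <-> exists2 r0 : R, 0 < r0 & forall r : R, 0 < r < r0 -> P r.
Proof.
split.
- move=> [e /= e0 H]; exists e => // r /andP[r0 re]; apply: H => //=.
  by rewrite sub0r normrN gtr0_norm.
- move=> [e e0 H]; near=> r; apply: H; apply/andP; split; near: r.
    exact: nbhs_right_gt.
  exact: nbhs_right_lt.
Unshelve. all: by end_near. Qed.

(** One radius for a whole finite list: each property is assumed for all small radii, so it survives
    the passage to the minimum. *)
Lemma seq_radius (K : seq R) (P : R -> R -> Prop) :
  (forall x, x \in K -> exists2 r : R, 0 < r & forall r', 0 < r' <= r -> P x r') ->
  exists2 r : R, 0 < r & forall x, x \in K -> forall r', 0 < r' <= r -> P x r'.
Proof.
elim: K => [_|x K ih h]; first by exists 1.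
have [r1 r10 h1] := h x (mem_head _ _).
have [|r2 r20 h2] := ih; first by move=> y yK; apply: h; rewrite inE yK orbT.
exists (Num.min r1 r2); first by rewrite lt_min r10.
move=> y; rewrite inE => /predU1P[->|yK] r'; rewrite le_min => /and3P[h3 h4 h5].
  by apply: h1; rewrite h3.
by apply: h2 => //; rewrite h3.
Qed.

Lemma FTC_C1 f (a b : R) : C1 f -> a <= b ->
  \int[mu]_(x in `[a, b]) derive1 f x = f b - f a.
Proof.
move=> cf; rewrite le_eqVlt => /predU1P[->|ab].
  by rewrite set_itv1 Rintegral_set1 subrr.
rewrite /Rintegral (@continuous_FTC2 _ (derive1 f) f)//.
- by apply: continuous_subspaceT => x; exact: cf.2.
- split => //; first by move=> x _; exact: cf.1.
  + by apply: cvg_at_right_filter; exact: (C1_cont cf).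
  + by apply: cvg_at_left_filter; exact: (C1_cont cf).
Qed.

Lemma derive1_on_domain M f : C1 f -> on_domain M f -> on_domain M (derive1 f).
Proof.
case: M => //= cf pf x; have [_ e] := C1_affine 1 1 cf.
have := congr1 (@^~ x) e; rewrite /= !mul1r => <-; congr (derive1 _ x).
by apply/funext => y; rewrite mul1r pf.
Qed.

(** A fixed transition with slope at most 2. Rescaled to [stepf (h^-1 * t + - (h^-1 * y))] it has as
    derivative an averaging kernel on [y, y + h]. *)
Definition stepf : R -> R := sval (cid (@step_exists R 1 ltr01)).

Lemma stepfP : [/\ C1 stepf, (forall t, t <= 0 -> stepf t = 0 /\ derive1 stepf t = 0),
      (forall t, 1 <= t -> stepf t = 1 /\ derive1 stepf t = 0),
      (forall t, 0 <= stepf t <= 1) & forall t, 0 <= derive1 stepf t <= 1 + 1].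
Proof. exact: (svalP (cid (@step_exists R 1 ltr01))). Qed.

Definition chi t := stepf (1 * t + 2) - stepf (1 * t + - 1).

Lemma chiP : [/\ C1 chi, forall t, `|t| <= 1 -> chi t = 1,
   forall t, 2 <= `|t| -> chi t = 0 /\ derive1 chi t = 0,
   forall t, 0 <= chi t <= 1 & forall t, `|derive1 chi t| <= 4].
Proof.
have [cS S0 S1 S01 dS] := stepfP.
have [c1 e1] := C1_affine 1 2 cS; have [c2 e2] := C1_affine 1 (- 1) cS.
have [c e] := C1B c1 c2.
have dE t : derive1 chi t = derive1 stepf (1 * t + 2) - derive1 stepf (1 * t + - 1).
  by rewrite /chi e e1 e2 !mul1r.
split => // t.
- rewrite ler_norml => /andP[h1 h2].
  rewrite /chi; have [|-> _] := S1 (1 * t + 2); first by rlra.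
  by have [|-> _] := S0 (1 * t + - 1); [rlra|rewrite subr0].
- rewrite leNgt ltr_norml negb_and -!leNgt dE /chi => /orP[h|h].
    have [|-> ->] := S0 (1 * t + 2); first by rlra.
    by have [|-> ->] := S0 (1 * t + - 1); [rlra|rewrite subrr].
  have [|-> ->] := S1 (1 * t + 2); first by rlra.
  by have [|-> ->] := S1 (1 * t + - 1); [rlra|rewrite !subrr].
- rewrite /chi; have /andP[h1 h2] := S01 (1 * t + 2).
  have /andP[h3 h4] := S01 (1 * t + - 1).
  have [h|h] := leP t 0.
    by have [|-> _] := S0 (1 * t + - 1); [rlra|rewrite subr0 h1].
  by have [|-> _] := S1 (1 * t + 2); [rlra|apply/andP; split; rlra].
- rewrite dE ler_norml; have /andP[h1 h2] := dS (1 * t + 2).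
  have /andP[h3 h4] := dS (1 * t + - 1).
  by apply/andP; split; rlra.
Qed.

Definition bump M p r : R -> R := (fun t => chi (r^-1 * t + - (r^-1 * p))) \o rep M p.

Lemma bumpP M p r : 0 < r -> (M = Torus -> 2 * r < 1 / 2) ->
  [/\ C1 (bump M p r) /\ on_domain M (bump M p r),
    forall t, dist_dom M p t <= r -> bump M p r t = 1,
    forall t, 2 * r <= dist_dom M p t -> bump M p r t = 0 /\ derive1 (bump M p r) t = 0,
    forall t, 0 <= bump M p r t <= 1 &
    forall t, `|derive1 (bump M p r) t| <= 4 / r].
Proof.
move=> r0 r4; have [cc c1 c0 c01 dc] := chiP.
have [c e] := C1_affine (r^-1) (- (r^-1 * p)) cc.
have E s : `|r^-1 * s + - (r^-1 * p)| = r^-1 * `|s - p|.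
  by rewrite -mulrBr normrM gtr0_norm// invr_gt0.
have Z s : 2 * r <= `|s - p| -> 2 <= `|r^-1 * s + - (r^-1 * p)|.
  by move=> h; rewrite E -ler_pdivrMl ?invr_gt0// invrK mulrC.
have [cb eb] : C1 (bump M p r) /\ derive1 (bump M p r) =
    (fun x => r^-1 * derive1 chi (r^-1 * x + - (r^-1 * p))) \o rep M p.
  rewrite -e; apply: (@C1_lift _ M p _ (2 * r)) => // MT; split; first exact: r4.
  by move=> s /Z/c0[].
split => //.
- by split => //; exact: rep_on_domain.
- move=> t; rewrite dist_domE => h; apply: c1.
  by rewrite E ler_pdivrMl// mulr1.
- move=> t; rewrite dist_domE => /Z/c0[h1 h2]; split => //.
  by rewrite eb /= h2 mulr0.
- by move=> t; exact: c01.
- by move=> t; rewrite eb /= normrM gtr0_norm ?invr_gt0// mulrC ler_wpM2r// invr_ge0 ltW.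
Qed.

(** On a window [M] can be identified with an interval of the line: it stays inside a segment, or
    covers the circle at most once. *)
Definition window M p r : Prop :=
  match M with Segment a b _ => a <= p - r /\ p + r <= b | Torus => r <= 1 / 2 end.

Lemma window_exists M p : interior_dom M p ->
  exists2 r : R, 0 < r & forall r', 0 < r' <= r -> window M p r'.
Proof.
case: M => [a b ab|] /=; last by exists (1 / 2) => // r' /andP[].
rewrite in_itv/= => /andP[h1 h2].
exists (Num.min (p - a) (b - p)); first by rewrite lt_min !subr_gt0 h1.
by move=> r'; rewrite le_min => /and3P[h3 h4 h5]; split; rlra.
Qed.

Lemma window_carrier M p r : window M p r -> `[p - r, p + r]%classic `<=` carrier M.
Proof.
case: M => [a b ab [h1 h2] x|//]; rewrite /= !in_itv/= => /andP[h3 h4].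
by apply/andP; split; rlra.
Qed.

Lemma window_interior M p r : window M p r -> `]p - r, p + r[%classic `<=` interior_dom M.
Proof.
case: M => [a b ab [h1 h2] x|//]; rewrite /= !in_itv/= => /andP[h3 h4].
by apply/andP; split; rlra.
Qed.

Lemma window_small M p r : window M p r -> small_radius M r.
Proof. by case: M. Qed.

Lemma L1_window M u p r : L1 M u -> window M p r -> intg `[p - r, p + r] u.
Proof.
case: M => [a b ab [_ iu] h|[pu iu] h].
  by apply: integrableS iu => //=; exact: (@window_carrier (Segment ab)).
have mu0 : measurable_fun `[0%R, 1%R : R] (EFin \o u) by case/integrableP : iu.
have m1 : measurable_fun `[p - 1 / 2, p - 1 / 2 + 1 : R] (EFin \o u).
  by apply: periodic_measurable => //= x; rewrite pu.
have i1 : intg `[p - 1 / 2, p - 1 / 2 + 1] u.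
  apply/integrableP; split => //.
  rewrite (@periodic_integral R (fun x => `|(u x)%:E|)%E).
  - by case/integrableP : iu.
  - by move=> x /=; rewrite pu.
  - by apply: measurableT_comp.
apply: integrableS i1 => //; move=> x /=; rewrite !in_itv/= => /andP[h1 h2].
by simpl in h; apply/andP; split; rlra.
Qed.

End bump.

(** * Traces and jumps *)

Section jumps.
Context {R : realType}.
Local Notation mu := (@lebesgue_measure R).
Local Notation intg D f := (mu.-integrable D (EFin \o f)).
Implicit Types (M : domain R) (f g u w phi psi : R -> R) (p q r x y t : R) (U : set R).

Definition is_rtrace u x (l : R) : Prop :=
  r^-1 * \int[mu]_(y in `]x, x + r[) `|u y - l| @[r --> 0^'+] --> (0 : R).

Definition is_ltrace u x (l : R) : Prop :=
  r^-1 * \int[mu]_(y in `]x - r, x[) `|u y - l| @[r --> 0^'+] --> (0 : R).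

Lemma meanP (D : R -> set R) u (l : R) :
  r^-1 * \int[mu]_(y in D r) `|u y - l| @[r --> 0^'+] --> (0 : R) <->
  forall e, 0 < e -> exists2 r0 : R, 0 < r0 &
    forall r : R, 0 < r < r0 -> \int[mu]_(y in D r) `|u y - l| <= e * r.
Proof.
split.
- move=> /cvgr0Pnorm_le h e e0; have /near_rightP[r0 r00 H] := h e e0.
  exists r0 => // r rr; have := H r rr; have /andP[r1 _] := rr.
  rewrite normrM gtr0_norm ?invr_gt0// ger0_norm; last exact: Rintegral_ge0.
  by rewrite mulrC ler_pdivrMr.
- move=> h; apply/cvgr0Pnorm_le => e e0; apply/near_rightP.
  have [r0 r00 H] := h e e0; exists r0 => // r rr; have /andP[r1 _] := rr.
  rewrite normrM gtr0_norm ?invr_gt0// ger0_norm; last exact: Rintegral_ge0.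
  by rewrite mulrC ler_pdivrMr//; exact: H.
Qed.

(** If [u] were the constant [l], the integral would be [l * (f d - f c)] by the fundamental
    theorem; the error is the deviation of [u] from [l], amplified by the bound on the
    derivative. *)
Lemma half_jump u f (c d l B : R) : c <= d -> C1 f -> intg `[c, d] u ->
  (forall t, c <= t <= d -> `|derive1 f t| <= B) ->
  `|\int[mu]_(t in `[c, d]) (derive1 f t * u t) - l * (f d - f c)| <=
  B * \int[mu]_(t in `[c, d]) `|u t - l|.
Proof.
move=> cd cf iu fB.
have mD : measurable (`[c, d]%classic : set (measurableTypeR R)) by [].
have i1 : intg `[c, d] (fun t => derive1 f t * u t).
  by apply: (@integrable_continuousM R c d) => //; exact: cf.2.
have id1 : intg `[c, d] (derive1 f) by apply: (@integrable_continuous R c d) => //; exact: cf.2.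
have i2 : intg `[c, d] (fun t => l * derive1 f t) by exact: intgZ.
have il : intg `[c, d] (fun=> l).
  by apply: (@integrable_continuous R c d) => // x; exact: cvg_cst.
have i3 : intg `[c, d] (fun t => u t - l) by exact: intgB.
have i4 := intg_norm i3.
rewrite -FTC_C1// -RintegralZl// -RintegralB//.
apply: le_trans (le_normr_Rintegral _ _) _ => //; first exact: intgB.
rewrite -RintegralZl//; apply: le_Rintegral => //.
- exact/intg_norm/intgB.
- exact: intgZ.
- move=> t /=; rewrite in_itv/= => ht.
  by rewrite (mulrC l) -mulrBr normrM ler_wpM2r// fB.
Qed.

Lemma Rintegral_oo_cc f (c d : R) : intg `[c, d] f ->
  \int[mu]_(t in `]c, d[) f t = \int[mu]_(t in `[c, d]) f t.
Proof.
move=> i; have [cd|cd] := ltP c d; last first.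
  move: cd; rewrite le_eqVlt => /predU1P[->|cd].
    by rewrite set_itvoo0 set_itv1 Rintegral_set0 Rintegral_set1.
  by rewrite !set_itv_ge ?Rintegral_set0// bnd_simp -?leNgt -?ltNge ?ltW.
rewrite (@Rintegral_itv_obnd_cbnd R c (BLeft d)).
  rewrite Rintegral_itv_bndo_bndc//.
  by apply: integrableS i => // x /=; rewrite !in_itv/= => /andP[-> /ltW].
by apply: integrableS i => // x /=; rewrite !in_itv/= => /andP[/ltW -> /ltW].
Qed.

Lemma Rintegral_cc_split f (a b c : R) : a <= b -> b <= c -> intg `[a, c] f ->
  \int[mu]_(t in `[a, c]) f t = \int[mu]_(t in `[a, b]) f t + \int[mu]_(t in `[b, c]) f t.
Proof.
move=> ab bc i; rewrite /Rintegral (@integral_itv_split _ _ a b c)//; last first.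
  by case/integrableP : i.
rewrite fineD//; apply: integrable_fin_num => //.
  by apply: integrableS i => //; move=> x /=; rewrite !in_itv/= => /andP[-> h]; exact: le_trans h bc.
by apply: integrableS i => //; move=> x /=; rewrite !in_itv/= => /andP[h ->]; rewrite (le_trans ab h).
Qed.

Lemma pair_window M u p r f : L1 M u -> window M p r -> 0 < r ->
  C1 f -> on_domain M f -> (forall t, r <= dist_dom M p t -> derive1 f t = 0) ->
  pair M u f = \int[mu]_(t in `[p - r, p + r]) (derive1 f t * u t).
Proof.
move=> hu wp r0 cf of0 f0.
have iP := pair_integrable hu cf.
rewrite -Rintegral_oo_cc; last first.
  apply: (@integrable_continuousM R (p - r) (p + r)) => //; first exact: cf.2.
  exact: (L1_window hu wp).
rewrite /pair /Rintegral; congr fine.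
have := @integral_Nb R M p r (fun t => (derive1 f t * u t)%:E) _ _ (window_small wp).
have -> : `](p - r), (p + r)[%classic `&` carrier M = `]p - r, p + r[%classic.
  apply/setIidPl => x h; apply: (window_carrier wp).
  by move: h; rewrite /= !in_itv/= => /andP[/ltW -> /ltW].
move=> <-; last 2 first.
- have := derive1_on_domain cf of0; case: M hu of0 {wp f0 iP} => // -[h1 _] h2 h3 x.
  by rewrite h3 h1.
- by case/integrableP : iP.
rewrite integral_mkcondr; apply: eq_integral => x _; rewrite /patch.
case: ifPn => // h; rewrite f0 ?mul0r//.
by rewrite leNgt; apply: contra h => h; rewrite inE; apply/NbE.
Qed.

(** The shrinking bump isolates the atom of the derivative of [u] at [p]. On each half of its
    support [u] is replaced by its trace; the derivative of the bump is of order 1/r, which the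
    traces compensate because the mean deviation over length [r] is o(r). The difference is left
    minus right because the pairing is with [- du/dx]. *)
Lemma pair_bump_cvg M u p phi (ul ur : R) : L1 M u -> interior_dom M p ->
  is_rtrace u p ur -> is_ltrace u p ul -> C1 phi -> on_domain M phi ->
  pair M u (fun t => phi t * bump M p r t) @[r --> 0^'+] --> phi p * (ul - ur).
Proof.
move=> hu ip /meanP hr /meanP hl cphi ophi.
have [C1' C1'0 hC1'] := continuous_bound (p - 1) (p + 1) cphi.2.
have [C0 C00 hC0] := continuous_bound (p - 1) (p + 1) (C1_cont cphi).
have [rw rw0 hw] := window_exists ip.
apply/cvgrPdist_le => e e0; apply/near_rightP.
pose B := C1' + C0 * 4.
have B0 : 0 < B by rewrite addr_gt0// mulr_gt0.
have d0 : 0 < e / (4 * B) by rewrite divr_gt0// mulr_gt0.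
have [r1 r10 hr1] := hr _ d0; have [r2 r20 hr2] := hl _ d0.
(* The bound 1/5 keeps 2r below 1/2, so that the bump lives on the circle and inside the interval
   where [phi] was bounded; the halves are there because the support has radius 2r. *)
exists (Num.min (1 / 5) (Num.min (rw / 2) (Num.min (r1 / 2) (r2 / 2)))).
  by rewrite !lt_min !divr_gt0.
move=> r; rewrite !lt_min => /and5P[r0 r5 rw2 rr1 rr2].
have [[cb ob] b1 b0 b01 db] := @bumpP R M p r r0 (fun _ => ltac:(rlra)).
have wp : window M p (2 * r) by apply: hw; apply/andP; split; rlra.
have [cf ef] := C1M cphi cb.
set f := (fun t => phi t * bump M p r t) in cf ef *.
have of_ : on_domain M f by exact: on_domain2.
have rr0 : 0 < 2 * r by rlra.
rewrite (pair_window hu wp)//; last first.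
  by move=> t /b0[h1 h2]; rewrite ef h1 h2 !mulr0 addr0.
have fB t : p - 2 * r <= t <= p + 2 * r -> `|derive1 f t| <= B / r.
  move=> /andP[h1 h2]; rewrite ef (le_trans (ler_normD _ _))// !normrM.
  have ht : `[p - 1, p + 1]%classic t by rewrite /= in_itv/=; apply/andP; split; rlra.
  rewrite mulrDl lerD//.
    apply: (@le_trans _ _ (C1' * 1)).
      apply: ler_pM => //; first exact: hC1'.
      by have /andP[h3 h4] := b01 t; rewrite ger0_norm.
    by rewrite ler_pM2l// -invr1 lef_pV2 ?posrE//; rlra.
  by rewrite -mulrA; apply: ler_pM => //; exact: hC0.
have iu := L1_window hu wp.
rewrite (@Rintegral_cc_split _ _ p); [|rlra|rlra|]; last first.
  by apply: (@integrable_continuousM R (p - 2 * r) (p + 2 * r)) => //; exact: cf.2.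
have il : intg `[p - 2 * r, p] u.
  by apply: integrableS iu => //; move=> x /=; rewrite !in_itv/= => /andP[h1 h2]; apply/andP; split; rlra.
have ir : intg `[p, p + 2 * r] u.
  by apply: integrableS iu => //; move=> x /=; rewrite !in_itv/= => /andP[h1 h2]; apply/andP; split; rlra.
have Hl := @half_jump u f (p - 2 * r) p ul (B / r) ltac:(rlra) cf il.
have Hr := @half_jump u f p (p + 2 * r) ur (B / r) ltac:(rlra) cf ir.
have {}Hl := Hl (fun t h => fB t ltac:(case/andP : h => *; apply/andP; split; rlra)).
have {}Hr := Hr (fun t h => fB t ltac:(case/andP : h => *; apply/andP; split; rlra)).
have dist0 t : `|t - p| = 2 * r -> f t = 0.
  move=> h; have h' : `|t - p| < 1 / 2 by rewrite h; rlra.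
  by rewrite /f (b0 t _).1 ?mulr0// dist_domE near_rep// h.
have fp : f p = phi p.
  have h : `|p - p| < 1 / 2 by rewrite subrr normr0; rlra.
  by rewrite /f b1 ?mulr1// dist_domE near_rep// subrr normr0 ltW.
have e1 : f (p - 2 * r) = 0.
  by apply: dist0; rewrite addrAC subrr add0r normrN gtr0_norm.
have e2 : f (p + 2 * r) = 0.
  by apply: dist0; rewrite addrAC subrr add0r gtr0_norm.
rewrite e1 fp subr0 in Hl; rewrite e2 fp sub0r in Hr.
have il' : intg `[p - 2 * r, p] (fun t => `|u t - ul|).
  apply/intg_norm/intgB => //; apply: (@integrable_continuous R (p - 2 * r) p) => //.
  by move=> ?; exact: cvg_cst.
have ir' : intg `[p, p + 2 * r] (fun t => `|u t - ur|).
  apply/intg_norm/intgB => //; apply: (@integrable_continuous R p (p + 2 * r)) => //.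
  by move=> ?; exact: cvg_cst.
have tl := hr2 (2 * r) ltac:(apply/andP; split; rlra).
have tr := hr1 (2 * r) ltac:(apply/andP; split; rlra).
rewrite (Rintegral_oo_cc il') in tl; rewrite (Rintegral_oo_cc ir') in tr.
have Bl : B / r * (e / (4 * B) * (2 * r)) = e / 2.
  by field; rewrite gt_eqF//= gt_eqF.
have Br0 : 0 <= B / r by rewrite divr_ge0// ltW.
have {}Hl := le_trans Hl (ler_wpM2l Br0 tl); rewrite Bl in Hl.
have {}Hr := le_trans Hr (ler_wpM2l Br0 tr); rewrite Bl in Hr.
move: Hl Hr; set A1 := Rintegral _ _ _; set A2 := Rintegral _ _ _ => Hl Hr.
have -> : phi p * (ul - ur) - (A1 + A2) = - ((A1 - ul * phi p) + (A2 - ur * - phi p)).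
  by ring.
rewrite normrN (le_trans (ler_normD _ _))// (splitr e) lerD//.
Qed.

End jumps.

(** * Lebesgue points and the existence of one-sided limits *)

Section traces.
Context {R : realType}.
Local Notation mu := (@lebesgue_measure R).
Local Notation intg D f := (mu.-integrable D (EFin \o f)).
Implicit Types (M : domain R) (f g u w phi psi : R -> R) (p q r x y z t : R) (U : set R).

(** The one-sided interval lies in the centred ball of radius 2h, of measure 4h, which explains the
    threshold [e / 4]. *)
Lemma lebesgue_pt_mean f y : intg setT f -> lebesgue_pt f y ->
  forall e : R, 0 < e -> exists2 h0 : R, 0 < h0 &
    forall h : R, 0 < h < h0 -> \int[mu]_(t in `[y, y + h]) `|f t - f y| <= e * h.
Proof.
move=> intf ly e e0.
have e4 : (0 < (e / 4)%:E)%E by rewrite lte_fin divr_gt0.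
have : \forall r \near 0^'+, (davg f y r < (e / 4)%:E)%E.
  apply: (ly [set z | (z < (e / 4)%:E)%E]).
  by apply: open_nbhs_nbhs; split => //; exact: open_ereal_lt_ereal.
move=> /near_rightP[r0 r00 H]; exists (r0 / 2); first by rewrite divr_gt0.
move=> h /andP[h0 hr]; have hh : 0 < 2 * h < r0 by apply/andP; split; rlra.
have mf : measurable_fun [set: R] (EFin \o f) by case/integrableP : intf.
have mg : measurable_fun [set: measurableTypeR R] (fun t => `|f t - f y|%:E).
  apply/measurable_EFinP; apply: measurableT_comp => //.
  by apply: measurable_funB => //; exact/measurable_EFinP.
have h4 : 0 < 2 * h *+ 2 by rewrite pmulrn_lgt0//; rlra.
have := H _ hh; rewrite /davg /iavg lebesgue_measure_ball; last by rlra.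
rewrite inver gt_eqF// lte_pdivrMl//.
rewrite -EFinM => H1.
have le1 : (\int[mu]_(t in `[y, (y + h)%R]) `|f t - f y|%:E <=
            \int[mu]_(t in ball y (2 * h)%R) `|f t - f y|%:E)%E.
  apply: ge0_subset_integral => //.
  - exact: measurable_ball.
  - exact: measurable_funTS mg.
  - move=> t /=; rewrite in_itv/= /ball/= => /andP[h1 h2].
    by rewrite ltr_norml; apply/andP; split; rlra.
have H2 := le_lt_trans le1 H1.
rewrite -lee_fin /Rintegral fineK; first by apply: le_trans (ltW H2) _; rewrite lee_fin; rlra.
rewrite ge0_fin_numE; first by apply: lt_le_trans H2 _; exact: leey.
by apply: integral_ge0.
Qed.

Lemma Rintegral_cc_supp f (c d a b : R) : c <= a -> b <= d ->
  (forall t, c <= t <= d -> ~ (a <= t <= b) -> f t = 0) ->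
  \int[mu]_(t in `[c, d]) f t = \int[mu]_(t in `[a, b]) f t.
Proof.
move=> ca bd f0.
have -> : `[a, b]%classic = `[c, d]%classic `&` `[a, b]%classic.
  rewrite setIC; apply/esym/setIidPl => x /=; rewrite !in_itv/= => /andP[h1 h2].
  by rewrite (le_trans ca h1) (le_trans h2 bd).
rewrite Rintegral_mkcondr; apply: eq_Rintegral => t; rewrite inE/= in_itv/= => tcd.
rewrite /patch; case: ifPn => // /negP h; apply: f0 => // h2; apply: h.
by rewrite inE/= in_itv.
Qed.

(** The derivative of the rescaled step has integral 1 and lives on [y, y + h], so at a Lebesgue
    point its integral against [f] is close to [f y]. *)
Lemma step_mean f y : intg setT f -> lebesgue_pt f y -> forall e : R, 0 < e ->
  exists2 h0 : R, 0 < h0 & forall h : R, 0 < h < h0 -> forall c d : R, c <= y -> y + h <= d ->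
   `|\int[mu]_(t in `[c, d]) (derive1 (fun t => stepf (h^-1 * t + - (h^-1 * y))) t * f t) - f y| <= e.
Proof.
move=> intf ly e e0; have e2 : 0 < e / 2 by rewrite divr_gt0.
have [h0 h00 H] := lebesgue_pt_mean intf ly e2.
exists h0 => // h hh c d cy yd; have /andP[hp _] := hh.
have [cS S0 S1 S01 dS] := @stepfP R.
have [cs es] := C1_affine h^-1 (- (h^-1 * y)) cS.
have hi0 : 0 < h^-1 by rewrite invr_gt0.
have E s : h^-1 * s + - (h^-1 * y) = h^-1 * (s - y) by rewrite mulrBr.
rewrite (@Rintegral_cc_supp _ c d y (y + h))//; last first.
  move=> t _ /negP; rewrite negb_and -!ltNge es E => /orP[h1|h1].
    have [|_ ->] := S0 (h^-1 * (t - y)); last by rewrite mulr0 mul0r.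
    by rewrite nmulr_lle0 ?ltW// subr_lt0.
  have [|_ ->] := S1 (h^-1 * (t - y)); last by rewrite mulr0 mul0r.
  by rewrite ler_pdivlMl// mulr1; rlra.
have iy : intg `[y, y + h] f by apply: integrableS intf.
have B t : y <= t <= y + h ->
    `|derive1 (fun t => stepf (h^-1 * t + - (h^-1 * y))) t| <= h^-1 * 2.
  move=> _; rewrite es normrM gtr0_norm// ler_pM2l//.
  have /andP[h1 h2] := dS (h^-1 * t + - (h^-1 * y)).
  by rewrite ger0_norm.
have yh : y <= y + h by rlra.
have := half_jump (f y) yh cs iy B.
rewrite !E (S1 _ _).1; last by rewrite addrAC subrr add0r mulVf// gt_eqF.
rewrite (S0 _ _).1 ?subrr ?mulr0// subr0 mulr1 => /le_trans; apply.
apply: le_trans (ler_wpM2l _ (H h hh)) _; first by rewrite mulr_ge0// ltW.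
by rewrite le_eqVlt; apply/orP; left; apply/eqP; field; rewrite gt_eqF.
Qed.

Lemma close_diff (a b x y e d : R) : `|a - x| <= e / 2 -> `|b - y| <= e / 2 ->
  a - b <= d -> x - y <= d + e.
Proof. by rewrite !ler_norml => /andP[? ?] /andP[? ?] ?; rlra. Qed.

(** The test function is a step at [y] minus a step at [z]. It is bounded by 1 and compactly
    supported whichever point comes first, and its pairing with [f] is almost [f y - f z]. *)
Lemma oscillation_le f (c d delta : R) : intg setT f ->
  (forall Q, C1 Q -> (exists c' d' : R, [/\ c < c', d' < d &
      forall t, Q t != 0 -> c' <= t <= d']) -> (forall t, `|Q t| <= 1) ->
    \int[mu]_(t in `[c, d]) (derive1 Q t * f t) <= delta) ->
  forall y z, c < y < d -> c < z < d -> lebesgue_pt f y -> lebesgue_pt f z ->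
  f y - f z <= delta.
Proof.
move=> intf HQ y z /andP[cy yd] /andP[cz zd] ly lz.
apply/ler_addgt0Pr => e e0; have e2 : 0 < e / 2 by rewrite divr_gt0.
have [h1 h10 H1] := step_mean intf ly e2; have [h2 h20 H2] := step_mean intf lz e2.
pose m := Num.max y z.
have md : m < d by rewrite gt_max yd.
have ym : y <= m by rewrite le_max lexx.
have zm : z <= m by rewrite le_max lexx orbT.
pose h := Num.min (h1 / 2) (Num.min (h2 / 2) ((d - m) / 2)).
have h0 : 0 < h by rewrite !lt_min !divr_gt0// subr_gt0.
have : h <= h by []. rewrite {2}/h !le_min => /and3P[hh1 hh2 hm].
have {}H1 := H1 h ltac:(apply/andP; split; rlra) c d ltac:(rlra) ltac:(rlra).
have {}H2 := H2 h ltac:(apply/andP; split; rlra) c d ltac:(rlra) ltac:(rlra).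
have [cS S0 S1 S01 dS] := @stepfP R.
have [c1 e1] := C1_affine h^-1 (- (h^-1 * y)) cS.
have [c2 e2'] := C1_affine h^-1 (- (h^-1 * z)) cS.
have [c3 e3] := C1B c1 c2.
have hi0 : 0 < h^-1 by rewrite invr_gt0.
have Z0 x t : t < x -> stepf (h^-1 * t + - (h^-1 * x)) = 0.
  move=> tx; have [|->//] := S0 (h^-1 * t + - (h^-1 * x)).
  by rewrite -mulrBr pmulr_rle0// subr_le0 ltW.
have Z1 x t : x + h <= t -> stepf (h^-1 * t + - (h^-1 * x)) = 1.
  move=> tx; have [|->//] := S1 (h^-1 * t + - (h^-1 * x)).
  by rewrite -mulrBr ler_pdivlMl// mulr1; rlra.
have H3 : \int[mu]_(t in `[c, d]) (derive1 (fun x => stepf (h^-1 * x + - (h^-1 * y)) -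
    stepf (h^-1 * x + - (h^-1 * z))) t * f t) <= delta.
  apply: HQ => //.
- exists (Num.min y z), (m + h); split; [by rewrite lt_min cy|rlra|].
  move=> t; apply: contra_neqT; rewrite negb_and -!ltNge => /orP[|].
    rewrite lt_min => /andP[ty tz].
    by rewrite !Z0// subrr.
  by move=> mt; rewrite !Z1 ?subrr//; rlra.
- move=> t; have /andP[? ?] := S01 (h^-1 * t + - (h^-1 * y)).
  have /andP[? ?] := S01 (h^-1 * t + - (h^-1 * z)).
  by rewrite ler_norml; apply/andP; split; rlra.
rewrite e3 in H3.
have iD g : C1 g -> intg `[c, d] (fun t => derive1 g t * f t).
  move=> cg; apply: (@integrable_continuousM R c d) => //; first exact: cg.2.
  exact: integrableS intf.
have E3 : \int[mu]_(t in `[c, d]) ((derive1 (fun t => stepf (h^-1 * t + - (h^-1 * y))) t -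
   derive1 (fun t => stepf (h^-1 * t + - (h^-1 * z))) t) * f t) =
   \int[mu]_(t in `[c, d]) (derive1 (fun t => stepf (h^-1 * t + - (h^-1 * y))) t * f t) -
   \int[mu]_(t in `[c, d]) (derive1 (fun t => stepf (h^-1 * t + - (h^-1 * z))) t * f t).
  by rewrite -RintegralB//; [apply: eq_Rintegral => t _; rewrite mulrBl|exact: iD|exact: iD].
rewrite E3 in H3.
exact: close_diff H1 H2 H3.
Qed.

(** The oscillation bound makes the values at Lebesgue points a Cauchy family; its limit is close to
    [f] at every Lebesgue point of a short interval, thus almost everywhere there, and the mean
    deviation follows. The functions [lo] and [hi] treat left and right traces at once. *)
Lemma mean_limit_exists (lo hi : R -> R) (r1 : R) f : 0 < r1 -> intg setT f ->
  (forall r, 0 < r -> hi r - lo r = r) ->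
  (forall r r', 0 < r -> r <= r' -> lo r' <= lo r /\ hi r <= hi r') ->
  (forall delta : R, 0 < delta -> exists2 s : R, 0 < s & forall y z,
    lo s < y < hi s -> lo s < z < hi s -> lebesgue_pt f y -> lebesgue_pt f z ->
    f y - f z <= delta) ->
  exists l : R, forall e : R, 0 < e -> exists2 r0 : R, 0 < r0 &
    forall r : R, 0 < r < r0 -> \int[mu]_(t in `]lo r, hi r[) `|f t - l| <= e * r.
Proof.
move=> r10 intf hlo nest osc.
have mf : measurable_fun [set: R] f by apply/measurable_EFinP; case/integrableP : intf.
have locf : locally_integrable setT f.
  split => //; first exact: openT.
  move=> K _ cK; have iK : intg K f.
    by apply: integrableS intf => //; exact: compact_measurable.
  by case/integrableP : iK.
have aeL := lebesgue_differentiation locf.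
(* An interval without Lebesgue points would be null, but its length is [r]. *)
have pts r : 0 < r -> exists y, lo r < y < hi r /\ lebesgue_pt f y.
  move=> r0; apply: contrapT => h.
  have : mu `]lo r, hi r[ = 0%E.
    apply/negligibleP => //.
    apply: negligibleS aeL => y; rewrite /= in_itv/= => yr ly; apply: h.
    by exists y.
  rewrite lebesgue_measure_itv/= lte_fin.
  have hr := hlo r r0; have -> : lo r < hi r by rewrite -subr_gt0 hr.
  by rewrite -EFinB hr => -[] /eqP; rewrite gt_eqF.
have [Y HY] := choice (fun n : nat => pts n.+1%:R^-1 ltac:(by rewrite invr_gt0)).
have inn s : 0 < s -> \forall n \near \oo, forall y, lo n.+1%:R^-1 < y < hi n.+1%:R^-1 ->
    lo s < y < hi s.
  move=> s0; near=> n => y /andP[h1 h2].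
  have [||h3 h4] := nest n.+1%:R^-1 s; first by rewrite invr_gt0.
    by apply: ltW; near: n; exact: (near_infty_natSinv_lt (PosNum s0)).
  by rewrite (le_lt_trans h3 h1) (lt_le_trans h2 h4).
have : cvg (f (Y n) @[n --> \oo]).
  apply/cauchy_cvgP; apply: cauchy_exP => e e0.
  have e2 : 0 < e / 2 by rewrite divr_gt0.
  have [s s0 hs] := osc _ e2; have [y [ys ly]] := pts s s0.
  exists (f y); have ins := inn s s0.
  suff : \forall n \near \oo, ball (f y) e (f (Y n)) by [].
  near=> n; rewrite /ball/=.
  have [h1 h2] := HY n.
  have h3 : lo s < Y n < hi s by move: (Y n) h1; near: n.
  have a1 := hs _ _ ys h3 ly h2; have a2 := hs _ _ h3 ys h2 ly.
  by rewrite ltr_norml; apply/andP; split; rlra.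
move=> cf; pose l := lim (f (Y n) @[n --> \oo]); exists l => e e0.
have e2 : 0 < e / 2 by rewrite divr_gt0.
have [s s0 hs] := osc _ e2; exists s => // r /andP[r0 rs].
have bd y : lo s < y < hi s -> lebesgue_pt f y -> `|f y - l| <= e.
  move=> ys ly; have ins := inn s s0.
  have h4 : \forall n \near \oo, `|l - f (Y n)| < e / 2.
    by move/cvgrPdist_lt : cf => /(_ _ e2).
  have : \forall n \near \oo, lo s < Y n < hi s.
    by apply: filterS ins => n; apply; have [] := HY n.
  move=> /(filterI h4) /filter_ex[n [h5 h3]].
  have [_ h2] := HY n.
  have a1 := hs _ _ ys h3 ly h2; have a2 := hs _ _ h3 ys h2 ly.
  move: h5; rewrite ltr_norml ler_norml => /andP[? ?]; apply/andP; split; rlra.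
have [n1 n2] := nest r s r0 (ltW rs).
have H : (\int[mu]_(t in `]lo r, hi r[) `|(f t - l)%:E| <= e%:E * mu `]lo r, hi r[)%E.
  apply: integral_le_bound => //.
- apply/measurable_EFinP; apply: measurable_funB => //.
  exact: measurable_funTS mf.
- by rewrite lee_fin ltW.
- move: aeL; apply: filterS; first exact: (ae_filter_ringOfSetsType mu).
  move=> t lt /=; rewrite in_itv/= => /andP[h1 h2].
  by rewrite lee_fin bd// (le_lt_trans n1 h1) (lt_le_trans h2 n2).
have hr := hlo r r0.
have lhr : lo r < hi r by rewrite -subr_gt0 hr.
rewrite lebesgue_measure_itv/= lte_fin lhr -EFinB hr -EFinM in H.
rewrite -lee_fin /Rintegral fineK//.
rewrite ge0_fin_numE; first by apply: le_lt_trans H _; exact: ltry.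
by apply: integral_ge0.
Unshelve. all: by end_near. Qed.

End traces.

(** * Variation away from finitely many points *)

Section points.
Context {R : realType}.
Local Notation mu := (@lebesgue_measure R).
Local Notation intg D f := (mu.-integrable D (EFin \o f)).
Implicit Types (M : domain R) (f g u w phi psi : R -> R) (p q r x y z t : R) (U : set R)
  (K : seq R).

(** On the circle this contains all integer translates of the points of [K], so that its complement
    is again periodic. *)
Definition Kp M K : set R := [set t | exists2 x, x \in K & dist_dom M x t = 0].

Definition UK M K : set R := interior_dom M `\` Kp M K.

Lemma dist_dom_cont M p : continuous (dist_dom M p).
Proof.
move=> t; apply/cvgrPdist_lt => e e0; apply: filterS (near_dist t e0) => s h.
rewrite ltr_norml; have h1 := dist_dom_lip M p t s; have h2 := dist_dom_lip M p s t.
rewrite (distrC s t) in h2; apply/andP; split; rlra.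
Qed.

Lemma closed_dist_itv M p (a b : R) : closed [set t | a <= dist_dom M p t <= b].
Proof.
have -> : [set t | a <= dist_dom M p t <= b] = dist_dom M p @^-1` `[a, b]%classic.
  by apply/seteqP; split => t /=; rewrite in_itv.
by apply: closed_comp => [t _|]; [exact: dist_dom_cont|exact: itv_closed].
Qed.

Lemma UK_nil M : UK M [::] = interior_dom M.
Proof. by rewrite /UK; apply/seteqP; split => [x []//|x xM]; split => // -[]. Qed.

Lemma UK_cons M x K t : UK M (x :: K) t <-> UK M K t /\ 0 < dist_dom M x t.
Proof.
split=> [[it h]|[[it h] d]].
- split; first by split => // -[y yK e]; apply: h; exists y => //; rewrite inE yK orbT.
  rewrite lt_neqAle dist_dom_ge0 andbT eq_sym; apply/eqP => e; apply: h.
  by exists x => //; exact: mem_head.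
- split=> // -[y]; rewrite inE => /predU1P[-> e|yK e]; first by rewrite e ltxx in d.
  by apply: h; exists y.
Qed.

Lemma UK_cons_sub M x K : UK M (x :: K) `<=` UK M K.
Proof. by move=> t /UK_cons[]. Qed.

Lemma UK_interior M K : UK M K `<=` interior_dom M.
Proof. by move=> t []. Qed.

Lemma interior_on_domain M : on_domain M (interior_dom M).
Proof. by case: M. Qed.

Lemma interior_open M : open (interior_dom M).
Proof. by case: M => [a b ab|]; [exact: itv_open|exact: openT]. Qed.

Lemma UK_open M K : open (UK M K).
Proof.
elim: K => [|x K ih]; first by rewrite UK_nil; exact: interior_open.
have -> : UK M (x :: K) = UK M K `&` dist_dom M x @^-1` [set y : R | 0 < y].
  by apply/seteqP; split => t; rewrite UK_cons.
apply: openI => //; apply: open_comp; last exact: open_gt.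
by move=> t _; exact: dist_dom_cont.
Qed.

Lemma UK_on_domain M K : on_domain M (UK M K).
Proof.
have H x y : eqM M x y -> UK M K x -> UK M K y.
  move=> xy [h1 h2]; split; first by rewrite -(on_domain_eqM (interior_on_domain M) xy).
  by move=> [z zK e]; apply: h2; exists z => //; rewrite (dist_dom_eqM z xy).
case: M H => //= H x; apply/propext; split; apply: H.
  by exists (-1); rewrite intrN addrK.
by exists 1.
Qed.

Lemma C1c_gap M U x phi : C1c M U phi -> ~ U x ->
  exists2 r : R, 0 < r & forall t, dist_dom M x t < r -> phi t = 0.
Proof.
move=> hphi nU; have [oD d1 c1 h] := hphi.
have : (~` closure [set x | phi x != 0]) x by move=> /h.
have : open (~` closure [set x | phi x != 0]) by apply: closed_openC; exact: closed_closure.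
move=> /[swap] cx /(_ x cx)[e /= e0 he]; exists e => // t.
rewrite dist_domE => h1; rewrite (on_domain_eqM oD (eqM_rep M x t)).
have := he (rep M x t); rewrite /= distrC => /(_ h1) h2.
by apply/eqP; apply: contrapT => /negP h3; apply: h2; exact: subset_closure.
Qed.

Lemma add_le_lt (a b c d : R) : a - d < b -> b + c <= a -> c <= d.
Proof. by move=> *; rlra. Qed.

(** An almost maximizing test function [psi] vanishes near [K]. A test function that lives closer to
    [K] has values on a disjoint set, so it may be added to [psi]; since the sum cannot exceed the
    supremum, it gains at most the deficit [delta] of [psi]. *)
Lemma small_tv M K u : L1 M u -> (weighted_tv M (UK M K) (fun=> 1%R) u < +oo)%E ->
  (forall x, x \in K -> carrier M x) ->
  forall delta : R, 0 < delta -> exists2 r0 : R, 0 < r0 &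
    forall phi, C1c M (UK M K) phi -> (forall t, `|phi t| <= 1) ->
      (forall t, phi t != 0 -> exists2 x, x \in K & dist_dom M x t < r0) ->
      pair M u phi <= delta.
Proof.
move=> hu Vfin hK delta d0.
set V := weighted_tv _ _ _ _ in Vfin.
have V0 : (0 <= V)%E by apply: weighted_tv_ge0.
have Vn : V \is a fin_num by rewrite ge0_fin_numE.
have [|psi [hpsi psi1 psiV]] := @weighted_tv_gtP R M (UK M K) (fun=> 1) u (fine V - delta) hu.
  by rewrite -/V -{2}(fineK Vn) lte_fin; rlra.
have gap x : x \in K -> exists2 r : R, 0 < r & forall r', 0 < r' <= r ->
    (fun x r => forall t, dist_dom M x t < r -> psi t = 0) x r'.
  move=> xK; have [|r r0 hr] := C1c_gap (x := x) hpsi.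
    by move=> [_]; apply; exists x => //; rewrite dist_domE near_rep subrr normr0.
  exists r => // r' /andP[_ rr] t h; apply: hr; exact: lt_le_trans h rr.
have [r r0 hr] := seq_radius gap; exists r => // phi hphi phi1 near_K.
have disj t : phi t != 0 -> psi t = 0.
  by move=> /near_K[x xK h]; apply: (hr x xK r) => //; rewrite r0 lexx.
have := @weighted_tv_ge R M (UK M K) (fun=> 1) u _ hu (C1cD hpsi hphi).
rewrite -/V -(fineK Vn) lee_fin pairD//; [|exact: C1c_C1 hpsi|exact: C1c_C1 hphi].
move=> H; apply: add_le_lt psiV _; apply: H => t Ut; have [e|/disj e] := eqVneq (phi t) 0; first by rewrite e addr0; exact: psi1.
by rewrite e add0r; exact: phi1.
Qed.

Definition has_traces u x : Prop :=
  (exists l, is_rtrace u x l) /\ (exists l, is_ltrace u x l).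

Lemma right_traceP u x : has_traces u x -> is_rtrace u x (right_trace u x).
Proof. by move=> [h _]; exact: getPex h. Qed.

Lemma left_traceP u x : has_traces u x -> is_ltrace u x (left_trace u x).
Proof. by move=> [_ h]; exact: getPex h. Qed.

Lemma closed_sub_UK M K p (a b r0 : R) : interior_dom M p -> 0 < a ->
  window M p r0 -> b < r0 ->
  (forall x, x \in K -> dist_dom M p x = 0 \/ r0 <= dist_dom M p x) ->
  [set t | a <= dist_dom M p t <= b] `<=` UK M K.
Proof.
move=> ip a0 wp br hK t /= /andP[at_ tb]; split.
- rewrite (on_domain_eqM (interior_on_domain M) (eqM_rep M p t)).
  apply: (window_interior wp); rewrite /= in_itv/= -ltr_distl -dist_domE.
  exact: le_lt_trans tb br.
- move=> [x xK e]; have := hK x xK.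
  have e1 : dist_dom M p t <= dist_dom M p x.
    by apply: le_trans (dist_dom_triangle M p x t) _; rewrite e addr0.
  have e2 : dist_dom M p x <= dist_dom M p t.
    by apply: le_trans (dist_dom_triangle M p t x) _; rewrite (dist_dom_sym M t) e addr0.
  by case => h; rlra.
Qed.

(** On a one-sided interval next to [p] the variation tends to 0 by [small_tv], hence the
    oscillation over Lebesgue points does, and the one-sided mean limits exist. The point [p] may
    itself belong to [K], where no bound on the variation is known beforehand. *)
Lemma traces_exist M K u p : L1 M u ->
  (weighted_tv M (UK M K) (fun=> 1%R) u < +oo)%E ->
  (forall x, x \in K -> carrier M x) -> interior_dom M p -> has_traces u p.
Proof.
move=> hu Vfin0 hK0 ip.
(* Removing [p] keeps a jump at [p] out of the variation that has to become small. *)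
pose K' := p :: K.
have Vfin : (weighted_tv M (UK M K') (fun=> 1%R) u < +oo)%E.
  by apply: le_lt_trans Vfin0; apply: weighted_tv_mono => //; exact: UK_cons_sub.
have pc : carrier M p.
  by case: M ip {hu Vfin0 hK0 Vfin K'} => //= a b ab; rewrite !in_itv/= => /andP[/ltW -> /ltW ->].
have hK x : x \in K' -> carrier M x by rewrite inE => /predU1P[->|/hK0].
have [rw rw0 hw] := window_exists ip.
have [rk rk0 hk] : exists2 r : R, 0 < r & forall x, x \in K' ->
    dist_dom M p x = 0 \/ r <= dist_dom M p x.
  have [|r r0 H] := @seq_radius R K' (fun x r => dist_dom M p x = 0 \/ r <= dist_dom M p x).
    move=> x _; have [e|h] := eqVneq (dist_dom M p x) 0.
      by exists 1 => // r' _; left.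
    exists (dist_dom M p x) => [|r' /andP[_ h1]]; last by right.
    by rewrite lt_neqAle eq_sym h dist_dom_ge0.
  by exists r => // x xK; apply: H => //; rewrite r0 lexx.
have stv := small_tv hu Vfin hK; clear Vfin Vfin0.
pose r1 := Num.min (1 / 3) (Num.min rw rk).
have r10 : 0 < r1 by rewrite !lt_min rw0 rk0 divr_gt0.
have r13 : r1 <= 1 / 3 by rewrite ge_min lexx.
have r1w : r1 <= rw by rewrite /r1 !ge_min lexx !orbT.
have r1k : r1 <= rk by rewrite /r1 !ge_min lexx !orbT.
have wp : window M p r1 by apply: hw; rewrite r10.
have iu := L1_window hu wp.
(* Truncation gives a function integrable on the whole line, as Lebesgue differentiation is applied
   there. *)
pose f := u \_ `[p - r1, p + r1].
have intf : intg setT f.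
  rewrite /f -restrict_EFin; apply/integrable_restrict => //.
  by rewrite setTI.
have fE t : p - r1 <= t <= p + r1 -> f t = u t.
  by move=> h; rewrite /f patchE mem_set//= in_itv.
(* A test function supported strictly inside (p, p + s) or (p - s, p) lifts to one on [M] whose
   support avoids [K']. *)
have key (s delta c d : R) : 0 < s -> s < r1 -> (c = p /\ d = p + s) \/ (c = p - s /\ d = p) ->
   (forall phi, C1c M (UK M K') phi -> (forall t, `|phi t| <= 1) ->
      (forall t, phi t != 0 -> exists2 x, x \in K' & dist_dom M x t < s) ->
      pair M u phi <= delta) ->
   forall Q, C1 Q -> (exists c' d' : R, [/\ c < c', d' < d &
      forall t, Q t != 0 -> c' <= t <= d']) -> (forall t, `|Q t| <= 1) ->
    \int[mu]_(t in `[c, d]) (derive1 Q t * f t) <= delta.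
  move=> s0 sr1 cd H Q cQ [c' [d' [cc' dd' Q0]]] Q1.
  have [a [b [a0 bs ab]]] : exists a b : R, [/\ 0 < a, b < s & forall t, c' <= t <= d' -> a <= `|t - p| <= b].
    case: cd => -[ec ed].
      exists (c' - p), (d' - p); split; [rlra|rlra|move=> t /andP[h1 h2]].
      by rewrite ger0_norm; [apply/andP; split; rlra|rlra].
    exists (p - d'), (p - c'); split; [rlra|rlra|move=> t /andP[h1 h2]].
    by rewrite ler0_norm; [apply/andP; split; rlra|rlra].
  have cdp : c <= d /\ p - s <= c /\ d <= p + s by case: cd => -[-> ->]; split; [rlra|split; rlra|rlra|split; rlra].
  have [cld [psc dps]] := cdp.
  have Qab t : ~ (a <= `|t - p| <= b) -> Q t = 0.
    by move=> h; apply/eqP; apply: contra_notT h => /Q0/ab.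
  have [cl el] : C1 (Q \o rep M p) /\ derive1 (Q \o rep M p) = derive1 Q \o rep M p.
    apply: (@C1_lift R M p Q s) => // _; split; first by rlra.
    by move=> t h; apply: Qab => /andP[_ h2]; rlra.
  have hphi : C1c M (UK M K') (Q \o rep M p).
    apply: (@C1c_intro R M _ [set t | a <= dist_dom M p t <= b]) => //.
    - exact: rep_on_domain.
    - exact: closed_dist_itv.
    - move=> t; rewrite /= dist_domE => h; apply: contrapT => h2.
      by move: h; rewrite Qab ?eqxx.
    - apply: (closed_sub_UK ip a0 wp) => [|x xK]; first by rlra.
      by have [->|h] := hk x xK; [left|right; rlra].
  have := H _ hphi _ _; rewrite (pair_window hu wp r10 cl (rep_on_domain M Q p)); last first.
    move=> t; rewrite dist_domE => h; rewrite el /=.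
    rewrite (@derive1_near _ _ (fun=> 0)); first by rewrite (C1_cst 0).2.
    have sb : 0 < `|rep M p t - p| - b by rlra.
    apply: filterS (near_dist (rep M p t) sb) => x hx; apply: Qab => /andP[_ h2].
    have := ler_normD (rep M p t - x) (x - p); rewrite addrA subrK; rlra.
  have -> : \int[mu]_(t in `[(p - r1), (p + r1)]) (derive1 (Q \o rep M p) t * u t) =
      \int[mu]_(t in `[c, d]) (derive1 Q t * f t).
    rewrite (@Rintegral_cc_supp R _ (p - r1) (p + r1) c d); [|rlra|rlra|].
      apply: eq_Rintegral => t; rewrite inE/= in_itv/= => /andP[h1 h2].
      have h3 : `|t - p| < 1 / 2 by rewrite ltr_norml; apply/andP; split; rlra.
      by rewrite el/= near_rep// fE//; apply/andP; split; rlra.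
    move=> t /andP[h1 h2] ncd.
    have h3 : `|t - p| < 1 / 2 by rewrite ltr_norml; apply/andP; split; rlra.
    rewrite el /= near_rep//.
    rewrite (@derive1_near _ _ (fun=> 0)); first by rewrite (C1_cst 0).2 mul0r.
    have : ~ (c' <= t <= d') by move=> /andP[h4 h5]; apply: ncd; apply/andP; split; rlra.
    move=> /negP; rewrite negb_and -!ltNge => /orP[h4|h4].
      have sb : 0 < c' - t by rlra.
      apply: filterS (near_dist t sb) => x; rewrite ltr_norml => /andP[h5 h6].
      by apply/eqP; apply: contraT => /Q0/andP[h7 h8]; exfalso; rlra.
    have sb : 0 < t - d' by rlra.
    apply: filterS (near_dist t sb) => x; rewrite ltr_norml => /andP[h5 h6].
    by apply/eqP; apply: contraT => /Q0/andP[h7 h8]; exfalso; rlra.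
  apply; first by move=> t; exact: Q1.
  move=> t h; exists p; first exact: mem_head.
  rewrite dist_domE; apply: contrapT => /negP; rewrite -leNgt => h2.
  by move: h; rewrite /= Qab ?eqxx// => /andP[_ h3]; rlra.
have osc (lo hi : R -> R) : (forall s, (lo s = p /\ hi s = p + s) \/ (lo s = p - s /\ hi s = p)) ->
  (forall delta : R, 0 < delta -> exists2 s : R, 0 < s & forall y z,
    lo s < y < hi s -> lo s < z < hi s -> lebesgue_pt f y -> lebesgue_pt f z ->
    f y - f z <= delta).
  move=> lohi delta d0; have [r0 r00 hr0] := stv delta d0.
  pose s := Num.min (r0 / 2) (r1 / 2).
  have s0 : 0 < s by rewrite lt_min !divr_gt0.
  have s1 : s <= r0 / 2 by rewrite ge_min lexx.
  have s2 : s <= r1 / 2 by rewrite ge_min lexx orbT.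
  exists s => // y z hy hz ly lz.
  apply: (@oscillation_le R f (lo s) (hi s) delta) => //.
  apply: (key s) => //; first by rlra.
  move=> phi h1 h2 h3; apply: hr0 => // t /h3[x xK h4]; exists x => //; rlra.
have fu (D : set R) l : D `<=` `[p - r1, p + r1] ->
    \int[mu]_(t in D) `|f t - l| = \int[mu]_(t in D) `|u t - l|.
  by move=> h; apply: eq_Rintegral => t; rewrite inE => /h; rewrite /= in_itv/= => /fE ->.
split.
- have [|||l hl] := @mean_limit_exists R (fun=> p) (fun s => p + s) r1 f r10 intf.
  + by move=> r _; rlra.
  + by move=> r r' _ h; split; rlra.
  + by apply: osc => s; left.
  exists l; apply/meanP => e e0; have [r0 r00 h] := hl e e0.
  exists (Num.min r0 r1); first by rewrite lt_min r00.
  move=> r; rewrite lt_min => /and3P[h1 h2 h3]; rewrite -fu; first by apply: h; rewrite h1.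
  by move=> t /=; rewrite !in_itv/= => /andP[h4 h5]; apply/andP; split; rlra.
- have [|||l hl] := @mean_limit_exists R (fun s => p - s) (fun=> p) r1 f r10 intf.
  + by move=> r _; rlra.
  + by move=> r r' _ h; split; rlra.
  + by apply: osc => s; right.
  exists l; apply/meanP => e e0; have [r0 r00 h] := hl e e0.
  exists (Num.min r0 r1); first by rewrite lt_min r00.
  move=> r; rewrite lt_min => /and3P[h1 h2 h3]; rewrite -fu; first by apply: h; rewrite h1.
  by move=> t /=; rewrite !in_itv/= => /andP[h4 h5]; apply/andP; split; rlra.
Qed.

End points.

(** * Contribution of single points to the weighted variation *)

Section jump_formula.
Context {R : realType}.
Local Notation mu := (@lebesgue_measure R).
Implicit Types (M : domain R) (f g u w phi psi : R -> R) (p q r x y z t : R) (U : set R)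
  (K : seq R).

Lemma bump_small (M : domain R) : exists2 r0 : R, 0 < r0 & forall r, r < r0 -> M = Torus -> 2 * r < 1 / 2.
Proof. by exists (1 / 4) => // r h _; rlra. Qed.

Lemma mul_le_abs (a b c d : R) : `|a| <= b -> a * (c - d) <= b * `|d - c|.
Proof.
move=> ab; apply: le_trans (ler_norm _) _.
by rewrite normrM (distrC c); apply: ler_wpM2r.
Qed.

(** A bump splits [phi] at [x]. The outer part is admissible off [x]; the pairing with the inner
    part tends to [phi x] times the difference of the traces, and [phi x] is bounded by [w x]. *)
Lemma weighted_tv_point_le M U x w u : L1 M u -> interior_dom M x -> has_traces u x ->
  (forall t, 0 <= w t) -> U `<=` interior_dom M ->
  (weighted_tv M U w u <=
   weighted_tv M (U `&` [set t | (0 < dist_dom M x t)%R]) w u + (w x * jump M u x)%:E)%E.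
Proof.
move=> hu ix tx w0 Ui; apply: weighted_tv_le => // phi hphi phiw.
set W := weighted_tv _ _ _ _.
have W0 : (0 <= W)%E by apply: weighted_tv_ge0.
have [Wn|Winf] := boolP (W \is a fin_num); last first.
  by move: Winf; rewrite ge0_fin_numE// -leNgt leye_eq => /eqP ->; rewrite addye// leey.
rewrite -(fineK Wn) -EFinD lee_fin.
have phix : `|phi x| <= w x.
  by have [Ux|nUx] := pselect (U x); [exact: phiw|rewrite (C1c_supp hphi nUx) normr0].
have cphi := C1c_C1 hphi.
have ophi : on_domain M phi by case: hphi.
have cvg := pair_bump_cvg hu ix (right_traceP tx) (left_traceP tx) cphi ophi.
set L := phi x * _ in cvg.
have Lle : L <= w x * jump M u x.
  by rewrite /jump mem_set// /L; exact: mul_le_abs phix.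
apply: le_trans (_ : pair M u phi <= fine W + L) _; last by rewrite lerD2l.
apply/ler_addgt0Pr => e e0.
move/cvgrPdist_le : cvg => /(_ e e0) /near_rightP[r1 r10 H].
have [r2 r20 hr2] := bump_small M.
pose r := Num.min (r1 / 2) (r2 / 2).
have r0 : 0 < r by rewrite lt_min !divr_gt0.
have ra : r <= r1 / 2 by rewrite ge_min lexx.
have rb : r <= r2 / 2 by rewrite ge_min lexx orbT.
have r4 : M = Torus -> 2 * r < 1 / 2 by apply: hr2; clear -rb r20; rlra.
have [[cb ob] b1 b0 b01 _] := bumpP x r0 r4.
have {}H := H r ltac:(clear -r0 ra r10; apply/andP; split; rlra).
have [k _] := C1_cst (1 : R).
have h1 : C1c M U (fun t => phi t * (1 - bump M x r t)).
  apply: (C1cM hphi (C1B k cb).1).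
  by move: ob; case: (M) => //= h t; rewrite h.
have h2 : C1c M (U `&` [set t | (0 < dist_dom M x t)%R]) (fun t => phi t * (1 - bump M x r t)).
  have a1 : on_domain M (fun t => phi t * (1 - bump M x r t)) by case: h1.
  apply: (@C1c_intro R M _ (closure [set t | phi t * (1 - bump M x r t) != 0] `&`
      dist_dom M x @^-1` [set y | r <= y]) _ a1 (C1c_C1 h1)).
  - apply: closedI; first exact: closed_closure.
    by apply: closed_comp => [t _|]; [exact: dist_dom_cont|exact: closed_ge].
  - move=> t h; split; first exact: subset_closure.
    rewrite /= leNgt; apply/negP => hd; move: h.
    by rewrite b1 ?subrr ?mulr0 ?eqxx// ltW.
  - move=> t [h3 /= h4]; split; last exact: lt_le_trans h4.
    by case: h1 => _ _ _; apply.
have hw t : (U `&` [set t | (0 < dist_dom M x t)%R]) t -> `|phi t * (1 - bump M x r t)| <= w t.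
  move=> [Ut _]; rewrite normrM; apply: le_trans (phiw t Ut).
  rewrite ler_piMr//; have /andP[? ?] := b01 t.
  by rewrite ler_norml; apply/andP; split; rlra.
have := weighted_tv_ge hu h2 hw; rewrite -/W -(fineK Wn) lee_fin.
have -> : pair M u phi = pair M u (fun t => phi t * (1 - bump M x r t)) +
    pair M u (fun t => phi t * bump M x r t).
  rewrite -(pairD hu (C1c_C1 h1) (C1M cphi cb).1).
  by congr pair; apply/funext => t; rewrite mulrBr mulr1 subrK.
move: H; clear Lle; move: (pair _ _ _) (pair _ _ _) (fine W) L => a b c d.
by rewrite /= ler_norml => /andP[? ?] ?; rlra.
Qed.

(** A test function off [x] vanishes near [x], so there is room for a narrow bump of height [h]
    there, admissible because [w] is at least [h] nearby; its pairing adds almost [h] times the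
    jump. *)
Lemma weighted_tv_point_ge M K x w u (h rho : R) : L1 M u -> UK M K x -> has_traces u x ->
  0 <= h -> (forall t, 0 <= w t) -> 0 < rho ->
  (forall t, dist_dom M x t < rho -> h <= w t) ->
  (weighted_tv M (UK M (x :: K)) w u + (h * jump M u x)%:E <=
   weighted_tv M (UK M K) w u)%E.
Proof.
move=> hu Ux tx h0 w0 rho0 hw; rewrite addeC -leeBrDl//.
apply: weighted_tv_le => // psi hpsi psiw.
rewrite leeBrDl//.
set W := weighted_tv _ _ _ _.
have W0 : (0 <= W)%E by apply: weighted_tv_ge0.
have [Wn|Winf] := boolP (W \is a fin_num); last first.
  by move: Winf; rewrite ge0_fin_numE// -leNgt leye_eq => /eqP ->; rewrite leey.
rewrite -(fineK Wn) -EFinD lee_fin.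
have ix := UK_interior Ux.
have nUx : ~ UK M (x :: K) x.
  by move=> /UK_cons[_]; rewrite dist_domE near_rep subrr normr0 ?ltxx.
have [r3 r30 hr3] := C1c_gap hpsi nUx.
(* The sign of the bump is that of left minus right trace, which makes its contribution positive. *)
pose s : R := if 0 <= left_trace u x - right_trace u x then 1 else -1.
have s1 : `|s| = 1 by rewrite /s; case: ifP; rewrite ?normrN normr1.
have sj : s * h * (left_trace u x - right_trace u x) = h * jump M u x.
  rewrite /jump mem_set// distrC (mulrC s) -mulrA; congr (_ * _).
  rewrite /s; case: ifPn => [h1|]; first by rewrite mul1r ger0_norm.
  by rewrite -ltNge => h1; rewrite mulN1r ltr0_norm.
have [cc _] := C1_cst (s * h).
have oc : on_domain M (fun=> s * h) by case: (M).
have cvg := pair_bump_cvg hu ix (right_traceP tx) (left_traceP tx) cc oc.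
rewrite sj in cvg.
apply/ler_addgt0Pr => e e0.
move/cvgrPdist_le : cvg => /(_ e e0) /near_rightP[r1 r10 H].
have [r2 r20 hr2] := bump_small M.
have [rw rw0 hrw] := window_exists ix.
have [r5 r50 hr5] : exists2 r : R, 0 < r & forall t, dist_dom M x t < r -> UK M K t.
  have := @UK_open R M K; rewrite openE => /(_ x Ux)[r /= r0 hr]; exists r => // t ht.
  have := @UK_on_domain R M K => /on_domain_eqM/(_ (eqM_rep M x t)) ->.
  by apply: hr; rewrite /= distrC -dist_domE.
pose m := Num.min (Num.min r1 r2) (Num.min (Num.min r3 rho) r5).
have m0 : 0 < m by rewrite !lt_min r10 r20 r30 rho0.
have : m <= m by []. rewrite {2}/m !le_min => /andP[/andP[m1 m2] /andP[/andP[m3 m4] m5]].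
pose r := m / 3.
have r0 : 0 < r by rewrite divr_gt0.
have rm : 3 * r = m by rewrite /r mulrC divfK.
have r4 : M = Torus -> 2 * r < 1 / 2 by apply: hr2; clear -rm m2 r0; rlra.
have [[cb ob] b1 b0 b01 _] := bumpP x r0 r4.
have {}H := H r ltac:(clear -r0 rm m1; apply/andP; split; rlra).
have bz t : bump M x r t != 0 -> dist_dom M x t < 2 * r.
  by move=> hb; rewrite ltNge; apply: contra hb => /b0[-> _].
have h1 : C1c M (UK M K) (fun t => s * h * bump M x r t).
  apply: (@C1c_intro R M _ [set t | 0 <= dist_dom M x t <= 2 * r]).
  - by move: ob; case: (M) => //= hh t; rewrite hh.
  - exact: (C1Z _ cb).1.
  - exact: closed_dist_itv.
  - move=> t; rewrite mulf_eq0 negb_or => /andP[_ /bz/ltW]; rewrite /= => ->.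
    by rewrite dist_dom_ge0.
  - by move=> t /= /andP[_ ht]; apply: hr5; clear -ht rm m5 r0; rlra.
have h2 := C1c_sub (@UK_cons_sub R M x K) hpsi.
have := @weighted_tv_ge R M (UK M K) w u _ hu (C1cD h2 h1).
rewrite -/W -(fineK Wn) lee_fin (pairD hu (C1c_C1 hpsi) (C1c_C1 h1)) => HW.
have {HW} : pair M u psi + pair M u (fun t => s * h * bump M x r t) <= fine W.
  apply: HW => t Ut; have [d|d] := ltP (dist_dom M x t) (2 * r).
    rewrite hr3; last by clear -d rm m3 r0; rlra.
    rewrite add0r normrM normrM s1 mul1r (ger0_norm h0).
    have /andP[h3 h4] := b01 t; rewrite (ger0_norm h3).
    apply: le_trans (_ : h <= _); first by rewrite ler_piMr.
    by apply: hw; clear -d rm m4 r0; rlra.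
  have [-> _] := b0 t d; rewrite mulr0 addr0; apply: psiw; apply/UK_cons; split => //.
  by clear -d r0; rlra.
move: H; move: (pair _ _ _) (pair _ _ _) (fine W) (h * _) => a b c d.
by rewrite /= ler_norml => /andP[? ?] ?; rlra.
Qed.

Lemma UK_endpoint M x K : carrier M x -> ~ interior_dom M x -> UK M (x :: K) = UK M K.
Proof.
move=> cx nx; apply/seteqP; split => t; first exact: UK_cons_sub.
move=> Ut; apply/UK_cons; split => //; rewrite lt_neqAle dist_dom_ge0 andbT eq_sym.
apply/eqP => e; apply: nx; have := UK_interior Ut.
rewrite (on_domain_eqM (interior_on_domain M) (eqM_rep M x t)).
by move: e; rewrite dist_domE => /eqP; rewrite normr_eq0 subr_eq0 => /eqP ->.
Qed.

Lemma weighted_tv_UK_le M K w u : L1 M u -> (forall x, x \in K -> carrier M x) ->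
  (forall x, x \in K -> interior_dom M x -> has_traces u x) -> (forall t, 0 <= w t) ->
  (weighted_tv M (interior_dom M) w u <=
   weighted_tv M (UK M K) w u + (\sum_(x <- K) w x * jump M u x)%:E)%E.
Proof.
move=> hu + + w0; elim: K => [_ _|x K ih hK hT].
  by rewrite UK_nil big_nil adde0.
apply: le_trans (ih _ _) _.
- by move=> y yK; apply: hK; rewrite inE yK orbT.
- by move=> y yK; apply: hT; rewrite inE yK orbT.
rewrite big_cons EFinD addeA leeD2r//.
have [ix|nx] := pselect (interior_dom M x); last first.
  have jx : jump M u x = 0 by rewrite /jump memNset.
  rewrite jx mulr0 adde0 UK_endpoint//; apply: hK; exact: mem_head.
apply: le_trans (weighted_tv_point_le hu ix _ w0 (@UK_interior R M K)) _.
  by apply: hT => //; exact: mem_head.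
rewrite leeD2r// ; apply: weighted_tv_mono => // t [h1 h2]; exact/UK_cons.
Qed.

Definition separated M K : Prop := pairwise (fun x y => dist_dom M x y != 0) K.

Lemma weighted_tv_UK_ge M K w u (h : R -> R) : L1 M u -> separated M K ->
  (forall x, x \in K -> [/\ interior_dom M x, has_traces u x, 0 <= h x &
     exists2 rho : R, 0 < rho & forall t, dist_dom M x t < rho -> h x <= w t]) ->
  (forall t, 0 <= w t) ->
  (weighted_tv M (UK M K) w u + (\sum_(x <- K) h x * jump M u x)%:E <=
   weighted_tv M (interior_dom M) w u)%E.
Proof.
move=> hu + + w0; elim: K => [_ _|x K ih].
  by rewrite UK_nil big_nil adde0.
rewrite /separated pairwise_cons => /andP[/allP sx sK] hK.
apply: le_trans (ih sK _); last by move=> y yK; apply: hK; rewrite inE yK orbT.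
rewrite big_cons EFinD addeA leeD2r//.
have [ix tx hx [rho rho0 hr]] := hK x (mem_head _ _).
apply: (weighted_tv_point_ge hu _ tx hx w0 rho0 hr).
split => // -[y yK /eqP e]; have := sx y yK.
by rewrite dist_dom_sym => /negP; apply.
Qed.

Lemma jump_ge0 M u x : 0 <= jump M u x.
Proof. by rewrite /jump; case: ifP. Qed.

Lemma BV_traces M u x : BV M u -> interior_dom M x -> has_traces u x.
Proof. by move=> [hu V] ix; apply: (@traces_exist R M [::]) => //; rewrite UK_nil. Qed.

(** Finitely many points cannot carry infinite variation: traces exist there, and each point adds
    only its finite jump. *)
Lemma BV_UK M K u : L1 M u -> (forall x, x \in K -> carrier M x) ->
  (weighted_tv M (UK M K) (fun=> 1%R) u < +oo)%E -> BV M u.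
Proof.
move=> hu hK V; split => //.
apply: le_lt_trans (weighted_tv_UK_le (K := K) (w := fun=> 1) hu hK _ _) _ => //.
  by move=> x _ ix; exact: traces_exist hu V hK ix.
by rewrite lte_add_pinfty// ltry.
Qed.

(** The complement of finitely many points is one of the open sets over which the infimum is
    taken. *)
Lemma tv_measure_le M K (A : set R) u : L1 M u ->
  (forall t, interior_dom M t -> Kp M K t -> A t) ->
  (tv_measure M u (interior_dom M `\` A) <= weighted_tv M (UK M K) (fun=> 1%R) u)%E.
Proof.
move=> hu KA; apply: ereal_inf_lbound; exists (UK M K) => //; split.
- exact: UK_open.
- exact: UK_on_domain.
- by move=> t [it nA]; split => // /(KA t it).
- exact: UK_interior.
Qed.

End jump_formula.

(** * Sobolev functions *)

Section sobolev.
Context {R : realType}.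
Local Notation mu := (@lebesgue_measure R).
Local Notation intg D f := (mu.-integrable D (EFin \o f)).
Implicit Types (M : domain R) (f g h u v w phi psi : R -> R) (p q r x y z t : R) (U : set R).

(** Cousin's lemma, a form of compactness of [x, y]: a local property of intervals that can be
    concatenated is global. The supremum of the right ends reached from [x] is itself reached, and
    it cannot lie before [y]. *)
Lemma cousin (P : R -> R -> Prop) x y : x <= y ->
  (forall c, x <= c <= y -> exists2 e : R, 0 < e & forall s t, x <= s -> s <= t -> t <= y ->
     `|s - c| < e -> `|t - c| < e -> P s t) ->
  (forall r s t, x <= r -> r <= s -> s <= t -> t <= y -> P r s -> P s t -> P r t) ->
  P x y.
Proof.
move=> xy loc tr.
pose S := [set t | x <= t <= y /\ P x t].
have xx : x <= x <= y by rewrite lexx.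
have Sx : S x.
  have [e e0 h] := loc x xx.
  by split=> //; apply: h; rewrite ?lexx// subrr normr0.
have hsS : has_sup S by split; [exists x|exists y => t [/andP[]]].
have cS : x <= sup S <= y.
  apply/andP; split; first exact: ub_le_sup hsS.2 _ Sx.
  by apply: ge_sup; [exists x|move=> t [/andP[]]].
have [e e0 h] := loc (sup S) cS.
have [t [/andP[xt ty] Pt] tS] := sup_adherent e0 hsS.
have tle : t <= sup S by apply: ub_le_sup hsS.2 _ _; split => //; rewrite xt.
pose z := Num.min y (sup S + e / 2).
have zy : z <= y by rewrite ge_min lexx.
have ze : z <= sup S + e / 2 by rewrite ge_min lexx orbT.
have /andP[cS1 cS2] := cS.
have Sz : sup S <= z by rewrite le_min cS2 lerDl divr_ge0// ltW.
have Pz : P x z.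
  apply: (tr x t z) => //; first exact: le_trans tle Sz.
  apply: h => //; first exact: le_trans tle Sz.
    by rewrite ltr_norml; apply/andP; split; rlra.
  by rewrite ltr_norml; apply/andP; split; rlra.
have : z <= sup S by apply: ub_le_sup hsS.2 _ _; split => //; rewrite zy (le_trans cS1 Sz).
have [yz|zlt] := leP y (sup S + e / 2).
  by have <- : z = y by rewrite /z min_l.
have ez : z = sup S + e / 2 by rewrite /z min_r// ltW.
by rewrite ez gerDl leNgt divr_gt0.
Qed.

(** The cell has finite measure, and |g| is dominated by 1 + g^2. *)
Lemma L2_L1 M g : L2 M g -> L1 M g /\ L1 M (fun x => g x ^+ 2).
Proof.
move=> [og mg fg]; have [a [b [e ab]]] := cell_bounded M.
have m2 : measurable_fun (cell M : set (measurableTypeR R)) (fun x => g x ^+ 2).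
  exact: measurable_funX.
have i2 : intg (cell M) (fun x => g x ^+ 2).
  apply/integrableP; split; first exact/measurable_EFinP.
  under eq_integral do rewrite /= ger0_norm ?sqr_ge0//.
  exact: fg.
have o2 : on_domain M (fun x => g x ^+ 2).
  by case: M og {mg fg e m2 i2} => //= h x; rewrite h.
split; split => //.
have i1 : intg (cell M) (fun=> 1).
  rewrite e; apply: (@integrable_continuous R a b) => // x; exact: cvg_cst.
have i3 : intg (cell M) (fun x => 1 + g x ^+ 2).
  by apply: intgD => //; exact: cell_measurable.
apply: le_integrable i3; first exact: cell_measurable.
  exact/measurable_EFinP.
move=> x _ /=; rewrite lee_fin [leRHS]ger0_norm ?addr_ge0 ?sqr_ge0//.
rewrite -real_normK ?num_real//; have := normr_ge0 (g x).
move: `|g x| => k k0; have := sqr_ge0 (k - 1 / 2); nra.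
Qed.

Lemma cell_window M : exists p r : R, [/\ 0 < r, window M p r & cell M = `[p - r, p + r]%classic].
Proof.
case: M => [a b ab|].
  exists ((a + b) / 2), ((b - a) / 2); have e1 : (a + b) / 2 - (b - a) / 2 = a by field.
  have e2 : (a + b) / 2 + (b - a) / 2 = b by field.
  by split; rewrite /= ?e1 ?e2//; rlra.
exists (1 / 2), (1 / 2); split => //=; have -> : 1 / 2 - 1 / 2 = 0 :> R by field.
by have -> : 1 / 2 + 1 / 2 = 1 :> R by field.
Qed.

Lemma Rintegral_cell_window M f p r : L1 M f -> window M p r -> 0 < r ->
  (forall t, r <= dist_dom M p t -> f t = 0) ->
  \int[mu]_(t in cell M) f t = \int[mu]_(t in `[p - r, p + r]) f t.
Proof.
move=> hf wp r0 f0.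
rewrite -Rintegral_oo_cc; last exact: (L1_window hf wp).
rewrite /Rintegral; congr fine.
have := @integral_Nb R M p r (fun t => (f t)%:E) _ _ (window_small wp).
have -> : `](p - r), (p + r)[%classic `&` carrier M = `]p - r, p + r[%classic.
  apply/setIidPl => x h; apply: (window_carrier wp).
  by move: h; rewrite /= !in_itv/= => /andP[/ltW -> /ltW ->].
move=> <-; last 2 first.
- case: M hf wp f0 => //= -[h1 _] _ _ x; by rewrite h1.
- by case: hf => _ /integrableP[].
rewrite integral_mkcondr; apply: eq_integral => x _; rewrite /patch.
case: ifPn => // h; rewrite f0//.
by rewrite leNgt; apply: contra h => h; rewrite inE; apply/NbE.
Qed.

Lemma interior_continuous M v t : {within carrier M, continuous v} -> interior_dom M t ->
  {for t, continuous v}.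
Proof.
case: M => [a b ab|] cv it.
  have cv2 : {within `]a, b[, continuous v}.
    by apply: continuous_subspaceW cv; exact: subset_itv_oo_cc.
  move: cv2; rewrite continuous_open_subspace; last exact: itv_open.
  by apply; rewrite inE.
move: cv; rewrite continuous_open_subspace; last exact: openT.
by apply; rewrite inE.
Qed.

Lemma Rintegral_cc_cst (x y c : R) : x <= y -> \int[mu]_(t in `[x, y]) c = c * (y - x).
Proof.
move=> xy; rewrite /Rintegral integral_cst//= lebesgue_measure_itv/= lte_fin.
move: xy; rewrite le_eqVlt => /predU1P[->|xy]; last by rewrite xy.
by rewrite ltxx subrr mule0 mulr0.
Qed.

Lemma window_le M p r r' : r' <= r -> window M p r -> window M p r'.
Proof. by case: M => [a b ab|] /=; [move=> h [h1 h2]; split; rlra|move=> h h1; rlra]. Qed.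

(** This brings distributional identities on [M] down to integrals on the line, where test functions
    are easier to write. *)
Lemma local_test M p r a b (Q : R -> R) : window M p r -> p - r < a -> b < p + r -> a <= b ->
  C1 Q -> (forall t, ~ (a <= t <= b) -> Q t = 0) ->
  [/\ C1c M (interior_dom M) (Q \o rep M p),
    forall f, L1 M f -> pair M f (Q \o rep M p) = \int[mu]_(t in `[a, b]) (derive1 Q t * f t) &
    forall f, L1 M f ->
      \int[mu]_(t in cell M) (f t * (Q \o rep M p) t) = \int[mu]_(t in `[a, b]) (f t * Q t)].
Proof.
move=> wp pa bp ab cQ Q0.
have Q0' t : ~ (a <= t <= b) -> derive1 Q t = 0.
  move=> nt; rewrite (@derive1_near _ _ (fun=> 0)); first by rewrite (C1_cst 0).2.
  move: nt => /negP; rewrite negb_and -!ltNge => /orP[h|h].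
    have h0 : 0 < a - t by rewrite subr_gt0.
    apply: filterS (near_dist t h0) => x; rewrite ltr_norml => /andP[h1 h2].
    by apply: Q0 => /andP[h3 h4]; clear -h h1 h2 h3; rlra.
  have h0 : 0 < t - b by rewrite subr_gt0.
  apply: filterS (near_dist t h0) => x; rewrite ltr_norml => /andP[h1 h2].
  by apply: Q0 => /andP[h3 h4]; clear -h h1 h2 h4; rlra.
pose d := Num.max (b - p) (p - a).
have dr : d < r by rewrite gt_max; apply/andP; split; rlra.
have d1 : b - p <= d by rewrite le_max lexx.
have d2 : p - a <= d by rewrite le_max lexx orbT.
have d0 : 0 <= d by rlra.
have Qd t : d < `|t - p| -> Q t = 0 /\ derive1 Q t = 0.
  move=> h; suff nt : ~ (a <= t <= b) by rewrite Q0// Q0'.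
  move=> /andP[h1 h2]; move: h; rewrite ltNge => /negP; apply.
  by rewrite ler_norml; apply/andP; split; rlra.
pose d' := (d + r) / 2.
have dd' : d < d' by rewrite /d'; rlra.
have d'r : d' < r by rewrite /d'; rlra.
have d'0 : 0 < d' by rlra.
have wp' := window_le (ltW d'r) wp.
have [cl el] : C1 (Q \o rep M p) /\ derive1 (Q \o rep M p) = derive1 Q \o rep M p.
  apply: (@C1_lift R M p Q d') => // MT; split; first by move: wp; rewrite MT /=; rlra.
  by move=> t k; have [|-> //] := Qd t; exact: lt_le_trans k.
have ol : on_domain M (Q \o rep M p) by exact: rep_on_domain.
have zero t : d' <= dist_dom M p t -> (Q \o rep M p) t = 0 /\ derive1 (Q \o rep M p) t = 0.
  by rewrite dist_domE el /= => k; apply: Qd; exact: lt_le_trans k.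
have wrep t : p - d' <= t <= p + d' -> rep M p t = t.
  move=> /andP[k1 k2]; case: (M) wp => //= r2; apply: (@near_rep R Torus).
  by rewrite ltr_norml; apply/andP; split; rlra.
have cQl := C1_cont cl.
split.
- apply: (@C1c_intro R M _ [set t | 0 <= dist_dom M p t <= d']) => //.
  + exact: closed_dist_itv.
  + move=> t; rewrite /= dist_dom_ge0/=; apply: contraNT; rewrite -ltNge => k.
    by have [|/= -> _] := zero t; [exact: ltW|rewrite eqxx].
  + move=> t /= /andP[_ k]; rewrite (on_domain_eqM (interior_on_domain M) (eqM_rep M p t)).
    apply: (window_interior wp); rewrite /= in_itv/= -ltr_distl -dist_domE.
    exact: le_lt_trans k d'r.
- move=> f hf; rewrite (pair_window hf wp' d'0 cl ol); last by move=> t /zero[].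
  rewrite (@Rintegral_cc_supp R _ (p - d') (p + d') a b); [|rlra|rlra|].
    apply: eq_Rintegral => t; rewrite inE/= in_itv/= => /andP[k1 k2].
    by rewrite el /= wrep//; apply/andP; split; rlra.
  by move=> t tp k; rewrite el /= wrep// Q0'// mul0r.
- move=> f hf.
  have gphi : L1 M (fun t => f t * (Q \o rep M p) t).
    split; first by move: hf.1 ol; case: (M) => //= k1 k2 t; rewrite k1 k2.
    have [c [e [e' _]]] := cell_bounded M.
    have : intg (cell M) (fun t => (Q \o rep M p) t * f t).
      apply: (@integrable_continuousM R c e); rewrite ?e'//; have := hf.2; rewrite e'; exact.
    by apply: eq_integrable; [exact: cell_measurable|move=> t _; rewrite /= mulrC].
  rewrite (Rintegral_cell_window gphi wp' d'0); last by move=> t /zero[-> _]; rewrite mulr0.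
  rewrite (@Rintegral_cc_supp R _ (p - d') (p + d') a b); [|rlra|rlra|].
    apply: eq_Rintegral => t; rewrite inE/= in_itv/= => /andP[k1 k2].
    by rewrite /= wrep//; apply/andP; split; rlra.
  by move=> t tp k; rewrite /= wrep// Q0// mulr0.
Qed.

(** From |g| <= k/2 + g^2/(2k): [k] is taken so large that the second term integrates to at most
    e/2, and then the interval so short that the first one does too. *)
Lemma short_integral g (c d e : R) : intg `[c, d] g -> intg `[c, d] (fun x => g x ^+ 2) -> 0 < e ->
  exists2 h0 : R, 0 < h0 & forall x y, c <= x -> x <= y -> y <= d -> y - x < h0 ->
    \int[mu]_(t in `[x, y]) `|g t| <= e.
Proof.
move=> ig ig2 e0.
pose G2 := \int[mu]_(t in `[c, d]) (g t ^+ 2).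
have G20 : 0 <= G2 by apply: Rintegral_ge0 => t _; exact: sqr_ge0.
pose k := (G2 + 1) / e.
have k0 : 0 < k by rewrite divr_gt0// ltr_wpDl.
exists (e / k) => [|x y cx xy yd hxy]; first by rewrite divr_gt0.
have sub : `[x, y]%classic `<=` `[c, d]%classic.
  by move=> t /=; rewrite !in_itv/= => /andP[h1 h2]; rewrite (le_trans cx h1) (le_trans h2 yd).
have igx : intg `[x, y] g by apply: integrableS ig.
have ig2x : intg `[x, y] (fun x => g x ^+ 2) by apply: integrableS ig2.
have kk0 : (2 * k)^-1 >= 0 by rewrite invr_ge0 mulr_ge0// ltW.
have i1 : intg `[x, y] (fun=> k / 2).
  by apply: (@integrable_continuous R x y) => // ?; exact: cvg_cst.
have i2 : intg `[x, y] (fun t => (2 * k)^-1 * g t ^+ 2) by exact: intgZ.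
apply: (@le_trans _ _ (\int[mu]_(t in `[x, y]) (k / 2 + (2 * k)^-1 * g t ^+ 2))).
  apply: le_Rintegral => //; first exact: intg_norm.
    exact: intgD.
  move=> t _; rewrite -[g t ^+ 2]real_normK ?num_real//.
  move: `|g t| => z; rewrite -subr_ge0.
  have -> : k / 2 + (2 * k)^-1 * z ^+ 2 - z = (2 * k)^-1 * (z - k) ^+ 2.
    by field; rewrite gt_eqF.
  by rewrite mulr_ge0// sqr_ge0.
rewrite RintegralD// Rintegral_cc_cst// RintegralZl//.
have G2x : \int[mu]_(t in `[x, y]) (g t ^+ 2) <= G2.
  rewrite /G2 /Rintegral fine_le//.
  - by apply: integrable_fin_num.
  - by apply: integrable_fin_num.
  - apply: ge0_subset_integral => //; first by case/integrableP : ig2.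
    by move=> t _; rewrite lee_fin sqr_ge0.
have e1 : (2 * k)^-1 * G2 <= e / 2.
  have ke : 2 * k * (e / 2) = G2 + 1 by rewrite /k; field; rewrite gt_eqF.
  have k2 : 0 < 2 * k by rewrite mulr_gt0.
  by rewrite (ler_pdivrMl _ _ k2) ke lerDl.
have e2 : (2 * k)^-1 * \int[mu]_(t in `[x, y]) (g t ^+ 2) <= e / 2.
  by apply: le_trans e1; apply: ler_wpM2l.
have e3 : k / 2 * (y - x) <= e / 2.
  move: (ler_wpM2l (ltW k0) (ltW hxy)); rewrite mulrCA divff ?gt_eqF// mulr1 => h.
  by rewrite mulrAC ler_pM2r.
by rewrite (splitr e) lerD.
Qed.

Lemma ftc_close (a b c d e g vx vy : R) : a - b = - (c + d) -> `|a - vx| <= e / 4 ->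
  `|b - vy| <= e / 4 -> `|c - g| <= e / 4 -> `|d| <= e / 4 -> `|vy - vx - g| <= e.
Proof.
rewrite !ler_norml => h /andP[? ?] /andP[? ?] /andP[? ?] /andP[? ?].
by apply/andP; split; rlra.
Qed.

(** The test function is the difference of a step at [x] and a step at [y], an approximate indicator
    of [x, y]. Its derivative averages [v] just after [x] and just after [y], where continuity gives
    the values of [v]; the other side is the integral of [g] up to two short intervals, negligible
    by [short_integral]. *)
Lemma H1_ftc M v g p r x y : H1 M v -> weak_derivative M v g -> window M p r ->
  p - r < x -> x <= y -> y < p + r -> v y - v x = \int[mu]_(t in `[x, y]) g t.
Proof.
move=> [L2v cv _] [L2g wg] wp prx; rewrite le_eqVlt => /predU1P[->|xy] ypr.
  by rewrite set_itv1 Rintegral_set1 subrr.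
have [hv _] := L2_L1 L2v; have [hg hg2] := L2_L1 L2g.
have r0 : 0 < r by rlra.
have iv := L1_window hv wp; have ig := L1_window hg wp; have ig2 := L1_window hg2 wp.
have cvx : {for x, continuous v}.
  apply: (interior_continuous cv); apply: (window_interior wp); rewrite /= in_itv/=.
  by apply/andP; split; rlra.
have cvy : {for y, continuous v}.
  apply: (interior_continuous cv); apply: (window_interior wp); rewrite /= in_itv/=.
  by apply/andP; split; rlra.
apply/eqP; rewrite -subr_eq0 -normr_le0; apply/ler_addgt0Pr => e e0; rewrite add0r.
have e8 : 0 < e / 8 by rewrite divr_gt0.
have e4 : 0 < e / 4 by rewrite divr_gt0.
have /nbhs_ballP[d1 /= d10 hd1] : \forall t \near x, `|v x - v t| <= e / 8 by move/cvgrPdist_le : cvx; apply.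
have /nbhs_ballP[d2 /= d20 hd2] : \forall t \near y, `|v y - v t| <= e / 8 by move/cvgrPdist_le : cvy; apply.
have [d3 d30 hd3] := short_integral ig ig2 e4.
pose m := Num.min (Num.min d1 d2) (Num.min d3 (Num.min (y - x) (p + r - y))).
have m0 : 0 < m by rewrite !lt_min d10 d20 d30 !subr_gt0 xy.
have : m <= m by []. rewrite {2}/m !le_min => /andP[/andP[m1 m2] /and3P[m3 m4 m5]].
pose hh := m / 2.
have h0 : 0 < hh by rewrite divr_gt0.
have hm : 2 * hh = m by rewrite /hh mulrC divfK.
have [cS S0 S1 S01 dS] := @stepfP R.
have hi0 : 0 < hh^-1 by rewrite invr_gt0.
pose s z t := stepf (hh^-1 * t + - (hh^-1 * z)).
have cs z : C1 (s z) by exact: (C1_affine hh^-1 (- (hh^-1 * z)) cS).1.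
have ds z : derive1 (s z) = (fun t => hh^-1 * derive1 stepf (hh^-1 * t + - (hh^-1 * z))).
  exact: (C1_affine hh^-1 (- (hh^-1 * z)) cS).2.
have Z0 z t : t <= z -> s z t = 0 /\ derive1 (s z) t = 0.
  move=> tz; rewrite ds /s; have [|-> ->] := S0 (hh^-1 * t + - (hh^-1 * z)).
    by rewrite -mulrBr pmulr_rle0// subr_le0.
  by rewrite mulr0.
have Z1 z t : z + hh <= t -> s z t = 1 /\ derive1 (s z) t = 0.
  move=> tz; rewrite ds /s; have [|-> ->] := S1 (hh^-1 * t + - (hh^-1 * z)).
    by rewrite -mulrBr ler_pdivlMl// mulr1; rlra.
  by rewrite mulr0.
have Bs z t : `|derive1 (s z) t| <= hh^-1 * 2.
  rewrite ds normrM gtr0_norm// ler_pM2l//.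
  by have /andP[k1 k2] := dS (hh^-1 * t + - (hh^-1 * z)); rewrite ger0_norm.
have [cQ dQ] := C1B (cs x) (cs y).
set Q := (fun t => s x t - s y t) in cQ dQ.
have Q0 t : ~ (x <= t <= y + hh) -> Q t = 0.
  move=> /negP; rewrite negb_and -!ltNge /Q => /orP[tx|ty].
    have [|-> _] := Z0 x t; first exact: ltW.
    by have [|-> _] := Z0 y t; [rlra|rewrite subrr].
  have [|-> _] := Z1 x t; first by rlra.
  by have [|-> _] := Z1 y t; [rlra|rewrite subrr].
have [|||tphi pQ iQ] := local_test (p := p) (r := r) (a := x) (b := y + hh) wp _ _ _ cQ Q0; [rlra|rlra|rlra|].
have W := wg _ tphi.
rewrite (iQ g hg) in W.
have {}W : pair M v (Q \o rep M p) = - \int[mu]_(t in `[x, (y + hh)]) (g t * Q t).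
  by rewrite -W; apply: eq_Rintegral => t _; rewrite mulrC.
rewrite (pQ v hv) in W.
have sub c d : p - r <= c -> d <= p + r -> `[c, d]%classic `<=` `[p - r, p + r]%classic.
  by move=> k1 k2 t /=; rewrite !in_itv/= => /andP[k3 k4]; rewrite (le_trans k1 k3) (le_trans k4 k2).
have ivs c d : p - r <= c -> d <= p + r -> intg `[c, d] v.
  by move=> k1 k2; apply: integrableS iv => //; exact: sub.
have igs c d : p - r <= c -> d <= p + r -> intg `[c, d] g.
  by move=> k1 k2; apply: integrableS ig => //; exact: sub.
have iM c d k : C1 k -> p - r <= c -> d <= p + r -> intg `[c, d] (fun t => derive1 k t * v t).
  by move=> ck k1 k2; apply: (@integrable_continuousM R c d) => //; [exact: ck.2|exact: ivs].
have iG c d : p - r <= c -> d <= p + r -> intg `[c, d] (fun t => g t * Q t).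
  move=> k1 k2; have : intg `[c, d] (fun t => Q t * g t).
    by apply: (@integrable_continuousM R c d) => //; [exact: (C1_cont cQ)|exact: igs].
  by apply: eq_integrable => // t _; rewrite /= mulrC.
have Sm z (d : R) : p - r <= z -> z + hh <= p + r -> x <= z -> z + hh <= y + hh ->
    (forall t, `|z - t| < d -> `|v z - v t| <= e / 8) -> m <= d ->
    `|\int[mu]_(t in `[x, y + hh]) (derive1 (s z) t * v t) - v z| <= e / 4.
  move=> k1 k2 k3 k4 hd md.
  rewrite (@Rintegral_cc_supp R _ x (y + hh) z (z + hh))//; last first.
    move=> t _ /negP; rewrite negb_and -!ltNge => /orP[k5|k5].
      by have [|_ ->] := Z0 z t; [exact: ltW|rewrite mul0r].
    by have [|_ ->] := Z1 z t; [exact: ltW|rewrite mul0r].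
  have zz : z <= z + hh by rewrite lerDl ltW.
  have := half_jump (v z) zz (cs z) (ivs _ _ k1 k2) (fun t _ => Bs z t).
  rewrite (Z0 z z (lexx _)).1 (Z1 z (z + hh) (lexx _)).1 subr0 mulr1 => /le_trans; apply.
  have ic c : intg `[z, z + hh] (fun=> c).
    by apply: (@integrable_continuous R z (z + hh)) => // ?; exact: cvg_cst.
  have : \int[mu]_(t in `[z, z + hh]) `|v t - v z| <= \int[mu]_(t in `[z, z + hh]) (e / 8).
    apply: le_Rintegral => //.
      by apply: intg_norm; apply: intgB => //; exact: ivs.
    move=> t /=; rewrite in_itv/= => /andP[k5 k6]; rewrite distrC; apply: hd.
    by rewrite ltr_norml; clear -k5 k6 hm md h0; apply/andP; split; rlra.
  rewrite Rintegral_cc_cst// addrAC subrr add0r => k5.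
  have k0 : 0 <= hh^-1 * 2 by rewrite mulr_ge0// ltW.
  apply: le_trans (ler_wpM2l k0 k5) _.
  by rewrite le_eqVlt; apply/orP; left; apply/eqP; field; rewrite gt_eqF.
have Sx := Sm x d1 ltac:(rlra) ltac:(rlra) (lexx _) ltac:(rlra) hd1 m1.
have Sy := Sm y d2 ltac:(rlra) ltac:(rlra) (ltW xy) (lexx _) hd2 m2.
have EQ : \int[mu]_(t in `[x, (y + hh)]) (derive1 Q t * v t) =
   \int[mu]_(t in `[x, (y + hh)]) (derive1 (s x) t * v t) -
   \int[mu]_(t in `[x, (y + hh)]) (derive1 (s y) t * v t).
  rewrite -RintegralB//; [|by apply: iM => //; rlra|by apply: iM => //; rlra].
  by apply: eq_Rintegral => t _; rewrite dQ mulrBl.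
have yyh : y <= y + hh by rlra.
have EG := Rintegral_cc_split (ltW xy) yyh (iG x (y + hh) ltac:(rlra) ltac:(rlra)).
have Q01 t : `|Q t| <= 1.
  rewrite /Q /s; have /andP[? ?] := S01 (hh^-1 * t + - (hh^-1 * x)).
  have /andP[? ?] := S01 (hh^-1 * t + - (hh^-1 * y)).
  by rewrite ler_norml; apply/andP; split; rlra.
have G2 : `|\int[mu]_(t in `[y, y + hh]) (g t * Q t)| <= e / 4.
  apply: le_trans (hd3 y (y + hh) _ _ _ _); [|rlra|rlra|rlra|rlra].
  apply: le_trans (le_normr_Rintegral _ _) _ => //; first by apply: iG; rlra.
  apply: le_Rintegral => //; [by apply: intg_norm; apply: iG; rlra|by apply: intg_norm; apply: igs; rlra|].
  by move=> t _; rewrite normrM ler_piMr.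
have G1 : `|\int[mu]_(t in `[x, y]) (g t * Q t) - \int[mu]_(t in `[x, y]) g t| <= e / 4.
  rewrite -RintegralB//; [|by apply: iG; rlra|by apply: igs; rlra].
  have iB c d : p - r <= c -> d <= p + r -> intg `[c, d] (fun t => g t * Q t - g t).
    by move=> k1 k2; apply: intgB => //; [exact: iG|exact: igs].
  rewrite (@Rintegral_cc_supp R _ x y x (x + hh)); [|rlra|rlra|]; last first.
    move=> t /andP[k1 k2] k3; have [|e1 _] := Z1 x t.
      by rewrite leNgt; apply/negP => k4; apply: k3; rewrite k1/= ltW.
    by have [e2 _] := Z0 y t k2; rewrite /Q e1 e2 subr0 mulr1 subrr.
  apply: le_trans (hd3 x (x + hh) _ _ _ _); [|rlra|rlra|rlra|rlra].
  apply: le_trans (le_normr_Rintegral _ _) _ => //; first by apply: iB; rlra.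
  apply: le_Rintegral => //; [by apply: intg_norm; apply: iB; rlra|by apply: intg_norm; apply: igs; rlra|].
  move=> t; rewrite /= in_itv/= => /andP[k1 k2]; rewrite -{2}[g t]mulr1 -mulrBr normrM ler_piMr//.
  have [|e2 _] := Z0 y t; first by rlra.
  rewrite /Q e2 subr0 /s; have /andP[? ?] := S01 (hh^-1 * t + - (hh^-1 * x)).
  by rewrite ler_norml; apply/andP; split; rlra.
rewrite EQ EG in W.
move: W Sx Sy G1 G2; exact: ftc_close.
Qed.

End sobolev.

(** * The energy of a path *)

Section energy.
Context {R : realType}.
Local Notation mu := (@lebesgue_measure R).
Local Notation intg D f := (mu.-integrable D (EFin \o f)).
Implicit Types (M : domain R) (f g h u v w phi psi : R -> R) (p q r x y z t : R) (U : set R).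
Variables (F : R -> R).
Hypotheses (F_cont : continuous F) (F_ge0 : forall t, 0 <= F t)
  (F_eq0 : forall t, F t = 0 <-> t = 1).

(* The signed version of [G]. *)
Definition Hf (t : R) : R :=
  if 1 <= t then \int[mu]_(s in `[1, t]) Num.sqrt (F s)
  else - \int[mu]_(s in `[t, 1]) Num.sqrt (F s).

Lemma sqrtF_cont : continuous (fun s => Num.sqrt (F s)).
Proof. by move=> x; apply: continuous_comp; [exact: F_cont|exact: sqrt_continuous]. Qed.

Lemma sqrtF_integrable (a b : R) : intg `[a, b] (fun s => Num.sqrt (F s)).
Proof. by apply: (@integrable_continuous R a b) => //; exact: sqrtF_cont. Qed.

Lemma Hf_sub (a b : R) : a <= b -> Hf b - Hf a = \int[mu]_(s in `[a, b]) Num.sqrt (F s).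
Proof.
move=> ab; rewrite /Hf; have [b1|b1] := leP 1 b; have [a1|a1] := leP 1 a.
- by rewrite (Rintegral_cc_split a1 ab (sqrtF_integrable _ _)) addrAC subrr add0r.
- rewrite opprK addrC -Rintegral_cc_split//; first exact: ltW.
  exact: sqrtF_integrable.
- by have := le_trans a1 ab; rewrite leNgt b1.
- rewrite (Rintegral_cc_split ab (ltW b1) (sqrtF_integrable _ _)) opprK addrC.
  by rewrite addrK.
Qed.

Lemma Hf1 : Hf 1 = 0.
Proof. by rewrite /Hf lexx set_itv1 Rintegral_set1. Qed.

Lemma Hf_mono (a b : R) : a <= b -> Hf a <= Hf b.
Proof.
move=> ab; rewrite -subr_ge0 Hf_sub//; apply: Rintegral_ge0 => t _; exact: sqrtr_ge0.
Qed.

Lemma Hf_le (a b B : R) : a <= b -> (forall s, a <= s <= b -> Num.sqrt (F s) <= B) ->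
  Hf b - Hf a <= B * (b - a).
Proof.
move=> ab h; rewrite Hf_sub// -Rintegral_cc_cst//; apply: le_Rintegral => //.
- exact: sqrtF_integrable.
- by apply: (@integrable_continuous R a b) => // ?; exact: cvg_cst.
Qed.

Lemma Hf_ge (a b B : R) : a <= b -> (forall s, a <= s <= b -> B <= Num.sqrt (F s)) ->
  B * (b - a) <= Hf b - Hf a.
Proof.
move=> ab h; rewrite Hf_sub// -Rintegral_cc_cst//; apply: le_Rintegral => //.
- by apply: (@integrable_continuous R a b) => // ?; exact: cvg_cst.
- exact: sqrtF_integrable.
Qed.

Lemma Hf_cont : continuous Hf.
Proof.
move=> t; have [C C0 hC] := continuous_bound (t - 1) (t + 1) sqrtF_cont.
have bd a b : t - 1 <= a -> a <= b -> b <= t + 1 -> `|Hf b - Hf a| <= C * (b - a).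
  move=> h1 h2 h3; rewrite ger0_norm ?subr_ge0 ?Hf_mono//.
  apply: Hf_le => // s /andP[h4 h5]; apply: le_trans (ler_norm _) _; apply: hC.
  by rewrite /= in_itv/=; apply/andP; split; rlra.
apply/cvgrPdist_le => e e0.
have d0 : 0 < Num.min 1 (e / C) by rewrite lt_min ltr01 divr_gt0.
apply: filterS (near_dist t d0) => s; rewrite lt_min => /andP[h1 h2].
have h3 : C * `|t - s| <= e by rewrite -ler_pdivlMl// mulrC ltW.
move: h1; rewrite ltr_norml => /andP[h4 h5]; apply: le_trans h3.
have [st|ts] := leP s t.
  by rewrite (ger0_norm (_ : 0 <= t - s)) ?subr_ge0//; apply: bd => //; rlra.
rewrite distrC (distrC t) (ger0_norm (_ : 0 <= s - t)) ?subr_ge0 ?(ltW ts)//.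
by apply: bd => //; rlra.
Qed.

(** Between [a] and [b] there is a point other than 1, and [sqrt F] is bounded below by a positive
    number near it. *)
Lemma Hf_strict (a b : R) : a < b -> Hf a < Hf b.
Proof.
move=> ab.
have [c [ac cb c1]] : exists c, [/\ a < c, c < b & c != 1].
  have [c [h1 h2]] : exists c, a < c /\ c < b by exists ((a + b) / 2); split; rlra.
  have [e|ne] := eqVneq c 1; last by exists c.
  by exists ((c + b) / 2); split; [rlra|rlra|rewrite gt_eqF//; rlra].
have Fc : 0 < Num.sqrt (F c).
  rewrite sqrtr_gt0 lt_neqAle F_ge0 andbT eq_sym; apply: contra c1 => /eqP/F_eq0 ->.
  by rewrite eqxx.
have Fc2 : 0 < Num.sqrt (F c) / 2 by rewrite divr_gt0.
have /nbhs_ballP[d /= d0 hd] : \forall s \near c, `|Num.sqrt (F c) - Num.sqrt (F s)| <= Num.sqrt (F c) / 2.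
  by have := @sqrtF_cont c; move=> /cvgrPdist_le; apply.
pose m := Num.min (d / 2) (b - c).
have m0 : 0 < m by rewrite lt_min divr_gt0//= subr_gt0.
have md : m <= d / 2 by rewrite ge_min lexx.
have mb : m <= b - c by rewrite ge_min lexx orbT.
have h1 : Hf a <= Hf c by apply: Hf_mono; exact: ltW.
have h2 : Hf (c + m) <= Hf b by apply: Hf_mono; clear -mb; rlra.
have h3 : Num.sqrt (F c) / 2 * (c + m - c) <= Hf (c + m) - Hf c.
  apply: Hf_ge; first by rewrite lerDl ltW.
  move=> s /andP[h3 h4]; have := hd s; rewrite /ball/= => /(_ _); rewrite ler_norml => h5.
  have /andP[_ ] : - (Num.sqrt (F c) / 2) <= Num.sqrt (F c) - Num.sqrt (F s) <= Num.sqrt (F c) / 2.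
    by apply: h5; rewrite ltr_norml; clear -h3 h4 md d0 m0; apply/andP; split; rlra.
  by clear; rlra.
have : 0 < Num.sqrt (F c) / 2 * (c + m - c) by rewrite addrAC subrr add0r mulr_gt0.
clear -h1 h2 h3; rlra.
Qed.

Lemma G_Hf t : G F t = `|Hf t|.
Proof.
rewrite /G /Hf; have [h|h] := leP 1 t.
  by rewrite ger0_norm//; apply: Rintegral_ge0 => s _; exact: sqrtr_ge0.
by rewrite normrN ger0_norm//; apply: Rintegral_ge0 => s _; exact: sqrtr_ge0.
Qed.

Lemma G_ge t : 1 <= t -> G F t = Hf t.
Proof. by move=> h; rewrite G_Hf ger0_norm// -Hf1 Hf_mono. Qed.

Lemma G_le t : t <= 1 -> G F t = - Hf t.
Proof. by move=> h; rewrite G_Hf ler0_norm// -Hf1 Hf_mono. Qed.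

Definition density M (eps : R) v t : R :=
  eps / 2 * wderiv M v t ^+ 2 + (2 * eps)^-1 * F (v t).

Lemma wderivP M v : H1 M v -> weak_derivative M v (wderiv M v).
Proof. by move=> [_ _ h]; rewrite /wderiv; exact: xgetPex h. Qed.

Lemma Fv_L1 M v : H1 M v -> L1 M (fun t => F (v t)).
Proof.
move=> [[ov _ _] cv _]; split; first by case: (M) ov => //= h x; rewrite h.
have [a [b [e ab]]] := cell_bounded M.
rewrite e; apply: continuous_compact_integrable; first exact: segment_compact.
apply: (@within_continuous_comp _ _ _ `[a, b]%classic v F).
  by move=> x _; exact: F_cont.
by apply: continuous_subspaceW cv; rewrite -e; exact: cell_carrier.
Qed.

Lemma density_L1 M (eps : R) v : H1 M v -> L1 M (density M eps v).
Proof.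
move=> hv; have [L2g _] := wderivP hv; have [_ hg2] := L2_L1 L2g.
have hF := Fv_L1 hv; split.
  case: (M) hg2 hF {L2g hv} => //= -[h1 _] [h2 _] x; by rewrite /density h1 h2.
by apply: intgD; [exact: cell_measurable|apply: intgZ; [exact: cell_measurable|exact: hg2.2]|
  apply: intgZ; [exact: cell_measurable|exact: hF.2]].
Qed.

Lemma density_ge0 M (eps : R) v t : 0 < eps -> 0 <= density M eps v t.
Proof.
move=> e0; rewrite /density addr_ge0// mulr_ge0 ?sqr_ge0 ?divr_ge0 ?F_ge0 ?invr_ge0 ?mulr_ge0//; exact: ltW.
Qed.

Lemma E_sMM_density M (eps : R) v : H1 M v -> 0 < eps ->
  E_sMM M F eps v = (\int[mu]_(t in cell M) density M eps v t)%:E.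
Proof.
move=> hv e0; have [L2g _] := wderivP hv; have [_ hg2] := L2_L1 L2g.
have hF := Fv_L1 hv; have mc := @cell_measurable R M.
rewrite /density RintegralD//; [|by apply: intgZ => //; exact: hg2.2|by apply: intgZ => //; exact: hF.2].
rewrite RintegralZl//; last exact: hg2.2.
rewrite RintegralZl//; last exact: hF.2.
rewrite /E_sMM EFinD !EFinM; congr (_ * _ + _ * _)%E.
- rewrite /Rintegral fineK; last by apply: integrable_fin_num => //; exact: hg2.2.
  by apply: eq_integral => t _; rewrite real_normK ?num_real.
- by rewrite /Rintegral fineK//; apply: integrable_fin_num => //; exact: hF.2.
Qed.

Lemma within_integrableM (a b : R) f g : a <= b -> {within `[a, b], continuous f} ->
  intg `[a, b] g -> intg `[a, b] (fun x => f x * g x).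
Proof.
move=> ab cf ig.
have mf : measurable_fun (`[a, b]%classic : set (measurableTypeR R)) f.
  by apply: subspace_continuous_measurable_fun.
have cn : {within `[a, b], continuous (fun x => `|f x|)}.
  apply: (@within_continuous_comp _ _ _ `[a, b]%classic f (@Num.norm R R)) => // x _.
  exact: norm_continuous.
have [c _ h] := EVT_max ab cn.
have bf : [bounded f x | x in `[a, b]%classic].
  exists `|f c|; split; first exact: num_real.
  by move=> y Cy x Dx; apply: le_trans (ltW Cy); apply: h.
have := integrableMl _ ig mf bf; move=> /(_ ltac:(by [])); apply: eq_integrable => // x _.
by rewrite /= -EFinM mulrC.
Qed.

Lemma am_gm (a b eps : R) : 0 < eps ->
  a * b <= eps / 2 * b ^+ 2 + (2 * eps)^-1 * a ^+ 2.
Proof.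
move=> e0; rewrite -subr_ge0.
have -> : eps / 2 * b ^+ 2 + (2 * eps)^-1 * a ^+ 2 - a * b = (2 * eps)^-1 * (eps * b - a) ^+ 2.
  by field; rewrite gt_eqF.
by rewrite mulr_ge0 ?sqr_ge0// invr_ge0 mulr_ge0// ltW.
Qed.

(** No chain rule for [Hf o v] is used. On short intervals the increment of [Hf o v] is at most the
    supremum of [sqrt F] over the values of [v] times the increment of [v], hence at most the
    integral of [(sqrt (F v) + d) * |g|]; Cousin's lemma adds these bounds up. AM-GM then applies
    pointwise, and [d] is chosen so that the surplus is at most [e]. *)
Lemma energy_ge M (eps : R) v p r x y : H1 M v -> 0 < eps -> window M p r ->
  p - r < x -> x <= y -> y < p + r ->
  `|Hf (v y) - Hf (v x)| <= \int[mu]_(t in `[x, y]) density M eps v t.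
Proof.
move=> hv e0 wp px xy yp; have wg := wderivP hv.
set g := wderiv M v in wg *.
have [L2g _] := wg; have [hg hg2] := L2_L1 L2g.
have r0 : 0 < r by rlra.
have ig := L1_window hg wp; have iD := L1_window (density_L1 eps hv) wp.
have cv s : x <= s <= y -> {for s, continuous v}.
  move=> /andP[h1 h2]; have [_ cv _] := hv.
  apply: (interior_continuous cv); apply: (window_interior wp); rewrite /= in_itv/=.
  by clear -h1 h2 px yp; apply/andP; split; rlra.
have cw s t : x <= s -> t <= y -> {within `[s, t], continuous v}.
  move=> h1 h2; apply: continuous_in_subspaceT => z.
  by rewrite inE/= in_itv/= => /andP[h3 h4]; apply: cv; rewrite (le_trans h1 h3) (le_trans h4 h2).
have sub s t : x <= s -> t <= y -> `[s, t]%classic `<=` `[p - r, p + r]%classic.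
  move=> h1 h2 z /=; rewrite !in_itv/= => /andP[h3 h4].
  by clear -h1 h2 h3 h4 px yp; apply/andP; split; rlra.
have igs s t : x <= s -> t <= y -> intg `[s, t] g.
  by move=> h1 h2; apply: integrableS ig => //; exact: sub.
have iabs := intg_norm (igs x y (lexx _) (lexx _)).
pose N := \int[mu]_(t in `[x, y]) `|g t|.
have N0 : 0 <= N by exact: Rintegral_ge0.
apply/ler_addgt0Pr => e ep.
pose d := e / (N + 1).
have N1 : 0 < N + 1 by rewrite ltr_wpDl.
have d0 : 0 < d by rewrite divr_gt0.
have dN : d * N <= e.
  by rewrite /d mulrAC ler_pdivrMr// ler_pM2l// lerDl.
pose k s := Num.sqrt (F (v s)) + d.
have ik s t : x <= s -> s <= t -> t <= y -> intg `[s, t] (fun z => k z * `|g z|).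
  move=> h1 h2 h3; apply: within_integrableM => //; last exact/intg_norm/igs.
  apply: (@within_continuous_comp _ _ _ `[s, t]%classic v (fun z => Num.sqrt (F z) + d)); last exact: cw.
  by move=> z _; apply: cvgD; [exact: sqrtF_cont|exact: cvg_cst].
have key : `|Hf (v y) - Hf (v x)| <= \int[mu]_(t in `[x, y]) (k t * `|g t|).
  apply: (@cousin R (fun s t => `|Hf (v t) - Hf (v s)| <= \int[mu]_(z in `[s, t]) (k z * `|g z|))) => //.
  - move=> c hc; have d2 : 0 < d / 2 by rewrite divr_gt0.
    have cc : {for c, continuous (fun s => Num.sqrt (F (v s)))}.
      apply: (@continuous_comp _ _ _ v (fun z => Num.sqrt (F z))); first exact: cv.
      exact: sqrtF_cont.
    have /nbhs_ballP[e1 /= e10 he1] : \forall s \near c, `|Num.sqrt (F (v c)) - Num.sqrt (F (v s))| <= d / 2.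
      by have /cvgrPdist_le := cc; apply.
    exists e1 => // s t xs st ty sc tc.
    pose B := Num.sqrt (F (v c)) + d / 2.
    have near_c z : s <= z <= t -> `|Num.sqrt (F (v c)) - Num.sqrt (F (v z))| <= d / 2.
      move=> /andP[h1 h2]; apply: he1; rewrite /ball/= distrC.
      by move: sc tc; rewrite !ltr_norml => /andP[? ?] /andP[? ?]; rlra.
    have vB tau : Num.min (v s) (v t) <= tau <= Num.max (v s) (v t) -> Num.sqrt (F tau) <= B.
      move=> /(IVT st (cw s t xs ty))[z]; rewrite in_itv/= => /near_c h <-.
      by move: h; rewrite /B ler_norml => /andP[? ?]; rlra.
    have B0 : 0 <= B by rewrite addr_ge0 ?sqrtr_ge0// ltW.
    have HB : `|Hf (v t) - Hf (v s)| <= B * `|v t - v s|.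
      have [h|h] := leP (v s) (v t).
        rewrite ger0_norm ?subr_ge0 ?Hf_mono// (ger0_norm (_ : 0 <= v t - v s)) ?subr_ge0//.
        by apply: Hf_le => // tau; rewrite -{1}(min_l h) -{2}(max_r h); exact: vB.
      rewrite distrC (distrC (v t)) ger0_norm ?subr_ge0 ?Hf_mono ?(ltW h)//.
      rewrite (ger0_norm (_ : 0 <= v s - v t)) ?subr_ge0 ?(ltW h)//.
      apply: Hf_le; first exact: ltW.
      by move=> tau; rewrite -{1}(min_r (ltW h)) -{2}(max_l (ltW h)); exact: vB.
    apply: le_trans HB _.
    have ev := H1_ftc hv wg wp (lt_le_trans px xs) st (le_lt_trans ty yp).
    have ist := igs s t xs ty.
    have : `|v t - v s| <= \int[mu]_(z in `[s, t]) `|g z|.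
      by rewrite ev; apply: le_normr_Rintegral.
    move=> /(ler_wpM2l B0)/le_trans; apply.
    rewrite -RintegralZl//; last exact: intg_norm.
    apply: le_Rintegral => //.
    + exact/intgZ/intg_norm.
    + exact: ik.
    + move=> z /=; rewrite in_itv/= => /near_c; rewrite ler_norml => /andP[h1 h2].
      by apply: ler_wpM2r => //; rewrite /B /k; rlra.
  - move=> s t z xs st tz zy h1 h2.
    rewrite (Rintegral_cc_split st tz); last by apply: ik => //; exact: le_trans st tz.
    apply: le_trans (lerD h1 h2); rewrite [leRHS]addrC.
    have -> : Hf (v z) - Hf (v s) = (Hf (v z) - Hf (v t)) + (Hf (v t) - Hf (v s)).
      by rewrite addrA subrK.
    exact: ler_normD.
apply: le_trans key _.
have iDs : intg `[x, y] (density M eps v) by apply: integrableS iD => //; exact: sub.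
apply: (@le_trans _ _ (\int[mu]_(t in `[x, y]) (density M eps v t + d * `|g t|))).
  apply: le_Rintegral => //; first exact: ik.
    by apply: intgD => //; exact: intgZ.
  move=> t _; rewrite /k mulrDl lerD2r /density -/g.
  have := am_gm (Num.sqrt (F (v t))) `|g t| e0.
  by rewrite sqr_sqrtr// real_normK ?num_real.
rewrite RintegralD//; last exact: intgZ.
by rewrite RintegralZl// lerD2l.
Qed.

End energy.

(** * Graph convergence *)

Section graphs.
Context {R : realType}.
Local Notation mu := (@lebesgue_measure R).
Implicit Types (M : domain R) (f g h u w phi psi : R -> R) (p q r x y z t : R) (U : set R)
  (v : R -> R -> R) (Xi : R -> set R).

Lemma dist_prod_ge M (z w : R * R) :
  dist_dom M z.1 w.1 <= dist_prod M z w /\ `|z.2 - w.2| <= dist_prod M z w.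
Proof.
rewrite /dist_prod; split.
- rewrite -[leLHS]ger0_norm ?dist_dom_ge0// -sqrtr_sqr ler_wsqrtr// lerDl.
  exact: sqr_ge0.
- rewrite -[leLHS]ger0_norm// -sqrtr_sqr ler_wsqrtr// lerDr.
  exact: sqr_ge0.
Qed.

Lemma dist_prod_le M (z w : R * R) : dist_prod M z w <= dist_dom M z.1 w.1 + `|z.2 - w.2|.
Proof.
rewrite /dist_prod; have d0 := dist_dom_ge0 M z.1 w.1.
move: (dist_dom _ _ _) `|_| (normr_ge0 (z.2 - w.2)) d0 => a b b0 a0.
rewrite -[leRHS]ger0_norm ?addr_ge0// -sqrtr_sqr ler_wsqrtr// sqrrD.
by rewrite -addrA lerD2l addrC lerDl -mulr_natl mulr_ge0// mulr_ge0.
Qed.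

Lemma graph_cvg_near M v Xi : graph_cvg M v Xi -> forall d : R, 0 < d ->
  \forall eps \near 0^'+,
    (forall x, cell M x -> exists x' y', [/\ cell M x', Xi x' y',
       dist_dom M x x' < d & `|v eps x - y'| < d]) /\
    (forall x y, cell M x -> Xi x y -> exists x', [/\ cell M x',
       dist_dom M x x' < d & `|v eps x' - y| < d]).
Proof.
move=> gc d d0.
have d0' : (0 < d%:E)%E by rewrite lte_fin.
have : \forall eps \near 0^'+, (dist_graph M (graph_of (v eps)) Xi < d%:E)%E.
  apply: (gc [set z | (z < d%:E)%E]).
  by apply: open_nbhs_nbhs; split => //; exact: open_ereal_lt_ereal.
apply: filterS => eps; rewrite /dist_graph /hausdorff_dist gt_max => /andP[h1 h2]; split.
- move=> x cx.
  have : (ereal_inf [set (dist_prod M (x, v eps x) w)%:E | w in graph M Xi] < d%:E)%E.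
    apply: le_lt_trans h1; apply: ereal_sup_ubound.
    by exists (x, v eps x).
  move=> /ereal_inf_lt[_ [[x' y'] [/= cx' Xy] <-]]; rewrite lte_fin => h.
  have [h3 h4] := dist_prod_ge M (x, v eps x) (x', y').
  by exists x', y'; split => //; [exact: le_lt_trans h3 h|exact: le_lt_trans h4 h].
- move=> x y cx Xy.
  have : (ereal_inf [set (dist_prod M z (x, y))%:E | z in graph M (graph_of (v eps))] < d%:E)%E.
    apply: le_lt_trans h2; apply: ereal_sup_ubound.
    by exists (x, y).
  move=> /ereal_inf_lt[_ [[x' y'] [/= cx' ->] <-]]; rewrite lte_fin => h.
  have [h3 h4] := dist_prod_ge M (x', v eps x') (x, y).
  exists x'; split => //; first by rewrite dist_dom_sym; exact: le_lt_trans h3 h.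
  exact: le_lt_trans h4 h.
Qed.

Lemma carrier_reps M x : carrier M x -> exists x', reps M x' /\ eqM M x x'.
Proof.
case: M => [a b ab|] /=; first by exists x.
move=> _; exists (x - (Num.floor x)%:~R); split; last first.
  by exists (- Num.floor x); rewrite intrN.
have /andP[h1 h2] := floor_itv x; rewrite intrD in h2.
by rewrite in_itv/=; apply/andP; split; rlra.
Qed.

Lemma reps_cell M : reps M `<=` cell M.
Proof.
case: M => [a b ab|] x //=; rewrite !in_itv/= => /andP[-> /ltW]; exact.
Qed.

Lemma carrier_cell M x : carrier M x -> exists x', cell M x' /\ eqM M x x'.
Proof. by move=> /carrier_reps[x' [/reps_cell h1 h2]]; exists x'. Qed.

Lemma carrier_eqM M x y : carrier M x -> eqM M x y -> carrier M y.
Proof. by case: M => //= a b ab h ->. Qed.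

Lemma reps_dist_gt0 M x y : reps M x -> reps M y -> x != y -> 0 < dist_dom M x y.
Proof.
move=> rx ry xy; rewrite lt_neqAle dist_dom_ge0 andbT eq_sym dist_domE normr_eq0 subr_eq0.
apply/eqP => e; have := eqM_rep M x y; rewrite e.
case: M rx ry e => [a b ab /= _ _ _ e|rx ry _ /= [k e]].
  by move: xy; rewrite e eqxx.
move: rx ry; rewrite /= !in_itv/= => /andP[x0 x1] /andP[y0 y1].
have k1 : k < 1 by rewrite -(ltr_int R) ; rewrite e in x1; rlra.
have k2 : -1 < k by rewrite -(ltr_int R) intrN; rewrite e in x0; rlra.
have k0 : k = 0 by lia.
by move: xy; rewrite e k0 addr0 eqxx.
Qed.

(* On the torus the nearby points are translated by integers, so that they lie near [x] as reals. *)
Lemma graph_cvg_carrier M v Xi : on_domain M Xi -> graph_cvg M v Xi ->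
  (forall eps : R, 0 < eps < 1 -> on_domain M (v eps)) -> forall d : R, 0 < d ->
  \forall eps \near 0^'+,
    (forall x, carrier M x -> exists x' y', [/\ carrier M x', Xi x' y',
       `|x - x'| < d & `|v eps x - y'| < d]) /\
    (forall x y, carrier M x -> Xi x y -> exists x', [/\ carrier M x',
       `|x - x'| < d & `|v eps x' - y| < d]).
Proof.
move=> oXi gc ov d d0; have h1 := graph_cvg_near gc d0.
have h2 : \forall eps \near (0 : R)^'+, 0 < eps < 1.
  by apply/near_rightP; exists 1.
apply: filterS (filterI h1 h2) => eps [[H1 H2] /ov ove].
have key x x' : carrier M x -> cell M x' -> dist_dom M x x' < d ->
    exists x'', [/\ carrier M x'', eqM M x' x'' & `|x - x''| < d].
  move=> cx cx' h; exists (rep M x x'); split.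
  - by apply: carrier_eqM (eqM_rep M x x'); exact: cell_carrier.
  - exact: eqM_rep.
  - by rewrite distrC -dist_domE.
split.
- move=> x cx; have [x0 [c0 e0]] := carrier_cell cx.
  have [x' [y' [cx' Xy h3 h4]]] := H1 x0 c0.
  have [|x'' [c'' e'' h'']] := key x x' cx cx'.
    rewrite dist_dom_sym (dist_dom_eqM _ e0) dist_dom_sym; exact: h3.
  exists x'', y'; split => //; first by rewrite -(on_domain_eqM oXi e'').
  by rewrite (on_domain_eqM ove e0).
- move=> x y cx; have [x0 [c0 e0]] := carrier_cell cx.
  rewrite (on_domain_eqM oXi e0) => /(H2 x0 y c0)[x' [cx' h3 h4]].
  have [|x'' [c'' e'' h'']] := key x x' cx cx'.
    rewrite dist_dom_sym (dist_dom_eqM _ e0) dist_dom_sym; exact: h3.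
  by exists x''; split => //; rewrite -(on_domain_eqM ove e'').
Qed.

(** On the circle compactness is known only above the cell [0, 1]. With [x] moved to [0, 1), a
    nearby point lies in the same period or in one of the two adjacent ones; each of these three
    positions gives a translate to which closedness above the cell applies. *)
Lemma compact_graph_closed M Xi x y : compact_graph M Xi -> carrier M x ->
  (forall d : R, 0 < d -> exists x' y', [/\ carrier M x', Xi x' y', `|x - x'| < d & `|y - y'| < d]) ->
  Xi x y.
Proof.
move=> [oXi _ cG] cx H; apply: contrapT => nXi.
have clG : closed (graph M Xi) by apply: compact_closed => //; exact: norm_hausdorff.
have gap (z : R * R) : ~ graph M Xi z -> exists2 d : R, 0 < d &
    forall x' y', graph M Xi (x', y') -> ~ (`|z.1 - x'| < d /\ `|z.2 - y'| < d).
  move=> nz; have : (~` graph M Xi) z by [].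
  have oC := closed_openC clG.
  move: oC; rewrite openE => /[swap] hz /(_ z hz) /nbhs_ballP[d /= d0 hd].
  by exists d => // x' y' gxy [h1 h2]; apply: (hd (x', y') _) gxy; split.
case: M oXi cx H clG gap nXi {cG} => [a b ab|] oXi cx H clG gap nXi.
  have ng : ~ graph (Segment ab) Xi (x, y) by move=> [_ h]; exact: nXi.
  have [d d0 hd] := gap (x, y) ng.
  by have [x' [y' [c1 c2 c3 c4]]] := H d d0; exact: (hd x' y').
pose n := Num.floor x.
have gapj (j : int) : exists2 d : R, 0 < d & forall x' y',
    graph Torus Xi (x', y') -> ~ (`|x - n%:~R + j%:~R - x'| < d /\ `|y - y'| < d).
  apply: (gap (x - n%:~R + j%:~R, y)) => -[_ /= h]; apply: nXi.
  rewrite (@on_domain_eqM R Torus _ Xi x (x - n%:~R + j%:~R))//.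
  by exists (j - n); rewrite intrB; ring.
have [d1 d10 h1] := gapj (-1); have [d2 d20 h2] := gapj 0; have [d3 d30 h3] := gapj 1.
pose d := Num.min 1 (Num.min d1 (Num.min d2 d3)).
have d0 : 0 < d by rewrite !lt_min ltr01 d10 d20.
have : d <= d by []. rewrite {2}/d !le_min => /and4P[e0 e1 e2 e3].
have [x' [y' [_ Xxy hx hy]]] := H d d0.
have /andP[n1 n2] := floor_itv x; rewrite intrD -/n in n1 n2.
have conc (j : int) (dj : R) : d <= dj -> cell Torus (x' - n%:~R + j%:~R) ->
    `|x - n%:~R + j%:~R - (x' - n%:~R + j%:~R)| < dj /\ `|y - y'| < dj /\
    graph Torus Xi (x' - n%:~R + j%:~R, y').
  move=> dd cc; have -> : x - n%:~R + j%:~R - (x' - n%:~R + j%:~R) = x - x' by ring.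
  split; first exact: lt_le_trans hx dd.
  split; first exact: lt_le_trans hy dd.
  split => //=; rewrite -(@on_domain_eqM R Torus _ Xi x' _ oXi)//.
  by exists (j - n); rewrite intrB; ring.
move: hx; rewrite ltr_norml => /andP[hx1 hx2].
have [l1|l1] := ltP x' n%:~R.
  have [|k1 [k2 k3]] := conc 1 d3 e3; last exact: (h3 _ _ k3).
  by rewrite /= in_itv/=; clear -l1 hx1 hx2 n1 n2 e0; apply/andP; split; rlra.
have [l2|l2] := leP x' (n%:~R + 1).
  have [|k1 [k2 k3]] := conc 0 d2 e2; last exact: (h2 _ _ k3).
  by rewrite /= in_itv/=; clear -l1 l2; apply/andP; split; rlra.
have [|k1 [k2 k3]] := conc (-1) d1 e1; last exact: (h1 _ _ k3).
by rewrite /= in_itv/= intrN; clear -l2 hx1 hx2 n1 n2 e0; apply/andP; split; rlra.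
Qed.

(** Energy estimates are available between interior points only, so a point of a segment is pushed
    slightly towards the midpoint. *)
Lemma near_interior M (w : R -> R) x (e : R) : {within carrier M, continuous w} -> carrier M x ->
  0 < e -> exists x', [/\ interior_dom M x', `|x' - x| < e & `|w x' - w x| < e].
Proof.
move=> cw cx e0; case: M cw cx => [a b ab|] cw cx; last first.
  by exists x; rewrite !subrr normr0.
move: cx; rewrite /= in_itv/= => /andP[ax xb].
have : \forall t \near within `[a, b] (nbhs x), `|w x - w t| < e.
  have /subspace_continuousP/(_ x) := cw.
  rewrite /= in_itv/= ax xb => /(_ isT) /cvgrPdist_lt/(_ e e0) h; exact: h.
rewrite near_withinE => /nbhs_ballP[d /= d0 hd].
pose m := (a + b) / 2.
have [k k0 k1] : exists2 k : R, 0 < k < 1 & k * (b - a) < Num.min d e.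
  have de : 0 < Num.min d e by rewrite lt_min d0.
  have ba : 0 < b - a by rewrite subr_gt0.
  exists (Num.min (1 / 2) (Num.min d e / (2 * (b - a)))).
    by rewrite lt_min !divr_gt0 ?mulr_gt0//= gt_min; apply/orP; left; rlra.
  apply: (@le_lt_trans _ _ (Num.min d e / (2 * (b - a)) * (b - a))).
    by rewrite ler_pM2r// ge_min lexx orbT.
  have -> : Num.min d e / (2 * (b - a)) * (b - a) = Num.min d e / 2 by field; rewrite gt_eqF.
  by move: de; move: (Num.min d e) => z; rlra.
pose x' := x + k * (m - x).
move: k0 k1; rewrite lt_min => /andP[k0 k2] /andP[k3 k4].
have hx : `|x' - x| <= k * (b - a).
  rewrite /x' addrAC subrr add0r normrM (gtr0_norm k0) ler_pM2l// ler_norml /m.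
  by apply/andP; split; rlra.
have ix : a < x' < b by rewrite /x' /m; apply/andP; split; nra.
exists x'; split; first by rewrite /= in_itv.
  exact: le_lt_trans hx k4.
rewrite distrC; apply: hd; first by rewrite /ball/= distrC; exact: le_lt_trans hx k3.
by rewrite /= in_itv/=; case/andP : ix => /ltW -> /ltW ->.
Qed.

End graphs.

(** * Lower bounds *)

Section lower.
Context {R : realType}.
Local Notation mu := (@lebesgue_measure R).
Local Notation intg D f := (mu.-integrable D (EFin \o f)).
Implicit Types (M : domain R) (f g h u w phi psi : R -> R) (p q r x y z t : R) (U : set R)
  (Xi : R -> set R).

Fixpoint US M (s : seq R) r : set R :=
  if s is x :: s' then Nb M x r `|` US M s' r else set0.

Lemma US_P M s r t : US M s r t <-> exists2 x, x \in s & Nb M x r t.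
Proof.
elim: s => [|x s ih] /=; first by split => // -[].
split; first by move=> [h|/ih[y ys h]]; [exists x; rewrite ?mem_head|exists y; rewrite ?inE ?ys ?orbT].
move=> [y]; rewrite inE => /predU1P[->|ys] h; first by left.
by right; apply/ih; exists y.
Qed.

Lemma US_measurable M s r : measurable (US M s r).
Proof. by elim: s => [|x s ih] //=; apply: measurableU => //; exact: Nb_measurable. Qed.

Lemma Rintegral_sub (A B : set (measurableTypeR R)) f : measurable A -> measurable B -> A `<=` B ->
  intg B f -> (forall t, B t -> 0 <= f t) -> \int[mu]_(t in A) f t <= \int[mu]_(t in B) f t.
Proof.
move=> mA mB AB iB f0; apply: fine_le.
- by apply: integrable_fin_num => //; exact: integrableS iB.
- by apply: integrable_fin_num.
- by apply: ge0_subset_integral => //; case/integrableP : iB.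
Qed.

Lemma sum_Nb M s r f : L1 M f -> (forall t, 0 <= f t) -> uniq s ->
  (forall x y, x \in s -> y \in s -> x != y -> 2 * r <= dist_dom M x y) ->
  \sum_(x <- s) \int[mu]_(t in cell M `&` Nb M x r) f t =
  \int[mu]_(t in cell M `&` US M s r) f t.
Proof.
move=> [of1 if_] f0; have mc := @cell_measurable R M.
elim: s => [_ _|x s ih /= /andP[xs us] sep]; first by rewrite big_nil /= setI0 Rintegral_set0.
rewrite big_cons ih//; last by move=> y z ys zs; apply: sep; rewrite inE ?ys ?zs orbT.
have mx := measurableI _ _ mc (Nb_measurable M x r).
have mS := measurableI _ _ mc (US_measurable M s r).
rewrite setIUr /Rintegral ge0_integral_setU//.
- have fin (A : set (measurableTypeR R)) : measurable A -> A `<=` cell M ->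
    (\int[mu]_(t in A) (f t)%:E)%E \is a fin_num.
    by move=> mA Ac; apply: integrable_fin_num => //; exact: integrableS if_.
  have s1 (B : set R) : cell M `&` B `<=` cell M by move=> t [].
  rewrite [RHS]fineD//; [exact: fin mx (s1 _)|exact: fin mS (s1 _)].
- apply: measurable_funS (measurable_int _ if_) => //.
  by move=> t [[]|[]].
- by move=> t _; rewrite lee_fin.
- apply/disj_setPS => t [[_ /NbE h1] [_ /US_P[y ys /NbE h2]]].
  have xy : x != y by apply: contraNneq xs => ->.
  have := sep x y; rewrite mem_head inE ys orbT => /(_ isT isT xy) h.
  have := dist_dom_triangle M x t y; rewrite (dist_dom_sym M t y) => h3.
  by clear -h h1 h2 h3; rlra.
Qed.

Lemma sum_Nb_le M s r f : L1 M f -> (forall t, 0 <= f t) -> uniq s ->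
  (forall x y, x \in s -> y \in s -> x != y -> 2 * r <= dist_dom M x y) ->
  \sum_(x <- s) \int[mu]_(t in cell M `&` Nb M x r) f t <= \int[mu]_(t in cell M) f t.
Proof.
move=> hf f0 us sep; have mc := @cell_measurable R M.
rewrite sum_Nb//; apply: Rintegral_sub => //; [exact: measurableI (US_measurable _ _ _)|exact: hf.2].
Qed.

Lemma sep_radius M (s : seq R) : (forall x, x \in s -> reps M x) ->
  exists2 d : R, 0 < d & forall x y, x \in s -> y \in s -> x != y -> d <= dist_dom M x y.
Proof.
move=> ss.
have [|d d0 hd] := @seq_radius R s (fun x r => forall y, y \in s -> x != y -> r <= dist_dom M x y).
  move=> x xs.
  have [|d d0 hd] := @seq_radius R s (fun y r => x != y -> r <= dist_dom M x y).
    move=> y ys; have [->|xy] := eqVneq x y; first by exists 1.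
    exists (dist_dom M x y); first exact: reps_dist_gt0 (ss x xs) (ss y ys) xy.
    by move=> r /andP[].
  by exists d => // r rd y ys; exact: hd.
by exists d => // x y xs ys; apply: (hd x xs d) => //; rewrite d0 lexx.
Qed.

Variables (F : R -> R).
Hypotheses (F_cont : continuous F) (F_ge0 : forall t, 0 <= F t)
  (F_eq0 : forall t, F t = 0 <-> t = 1)
  (F_infty : (0 < limf_einf (fun t => (F t)%:E) norm_infty)%E).

(** Near infinity the lower limit gives a positive bound; the remaining values form two compact
    intervals that avoid 1, and [F] has a positive minimum on each. *)
Lemma F_far_pos (k : R) : 0 < k -> exists2 m : R, 0 < m & forall t, k <= `|t - 1| -> m <= F t.
Proof.
move=> k0; have : exists2 m : R, 0 < m & exists B : R, forall t, B < `|t| -> m <= F t.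
  move: F_infty; rewrite limf_einfE => /ereal_sup_gt[_ [A [B hB] <-]] h.
  have [m0 [m00 hm]] : exists m : R, 0 < m /\ (m%:E <= ereal_inf [set (F x)%:E | x in A])%E.
    case: (ereal_inf _) h => [m| |//]; rewrite ?lte_fin => h; first by exists m.
    by exists 1; rewrite leey.
  exists m0 => //; exists B => t Bt.
  rewrite -lee_fin; apply: le_trans hm _; apply: ereal_inf_lbound.
  by exists t => //; exact: hB.
move=> [m1 m10 [B hB]].
have seg a b : a <= b -> (forall t, a <= t <= b -> t != 1) ->
    exists2 m : R, 0 < m & forall t, a <= t <= b -> m <= F t.
  move=> ab n1; have [c + hc] := @EVT_min R F a b ab (continuous_subspaceT F_cont).
  rewrite in_itv/= => cab; exists (F c).
    by rewrite lt_neqAle F_ge0 andbT eq_sym; apply: contra (n1 c cab) => /eqP/F_eq0 ->.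
  by move=> t tab; apply: hc; rewrite in_itv.
have B0 : B <= `|B| by exact: ler_norm.
have [||m2 m20 h2] := seg (1 + k) (1 + k + `|B|); first by rewrite lerDl.
  by move=> t /andP[h _]; rewrite gt_eqF//; rlra.
have [||m3 m30 h3] := seg (1 - k - 2 - `|B|) (1 - k).
    by have b0 := normr_ge0 B; rlra.
  by move=> t /andP[_ h]; rewrite lt_eqF//; rlra.
exists (Num.min m1 (Num.min m2 m3)); first by rewrite !lt_min m10 m20.
move=> t; rewrite !ge_min; have [t1|t1] := leP 1 t => kt.
  have [h|h] := leP t (1 + k + `|B|).
    by rewrite h2 ?orbT// h andbT -lerBrDl -(@ger0_norm _ (t - 1))// subr_ge0.
  rewrite hB//; apply: le_lt_trans B0 _; apply: lt_le_trans (ler_norm _).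
  by apply: le_lt_trans h; rlra.
have [h|h] := leP (1 - k - 2 - `|B|) t.
  rewrite h3 ?orbT// h /=.
  by move: kt; rewrite ltr0_norm ?subr_lt0// => kt; rlra.
rewrite hB//; apply: le_lt_trans B0 _; rewrite -(normrN t); apply: lt_le_trans (ler_norm _).
by rlra.
Qed.

(* On a segment the whole interior is a window, so only on the torus does the radius matter. *)
Lemma energy_interval M (eps : R) v x r y z : H1 M v -> 0 < eps -> small_radius M r ->
  interior_dom M y -> interior_dom M z -> x - r < y -> y <= z -> z < x + r ->
  `|Hf F (v z) - Hf F (v y)| <= \int[mu]_(t in `[y, z]) density F M eps v t.
Proof.
case: M => [a b ab|] hv e0 /=; last by move=> rs _ _; exact: energy_ge.
move=> _; rewrite !in_itv/= => /andP[ay yb] /andP[az zb] _ yz _.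
have e1 : (a + b) / 2 - (b - a) / 2 = a by field.
have e2 : (a + b) / 2 + (b - a) / 2 = b by field.
by apply: (@energy_ge R F F_cont F_ge0 (Segment ab) eps v ((a + b) / 2) ((b - a) / 2)); rewrite /window ?e1 ?e2.
Qed.

Lemma interval_Nb M f x r a b : L1 M f -> (forall t, 0 <= f t) -> small_radius M r ->
  interior_dom M a -> interior_dom M b -> x - r < a -> b < x + r ->
  intg `[a, b] f /\ \int[mu]_(t in `[a, b]) f t <= \int[mu]_(t in cell M `&` Nb M x r) f t.
Proof.
move=> hf f0 rs ia ib xa bx.
have sub : `[a, b]%classic `<=` `](x - r), (x + r)[%classic `&` carrier M.
  move=> t; rewrite /= in_itv/= => /andP[h1 h2]; split.
    by rewrite /= in_itv/=; apply/andP; split; rlra.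
  case: (M) ia ib => //= a' b' ab; rewrite !in_itv/= => /andP[h3 _] /andP[_ h4].
  by apply/andP; split; rlra.
have mI : measurable (`](x - r), (x + r)[ `&` carrier M : set (measurableTypeR R)).
  by apply: measurableI => //; exact: carrier_measurable.
have iI : intg (`](x - r), (x + r)[ `&` carrier M) f.
  case: (M) hf rs mI {sub ia ib} => [a' b' ab|] [oD iD] /= rs mI.
    by apply: integrableS iD => //; exact: cell_measurable.
  rewrite setIT; apply: integrableS (@L1_window R Torus _ x r (conj oD iD) rs) => //.
  by move=> t /=; rewrite !in_itv/= => /andP[/ltW -> /ltW ->].
split; first exact: integrableS iI.
have -> : \int[mu]_(t in cell M `&` Nb M x r) f t =
    \int[mu]_(t in `](x - r), (x + r)[ `&` carrier M) f t.
  rewrite /Rintegral (@integral_Nb R M x r (fun t => (f t)%:E))//.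
  - by case: (M) hf => //= -[h _] t; rewrite h.
  - by case/integrableP : hf.2.
exact: Rintegral_sub.
Qed.

(** The equalities [a = y] and [z = b] are allowed: an endpoint of a segment leaves only two
    stretches. *)
Lemma energy_chain M (eps : R) v x r a y z b : H1 M v -> 0 < eps -> small_radius M r ->
  interior_dom M a -> interior_dom M y -> interior_dom M z -> interior_dom M b ->
  x - r < a -> a <= y -> y <= z -> z <= b -> b < x + r ->
  `|Hf F (v y) - Hf F (v a)| + `|Hf F (v z) - Hf F (v y)| + `|Hf F (v b) - Hf F (v z)| <=
  \int[mu]_(t in cell M `&` Nb M x r) density F M eps v t.
Proof.
move=> hv e0 rs ia iy iz ib xa ay yz zb bx.
have hD := density_L1 F_cont eps hv.
have D0 t : 0 <= density F M eps v t by exact: density_ge0.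
have e1 := @energy_interval M eps v x r a y hv e0 rs ia iy xa ay (le_lt_trans (le_trans yz zb) bx).
have e2 := @energy_interval M eps v x r y z hv e0 rs iy iz (lt_le_trans xa ay) yz (le_lt_trans zb bx).
have e3 := @energy_interval M eps v x r z b hv e0 rs iz ib (lt_le_trans (lt_le_trans xa ay) yz) zb bx.
apply: le_trans (lerD (lerD e1 e2) e3) _.
have [iab hab] := interval_Nb hD D0 rs ia ib xa bx.
rewrite -(@Rintegral_cc_split R _ a y z)//; last first.
  by apply: integrableS iab => // t /=; rewrite !in_itv/= => /andP[-> h]; exact: le_trans h zb.
by rewrite -(@Rintegral_cc_split R _ a z b)//; exact: le_trans yz.
Qed.

Definition cost M x (lo hi : R) : R := 2 * (G F lo + G F hi)
  - (is_endpoint M x)%:R * Num.max (G F lo) (G F hi).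

(* Among the points of an interval of length [d], one must have [v] close to 1, since otherwise
   the potential term alone would cost at least [m d / (2 eps)]. *)
Lemma near_one M (k d C : R) : 0 < k -> 0 < d -> 0 <= C ->
  exists2 e0 : R, 0 < e0 & forall (eps : R) v x r y z, 0 < eps < e0 -> H1 M v -> small_radius M r ->
    interior_dom M y -> interior_dom M z -> x - r < y -> d <= z - y -> z < x + r ->
    \int[mu]_(t in cell M) density F M eps v t <= C ->
    exists t, [/\ y <= t <= z, interior_dom M t & `|v t - 1| < k].
Proof.
move=> k0 d0 C0; have [m m0 hm] := F_far_pos k0.
exists (m * d / (2 * (C + 1))); first by rewrite divr_gt0 ?mulr_gt0//; rlra.
move=> eps v x r y z /andP[e0 e1] hv rs iy iz xy yz zx hE.
apply: contrapT => nex.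
have D0 t : 0 <= density F M eps v t by exact: density_ge0.
have hD := density_L1 F_cont eps hv.
have yz' : y <= z by rlra.
have [iyz hyz] := interval_Nb hD D0 rs iy iz xy zx.
have : \int[mu]_(t in cell M `&` Nb M x r) density F M eps v t <= C.
  apply: le_trans hE; apply: Rintegral_sub => //.
  - by apply: measurableI; [exact: cell_measurable|exact: Nb_measurable].
  - exact: cell_measurable.
  - exact: hD.2.
have : (2 * eps)^-1 * m * (z - y) <= \int[mu]_(t in `[y, z]) density F M eps v t.
  rewrite -Rintegral_cc_cst//; apply: le_Rintegral => //.
    by apply: (@integrable_continuous R y z) => // ?; exact: cvg_cst.
  move=> t; rewrite /= in_itv/= => tyz; rewrite /density ler_wpDl//.
    by rewrite mulr_ge0 ?sqr_ge0// divr_ge0// ltW.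
  rewrite ler_pM2l ?invr_gt0 ?mulr_gt0//; apply: hm; rewrite leNgt; apply/negP => h.
  apply: nex; exists t; split => //.
  by case: (M) iy iz => //= a b ab; rewrite !in_itv/= => /andP[h3 _] /andP[_ h4];
    apply/andP; split; case/andP: tyz => h1 h2; rlra.
move=> h1 h2; have h3 := le_trans (le_trans h1 hyz) h2.
have h4 : m * d <= C * (2 * eps).
  rewrite -ler_pdivrMr ?mulr_gt0// mulrC; apply: le_trans h3; rewrite -mulrA.
  by rewrite ler_pM2l ?invr_gt0 ?mulr_gt0// ler_pM2l.
move: e1; rewrite ltr_pdivlMr ?mulr_gt0//; last by rlra.
by move: h4 e0; clear; move: (m * d) => w h1 h2 h3; rlra.
Qed.

(* The two orders in which [v] visits [lo] and [hi] cost the same at an interior point. *)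
Lemma interior_cost (A P Q B lo hi n : R) : lo <= 0 -> 0 <= hi -> `|A| <= n -> `|B| <= n ->
  `|P - lo| <= n -> `|Q - hi| <= n ->
  2 * (- lo + hi) - 6 * n <= `|P - A| + `|Q - P| + `|B - Q| /\
  2 * (- lo + hi) - 6 * n <= `|Q - A| + `|P - Q| + `|B - P|.
Proof.
move=> l0 h0; rewrite !ler_norml => /andP[a1 a2] /andP[b1 b2] /andP[p1 p2] /andP[q1 q2].
have := ler_norm (P - A); have := ler_norm (Q - P); have := ler_norm (B - Q).
have := ler_norm (Q - A); have := ler_norm (P - Q); have := ler_norm (B - P).
have := ler_norm (A - P); have := ler_norm (Q - B).
rewrite (distrC A P) (distrC Q B) (distrC P Q).
move: `|P - A| `|Q - P| `|B - Q| `|Q - A| `|B - P| => z1 z2 z3 z4 z5 *.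
by split; rlra.
Qed.

(** Only one side of the point leads back to 1. The path starts at one extreme, crosses to the other
    and returns to 1, which spares the trip to the first extreme; at best the dearer trip is spared,
    hence the maximum. *)
Lemma endpoint_cost (P Q B lo hi n : R) : lo <= 0 -> 0 <= hi -> `|B| <= n ->
  `|P - lo| <= n -> `|Q - hi| <= n ->
  2 * (- lo + hi) - Num.max (- lo) hi - 6 * n <= `|Q - P| + `|B - Q| /\
  2 * (- lo + hi) - Num.max (- lo) hi - 6 * n <= `|P - Q| + `|B - P|.
Proof.
move=> l0 h0; rewrite !ler_norml => /andP[b1 b2] /andP[p1 p2] /andP[q1 q2].
have := ler_norm (Q - P); have := ler_norm (B - P); have := ler_norm (Q - B).
have : - lo <= Num.max (- lo) hi by rewrite le_max lexx.
have : hi <= Num.max (- lo) hi by rewrite le_max lexx orbT.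
rewrite (distrC Q B) (distrC P Q).
move: `|Q - P| `|B - Q| `|B - P| (Num.max _ _) => z1 z2 z3 z4 *.
by split; rlra.
Qed.

Lemma side_cases M x : reps M x -> exists2 d : R, 0 < d &
  let R_ := forall t, 0 < t <= d -> interior_dom M (x + t) in
  let L_ := forall t, 0 < t <= d -> interior_dom M (x - t) in
  if is_endpoint M x then R_ \/ L_ else R_ /\ L_.
Proof.
case: M => [a b ab|] /=; last by exists 1.
rewrite in_itv/= => /andP[ax xb].
have d0 : 0 < (b - a) / 2 by rlra.
have [->|xa] := eqVneq x a => /=.
  exists ((b - a) / 2) => //; left => t /andP[t0 t1]; rewrite in_itv/=; apply/andP; split; rlra.
have [->|xb'] := eqVneq x b => /=.
  exists ((b - a) / 2) => //; right => t /andP[t0 t1]; rewrite in_itv/=; apply/andP; split; rlra.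
have ax' : a < x by rewrite lt_neqAle eq_sym xa.
have xb'' : x < b by rewrite lt_neqAle xb'.
exists (Num.min (x - a) (b - x) / 2).
  by rewrite divr_gt0// lt_min !subr_gt0 ax'.
have : Num.min (x - a) (b - x) <= x - a by rewrite ge_min lexx.
have : Num.min (x - a) (b - x) <= b - x by rewrite ge_min lexx orbT.
move: (Num.min _ _) => m m1 m2.
by split=> t /andP[t0 t1]; rewrite in_itv/=; apply/andP; split; rlra.
Qed.

Lemma cvg_point (f : R -> R) (x e : R) : {for x, continuous f} -> 0 < e ->
  exists2 d : R, 0 < d & forall t, `|t - x| < d -> `|f t - f x| <= e.
Proof.
move=> cf e0; have h : f t @[t --> x] --> f x := cf.
move/cvgrPdist_lt : h => /(_ e e0) /nbhs_ballP[d /= d0 hd]; exists d => // t td; rewrite distrC ltW//; apply: hd.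
by rewrite /ball/= distrC.
Qed.

(** Within s/2 of [x] the function comes close to both [lo] and [hi], in an unknown order, and
    between s/2 and s it comes close to 1 on each side that lies in [M]. The values of [Hf] at these
    points are known up to d/6, and the two cost lemmas lose six such errors. *)
Lemma point_lower M (v : R -> R -> R) Xi x lo hi r (d C : R) :
  (forall eps : R, 0 < eps < 1 -> H1 M (v eps)) -> on_domain M Xi -> graph_cvg M v Xi ->
  reps M x -> Xi x lo -> Xi x hi -> lo <= 1 -> 1 <= hi -> 0 < r -> small_radius M r ->
  0 < d -> 0 <= C ->
  \forall eps \near (0 : R)^'+, \int[mu]_(t in cell M) density F M eps (v eps) t <= C ->
    cost M x lo hi - d <= \int[mu]_(t in cell M `&` Nb M x r) density F M eps (v eps) t.
Proof.
move=> hv oXi gc rx Xlo Xhi lo1 hi1 r0 rs d0 C0.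
have cx : carrier M x by case: (M) rx.
have n0 : 0 < d / 6 by rlra.
have [k1 k10 hk1] := cvg_point (Hf_cont F_cont (x := lo)) n0.
have [k2 k20 hk2] := cvg_point (Hf_cont F_cont (x := hi)) n0.
have [k3 k30 hk3] := cvg_point (Hf_cont F_cont (x := 1)) n0.
have [r1 r10 sides] := side_cases rx.
pose s := Num.min r r1 / 2.
have m0 : 0 < Num.min r r1 by rewrite lt_min r0.
have sr : s < r.
  have : Num.min r r1 <= r by rewrite ge_min lexx.
  by rewrite /s; move: (Num.min _ _) m0 => m *; rlra.
have sr1 : s <= r1.
  have : Num.min r r1 <= r1 by rewrite ge_min lexx orbT.
  by rewrite /s; move: (Num.min _ _) m0 => m *; rlra.
have s0 : 0 < s by rewrite /s divr_gt0.
clearbody s.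
pose k := Num.min k1 k2.
have k0 : 0 < k by rewrite lt_min k10.
have kk1 : k <= k1 by rewrite ge_min lexx.
have kk2 : k <= k2 by rewrite ge_min lexx orbT.
clearbody k.
(* Two displacements of size [e], first to a point given by graph convergence and then into the
   interior, remain within s/2 of [x] and within [k] of the prescribed value. *)
pose e := Num.min (k / 2) (s / 4).
have e0 : 0 < e by rewrite lt_min !divr_gt0.
have ek : e <= k / 2 by rewrite ge_min lexx.
have es : e <= s / 4 by rewrite ge_min lexx orbT.
clearbody e.
have s20 : 0 < s / 2 by rlra.
have [e1 e10 h1] := near_one M k30 s20 C0.
have near1 : \forall eps \near (0 : R)^'+, 0 < eps < Num.min 1 e1.
  by apply/near_rightP; exists (Num.min 1 e1) => //; rewrite lt_min ltr01.
have ov eps : 0 < eps < 1 -> on_domain M (v eps) by move=> /hv[[]].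
have near2 := graph_cvg_carrier oXi gc ov e0.
apply: filterS (filterI near1 near2) => eps [/andP[eps0]]; rewrite lt_min => /andP[eps1 epse1] [_ hg] hE.
have hve : H1 M (v eps) by apply: hv; rewrite eps0 eps1.
have cve : {within carrier M, continuous (v eps)} by case: hve.
have find y : Xi x y -> exists p, [/\ interior_dom M p, x - s / 2 < p, p < x + s / 2 & `|v eps p - y| < k].
  move=> Xy; have [x' [cx' xx' vx']] := hg x y cx Xy.
  have [p [ip px' vp]] := near_interior cve cx' e0.
  exists p; move: xx' px'; rewrite (ltr_norml (x - x')) (ltr_norml (p - x')) => /andP[z1 z2] /andP[z3 z4]; split => //.
  - by rlra.
  - by rlra.
  - have -> : v eps p - y = (v eps p - v eps x') + (v eps x' - y) by ring.
    apply: le_lt_trans (ler_normD _ _) _.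
    by apply: lt_le_trans (ltrD vp vx') _; rlra.
have [p [ip p1 p2 vp]] := find lo Xlo.
have [q [iq q1 q2 vq]] := find hi Xhi.
have {vp}Plo := hk1 _ (lt_le_trans vp kk1).
have {vq}Qhi := hk2 _ (lt_le_trans vq kk2).
clear k10 k20 k30 n0 m0 kk1 kk2 e0 ek es near1 near2 hg.
have findR : (forall t, 0 < t <= r1 -> interior_dom M (x + t)) ->
    exists b, [/\ interior_dom M b, x + s / 2 <= b, b < x + r & `|Hf F (v eps b)| <= d / 6].
  move=> hR; have [|||||||||t [/andP[t1 t2] it vt]] := h1 eps (v eps) x r (x + s / 2) (x + s) => //.
  - by rewrite eps0.
  - by apply: hR; apply/andP; split; rlra.
  - by apply: hR; apply/andP; split; rlra.
  - by rlra.
  - by rlra.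
  - by rlra.
  exists t; split => //; first by rlra.
  by have := hk3 _ vt; rewrite Hf1 subr0.
have findL : (forall t, 0 < t <= r1 -> interior_dom M (x - t)) ->
    exists a, [/\ interior_dom M a, a <= x - s / 2, x - r < a & `|Hf F (v eps a)| <= d / 6].
  move=> hL; have [|||||||||t [/andP[t1 t2] it vt]] := h1 eps (v eps) x r (x - s) (x - s / 2) => //.
  - by rewrite eps0.
  - by apply: hL; apply/andP; split; rlra.
  - by apply: hL; apply/andP; split; rlra.
  - by rlra.
  - by rlra.
  - by rlra.
  exists t; split => //; first by rlra.
  by have := hk3 _ vt; rewrite Hf1 subr0.
clear e10 h1 eps1 epse1.
have l0 : Hf F lo <= 0 by rewrite -(Hf1 F) Hf_mono.
have h0 : 0 <= Hf F hi by rewrite -(Hf1 F) Hf_mono.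
have chain := @energy_chain M eps (v eps) x r _ _ _ _ hve eps0 rs.
have pL : x - r < p by rlra.
have pR : p < x + r by rlra.
have qL : x - r < q by rlra.
have qR : q < x + r by rlra.
rewrite /cost (G_le F_cont lo1) (G_ge F_cont hi1).
have dd : d = 6 * (d / 6) by field.
rewrite [X in _ - X <= _]dd.
case: (is_endpoint M x) sides => /= [[hR|hL]|[hR hL]].
- have [b [ib b1 b2 vb]] := findR hR.
  have pb := ltW (lt_le_trans p2 b1); have qb := ltW (lt_le_trans q2 b1).
  have [c1 c2] := endpoint_cost l0 h0 vb Plo Qhi; rewrite mul1r.
  have [pq|qp] := leP p q.
  + apply: le_trans c1 _; rewrite -[X in X + _]add0r -(normr0 R) -(subrr (Hf F (v eps p))).
    by apply: chain => //; exact: ltW.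
  + apply: le_trans c2 _; rewrite -[X in X + _]add0r -(normr0 R) -(subrr (Hf F (v eps q))).
    by apply: chain => //; exact: ltW.
- have [b [ib b1 b2 vb]] := findL hL.
  have bp := ltW (le_lt_trans b1 p1); have bq := ltW (le_lt_trans b1 q1).
  have [c1 c2] := endpoint_cost l0 h0 vb Plo Qhi; rewrite mul1r.
  have [pq|qp] := leP p q.
  + apply: le_trans c2 _; rewrite addrC (distrC (Hf F (v eps b)) (Hf F (v eps p))) (distrC (Hf F (v eps p)) (Hf F (v eps q))).
    rewrite -[leLHS]addr0 -[X in _ + X](normr0 R) -(subrr (Hf F (v eps q))).
    by apply: chain => //; exact: ltW.
  + apply: le_trans c1 _; rewrite addrC (distrC (Hf F (v eps b)) (Hf F (v eps q))) (distrC (Hf F (v eps q)) (Hf F (v eps p))).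
    rewrite -[leLHS]addr0 -[X in _ + X](normr0 R) -(subrr (Hf F (v eps p))).
    by apply: chain => //; exact: ltW.
- have [a [ia a1 a2 va]] := findL hL.
  have [b [ib b1 b2 vb]] := findR hR.
  have ap := ltW (le_lt_trans a1 p1); have aq := ltW (le_lt_trans a1 q1).
  have pb := ltW (lt_le_trans p2 b1); have qb := ltW (lt_le_trans q2 b1).
  have [c1 c2] := interior_cost l0 h0 va vb Plo Qhi; rewrite mul0r subr0.
  have [pq|qp] := leP p q.
  + by apply: le_trans c1 _; apply: chain => //; exact: ltW.
  + by apply: le_trans c2 _; apply: chain => //; exact: ltW.
Qed.

Lemma near_seq (T : Type) (Fl : set_system T) {FF : Filter Fl} (s : seq R) (P : R -> T -> Prop) :
  (forall x, x \in s -> \forall e \near Fl, P x e) -> \forall e \near Fl, forall x, x \in s -> P x e.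
Proof.
elim: s => [_|x s ih h]; first exact: nearW.
have h2 : \forall e \near Fl, forall y, y \in s -> P y e.
  by apply: ih => y ys; apply: h; rewrite inE ys orbT.
apply: filterS (filterI (h x (mem_head _ _)) h2) => e [h3 h4] y.
by rewrite inE => /predU1P[->|/h4].
Qed.

Lemma G_ge0 t : 0 <= G F t.
Proof. by rewrite G_Hf. Qed.

Lemma cost_ge0 M x (lo hi : R) : 0 <= cost M x lo hi.
Proof.
have := G_ge0 lo; have := G_ge0 hi; rewrite /cost; move: (G F lo) (G F hi) => a b a0 b0.
have : Num.max a b <= a + b by rewrite ge_max; apply/andP; split; rlra.
by case: (is_endpoint M x) => /=; rewrite ?mul1r ?mul0r; move: (Num.max _ _) => m; rlra.
Qed.

(** If the total energy exceeds the sum [C] of the costs nothing is to be shown. Otherwise it is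
    bounded, so the estimate at each point applies, on disjoint balls. *)
Lemma sMM_lower M (v : R -> R -> R) Xi (s : seq R) (lo hi : R -> R) (d : R) :
  (forall eps : R, 0 < eps < 1 -> H1 M (v eps)) -> on_domain M Xi -> graph_cvg M v Xi ->
  uniq s -> (forall x, x \in s -> [/\ reps M x, Xi x (lo x), Xi x (hi x), lo x <= 1 & 1 <= hi x]) ->
  0 < d ->
  \forall eps \near (0 : R)^'+, \sum_(x <- s) cost M x (lo x) (hi x) - d <=
    \int[mu]_(t in cell M) density F M eps (v eps) t.
Proof.
move=> hv oXi gc us hs d0.
have [|r0 r00 hr0] := @sep_radius M s; first by move=> x /hs[].
pose r := Num.min (r0 / 2) (1 / 2).
have rpos : 0 < r by rewrite lt_min !divr_gt0.
have rs : small_radius M r by case: (M) => //=; rewrite /r ge_min lexx orbT.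
have rr0 : 2 * r <= r0.
  have : r <= r0 / 2 by rewrite ge_min lexx.
  by rlra.
pose C := \sum_(x <- s) cost M x (lo x) (hi x).
have C0 : 0 <= C by apply: sumr_ge0 => x _; exact: cost_ge0.
pose d' := d / ((size s)%:R + 1).
have d'0 : 0 < d' by rewrite divr_gt0// ltr_wpDl.
have near1 : \forall eps \near (0 : R)^'+, 0 < eps < 1.
  by apply/near_rightP; exists 1.
have near2 : \forall eps \near (0 : R)^'+, forall x, x \in s ->
    \int[mu]_(t in cell M) density F M eps (v eps) t <= C ->
    cost M x (lo x) (hi x) - d' <= \int[mu]_(t in cell M `&` Nb M x r) density F M eps (v eps) t.
  apply: near_seq => x /hs[rx Xl Xh l1 h1].
  by apply: (@point_lower M v Xi).
apply: filterS (filterI near1 near2) => eps [e01 h].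
have [hE|hE] := leP (\int[mu]_(t in cell M) density F M eps (v eps) t) C; last first.
  by apply: le_trans (ltW hE); rewrite lerBlDr lerDl ltW.
have hD : L1 M (density F M eps (v eps)) by apply: density_L1 => //; exact: hv.
have D0 t : 0 <= density F M eps (v eps) t by apply: density_ge0 => //; case/andP: e01.
have := @sum_Nb_le M s r _ hD D0 us.
move=> h1.
apply: le_trans (h1 _); last by move=> x y xs ys xy; apply: le_trans rr0 _; exact: hr0.
apply: (@le_trans _ _ (\sum_(x <- s) (cost M x (lo x) (hi x) - d'))).
  rewrite [leRHS]big_split /= lerD2l sumrN lerN2 big_const_seq count_predT iter_addr_0.
  rewrite -mulr_natl /d' mulrA ler_pdivrMr ?ltr_wpDl//.
  by rewrite mulrC ler_pM2l// lerDl.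
rewrite !big_seq; apply: ler_sum => x xs; exact: h.
Qed.
End lower.

(** * Limits of functions of bounded energy belong to A0 *)

Section consequences.
Context {R : realType}.
Local Notation mu := (@lebesgue_measure R).
Local Notation intg D f := (mu.-integrable D (EFin \o f)).
Implicit Types (M : domain R) (f g h u w phi psi : R -> R) (p q r x y z t : R) (U : set R)
  (Xi : R -> set R).

Lemma compact_has_bounds (A : set R) : compact A -> A !=set0 -> has_inf A /\ has_sup A.
Proof.
move=> cA A0; have [B [_ hB]] := compact_bounded cA.
have hB1 : forall x, A x -> `|x| <= B + 1 by apply: hB; rewrite ltrDl.
split; split => //; [exists (- (B + 1))|exists (B + 1)] => x /hB1; rewrite ler_norml => /andP[] //.
Qed.

Lemma compact_inf_sup (A : set R) : compact A -> A !=set0 -> A (inf A) /\ A (sup A).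
Proof.
move=> cA A0; have [hi hs] := compact_has_bounds cA A0.
have clA : closed A by apply: compact_closed => //; exact: norm_hausdorff.
have adh x : (forall e : R, 0 < e -> exists2 y, A y & `|x - y| < e) -> A x.
  move=> h; apply: clA => B /nbhs_ballP[e /= e0 he].
  by have [y Ay xy] := h e e0; exists y; split => //; exact: he.
split; apply: adh => e e0.
- have [y Ay ye] := inf_adherent e0 hi; exists y => //.
  have iy : inf A <= y by apply: ge_inf => //; exact: hi.2.
  by rewrite distrC ger0_norm ?subr_ge0// ltrBlDl.
- have [y Ay ye] := sup_adherent e0 hs; exists y => //.
  have iy : y <= sup A by apply: sup_upper_bound.
  by rewrite ger0_norm ?subr_ge0// ltrBlDl -ltrBlDr.
Qed.

Lemma inf_sup_bounds (A : set R) x : compact A -> A x -> inf A <= x <= sup A.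
Proof.
move=> cA Ax; have [hi hs] := compact_has_bounds cA (ex_intro _ x Ax).
by rewrite ge_inf//=; [exact: sup_upper_bound|exact: hi.2].
Qed.

Lemma xi_itv (a b : R) : a <= b -> inf `[a, b]%classic = a /\ sup `[a, b]%classic = b.
Proof.
by move=> ab; split; [rewrite inf_itvcc|rewrite sup_itvcc].
Qed.

Definition interval_valued M Xi : Prop :=
  forall x, carrier M x -> Xi x = `[xi_minus Xi x, xi_plus Xi x]%classic /\
    xi_minus Xi x <= 1 <= xi_plus Xi x.

Lemma A0_interval M Xi : A0 M Xi -> interval_valued M Xi.
Proof.
move=> [_ [S [_ _ _ h1 h2]]] x cx; rewrite /xi_minus /xi_plus.
have [Sx|nSx] := pselect (S x); last first.
  have -> : Xi x = `[1, 1]%classic by rewrite set_itv1; exact: h1.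
  by have [-> ->] := @xi_itv 1 1 (lexx _); rewrite lexx.
by have [a [b [ab h ->]]] := h2 x Sx; have [-> ->] := xi_itv (ltW ab).
Qed.

Lemma exceptional_lt M Xi x : interval_valued M Xi -> exceptional M Xi x ->
  xi_minus Xi x < xi_plus Xi x.
Proof.
move=> iv [cx ne]; have [e /andP[h1 h2]] := iv x cx.
rewrite lt_neqAle (le_trans h1 h2) andbT; apply/eqP => ee; apply: ne.
have e1 : xi_plus Xi x = 1 by apply/eqP; rewrite eq_le h2 -ee h1.
by rewrite e ee e1 set_itv1.
Qed.

Lemma exceptional_on_domain M Xi : on_domain M Xi -> on_domain M (exceptional M Xi).
Proof. by case: M => //= h x; rewrite /exceptional /= h. Qed.

Lemma A0_countable M Xi : A0 M Xi -> countable (exceptional M Xi `&` reps M).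
Proof.
move=> [_ [S [cS _ _ h1 _]]]; apply: sub_countable cS; apply: subset_card_le.
move=> x [[cx ne] rx]; split => //; apply: contrapT => nS; apply: ne; exact: h1.
Qed.

Lemma A0_intro M Xi : compact_graph M Xi -> interval_valued M Xi ->
  countable (exceptional M Xi `&` reps M) -> A0 M Xi.
Proof.
move=> cG iv cE; split => //; exists (exceptional M Xi); split => //.
- by apply: exceptional_on_domain; case: cG.
- by move=> x [].
- by move=> x cx h; apply: contrapT => ne; apply: h.
- move=> x ex; have [e h] := iv x ex.1.
  by exists (xi_minus Xi x), (xi_plus Xi x); split => //; exact: exceptional_lt ex.
Qed.

Variables (F : R -> R).
Hypotheses (F_cont : continuous F) (F_ge0 : forall t, 0 <= F t)
  (F_eq0 : forall t, F t = 0 <-> t = 1)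
  (F_infty : (0 < limf_einf (fun t => (F t)%:E) norm_infty)%E).

Definition xcost M Xi x : R := cost F M x (xi_minus Xi x) (xi_plus Xi x).

(** On the circle [is_endpoint] is false, so one formula serves both domains. *)
Lemma E0_sMM_esum M Xi :
  E0_sMM M F Xi = esum (exceptional M Xi `&` reps M) (fun x => (xcost M Xi x)%:E).
Proof.
case: M => [a b ab|] /=; first by [].
rewrite (_ : 2%:E = 1%:E + 1%:E)%E; last by rewrite -EFinD; congr EFin; ring.
rewrite ge0_muleDl ?lee_fin// ?mul1e.
rewrite -esumD; [|by move=> x _; rewrite lee_fin addr_ge0// G_ge0..].
by apply: eq_esum => x _; rewrite -EFinD /xcost /cost /= mul0r subr0; congr EFin; ring.
Qed.

Lemma esum_gt (S : set R) (f : R -> R) (l : \bar R) :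
  (l < esum S (fun x => (f x)%:E))%E ->
  exists s : seq R, [/\ uniq s, forall x, x \in s -> S x & (l < (\sum_(x <- s) f x)%:E)%E].
Proof.
move=> /ereal_sup_gt[_ [X [fX XS] <-]] h.
exists (finmap.enum_fset (fset_set X)); split => //.
- exact: finmap.fset_uniq.
- by move=> x; rewrite in_fset_set// inE => /XS.
- by move: h; rewrite fsbig_finite//= sumEFin.
Qed.

(** At an endpoint only the larger of the two terms is subtracted from twice their sum, so at least
    one copy of the sum is left. *)
Lemma xcost_gt0 M Xi x : interval_valued M Xi -> carrier M x -> xi_minus Xi x < xi_plus Xi x ->
  G F (xi_minus Xi x) + G F (xi_plus Xi x) <= xcost M Xi x /\ 0 < xcost M Xi x.
Proof.
move=> iv cx lt; have [_ /andP[h1 h2]] := iv x cx.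
have Hlt := Hf_strict F_cont F_ge0 F_eq0 lt.
have g1 := G_ge0 F (xi_minus Xi x); have g2 := G_ge0 F (xi_plus Xi x).
have : 0 < G F (xi_minus Xi x) + G F (xi_plus Xi x).
  by rewrite (G_le F_cont h1) (G_ge F_cont h2); rlra.
rewrite /xcost /cost; move: (G F _) (G F _) g1 g2 => b a b0 a0 ab.
have : Num.max a b <= a + b by rewrite ge_max; apply/andP; split; rlra.
by case: (is_endpoint M x) => /=; rewrite ?mul1r ?mul0r; move: (Num.max _ _) => m; split; rlra.
Qed.

Section convergent.
Variables (M : domain R) (Xi : R -> set R) (v : R -> R -> R).
Hypotheses (hv : forall eps : R, 0 < eps < 1 -> H1 M (v eps)) (cG : compact_graph M Xi)
  (gc : graph_cvg M v Xi).

Let oXi : on_domain M Xi. Proof. by case: cG. Qed.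
Let ov (eps : R) : 0 < eps < 1 -> on_domain M (v eps). Proof. by move=> /hv[[]]. Qed.
Let near1 : \forall eps \near (0 : R)^'+, 0 < eps < 1.
Proof. by apply/near_rightP; exists 1. Qed.

(** Near [x] the continuous function [v eps] passes from a value close to [y1] to one close to [y2],
    so it takes the value [y]; such points accumulate at [(x, y)], which belongs to the graph
    because the graph is closed. *)
Lemma intermediate_value x y1 y y2 : carrier M x -> Xi x y1 -> Xi x y2 -> y1 <= y <= y2 -> Xi x y.
Proof.
move=> cx X1 X2 /andP[]; rewrite le_eqVlt => /predU1P[<-//|y1y].
rewrite le_eqVlt => /predU1P[->//|yy2].
apply: (compact_graph_closed cG cx) => d d0.
pose k := Num.min (d / 2) (Num.min (y - y1) (y2 - y)).
have k0 : 0 < k by rewrite !lt_min divr_gt0// !subr_gt0 y1y.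
have : k <= k by []. rewrite {2}/k !le_min => /and3P[kd k1 k2].
clearbody k.
have near2 := graph_cvg_carrier oXi gc ov k0.
have [eps [e1 [h1 h2]]] := filter_ex (filterI near1 near2).
have [p1 [c1 p1x vp1]] := h2 x y1 cx X1.
have [p2 [c2 p2x vp2]] := h2 x y2 cx X2.
have cve : {within carrier M, continuous (v eps)} by have [] := hv e1.
have [t [ct tx vt]] : exists t, [/\ carrier M t, `|x - t| < k & v eps t = y].
  move: p1x p2x vp1 vp2; rewrite !ltr_norml => /andP[a1 a2] /andP[a3 a4] /andP[b1 b2] /andP[b3 b4].
  have sub a b : carrier M a -> carrier M b -> `[a, b]%classic `<=` carrier M.
    case: (M) => //= a' b' ab; rewrite !in_itv/= => /andP[z1 z2] /andP[z3 z4] t.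
    by rewrite /= !in_itv/= => /andP[z5 z6]; apply/andP; split; rlra.
  have vy1 : v eps p1 <= y by rlra.
  have vy2 : y <= v eps p2 by rlra.
  have [pp|pp] := leP p1 p2.
  + have [|t] := @IVT R (v eps) p1 p2 y pp (continuous_subspaceW (sub _ _ c1 c2) cve).
      by rewrite ge_min vy1 le_max vy2 orbT.
    rewrite in_itv/= => /andP[t1 t2] e; exists t; split => //.
      by apply: (sub p1 p2) => //; rewrite /= in_itv/= t1.
    by rewrite ltr_norml; apply/andP; split; rlra.
  + have [|t] := @IVT R (v eps) p2 p1 y (ltW pp) (continuous_subspaceW (sub _ _ c2 c1) cve).
      by rewrite ge_min vy1 le_max vy2 orbT.
    rewrite in_itv/= => /andP[t1 t2] e; exists t; split => //.
      by apply: (sub p2 p1) => //; rewrite /= in_itv/= t1.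
    by rewrite ltr_norml; apply/andP; split; rlra.
have [x' [y' [cx' Xy' tx' vy']]] := h1 t ct.
exists x', y'; split => //; last by rewrite -vt; apply: lt_le_trans vy' _; rlra.
have -> : x - x' = (x - t) + (t - x') by ring.
by apply: le_lt_trans (ler_normD _ _) _; rlra.
Qed.

(** The bound holds for arbitrarily small [eps] only, which is what a finite lower limit
    provides. *)
Hypothesis bounded : exists C : R, forall e : R, 0 < e -> exists2 eps : R, 0 < eps < e &
  \int[mu]_(t in cell M) density F M eps (v eps) t <= C.

Lemma frequently (P : R -> Prop) (C : R) : (\forall eps \near (0 : R)^'+, P eps) ->
  (forall e : R, 0 < e -> exists2 eps : R, 0 < eps < e &
    \int[mu]_(t in cell M) density F M eps (v eps) t <= C) ->
  exists eps, P eps /\ \int[mu]_(t in cell M) density F M eps (v eps) t <= C.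
Proof.
by move=> /near_rightP[e e0 he] h; have [eps e1 h2] := h e e0; exists eps; split => //; exact: he.
Qed.

(** On any short interval beside [x] the potential term forces [v eps] close to 1 somewhere, and the
    limit graph is closed. *)
Lemma one_in x : carrier M x -> Xi x 1.
Proof.
move=> /carrier_reps[x' [rx' xx']]; rewrite (on_domain_eqM oXi xx') => {xx'}.
move: x' rx' => {}x rx; have cx : carrier M x by case: (M) rx.
have [C hC] := bounded.
apply: (compact_graph_closed cG cx) => d d0.
have [d1 d10 sides] := side_cases rx.
pose s := Num.min (d / 8) (Num.min (d1 / 2) (1 / 8)).
have s0 : 0 < s by rewrite !lt_min !divr_gt0.
have : s <= s by []. rewrite {2}/s !le_min => /and3P[sd sd1 s4].
clearbody s.
have d20 : 0 < d / 2 by lra.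
have [e1 e10 h1] := near_one F_cont F_ge0 F_eq0 F_infty M d20 s0 (normr_ge0 C).
have near2 := graph_cvg_carrier oXi gc ov d20.
have near3 : \forall eps \near (0 : R)^'+, 0 < eps < e1 by apply/near_rightP; exists e1.
have [eps [[[e01 near3'] [h3 _]] hE]] := frequently (filterI (filterI near1 near3) near2) hC.
have [t [ct xt vt]] : exists t, [/\ carrier M t, `|x - t| < d / 2 & `|v eps t - 1| < d / 2].
  have ic y : interior_dom M y -> carrier M y.
    by case: (M) => //= a b ab; rewrite !in_itv/= => /andP[/ltW -> /ltW ->].
  have both y z : interior_dom M y -> interior_dom M z -> x - 2 * s <= y -> s <= z - y -> z <= x + 2 * s ->
      exists t, [/\ carrier M t, `|x - t| < d / 2 & `|v eps t - 1| < d / 2].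
    move=> iy iz xy yz zx.
    have [||||||t [/andP[t1 t2] it vt]] := h1 eps (v eps) x (1 / 2) y z _ (hv e01) _ iy iz.
    - by [].
    - by case: (M) => //=.
    - by rlra.
    - by rlra.
    - by rlra.
    - by apply: le_trans hE _; exact: ler_norm.
    exists t; split => //; first exact: ic.
    by rewrite ltr_norml; apply/andP; split; rlra.
  case: (is_endpoint M x) sides => /= [[hR|hL]|[hR hL]].
  - apply: (both (x + s / 2) (x + 3 / 2 * s)); [apply: hR|apply: hR|..]; [apply/andP; split|apply/andP; split|..]; rlra.
  - apply: (both (x - 3 / 2 * s) (x - s / 2)); [apply: hL|apply: hL|..]; [apply/andP; split|apply/andP; split|..]; rlra.
  - apply: (both (x + s / 2) (x + 3 / 2 * s)); [apply: hR|apply: hR|..]; [apply/andP; split|apply/andP; split|..]; rlra.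
have [x' [y' [cx' Xy' tx' vy']]] := h3 t ct.
exists x', y'; split => //.
- have -> : x - x' = (x - t) + (t - x') by ring.
  by apply: le_lt_trans (ler_normD _ _) _; rlra.
- have -> : 1 - y' = - (v eps t - 1) + (v eps t - y') by ring.
  by apply: le_lt_trans (ler_normD _ _) _; rewrite normrN; rlra.
Qed.

Lemma limit_interval_valued : interval_valued M Xi.
Proof.
move=> x cx; have X1 := one_in cx.
have cX : compact (Xi x) by have [_ h _] := cG; exact: h.
have [Xi1 Xi2] := compact_inf_sup cX (ex_intro _ _ X1).
split; last exact: inf_sup_bounds.
apply/seteqP; split=> [y Xy|y]; first by rewrite /= in_itv/=; exact: inf_sup_bounds.
by rewrite /= in_itv/=; exact: (intermediate_value cx Xi1 Xi2).
Qed.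

Lemma sMM_sum_lower (s : seq R) (d : R) : interval_valued M Xi -> uniq s ->
  (forall x, x \in s -> reps M x) -> 0 < d ->
  \forall eps \near (0 : R)^'+, \sum_(x <- s) xcost M Xi x - d <=
    \int[mu]_(t in cell M) density F M eps (v eps) t.
Proof.
move=> iv us hs d0; apply: (sMM_lower F_cont F_ge0 F_eq0 F_infty hv oXi gc us) => // x xs.
have cx : carrier M x by have := hs x xs; case: (M).
have [e /andP[h1 h2]] := iv x cx.
have h3 := le_trans h1 h2.
by split => //; [exact: hs|rewrite e /= in_itv/= lexx|rewrite e /= in_itv/= lexx andbT].
Qed.

(** By the lower bound, N points of cost at least [k] need energy at least N k - 1; hence N is at
    most (|C| + 1)/k. *)
Lemma finite_cost (k : R) : interval_valued M Xi -> 0 < k ->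
  finite_set [set x | (exceptional M Xi `&` reps M) x /\ k <= xcost M Xi x].
Proof.
move=> iv k0; have [C hC] := bounded.
apply: contrapT => /(@infinite_set_fset R _ (Num.truncn ((`|C| + 1) / k)).+1)[B BS szB].
have [||eps [h hE]] := frequently (@sMM_sum_lower (finmap.enum_fset B) 1 iv _ _ ltr01) hC.
- exact: finmap.fset_uniq.
- by move=> x xB; have [[]] := BS x xB.
have : \sum_(x <- finmap.enum_fset B) k <= \sum_(x <- finmap.enum_fset B) xcost M Xi x.
  by rewrite !big_seq; apply: ler_sum => x xB; have [] := BS x xB.
rewrite big_const_seq count_predT iter_addr_0 -[X in X <= _]mulr_natl => h2.
have h3 := @truncnS_gt R ((`|C| + 1) / k).
have h4 : (Num.truncn ((`|C| + 1) / k)).+1%:R <= (size (finmap.enum_fset B))%:R :> R by rewrite ler_nat.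
have : `|C| + 1 < (size (finmap.enum_fset B))%:R * k.
  by rewrite -ltr_pdivrMr//; exact: lt_le_trans h3 h4.
have h5 := le_trans h hE; have h6 := ler_norm C.
move: h2 h5 h6 {h3 h4 h hE}; move: (\sum_(_ <- _) _) (_ * k) => z1 z2 *.
by lra.
Qed.

(** Every exceptional point has positive cost, so the exceptional set is the union over n of the
    finite sets of points of cost at least 1/(n + 1). *)
Lemma limit_A0 : A0 M Xi.
Proof.
have iv := limit_interval_valued.
apply: A0_intro => //.
pose S n := [set x | (exceptional M Xi `&` reps M) x /\ n.+1%:R^-1 <= xcost M Xi x].
have fS n : finite_set (S n) by exact: finite_cost.
apply: (@sub_countable _ _ _ (\bigcup_n S n)); last first.
  by apply: bigcup_countable => // n _; exact: finite_set_countable.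
apply: subset_card_le => x [ex rx].
have [_ c0] := xcost_gt0 iv ex.1 (exceptional_lt iv ex).
have [n hn] := @ltr_add_invr R 0 (xcost M Xi x) c0.
by exists n => //; split => //; rewrite ltW// -[ltLHS]add0r.
Qed.
End convergent.
End consequences.

(** * Jumps and representatives, removable points, step weights *)

Section comparison.
Context {R : realType}.
Local Notation mu := (@lebesgue_measure R).
Local Notation intg D f := (mu.-integrable D (EFin \o f)).
Implicit Types (M : domain R) (f g h u w phi psi : R -> R) (p q r x y z t : R) (U : set R)
  (K : seq R) (Xi : R -> set R).

Lemma trace_integral_shift u (k : int) (l a b : R) : L1 Torus u -> a <= b -> b - a < 1 / 2 ->
  \int[mu]_(y in `](a + k%:~R), (b + k%:~R)[) `|u y - l| = \int[mu]_(y in `]a, b[) `|u y - l|.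
Proof.
move=> hu ab bs; rewrite /Rintegral (@integral_shift _ `](a + k%:~R), (b + k%:~R)[%classic _ k%:~R)//; last first.
  have iu : intg `[a + k%:~R - 1 / 2, a + k%:~R + 1 / 2] u by exact: (@L1_window R Torus _ (a + k%:~R) (1 / 2) hu (lexx _)).
  apply/measurable_EFinP; apply: measurableT_comp => //; apply: measurable_funB => //.
  have /measurable_EFinP mu_ := measurable_int _ iu.
  apply: measurable_funS mu_ => // t /=; rewrite !in_itv/= => /andP[h1 h2].
  by apply/andP; split; move: h1 h2; move: k%:~R => kk; clear -ab bs => h1 h2; rlra.
congr fine; have -> : (fun x : R => x + k%:~R) @^-1` `](a + k%:~R), (b + k%:~R)[%classic = `]a, b[%classic.
  by apply/seteqP; split => t /=; rewrite !in_itv/= !ltrD2r.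
apply: eq_integral => t _; rewrite -(@on_domain_eqM R Torus _ u t (t + k%:~R))//; first by case: hu.
by exists k.
Qed.

(** The traces are selected by [get], so their invariance requires the predicates defining them to
    be equal and not just to have a common solution. *)
Lemma trace_shift u x (k : int) : L1 Torus u ->
  is_rtrace u (x + k%:~R) = is_rtrace u x /\ is_ltrace u (x + k%:~R) = is_ltrace u x.
Proof.
move=> hu.
have hr y (m : int) l : is_rtrace u y l -> is_rtrace u (y + m%:~R) l.
  move=> /meanP H; apply/meanP => e e0; have [r0 r00 hr0] := H e e0.
  exists (Num.min r0 (1 / 2)); first by rewrite lt_min r00/=.
  move=> r /andP[r1]; rewrite lt_min => /andP[r2 r3].
  rewrite [_ + _ + r]addrAC trace_integral_shift//; first by apply: hr0; rewrite r1.
    by rewrite lerDl ltW.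
  by rewrite addrAC subrr add0r.
have hl y (m : int) l : is_ltrace u y l -> is_ltrace u (y + m%:~R) l.
  move=> /meanP H; apply/meanP => e e0; have [r0 r00 hr0] := H e e0.
  exists (Num.min r0 (1 / 2)); first by rewrite lt_min r00/=.
  move=> r /andP[r1]; rewrite lt_min => /andP[r2 r3].
  rewrite [_ + _ - r]addrAC trace_integral_shift//; first by apply: hr0; rewrite r1.
    by rewrite gerBl ltW.
  by rewrite opprB addrC subrK.
have back : x + k%:~R + (- k)%:~R = x by rewrite intrN addrK.
split; apply/funext => l; apply/propext; split => h.
- by rewrite -back; apply: hr h.
- by apply: hr h.
- by rewrite -back; apply: hl h.
- by apply: hl h.
Qed.

Lemma jump_eqM M u x y : L1 M u -> eqM M x y -> jump M u x = jump M u y.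
Proof.
case: M => [a b ab _ ->//|hu [k ->]]; rewrite /jump.
have -> : x \in interior_dom (@Torus R) = true by apply/mem_set.
have -> : x + k%:~R \in interior_dom (@Torus R) = true by apply/mem_set.
have [er el] := trace_shift x k hu.
have rE t : right_trace u t = get (is_rtrace u t) by [].
have lE t : left_trace u t = get (is_ltrace u t) by [].
by rewrite !rE !lE er el.
Qed.

(** A point without jump contributes nothing and can be taken out of the open set. *)
Lemma weighted_tv_remove M U K u : L1 M u -> U `<=` interior_dom M ->
  (forall x, x \in K -> interior_dom M x -> has_traces u x /\ jump M u x = 0) ->
  (forall x, x \in K -> carrier M x) ->
  (weighted_tv M U (fun=> 1%R) u <= weighted_tv M (U `&` UK M K) (fun=> 1%R) u)%E.
Proof.
move=> hu Ui; elim: K => [_ _|x K ih hK cK].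
  by rewrite UK_nil setIidl.
apply: le_trans (ih _ _) _.
- by move=> y yK; apply: hK; rewrite inE yK orbT.
- by move=> y yK; apply: cK; rewrite inE yK orbT.
have [ix|nx] := pselect (interior_dom M x); last first.
  by rewrite UK_endpoint//; apply: cK; exact: mem_head.
have [tx jx] := hK x (mem_head _ _) ix.
have UiK : U `&` UK M K `<=` interior_dom M by move=> t [/Ui].
apply: le_trans (weighted_tv_point_le (w := fun=> 1) hu ix tx _ UiK) _ => //.
rewrite jx mulr0 adde0; apply: weighted_tv_mono => // t [[h1 h2] h3]; split => //.
exact/UK_cons.
Qed.

Lemma UK_sub M K K' : {subset K <= K'} -> UK M K' `<=` UK M K.
Proof. by move=> KK t [it nK]; split => // -[x /KK xK e]; apply: nK; exists x. Qed.

(** Only the points of [K] where [u] jumps have to lie in [A]: the others may be added to the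
    removed set without changing the variation. *)
Lemma tv_measure_le_UK M K (A : set R) u : L1 M u -> (forall x, x \in K -> carrier M x) ->
  (forall x, x \in K -> interior_dom M x -> has_traces u x) ->
  (forall x t, x \in K -> 0 < jump M u x -> interior_dom M t -> dist_dom M x t = 0 -> A t) ->
  (tv_measure M u (interior_dom M `\` A) <= weighted_tv M (UK M K) (fun=> 1%R) u)%E.
Proof.
move=> hu cK tK hA.
pose KJ := [seq x <- K | 0 < jump M u x]; pose KN := [seq x <- K | jump M u x == 0].
apply: le_trans (@tv_measure_le R M KJ A u hu _) _.
  by move=> t it [x]; rewrite mem_filter => /andP[jx xK] e; exact: (hA x).
apply: le_trans (@weighted_tv_remove M (UK M KJ) KN u hu (@UK_interior R M KJ) _ _) _.
- by move=> x; rewrite mem_filter => /andP[/eqP jx xK] ix; split => //; exact: tK.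
- by move=> x; rewrite mem_filter => /andP[_]; exact: cK.
apply: weighted_tv_mono => // t [[it n1] [_ n2]]; split => // -[x xK e].
have [jx|jx] := eqVneq (jump M u x) 0.
  by apply: n2; exists x => //; rewrite mem_filter jx eqxx.
by apply: n1; exists x => //; rewrite mem_filter xK lt_neqAle eq_sym jx jump_ge0.
Qed.

(** The step weight of the lower bound. The order of [K] would decide between overlapping balls; for
    separated points there is no overlap. *)
Fixpoint wgt M K (rho : R) (h : R -> R) (c : R) t : R :=
  if K is x :: K' then if dist_dom M x t < rho then h x else wgt M K' rho h c t else c.

Lemma wgt_cases M K rho h c t :
  (wgt M K rho h c t = c /\ forall x, x \in K -> rho <= dist_dom M x t) \/
  (exists x, [/\ x \in K, dist_dom M x t < rho & wgt M K rho h c t = h x]).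
Proof.
elim: K => [|x K ih] /=; first by left.
case: ltP => h1; first by right; exists x; rewrite mem_head.
case: ih => [[-> h2]|[y [yK h2 h3]]].
  by left; split => // y; rewrite inE => /predU1P[->|/h2].
by right; exists y; rewrite inE yK orbT.
Qed.

Lemma wgt_near M K rho h c x t : x \in K ->
  (forall x y, x \in K -> y \in K -> x != y -> 2 * rho <= dist_dom M x y) ->
  dist_dom M x t < rho -> wgt M K rho h c t = h x.
Proof.
move=> xK sep xt; case: (wgt_cases M K rho h c t) => [[_ /(_ x xK)]|[y [yK yt ->]]].
  by rewrite leNgt xt.
have [->//|xy] := eqVneq x y.
have := sep x y xK yK xy; have := dist_dom_triangle M x t y.
by rewrite (dist_dom_sym M t y) => h1 h2; clear -h1 h2 xt yt; rlra.
Qed.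

Lemma C1c_UK_gap M K phi : C1c M (UK M K) phi -> exists2 r : R, 0 < r &
  forall x t, x \in K -> dist_dom M x t < r -> phi t = 0.
Proof.
move=> hp; have [|r r0 hr] := @seq_radius R K (fun x r => forall t, dist_dom M x t < r -> phi t = 0).
  move=> x xK; have [|d d0 hd] := @C1c_gap R M _ x phi hp.
    by move=> [_]; apply; exists x => //; rewrite dist_domE near_rep ?subrr ?normr0.
  by exists d => // r' /andP[_ rd] t h; apply: hd; exact: lt_le_trans h rd.
by exists r => // x t xK; apply: (hr x xK r); rewrite r0 lexx.
Qed.
End comparison.

(** * Lower bound for the weighted total variation *)

Section liminf.
Context {R : realType}.
Local Notation mu := (@lebesgue_measure R).
Local Notation intg D f := (mu.-integrable D (EFin \o f)).
Implicit Types (M : domain R) (f g h w phi psi : R -> R) (p q r x y z t : R) (U : set R)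
  (K : seq R).

Lemma carrier_of_reps M x : reps M x -> carrier M x.
Proof. by case: M. Qed.

Lemma interior_carrier M : interior_dom M `<=` carrier M.
Proof. by case: M => //= a b ab x; rewrite /= !in_itv/= => /andP[/ltW -> /ltW ->]. Qed.

Lemma separated_reps M K : uniq K -> (forall x, x \in K -> reps M x) -> separated M K.
Proof.
rewrite /separated; elim: K => //= x K ih /andP[xK uK] hK; rewrite ih//; last first.
  by move=> y yK; apply: hK; rewrite inE yK orbT.
rewrite andbT; apply/allP => y yK; rewrite gt_eqF//.
apply: reps_dist_gt0; [exact: hK (mem_head _ _)|apply: hK; rewrite inE yK orbT//|].
by apply: contraNneq xK => ->.
Qed.

Lemma sum_subset_le (T : eqType) (s K : seq T) (f : T -> R) : uniq s -> uniq K -> {subset s <= K} ->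
  (forall x : T, 0 <= f x) -> \sum_(x <- s) f x <= \sum_(x <- K) f x.
Proof.
move=> us uK sK f0; rewrite [leRHS](bigID (fun x : T => x \in s)) /=.
have p : perm_eq s [seq x : T <- K | x \in s].
  apply: uniq_perm => //; first exact: filter_uniq.
  by move=> z; rewrite mem_filter; case: (boolP (z \in s)) => // /sK ->.
by rewrite -[X in X + _]big_filter -(perm_big _ p) lerDl sumr_ge0.
Qed.

Lemma slack (l g tau dt dD S A B P Q : R) : g = tau + S - l -> 0 < g -> dt + dD <= g / 4 ->
  B <= A -> S - dD <= B -> tau - dt - g / 4 <= P -> P <= Q -> l + g / 4 < Q + A.
Proof. by move=> ge; lra. Qed.

Variables (M : domain R) (Xi : R -> set R) (v us : R -> R -> R) (u : R -> R).
Hypotheses (hv : forall eps : R, 0 < eps < 1 -> H1 M (v eps)) (oXi : on_domain M Xi)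
  (gc : graph_cvg M v Xi) (iv : interval_valued M Xi)
  (hus : forall eps : R, 0 < eps < 1 -> L1 M (us eps)) (hu : L1 M u) (cu : L1_cvg M us u).

Let near1 : \forall eps \near (0 : R)^'+, 0 < eps < 1.
Proof. by apply/near_rightP; exists 1. Qed.

(** An asymptotic lower bound for [v eps ^+ 2] near [x]. The positive part is taken before squaring,
    since a function that may cross 0 has no positive lower bound for its square; the cap 1 - d
    keeps the height below the weight [(1 - 2 * d) ^+ 2] used elsewhere. *)
Definition height (d x : R) : R := Num.max 0 (Num.min (xi_minus Xi x) (1 - d) - d) ^+ 2.

(** Where [xi_minus] is at least 1 - d the functions stay almost above 1, so these points need not
    be listed, and the list can be finite. *)
Definition covers (d : R) K : Prop :=
  forall x, exceptional M Xi x -> reps M x -> xi_minus Xi x < 1 - d -> x \in K.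

(** Each point of the graph of [v eps] is close to a point of the graph of [Xi], whose ordinate is
    at least [xi_minus] at its own abscissa. *)
Lemma v_lower K (d e : R) : covers d K -> 0 < d -> 0 < e ->
  \forall eps \near (0 : R)^'+, forall t, carrier M t ->
    1 - d - e <= v eps t \/
    exists x, [/\ x \in K, dist_dom M x t < e & xi_minus Xi x - e <= v eps t].
Proof.
move=> cov d0 e0; apply: filterS (filterI near1 (graph_cvg_near gc e0)) => eps [e01 [h _]] t ct.
have ove : on_domain M (v eps) by have [[]] := hv e01.
have [t0 [ct0 tt0]] := carrier_cell ct.
have [x' [y' [cx' Xy' dx vy]]] := h t0 ct0.
have [x [rx xx]] := carrier_reps (cell_carrier cx').
have Xy : Xi x y' by rewrite -(on_domain_eqM oXi xx).
rewrite (on_domain_eqM ove tt0).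
have [e1 _] := iv (carrier_of_reps rx).
have : `[xi_minus Xi x, xi_plus Xi x]%classic y' by rewrite -e1.
rewrite /= in_itv/= => /andP[y1 y2].
have [hx|hx] := leP (1 - d) (xi_minus Xi x); first by left; move: vy; rewrite ltr_norml => /andP[]; lra.
right; exists x; split.
- apply: cov => //; split; first exact: carrier_of_reps.
  by move=> X1; move: hx; rewrite /xi_minus X1 inf1 => ?; lra.
- by rewrite (dist_dom_eqM _ tt0) dist_dom_sym -(dist_dom_eqM _ xx).
- by move: vy; rewrite ltr_norml => /andP[]; lra.
Qed.

Lemma wgt_le K (d rho : R) : covers d K -> 0 < d <= 1 / 4 -> 0 < rho ->
  (forall x y, x \in K -> y \in K -> x != y -> 2 * rho <= dist_dom M x y) ->
  \forall eps \near (0 : R)^'+, forall t, carrier M t ->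
    wgt M K rho (height d) ((1 - 2 * d) ^+ 2) t <= v eps t ^+ 2.
Proof.
move=> cov /andP[d0 d4] rho0 sep.
have e0 : 0 < Num.min d rho by rewrite lt_min d0.
apply: filterS (v_lower cov d0 e0) => eps h t ct.
have ed : Num.min d rho <= d by rewrite ge_min lexx.
have er : Num.min d rho <= rho by rewrite ge_min lexx orbT.
move: (Num.min d rho) e0 ed er h => e e0 ed er h.
have hle x : height d x <= (1 - 2 * d) ^+ 2.
  rewrite /height ler_sqr ?nnegrE ?le_max ?lexx//; last by lra.
  rewrite ge_max; apply/andP; split; first by lra.
  have : Num.min (xi_minus Xi x) (1 - d) <= 1 - d by rewrite ge_min lexx orbT.
  by move: (Num.min _ _) => m hm; lra.
have [v1|[x [xK xt vx]]] := h t ct.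
  have v2 : (1 - 2 * d) ^+ 2 <= v eps t ^+ 2.
    by rewrite ler_sqr ?nnegrE//; lra.
  case: (wgt_cases M K rho (height d) ((1 - 2 * d) ^+ 2) t) => [[-> _]//|[x [_ _ ->]]].
  exact: le_trans (hle x) v2.
rewrite (wgt_near _ _ xK sep); last exact: lt_le_trans xt er.
rewrite /height -[leRHS]real_normK ?num_real// ler_sqr ?nnegrE ?le_max ?lexx//.
rewrite ge_max normr_ge0/=; apply: le_trans (ler_norm _); apply: le_trans vx.
have : Num.min (xi_minus Xi x) (1 - d) <= xi_minus Xi x by rewrite ge_min lexx.
by move: (Num.min _ _) => m hm; lra.
Qed.

Lemma test_lower K (d rho e : R) phi : covers d K -> 0 < d <= 1 / 4 -> 0 < rho ->
  (forall x y, x \in K -> y \in K -> x != y -> 2 * rho <= dist_dom M x y) ->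
  C1c M (interior_dom M) phi ->
  (forall t, interior_dom M t -> `|phi t| <= wgt M K rho (height d) ((1 - 2 * d) ^+ 2) t) ->
  0 < e ->
  \forall eps \near (0 : R)^'+, ((pair M u phi - e)%:E <=
    weighted_tv M (interior_dom M) (fun x => (v eps x ^+ 2)%R) (us eps))%E.
Proof.
move=> cov d4 rho0 sep hphi phiw e0.
have /cvgrPdist_lt/(_ e e0) near2 := pair_cvg hus hu cu (C1c_C1 hphi).
apply: filterS (filterI near1 (filterI near2 (wgt_le cov d4 rho0 sep))) => eps [e01 [h1 h2]].
apply: (@le_trans _ _ (pair M (us eps) phi)%:E).
  by rewrite lee_fin; move: h1; rewrite ltr_norml => /andP[]; lra.
apply: weighted_tv_ge => //; first exact: hus.
by move=> t it; apply: le_trans (phiw t it) _; apply: h2; exact: interior_carrier.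
Qed.

Lemma UK_test K (d : R) psi : 0 < d <= 1 / 4 -> C1c M (UK M K) psi ->
  (forall t, UK M K t -> `|psi t| <= 1) ->
  exists2 r : R, 0 < r & forall rho, 0 < rho <= r -> forall t,
    `|(1 - 2 * d) ^+ 2 * psi t| <= wgt M K rho (height d) ((1 - 2 * d) ^+ 2) t.
Proof.
move=> d4 hpsi psi1; have [r r0 hr] := C1c_UK_gap hpsi.
have psi2 t : `|psi t| <= 1.
  by have [Ut|nU] := pselect (UK M K t); [exact: psi1|rewrite (C1c_supp hpsi nU) normr0].
exists r => // rho /andP[rho0 rhor] t.
rewrite normrM ger0_norm ?sqr_ge0//.
case: (wgt_cases M K rho (height d) ((1 - 2 * d) ^+ 2) t) => [[-> _]|[x [xK xt ->]]].
  by rewrite ler_piMr ?sqr_ge0.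
by rewrite (hr x t xK (lt_le_trans xt rhor)) normr0 mulr0 sqr_ge0.
Qed.

Lemma sep_rho K : (forall x, x \in K -> reps M x) -> exists2 r : R, 0 < r &
  forall rho, rho <= r -> forall x y, x \in K -> y \in K -> x != y -> 2 * rho <= dist_dom M x y.
Proof.
move=> hK; have [d d0 hd] := sep_radius hK.
exists (d / 2); first by rewrite divr_gt0.
by move=> rho h x y xK yK xy; apply: le_trans (hd x y xK yK xy); lra.
Qed.

(** A test function off [K], scaled by [(1 - 2 * d) ^+ 2], is eventually admissible for the weights
    [v eps ^+ 2]. This bounds the variation of [u] off [K], and finitely many points do no harm by
    [BV_UK]. *)
Lemma BV_limit K (d C : R) : covers d K -> 0 < d <= 1 / 4 -> (forall x, x \in K -> reps M x) ->
  (forall e : R, 0 < e -> exists2 eps : R, 0 < eps < e &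
    (weighted_tv M (interior_dom M) (fun x => (v eps x ^+ 2)%R) (us eps) <= C%:E)%E) ->
  BV M u.
Proof.
move=> cov d4 rK hC; apply: (@BV_UK R M K) => //; first by move=> x /rK/carrier_of_reps.
have c0 : 0 < (1 - 2 * d) ^+ 2 by rewrite exprn_gt0//; case/andP: d4 => *; lra.
apply: (@le_lt_trans _ _ ((C + 1) / (1 - 2 * d) ^+ 2)%:E); last exact: ltry.
apply: weighted_tv_le => // psi hpsi psi1.
have [r r0 hr] := UK_test d4 hpsi psi1; have [r1 r10 hr1] := sep_rho rK.
pose rho := Num.min r r1.
have rho0 : 0 < rho by rewrite lt_min r0.
have rr : rho <= r by rewrite ge_min lexx.
have rr1 : rho <= r1 by rewrite ge_min lexx orbT.
have hcpsi : C1c M (interior_dom M) (fun t => (1 - 2 * d) ^+ 2 * psi t).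
  by apply: C1cZ; apply: C1c_sub hpsi; exact: UK_interior.
have hw t : interior_dom M t -> `|(1 - 2 * d) ^+ 2 * psi t| <=
    wgt M K rho (height d) ((1 - 2 * d) ^+ 2) t by move=> _; apply: hr; rewrite rho0.
have := test_lower cov d4 rho0 (hr1 rho rr1) hcpsi hw ltr01.
rewrite pairZ//; last exact: C1c_C1 hpsi.
move=> /near_rightP[e e0 he]; have [eps e1 h1] := hC e e0.
have := le_trans (he eps e1) h1; rewrite !lee_fin ler_pdivlMr// => h2.
by rewrite mulrC; lra.
Qed.

(** With a for [xi_minus Xi x] in [0, 1]: (a - 2d)^2 is at least a^2 - 4d when a is at least 2d, and
    otherwise a^2 <= a < 4d. *)
Lemma height_ge (d x : R) : 0 < d <= 1 / 4 -> 0 <= xi_minus Xi x <= 1 ->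
  xi_minus Xi x ^+ 2 - 4 * d <= height d x.
Proof.
move=> /andP[d0 d4] /andP[x0 x1]; rewrite /height; move: (xi_minus Xi x) x0 x1 => a a0 a1.
set m := Num.max _ _.
have m0 : 0 <= m by rewrite /m le_max lexx.
have m1 : a - 2 * d <= m.
  rewrite /m le_max; apply/orP; right; rewrite lerBrDr le_min.
  by apply/andP; split; lra.
have [h|h] := leP (2 * d) a.
  have : (a - 2 * d) ^+ 2 <= m ^+ 2 by rewrite ler_sqr ?nnegrE// subr_ge0.
  have : 0 <= d * (1 - a) by rewrite mulr_ge0 ?subr_ge0// ltW.
  have : (a - 2 * d) ^+ 2 = a ^+ 2 - 4 * (a * d) + 4 * d ^+ 2 by ring.
  have := sqr_ge0 d; rewrite mulrBr mulr1 (mulrC d a); move: (_ ^+ 2) (_ ^+ 2) (_ ^+ 2) (_ ^+ 2) (a * d) => z1 z2 z3 z4 z5 *; lra.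
have : a ^+ 2 <= a * 1 by rewrite expr2 ler_wpM2l.
by have := sqr_ge0 m; move: (_ ^+ 2) (_ ^+ 2) => z1 z2 *; lra.
Qed.

(** The points carrying almost all of the jump sum are merged with a list that covers the low values
    of [xi_minus]. A test function off these points, and bumps of height [height d x] at them, are
    then admissible for the step weight, with total pairing above [l]. *)
Lemma u_lower (l : R) : BV M u -> A0 M Xi ->
  (forall d : R, 0 < d <= 1 / 4 -> exists K, [/\ uniq K, forall x, x \in K -> (exceptional M Xi `&` reps M) x
    & covers d K]) ->
  (forall x, jump_set M u x -> exceptional M Xi x -> 0 <= xi_minus Xi x) ->
  (l%:E < tv_measure M u (interior_dom M `\` (jump_set M u `&` exceptional M Xi)) +
    esum (exceptional M Xi `&` reps M) (fun x => (jump M u x * xi_minus Xi x ^+ 2)%:E))%E ->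
  \forall eps \near (0 : R)^'+, (l%:E <=
    weighted_tv M (interior_dom M) (fun x => (v eps x ^+ 2)%R) (us eps))%E.
Proof.
move=> bv a0 hcov nonneg.
set T := tv_measure _ _ _; set S := esum _ _ => lTS.
have T0 : (0 <= T)%E by apply: le_ereal_inf_tmp => _ [U _ <-]; exact: weighted_tv_ge0.
have Tfin : (T < +oo)%E.
  apply: le_lt_trans (@tv_measure_le R M [::] _ u hu _) _; first by move=> t _ [].
  by rewrite UK_nil; case: bv.
have [tau Te] : exists tau : R, T = tau%:E by exists (fine T); rewrite fineK// ge0_fin_numE.
have tau0 : 0 <= tau by move: T0; rewrite Te lee_fin.
have : ((l - tau)%:E < S)%E by move: lTS; rewrite Te EFinB lteBlDl.
move=> /esum_gt[s [us' hs]]; rewrite lte_fin => hls.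
pose D := \sum_(x <- s) jump M u x.
have D0 : 0 <= D by apply: sumr_ge0 => x _; exact: jump_ge0.
pose g := tau + \sum_(x <- s) jump M u x * xi_minus Xi x ^+ 2 - l.
have g0 : 0 < g by rewrite /g; lra.
(* Replacing the weights 1 and [xi_minus ^+ 2] by their lowered versions loses at most
   [4 * d * (tau + D)]; this choice keeps the loss below g/4. *)
pose d := Num.min (1 / 4) (g / (16 * (tau + D + 1))).
have d40 : 0 < 16 * (tau + D + 1) by lra.
have d0 : 0 < d by rewrite lt_min divr_gt0//= divr_gt0.
have d4 : 0 < d <= 1 / 4 by rewrite d0 ge_min lexx.
have dg : 4 * d * (tau + D) <= g / 4.
  have : d <= g / (16 * (tau + D + 1)) by rewrite ge_min lexx orbT.
  rewrite ler_pdivlMr// => h; move: (tau + D) (addr_ge0 tau0 D0) h => z z0 h.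
  by clear -h d0 z0; nra.
have [K0 [uK0 hK0 cov0]] := hcov d d4.
pose K := undup (K0 ++ s).
have uK : uniq K by exact: undup_uniq.
have hK x : x \in K -> (exceptional M Xi `&` reps M) x.
  by rewrite mem_undup mem_cat => /orP[/hK0|/hs].
have rK x : x \in K -> reps M x by case/hK.
have cK x : x \in K -> carrier M x by move/rK/carrier_of_reps.
have cov : covers d K by move=> x h1 h2 h3; rewrite mem_undup mem_cat cov0.
have sK : {subset s <= K} by move=> x xs; rewrite mem_undup mem_cat xs orbT.
clearbody K.
have tr x : interior_dom M x -> has_traces u x by exact: BV_traces.
have TV : (tau%:E <= weighted_tv M (UK M K) (fun=> 1%R) u)%E.
  rewrite -Te; apply: (tv_measure_le_UK hu cK (fun x _ => tr x)).
  move=> x t xK jx it e; have xt : eqM M x t.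
    by have := eqM_rep M x t; move: e; rewrite dist_domE => /eqP; rewrite normr_eq0 subr_eq0 => /eqP ->; exact: eqM_sym.
  split; first by rewrite /jump_set /= -(jump_eqM hu xt).
  by rewrite -(on_domain_eqM (exceptional_on_domain oXi) xt); case: (hK x xK).
clear lTS T0 Tfin Te T S hcov a0 bv.
have g4 : 0 < g / 4 by lra.
have : ((tau - g / 4)%:E < weighted_tv M (UK M K) (fun=> 1%R) u)%E.
  by apply: lt_le_trans TV; rewrite lte_fin; lra.
move=> /(weighted_tv_gtP hu)[psi [hpsi psi1 hpair]].
have [r r0 hr] := UK_test d4 hpsi psi1; have [r1 r10 hr1] := sep_rho rK.
pose rho := Num.min r r1.
have rho0 : 0 < rho by rewrite lt_min r0.
have rr : rho <= r by rewrite ge_min lexx.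
have rr1 : rho <= r1 by rewrite ge_min lexx orbT.
have sep := hr1 rho rr1.
pose c := (1 - 2 * d) ^+ 2.
pose w := wgt M K rho (height d) c.
have h0 x : 0 <= height d x by exact: sqr_ge0.
have w0 t : 0 <= w t.
  by rewrite /w; case: (wgt_cases M K rho (height d) c t) => [[-> _]|[x [_ _ ->]]]; exact: sqr_ge0.
pose Ki := [seq x <- K | x \in interior_dom M].
have iKi x : x \in Ki -> x \in K /\ interior_dom M x.
  by rewrite mem_filter => /andP[/set_mem h1 h2].
have W1 : ((c * pair M u psi)%:E <= weighted_tv M (UK M Ki) w u)%E.
  rewrite -pairZ//; last exact: C1c_C1 hpsi.
  have hcp : C1c M (UK M Ki) (fun x => c * psi x).
    by apply: C1cZ; apply: C1c_sub hpsi; apply: UK_sub => x /iKi[].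
  apply: (weighted_tv_ge hu hcp) => t _.
  by apply: hr; rewrite rho0.
have W2 : (weighted_tv M (UK M Ki) w u + (\sum_(x <- Ki) height d x * jump M u x)%:E <=
    weighted_tv M (interior_dom M) w u)%E.
  have sKi : separated M Ki.
    by apply: separated_reps; [exact: filter_uniq|move=> x /iKi[/rK]].
  apply: (weighted_tv_UK_ge hu sKi _ w0) => x /iKi[xK ix].
  split; [exact: ix|exact: tr|exact: h0|].
  by exists rho => // t xt; rewrite /w (wgt_near _ _ xK sep).
have E1 : \sum_(x <- Ki) height d x * jump M u x = \sum_(x <- K) height d x * jump M u x.
  rewrite big_filter big_mkcond /=; apply: eq_bigr => x _; case: ifP => // nx.
  by rewrite /jump nx mulr0.
have E2 : \sum_(x <- s) height d x * jump M u x <= \sum_(x <- K) height d x * jump M u x.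
  by apply: sum_subset_le => // x; rewrite mulr_ge0// jump_ge0.
have E3 : \sum_(x <- s) jump M u x * xi_minus Xi x ^+ 2 - 4 * d * D <=
    \sum_(x <- s) height d x * jump M u x.
  rewrite /D mulr_sumr -sumrB !big_seq; apply: ler_sum => x xs.
  have [ex rx] := hs x xs.
  have [jx|jx] := eqVneq (jump M u x) 0; first by rewrite jx !(mulr0, mul0r) subr0.
  rewrite (mulrC (height d x)) (mulrC (4 * d)) -mulrBr ler_wpM2l ?jump_ge0//.
  apply: height_ge => //; apply/andP; split.
    by apply: nonneg => //; rewrite /jump_set /= lt_neqAle eq_sym jx jump_ge0.
  by have [_ /andP[]] := iv ex.1.
have c1 : c * (tau - g / 4) >= tau - 4 * d * tau - g / 4.
  have hc1 : 1 - 4 * d <= c by rewrite /c -subr_ge0 (_ : _ - _ = (2 * d) ^+ 2) ?sqr_ge0//; ring.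
  have hc2 : c <= 1.
    rewrite /c expr_le1//; first by move: d0; lra.
    by case/andP: d4 => *; lra.
  have k1 : (1 - 4 * d) * tau <= c * tau by rewrite ler_wpM2r.
  have k2 : c * (g / 4) <= 1 * (g / 4) by rewrite ler_wpM2r// ltW.
  by rewrite mulrBr; move: k1 k2; rewrite mulrBl !mul1r; move: (c * tau) (c * (g / 4)) (4 * d * tau) => *; lra.
have : ((l + g / 4)%:E < weighted_tv M (interior_dom M) w u)%E.
  apply: lt_le_trans W2; rewrite E1.
  apply: (@lt_le_trans _ _ (c * pair M u psi + \sum_(x <- K) height d x * jump M u x)%:E); last first.
    by rewrite EFinD leeD2r.
  rewrite lte_fin.
  have cp : 0 < c by rewrite /c exprn_gt0//; case/andP: d4 => *; lra.
  apply: (@slack l g tau (4 * d * tau) (4 * d * D) _ _ _ (c * (tau - g / 4)) _ erefl g0 _ E2 E3 c1).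
    by rewrite -mulrDr.
  by rewrite ler_wpM2l// ltW.
(* One fixed test function for the step weight, independent of [eps]: to it the L1 convergence of
   [us] applies, and the remaining g/4 absorbs the error. *)
move=> /(weighted_tv_gtP hu)[phi [hphi phiw hp]].
apply: filterS (test_lower cov d4 rho0 sep hphi phiw g4) => eps; apply: le_trans.
by rewrite lee_fin lerBrDr ltW.
Qed.

End liminf.

(** * The liminf inequality *)

Section part_one.
Context {R : realType}.
Local Notation mu := (@lebesgue_measure R).
Variables (M : domain R) (sigma : R) (F : R -> R).
Hypotheses (sigma_ge0 : 0 <= sigma) (F_cont : continuous F) (F_ge0 : forall t, 0 <= F t)
  (F_eq0 : forall t, F t = 0 <-> t = 1)
  (F_infty : (0 < limf_einf (fun t => (F t)%:E) norm_infty)%E).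

Lemma limf_einf_ge (f : R -> \bar R) (x : \bar R) :
  (forall l : R, (l%:E < x)%E -> \forall eps \near (0 : R)^'+, (l%:E <= f eps)%E) ->
  (x <= limf_einf f (0 : R)^'+)%E.
Proof.
move=> h; rewrite leNgt limf_einfE; apply/negP => hlt.
have [l hl1 hl2] : exists2 l : R, (ereal_sup [set ereal_inf (f @` A) | A in (0 : R)^'+] < l%:E)%E & (l%:E < x)%E.
  move: hlt; move: (ereal_sup _) => y; case: x {h} => [x| |]; case: y => [y| |] //=.
  - rewrite lte_fin => xy; exists ((x + y) / 2); rewrite lte_fin; lra.
  - by move=> _; exists (x - 1); rewrite ?ltNyr// lte_fin; lra.
  - by move=> _; exists (y + 1); rewrite ?ltry// lte_fin; lra.
  - by move=> _; exists 0; rewrite ?ltry ?ltNyr.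
have hn := h l hl2.
move: hl1; rewrite ltNge => /negP; apply.
apply: ereal_sup_ge; exists (ereal_inf (f @` [set eps | (l%:E <= f eps)%E])); first by exists [set eps | (l%:E <= f eps)%E].
by apply: le_ereal_inf_tmp => _ [eps he <-].
Qed.

Lemma lt_addP (a b : \bar R) (l : R) : (0 <= a)%E -> (0 <= b)%E -> (l%:E < a + b)%E ->
  exists l1 l2 : R, [/\ (l1%:E < a)%E, (l2%:E < b)%E & l <= l1 + l2].
Proof.
case: a => [a| |]; case: b => [b| |] //= a0 b0.
- rewrite lte_fin => h; exists (a - (a + b - l) / 2), (b - (a + b - l) / 2).
  by rewrite !lte_fin; split; lra.
- by move=> _; exists (a - 1), (l - a + 1); rewrite lte_fin ltry; split => //; lra.
- by move=> _; exists (l - b + 1), (b - 1); rewrite lte_fin ltry; split => //; lra.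
- by move=> _; exists l, 0; rewrite !ltry; split => //; lra.
Qed.

Lemma lt_mulP (a : \bar R) (l : R) : 0 < sigma -> (l%:E < sigma%:E * a)%E ->
  exists2 l1 : R, (l1%:E < a)%E & l <= sigma * l1.
Proof.
move=> s0; case: a => [a| |].
- rewrite -EFinM lte_fin => h; exists (l / sigma); last by rewrite mulrC divfK// gt_eqF.
  by rewrite lte_fin ltr_pdivrMr// mulrC.
- by move=> _; exists (l / sigma); rewrite ?ltry// mulrC divfK// gt_eqF.
- by rewrite gt0_muleNy.
Qed.

Lemma sMM_liminf (v : R -> R -> R) (Xi : R -> set R) (l : R) :
  (forall eps, 0 < eps < 1 -> H1 M (v eps)) -> compact_graph M Xi -> graph_cvg M v Xi ->
  interval_valued M Xi ->
  (l%:E < esum (exceptional M Xi `&` reps M) (fun x => (xcost F M Xi x)%:E))%E ->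
  \forall eps \near (0 : R)^'+, l <= \int[mu]_(t in cell M) density F M eps (v eps) t.
Proof.
move=> hv cG gc iv /esum_gt[s [us hs]]; rewrite lte_fin => h.
have near2 : \forall eps \near (0 : R)^'+, \sum_(x <- s) xcost F M Xi x -
    (\sum_(x <- s) xcost F M Xi x - l) <= \int[mu]_(t in cell M) density F M eps (v eps) t.
  apply: (@sMM_sum_lower R F F_cont F_ge0 F_eq0 F_infty M Xi v hv cG gc s _ iv us).
    by move=> x /hs[].
  by rewrite subr_gt0.
by apply: filterS near2 => eps; rewrite opprB addrC subrK.
Qed.

Theorem liminf_inequality (v us : R -> R -> R) (Xi : R -> set R) (u : R -> R) :
  (forall eps, 0 < eps < 1 -> H1 M (v eps)) -> compact_graph M Xi -> graph_cvg M v Xi ->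
  (forall eps, 0 < eps < 1 -> L1 M (us eps)) -> L1 M u -> L1_cvg M us u ->
  (sigma = 0 -> BV M u) ->
  (0 < sigma -> BV M u -> A0 M Xi ->
     forall x, jump_set M u x -> exceptional M Xi x -> 0 <= xi_minus Xi x) ->
  (E0_KWC M sigma F u Xi <=
     limf_einf (fun eps => E_KWC M sigma F eps (us eps) (v eps)) (0 : R)^'+)%E.
Proof.
move=> hv cG gc hus hu cu bv0 nonneg.
have oXi : on_domain M Xi by case: cG.
have near1 : \forall eps \near (0 : R)^'+, 0 < eps < 1 by apply/near_rightP; exists 1.
pose W eps := weighted_tv M (interior_dom M) (fun x => (v eps x ^+ 2)%R) (us eps).
pose D eps := \int[mu]_(t in cell M) density F M eps (v eps) t.
have EE (eps : R) : 0 < eps < 1 -> E_KWC M sigma F eps (us eps) (v eps) = (sigma%:E * W eps + (D eps)%:E)%E.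
  by move=> /[dup] /hv hve /andP[e0 _]; rewrite /E_KWC E_sMM_density.
have W0 (eps : R) : 0 < eps < 1 -> (0 <= W eps)%E.
  by move=> e01; apply: weighted_tv_ge0 => [|x _]; [exact: hus|exact: sqr_ge0].
have D0 (eps : R) : 0 < eps < 1 -> 0 <= D eps.
  by move=> /andP[e0 _]; apply: Rintegral_ge0 => t _; exact: density_ge0.
have sW0 (eps : R) : 0 < eps < 1 -> (0 <= sigma%:E * W eps)%E.
  by move=> /W0 h; rewrite mule_ge0.
apply: limf_einf_ge => l hl.
(* If the energies are not bounded along any sequence of [eps] tending to 0, they eventually exceed
   [l]. *)
have [[C hC]|unb] := pselect (exists C : R, forall e : R, 0 < e -> exists2 eps : R, 0 < eps < e &
    (E_KWC M sigma F eps (us eps) (v eps) <= C%:E)%E); last first.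
  have : exists2 e : R, 0 < e & forall eps : R, 0 < eps < e -> (l%:E <= E_KWC M sigma F eps (us eps) (v eps))%E.
    apply: contrapT => ne; apply: unb; exists l => e e0.
    apply: contrapT => ne2; apply: ne; exists e => // eps he.
    have [//|h] := leP (l%:E) (E_KWC M sigma F eps (us eps) (v eps)).
    by exfalso; apply: ne2; exists eps => //; exact: ltW.
  by move=> h; apply/near_rightP.
have hC1 (e : R) : 0 < e -> exists eps : R, [/\ 0 < eps < e, 0 < eps < 1 & (sigma%:E * W eps + (D eps)%:E <= C%:E)%E].
  move=> e0; have [|eps /andP[h1]] := hC (Num.min e 1); first by rewrite lt_min e0/=.
  rewrite lt_min => /andP[h2 h3] h4; exists eps; rewrite h1 h2 h3; split => //.
  by rewrite -EE ?h1.
have hCD (e : R) : 0 < e -> exists2 eps : R, 0 < eps < e & D eps <= C.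
  move=> /hC1[eps [h1 h2 h3]]; exists eps => //; rewrite -lee_fin; apply: le_trans h3.
  by rewrite leeDr// sW0.
have a0 : A0 M Xi by apply: (limit_A0 F_cont F_ge0 F_eq0 F_infty hv cG gc); exists C.
have iv := A0_interval a0.
(* An exceptional point with [xi_minus] below 1 - d costs at least [G F (1 - d)], so bounded energy
   allows finitely many of them. *)
have hcov (d : R) : 0 < d <= 1 / 4 -> exists K, [/\ uniq K,
    forall x, x \in K -> (exceptional M Xi `&` reps M) x & covers M Xi d K].
  move=> /andP[d0 d4].
  have k0 : 0 < G F (1 - d).
    rewrite (G_le F_cont); last by lra.
    by rewrite oppr_gt0 -(Hf1 F); apply: Hf_strict => //; lra.
  have fin := finite_cost F_cont F_ge0 F_eq0 F_infty hv cG gc (ex_intro _ C hCD) iv k0.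
  set A := [set x | _] in fin.
  exists (finmap.enum_fset (fset_set A)); split; first exact: finmap.fset_uniq.
    by move=> x; rewrite in_fset_set// inE => -[].
  move=> x ex rx xd; rewrite in_fset_set//; apply/mem_set; split => //.
  have lt := exceptional_lt iv ex.
  have [h _] := xcost_gt0 F_cont F_ge0 F_eq0 iv ex.1 lt; apply: le_trans h.
  have [_ /andP[h1 h2]] := iv x ex.1.
  apply: (@le_trans _ _ (G F (xi_minus Xi x))); last by rewrite lerDl G_ge0.
  by rewrite (G_le F_cont h1) (G_le F_cont) ?lerN2 ?Hf_mono ?ltW//; lra.
have bv : BV M u.
  have [s0|s0] := eqVneq sigma 0; first exact: bv0.
  have sp : 0 < sigma by rewrite lt_neqAle eq_sym s0.
  have [|K [uK hK cov]] := hcov (1 / 4); first by apply/andP; split; lra.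
  apply: (@BV_limit R M Xi v us u hv oXi gc iv hus hu cu K (1 / 4) (C / sigma)) => //.
  - by apply/andP; split; lra.
  - by move=> x /hK[].
  - move=> e /hC1[eps [h1 h2 h3]]; exists eps => //.
    rewrite EFinM lee_pdivlMr//; apply: le_trans h3; rewrite muleC leeDl// lee_fin; exact: D0.
move: hl; rewrite /E0_KWC asboolT// E0_sMM_esum.
set T := tv_measure _ _ _; set S := esum _ _; set S2 := esum _ _.
have T0 : (0 <= T)%E by apply: le_ereal_inf_tmp => _ [U _ <-]; exact: weighted_tv_ge0.
have S0 : (0 <= S)%E.
  by apply: esum_ge0 => x _; rewrite lee_fin mulr_ge0 ?sqr_ge0// jump_ge0.
have S20 : (0 <= S2)%E by apply: esum_ge0 => x _; rewrite lee_fin cost_ge0.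
rewrite -ge0_muleDr// => /lt_addP[||l1 [l2 [hl1 hl2 ll]]] //.
  by rewrite mule_ge0 ?adde_ge0.
have nearD := sMM_liminf hv cG gc iv hl2.
have nearW : \forall eps \near (0 : R)^'+, (l1%:E <= sigma%:E * W eps)%E.
  (* For [sigma = 0] the product vanishes even if the weighted variation is infinite, and [hl1] says
     that [l1] is negative. *)
  have [s0|s0] := eqVneq sigma 0.
    apply: filterS near1 => eps /W0 h; rewrite s0 mul0e.
    by move: hl1; rewrite s0 mul0e => /ltW.
  have sp : 0 < sigma by rewrite lt_neqAle eq_sym s0.
  have [l3 h1 h2] := lt_mulP sp hl1.
  apply: filterS (@u_lower R M Xi v us u hv oXi gc iv hus hu cu l3 bv a0 hcov (nonneg sp bv a0) h1) => eps h.
  apply: (@le_trans _ _ (sigma%:E * l3%:E)%E); first by rewrite -EFinM lee_fin.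
  by rewrite lee_pmul2l.
apply: filterS (filterI near1 (filterI nearD nearW)) => eps [e01 [h1 h2]].
rewrite EE//; apply: (@le_trans _ _ (l1%:E + l2%:E)%E); first by rewrite -EFinD lee_fin.
by apply: leeD => //; rewrite lee_fin.
Qed.
End part_one.

(** * Optimal profiles *)

Section paths.
Context {R : realType}.
Local Notation mu := (@lebesgue_measure R).
Local Notation intg D f := (mu.-integrable D (EFin \o f)).
Implicit Types (f g h : R -> R) (a b c d p q r s t x y z : R).
Variables (F : R -> R).
Hypotheses (F_cont : continuous F) (F_ge0 : forall t, 0 <= F t)
  (F_eq0 : forall t, F t = 0 <-> t = 1).

Definition edens (eps : R) f t : R := eps / 2 * derive1 f t ^+ 2 + (2 * eps)^-1 * F (f t).

Lemma edens_cont (eps : R) f : C1 f -> continuous (edens eps f).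
Proof.
move=> cf t; rewrite /edens; apply: cvgD.
  apply: cvgMr; rewrite expr2; apply: cvgM; exact: cf.2.
apply: cvgMr; apply: continuous_comp; [exact: C1_cont|exact: F_cont].
Qed.

Lemma edens_int (eps : R) f a b : C1 f -> intg `[a, b] (edens eps f).
Proof. by move=> cf; apply: (@integrable_continuous R a b) => //; exact: edens_cont. Qed.

Lemma edens_ge0 (eps : R) f t : 0 < eps -> 0 <= edens eps f t.
Proof.
move=> e0; rewrite /edens addr_ge0// mulr_ge0 ?sqr_ge0 ?divr_ge0 ?F_ge0 ?invr_ge0 ?mulr_ge0//; exact: ltW.
Qed.

Lemma edens_near (eps : R) f g t : (\forall s \near t, f s = g s) -> edens eps f t = edens eps g t.
Proof. by move=> fg; rewrite /edens (derive1_near fg) (nbhs_singleton fg). Qed.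

Lemma edens_cst (eps : R) f t (k : R) : (\forall s \near t, f s = k) ->
  edens eps f t = (2 * eps)^-1 * F k.
Proof.
by move=> fk; rewrite (edens_near eps fk) /edens (C1_cst k).2 expr0n/= mulr0 add0r.
Qed.

Lemma edens_eq (eps : R) f g a b : C1 f -> C1 g -> (forall t, a < t < b -> f t = g t) ->
  \int[mu]_(t in `[a, b]) edens eps f t = \int[mu]_(t in `[a, b]) edens eps g t.
Proof.
move=> cf cg fg; rewrite -!Rintegral_oo_cc; [|exact: edens_int..].
apply: eq_Rintegral => t; rewrite inE /= in_itv/= => /andP[h1 h2]; apply: edens_near.
near=> s; apply: fg; apply/andP; split; near: s.
  exact: lt_nbhsr.
exact: lt_nbhsl.
Unshelve. all: by end_near. Qed.

Variables (lo hi : R).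

Definition path (eps E c d a b : R) f : Prop :=
  C1 f /\ [/\ c <= d, forall t, t <= c -> f t = a, forall t, d <= t -> f t = b,
    forall t, lo <= f t <= hi & \int[mu]_(t in `[c, d]) edens eps f t <= E].

(** As [f] equals [b] after [d] and [g] equals [b] before [d], the sum [f + g - b] follows [f] and
    then [g]; it is C1 without any matching of derivatives. *)
Lemma path_cat (eps E1 E2 c d e a b k : R) f g : 0 < eps ->
  path eps E1 c d a b f -> path eps E2 d e b k g ->
  exists h, [/\ path eps (E1 + E2) c e a k h, forall t, t <= d -> h t = f t &
    forall t, d <= t -> h t = g t].
Proof.
move=> e0 [cf [cd fa fb fr fE]] [cg [de ga gb gr gE]].
pose h t := f t + g t - b.
have ch : C1 h by apply: (C1B (C1D cf cg).1 (C1_cst b).1).1.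
have hf t : t <= d -> h t = f t by move=> td; rewrite /h (ga t td) addrK.
have hg t : d <= t -> h t = g t by move=> td; rewrite /h (fb t td) addrAC subrr add0r.
exists h; split => //; split => //; split.
- exact: le_trans cd de.
- by move=> t tc; rewrite hf ?fa//; exact: le_trans tc cd.
- by move=> t te; rewrite hg ?gb//; exact: le_trans de te.
- by move=> t; have [td|td] := leP t d; [rewrite hf//|rewrite hg//; exact: ltW].
- rewrite (Rintegral_cc_split cd de); last exact: edens_int.
  apply: lerD.
    by rewrite (@edens_eq eps h f)// => t /andP[_ td]; apply: hf; exact: ltW.
  by rewrite (@edens_eq eps h g)// => t /andP[td _]; apply: hg; exact: ltW.
Qed.

(** The energy is invariant under rescaling time by [eps], so a single bound [E] and a duration
    [L * eps] serve all [eps]. *)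
Definition reach (a b E : R) : Prop := exists2 L : R, 0 < L &
  forall eps c : R, 0 < eps -> exists f, path eps E c (c + L * eps) a b f.

Lemma reach_le a b E E' : E <= E' -> reach a b E -> reach a b E'.
Proof.
move=> EE [L L0 h]; exists L => // eps c e0; have [f [cf [h1 h2 h3 h4 h5]]] := h eps c e0.
by exists f; split => //; split => //; exact: le_trans h5 EE.
Qed.

Lemma reach_trans a b c E1 E2 : reach a b E1 -> reach b c E2 -> reach a c (E1 + E2).
Proof.
move=> [L1 L10 h1] [L2 L20 h2]; exists (L1 + L2); first exact: addr_gt0.
move=> eps x e0; have [f hf] := h1 eps x e0; have [g hg] := h2 eps (x + L1 * eps) e0.
have [h [hh _ _]] := path_cat e0 hf hg.
by exists h; rewrite mulrDl addrA.
Qed.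

(** [reach] asks for a positive duration; waiting at [a] has a cost proportional to its duration, so
    a short wait stays below [E]. *)
Lemma reach_cst a (E : R) : lo <= a <= hi -> 0 < E -> reach a a E.
Proof.
move=> ar E0; have Fa : 0 < F a + 1 by rewrite ltr_wpDl.
exists (E / (F a + 1)); first by rewrite divr_gt0.
move=> eps c e0; exists (fun=> a); split; first exact: (C1_cst a).1.
have cL : c <= c + E / (F a + 1) * eps by rewrite lerDl mulr_ge0 ?divr_ge0 ?ltW.
split => //; have -> : \int[mu]_(t in `[c, c + E / (F a + 1) * eps]) edens eps (fun=> a) t =
    \int[mu]_(t in `[c, c + E / (F a + 1) * eps]) ((2 * eps)^-1 * F a).
  by apply: eq_Rintegral => t _; rewrite /edens (C1_cst a).2 expr0n/= mulr0 add0r.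
rewrite Rintegral_cc_cst//.
have -> : (2 * eps)^-1 * F a * (c + E / (F a + 1) * eps - c) = E * (F a / (2 * (F a + 1))).
  by field; rewrite !gt_eqF.
rewrite ger_pMr// ler_pdivrMr ?mulr_gt0// mul1r; have := F_ge0 a; rlra.
Qed.

(** A rescaled step of mean speed B/eps: at this speed the gradient term matches the bound B^2/(2
    eps) of the potential term, the equality case of AM-GM. The factor tends to 1 with [k], the
    excess slope of the step. *)
Lemma reach_step a b (B k : R) : lo <= a <= hi -> lo <= b <= hi -> a != b -> 0 < B -> 0 < k ->
  (forall s, Num.min a b <= s <= Num.max a b -> F s <= B ^+ 2) ->
  reach a b (`|b - a| * B * (((1 + k) ^+ 2 + 1) / 2)).
Proof.
move=> ra rb ab B0 k0 FB.
have D0 : 0 < `|b - a| by rewrite normr_gt0 subr_eq0 eq_sym.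
have [S [cS S0 S1 S01 dS]] := step_exists k0.
exists (`|b - a| / B); first by rewrite divr_gt0.
move=> eps c e0; pose l := `|b - a| / B * eps.
have l0 : 0 < l by rewrite mulr_gt0// divr_gt0.
have [c1 d1] := C1_affine l^-1 (- (l^-1 * c)) cS.
have [c2 d2] := C1Z (b - a) c1; have [c3 d3] := C1D (C1_cst a).1 c2.
have arg t : l^-1 * t + - (l^-1 * c) = (t - c) / l by field; rewrite gt_eqF.
exists (fun t => a + (b - a) * S (l^-1 * t + - (l^-1 * c))).
have conv t : Num.min a b <= a + (b - a) * S t <= Num.max a b.
  have /andP[s0 s1] := S01 t; rewrite ge_min le_max.
  have [h|h] := leP a b; apply/andP; split; apply/orP; [left|right|right|left]; nra.
have cl : c <= c + l by rewrite lerDl ltW.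
split => //; split => //.
- move=> t tc; rewrite arg (S0 _ _).1 ?mulr0 ?addr0//.
  by rewrite ler_pdivrMr// mul0r subr_le0.
- move=> t tc; rewrite arg (S1 _ _).1; first by rewrite mulr1 addrC subrK.
  by rewrite ler_pdivlMr// mul1r lerBrDl.
- move=> t; have /andP[h1 h2] := conv (l^-1 * t + - (l^-1 * c)); apply/andP; split.
    by apply: le_trans h1; rewrite le_min; case/andP: ra => -> _; case/andP: rb.
  by apply: le_trans h2 _; rewrite ge_max; case/andP: ra => _ ->; case/andP: rb.
have -> : `|b - a| * B * (((1 + k) ^+ 2 + 1) / 2) =
    (B ^+ 2 / (2 * eps) * ((1 + k) ^+ 2 + 1)) * (c + l - c).
  by rewrite /l; field; rewrite !gt_eqF.
rewrite -Rintegral_cc_cst//; apply: le_Rintegral => //.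
- exact: edens_int.
- by apply: (@integrable_continuous R c (c + l)) => // ?; exact: cvg_cst.
move=> t _; rewrite /edens d3 d2 d1 (C1_cst a).2 add0r.
move: (dS (l^-1 * t + - (l^-1 * c))); move: (derive1 S _) => z /andP[z0 z1].
have FF : F (a + (b - a) * S (l^-1 * t + - (l^-1 * c))) <= B ^+ 2 by apply: FB; exact: conv.
have -> : eps / 2 * ((b - a) * (l^-1 * z)) ^+ 2 = B ^+ 2 / (2 * eps) * z ^+ 2.
  rewrite !exprMn -[(b - a) ^+ 2]real_normK ?num_real// exprVn.
  by rewrite /l; field; rewrite !gt_eqF.
rewrite mulrDr mulr1; apply: lerD.
  apply: ler_wpM2l; first by rewrite divr_ge0 ?sqr_ge0 ?mulr_ge0 ?ltW.
  by rewrite ler_sqr ?nnegrE//; rlra.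
by rewrite mulrC ler_wpM2r// invr_ge0 mulr_ge0// ltW.
Qed.

(** Instead of solving the equation of the optimal profile, the way is cut into steps on which
    [sqrt F] is almost constant, so that each costs almost the increment of [Hf]; Cousin's lemma
    concatenates them, in both directions. *)
Lemma reach_lt a b (e : R) : lo <= a -> a < b -> b <= hi -> 0 < e ->
  reach a b (Hf F b - Hf F a + e * (b - a)) /\ reach b a (Hf F b - Hf F a + e * (b - a)).
Proof.
move=> la ab bh e0.
(* For [s = t] the bound would be 0 while waiting has a cost; the premise [s < t] excludes this
   case. *)
have := @cousin R (fun s t => s < t -> reach s t (Hf F t - Hf F s + e * (t - s)) /\
  reach t s (Hf F t - Hf F s + e * (t - s))) a b (ltW ab).
apply=> //; last first.
  move=> r s t ar rs st tb h1 h2 rt.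
  move: rs; rewrite le_eqVlt => /predU1P[rs|rs].
    by rewrite rs; apply: h2; rewrite -rs.
  move: st; rewrite le_eqVlt => /predU1P[<-|st]; first exact: h1.
  have [k1 k2] := h1 rs; have [k3 k4] := h2 st.
  by split; [apply: reach_le (reach_trans k1 k3)|apply: reach_le (reach_trans k4 k2)]; rlra.
move=> x /andP[ax xb]; have e4 : 0 < e / 4 by rewrite divr_gt0.
have [d d0 hd] := @cvg_point R (fun s => Num.sqrt (F s)) x (e / 4) (sqrtF_cont F_cont (x := x)) e4.
(* [B] exceeds [sqrt F] near [x] and is positive even at a zero of [F]. The choice of [k] raises the
   rate to at most [sqrt (F x)] plus 3e/4, and the last e/4 is spent on comparing [sqrt (F x)] with
   the increment of [Hf]. *)
pose B := Num.sqrt (F x) + 2 * (e / 4).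
have q0 : 0 <= Num.sqrt (F x) by exact: sqrtr_ge0.
have B0 : 0 < B by rewrite /B; rlra.
pose k := Num.min 1 (e / 4 / (2 * B)).
have k0 : 0 < k by rewrite lt_min ltr01 divr_gt0// mulr_gt0.
have k1 : k <= 1 by rewrite ge_min lexx.
have kB : 2 * (k * B) <= e / 4.
  have : k <= e / 4 / (2 * B) by rewrite ge_min lexx orbT.
  by rewrite ler_pdivlMr ?mulr_gt0// => h; rlra.
have EB : B * (((1 + k) ^+ 2 + 1) / 2) <= Num.sqrt (F x) + 3 * (e / 4).
  have : B * (((1 + k) ^+ 2 + 1) / 2) = B + k * B + k * (k * B) / 2 by field.
  have : k * (k * B) <= 1 * (k * B) by rewrite ler_wpM2r// mulr_ge0// ltW.
  have := mulr_gt0 k0 B0; move: (k * (k * B)) (k * B) (B * (_ / 2)) kB => z1 z2 z3; rewrite /B => *; rlra.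
exists d => // s t sa st tb sx tx slt.
have near_ y : s <= y <= t -> `|y - x| < d.
  move: sx tx; rewrite !ltr_norml => /andP[s1 s2] /andP[t1 t2] /andP[y1 y2].
  by apply/andP; split; rlra.
have FB y : s <= y <= t -> F y <= B ^+ 2.
  move=> /near_/hd; rewrite ler_norml => /andP[_ h].
  rewrite -[leLHS]sqr_sqrtr// ler_sqr ?nnegrE ?sqrtr_ge0//; first by rewrite /B; rlra.
  exact: ltW.
have Hge : (Num.sqrt (F x) - e / 4) * (t - s) <= Hf F t - Hf F s.
  apply: Hf_ge => // y /near_/hd; rewrite ler_norml => /andP[h _]; rlra.
have ts0 : 0 < t - s by rlra.
have le1 : (t - s) * B * (((1 + k) ^+ 2 + 1) / 2) <= Hf F t - Hf F s + e * (t - s).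
  rewrite -mulrA; apply: le_trans (ler_wpM2l (ltW ts0) EB) _.
  by move: Hge; move: (Num.sqrt _) (Hf F t - Hf F s) => z1 z2 h; nra.
have r1 : lo <= s <= hi by apply/andP; split; rlra.
have r2 : lo <= t <= hi by apply/andP; split; rlra.
split.
- apply: reach_le le1 _; rewrite -[X in reach _ _ (X * _ * _)](@gtr0_norm _ (t - s))//.
  apply: reach_step => //; first by rewrite lt_eqF.
  by move=> y; rewrite (min_l st) (max_r st); exact: FB.
- apply: reach_le le1 _; rewrite -[X in reach _ _ (X * _ * _)](@gtr0_norm _ (t - s))// distrC.
  apply: reach_step => //; first by rewrite gt_eqF.
  by move=> y; rewrite (min_r st) (max_l st); exact: FB.
Qed.

Lemma reachP a b (e : R) : lo <= a <= hi -> lo <= b <= hi -> 0 < e ->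
  reach a b (`|Hf F b - Hf F a| + e).
Proof.
move=> /[dup] ra /andP[a1 a2] /andP[b1 b2] e0; have [ab|ab|<-] := ltgtP a b.
- have e1 : 0 < e / (b - a) by rewrite divr_gt0// subr_gt0.
  have [h _] := reach_lt a1 ab b2 e1; apply: reach_le h.
  by rewrite divfK ?gt_eqF ?subr_gt0// lerD2r ler_norm.
- have e1 : 0 < e / (a - b) by rewrite divr_gt0// subr_gt0.
  have [_ h] := reach_lt b1 ab a2 e1; apply: reach_le h.
  by rewrite divfK ?gt_eqF ?subr_gt0// lerD2r distrC ler_norm.
- by rewrite subrr normr0 add0r; exact: reach_cst.
Qed.

End paths.

(** * Profiles around one exceptional point *)

Section profiles.
Context {R : realType}.
Local Notation mu := (@lebesgue_measure R).
Local Notation intg D f := (mu.-integrable D (EFin \o f)).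
Implicit Types (M : domain R) (f g h P : R -> R) (a b c d p q r s t x y z : R).
Variables (F : R -> R).
Hypotheses (F_cont : continuous F) (F_ge0 : forall t, 0 <= F t)
  (F_eq0 : forall t, F t = 0 <-> t = 1).

Lemma edens_flat (eps : R) P a b : C1 P -> (forall t, a < t < b -> P t = 1) ->
  \int[mu]_(t in `[a, b]) edens F eps P t = 0.
Proof.
move=> cP h; rewrite (@edens_eq R F F_cont eps P (fun=> 1) a b cP (C1_cst 1).1 h).
rewrite /Rintegral integral0_eq// => t _; congr EFin.
by rewrite /edens (C1_cst 1).2 (F_eq0 1).2// expr0n/= !mulr0 addr0.
Qed.

Lemma carrier_convex M a b t : carrier M a -> carrier M b -> a <= t <= b -> carrier M t.
Proof.
case: M => //= a' b' ab; rewrite !in_itv/= => /andP[h1 h2] /andP[h3 h4] /andP[h5 h6].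
by apply/andP; split; [exact: le_trans h1 h5|exact: le_trans h6 h4].
Qed.

Lemma between M P x r (lo hi y t1 t2 : R) : C1 P -> carrier M t1 -> carrier M t2 ->
  `|t1 - x| < r -> `|t2 - x| < r -> P t1 = lo -> P t2 = hi -> lo <= y <= hi ->
  exists t, [/\ carrier M t, `|t - x| < r & P t = y].
Proof.
move=> cP c1 c2; rewrite !ltr_norml => /andP[a1 a2] /andP[b1 b2] e1 e2 /andP[y1 y2].
have [tt|tt] := leP t1 t2.
- have [|t] := @IVT R P t1 t2 y tt (continuous_subspaceT (C1_cont cP)).
    by rewrite e1 e2 ge_min y1 le_max y2 orbT.
  rewrite in_itv/= => /andP[h1 h2] e; exists t; split => //.
    by apply: (carrier_convex c1 c2); rewrite h1.
  by rewrite ltr_norml; apply/andP; split; rlra.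
- have [|t] := @IVT R P t2 t1 y (ltW tt) (continuous_subspaceT (C1_cont cP)).
    by rewrite e1 e2 ge_min y1 le_max y2 !orbT.
  rewrite in_itv/= => /andP[h1 h2] e; exists t; split => //.
    by apply: (carrier_convex c2 c1); rewrite h1.
  by rewrite ltr_norml; apply/andP; split; rlra.
Qed.

(* A profile may keep a value different from 1 beyond an endpoint of a segment, but only at
   distance at least [rho]. *)
Definition fat M rho t : Prop := exists2 y, carrier M y & `|t - y| < rho.

Definition profile M x (lo hi r eps E : R) P : Prop := C1 P /\
  [/\ exists2 rho : R, 0 < rho & forall t, fat M rho t -> r - rho <= `|t - x| -> P t = 1,
    forall t, lo <= P t <= hi, interior_dom M x -> P x = lo,
    forall y, lo <= y <= hi -> exists t, [/\ carrier M t, `|t - x| < r & P t = y] &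
    \int[mu]_(t in `](x - r), (x + r)[ `&` carrier M) edens F eps P t <= E].

Lemma Rintegral_sub_cc (D : set (measurableTypeR R)) f a b : measurable D -> D `<=` `[a, b] ->
  intg `[a, b] f -> (forall t, 0 <= f t) ->
  \int[mu]_(t in D) f t <= \int[mu]_(t in `[a, b]) f t.
Proof. by move=> mD Dab iab f0; apply: Rintegral_sub. Qed.

(** The profile goes from 1 to [hi], to [lo] and back to 1. It is timed backwards from [x], so that
    [lo] is reached exactly at [x], where [u] may jump. *)
Lemma profile_interior M x (lo hi r e : R) : window M x r -> 0 < r -> lo <= 1 -> 1 <= hi -> 0 < e ->
  exists2 e0 : R, 0 < e0 & forall eps : R, 0 < eps < e0 -> exists P,
    profile M x lo hi r eps (2 * (G F lo + G F hi) + e) P.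
Proof.
move=> wx r0 l1 h1 e0; have e3 : 0 < e / 3 by rewrite divr_gt0.
have lh := le_trans l1 h1.
have r1 : lo <= 1 <= hi by rewrite l1.
have rl : lo <= lo <= hi by rewrite lexx.
have rh : lo <= hi <= hi by rewrite lexx andbT.
have [L1 L10 H1] := reachP F_cont F_ge0 r1 rh e3.
have [L2 L20 H2] := reachP F_cont F_ge0 rh rl e3.
have [L3 L30 H3] := reachP F_cont F_ge0 rl r1 e3.
exists (r / (L1 + L2 + L3)); first by rewrite divr_gt0// !addr_gt0.
move=> eps /andP[eps0]; rewrite ltr_pdivlMr ?addr_gt0// => epsr.
pose c2 := x - L2 * eps; pose c1 := c2 - L1 * eps.
have [f1 hf1] := H1 eps c1 eps0; rewrite /c1 subrK -/c1 in hf1.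
have [f2 hf2] := H2 eps c2 eps0; rewrite {2}/c2 subrK in hf2.
have [f3 hf3] := H3 eps x eps0.
have [g [hg g1 g2]] := path_cat F_cont eps0 hf1 hf2.
have [P [hP P1 P2]] := path_cat F_cont eps0 hg hf3.
have Le1 : 0 < L1 * eps by rewrite mulr_gt0.
have Le2 : 0 < L2 * eps by rewrite mulr_gt0.
have Le3 : 0 < L3 * eps by rewrite mulr_gt0.
have Les : L1 * eps + L2 * eps + L3 * eps < r by rewrite -!mulrDl mulrC.
have Px : P x = lo by rewrite P1// g2 /c2; [case: hf2 => _ [_ _ -> //]|rlra].
have Pc : P c2 = hi by rewrite P1 /c2; [rewrite g1//; case: hf1 => _ [_ _ -> //]|rlra].
have cin t : x - r < t < x + r -> carrier M t.
  by move=> h; apply: (window_carrier wx); rewrite /= in_itv/=; case/andP: h => /ltW -> /ltW ->.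
exists P; case: hP => cP [_ Pa Pb Pr PE]; split => //; split => //.
- exists (r - (L1 * eps + L2 * eps + L3 * eps)); first by rewrite subr_gt0.
  move=> t _; rewrite opprB addrC subrK => tr; have [tx|tx] := leP t x.
    by apply: Pa; move: tr; rewrite distrC ger0_norm ?subr_ge0// /c1 /c2; rlra.
  by apply: Pb; move: tr; rewrite gtr0_norm ?subr_gt0//; rlra.
- move=> y; apply: (@between M P x r lo hi y x c2) => //.
  + by apply: cin; apply/andP; split; rlra.
  + by apply: cin; rewrite /c2; apply/andP; split; rlra.
  + by rewrite subrr normr0.
  + by rewrite /c2 addrAC subrr add0r normrN gtr0_norm//; rlra.
apply: (@le_trans _ _ (\int[mu]_(t in `[x - r, x + r]) edens F eps P t)).
  apply: Rintegral_sub_cc => //.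
  - by apply: measurableI => //; exact: carrier_measurable.
  - by move=> t [] /=; rewrite !in_itv/= => /andP[/ltW -> /ltW ->].
  - exact: edens_int.
  - by move=> t; exact: edens_ge0.
rewrite (@Rintegral_cc_split R _ _ c1); [|rewrite /c1 /c2; rlra|rewrite /c1 /c2; rlra|exact: edens_int].
rewrite edens_flat// ?add0r; last by move=> t /andP[_ tc]; apply: Pa; exact: ltW.
rewrite (@Rintegral_cc_split R _ _ (x + L3 * eps)); [|rewrite /c1 /c2; rlra|rlra|exact: edens_int].
rewrite [X in _ + X]edens_flat// ?addr0; last by move=> t /andP[tc _]; apply: Pb; exact: ltW.
apply: le_trans PE _; rewrite (G_le F_cont l1) (G_ge F_cont h1).
have := Hf_mono F_cont l1; have := Hf_mono F_cont h1; rewrite (Hf1 F).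
move: (Hf F lo) (Hf F hi) => A B B0 A0.
rewrite subr0 (ger0_norm B0) (ler0_norm (_ : A - B <= 0)) ?sub0r ?normrN ?(ler0_norm A0); rlra.
Qed.


(** The path starts at the extreme with the larger [G], so that the dearer trip from 1 is the one
    that is spared. *)
Lemma endpoint_order (lo hi : R) : lo <= 1 -> 1 <= hi -> exists v0 v1 : R,
  [/\ (v0 = lo /\ v1 = hi) \/ (v0 = hi /\ v1 = lo), lo <= v0 <= hi, lo <= v1 <= hi &
    `|Hf F v1 - Hf F v0| + `|Hf F v1| <= 2 * (G F lo + G F hi) - Num.max (G F lo) (G F hi)].
Proof.
move=> l1 h1; have lh := le_trans l1 h1.
rewrite (G_le F_cont l1) (G_ge F_cont h1).
have := Hf_mono F_cont l1; have := Hf_mono F_cont h1; rewrite (Hf1 F) => B0 A0.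
have [h|h] := leP (- Hf F lo) (Hf F hi).
- exists hi, lo; split; [by right|by rewrite lexx andbT|by rewrite lexx|].
  move: (Hf F lo) (Hf F hi) A0 B0 h => A B A0 B0 h.
  rewrite (ler0_norm (_ : A - B <= 0)) ?(ler0_norm A0); rlra.
- exists lo, hi; split; [by left|by rewrite lexx|by rewrite lexx andbT|].
  move: (Hf F lo) (Hf F hi) A0 B0 h => A B A0 B0 h.
  rewrite (ger0_norm (_ : 0 <= B - A)) ?(ger0_norm B0); rlra.
Qed.

Lemma two_radii (L r : R) : L < r -> 0 < r -> exists2 rho : R, 0 < rho & L <= r - rho /\ rho <= r - rho.
Proof.
move=> Lr r0; exists (Num.min (r - L) (r / 2)); first by rewrite lt_min subr_gt0 Lr divr_gt0.
have : Num.min (r - L) (r / 2) <= r - L by rewrite ge_min lexx.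
have : Num.min (r - L) (r / 2) <= r / 2 by rewrite ge_min lexx orbT.
by move: (Num.min _ _) => m *; split; rlra.
Qed.

Lemma profile_left (a b lo hi r e : R) (ab : a < b) : r < b - a -> 0 < r -> lo <= 1 -> 1 <= hi -> 0 < e ->
  exists2 e0 : R, 0 < e0 & forall eps : R, 0 < eps < e0 -> exists P,
    profile (Segment ab) a lo hi r eps (2 * (G F lo + G F hi) - Num.max (G F lo) (G F hi) + e) P.
Proof.
move=> rab r0 l1 h1 e0; have e2 : 0 < e / 2 by rewrite divr_gt0.
have [v0 [v1 [vv rv0 rv1 vE]]] := endpoint_order l1 h1.
have r1 : lo <= 1 <= hi by rewrite l1.
have [L1 L10 H1] := reachP F_cont F_ge0 rv0 rv1 e2.
have [L2 L20 H2] := reachP F_cont F_ge0 rv1 r1 e2.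
exists (r / (L1 + L2)); first by rewrite divr_gt0// addr_gt0.
move=> eps /andP[eps0]; rewrite ltr_pdivlMr ?addr_gt0// => epsr.
pose c := a + L1 * eps.
have [f1 hf1] := H1 eps a eps0; have [f2 hf2] := H2 eps c eps0.
have [P [hP P1 P2]] := path_cat F_cont eps0 hf1 hf2.
have Le1 : 0 < L1 * eps by rewrite mulr_gt0.
have Le2 : 0 < L2 * eps by rewrite mulr_gt0.
have Les : L1 * eps + L2 * eps < r by rewrite -!mulrDl mulrC.
have Pa' : P a = v0 by rewrite P1; [case: hf1 => _ [_ -> //]|rewrite lerDl ltW].
have Pc : P c = v1 by rewrite P2//; case: hf2 => _ [_ -> //].
have ca : carrier (Segment ab) a by rewrite /= in_itv/= lexx ltW.
have cc : carrier (Segment ab) c by rewrite /= in_itv/= /c; apply/andP; split; rlra.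
have na : `|a - a| < r by rewrite subrr normr0.
have nc : `|c - a| < r by rewrite /c addrAC subrr add0r gtr0_norm//; rlra.
exists P; case: hP => cP [_ Pa Pb Pr PE]; split => //; split => //.
(* To the left of [a] the requirement is void: a point of the fat set is there at distance less than
   [rho] from [a], while [rho] is at most [r - rho]. *)
- have [rho rho0 [rh1 rh2]] := two_radii Les r0; exists rho => // t [y]; rewrite /= in_itv/= ltr_norml => /andP[ay _] /andP[yt _] tr.
  apply: Pb; rewrite /c; have [ta|ta] := leP a t.
    by move: tr; rewrite ger0_norm ?subr_ge0//; rlra.
  by move: tr; rewrite ltr0_norm ?subr_lt0//; rlra.
- by rewrite /= in_itv/= ltxx.
- by case: vv => [[e3 e4]|[e3 e4]] y yr; [apply: (between cP ca cc na nc _ _ yr)|apply: (between cP cc ca nc na _ _ yr)];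
    rewrite ?Pa' ?Pc ?e3 ?e4.
apply: (@le_trans _ _ (\int[mu]_(t in `[a, a + r]) edens F eps P t)).
  apply: Rintegral_sub_cc => //.
  - by apply: measurableI => //; exact: (@carrier_measurable R (Segment ab)).
  - by move=> t [] /=; rewrite !in_itv/= => /andP[_ /ltW ->] /andP[->].
  - exact: edens_int.
  - by move=> t; exact: edens_ge0.
rewrite (@Rintegral_cc_split R _ _ (c + L2 * eps)); [|rewrite /c; rlra|rewrite /c; rlra|exact: edens_int].
rewrite [X in _ + X]edens_flat// ?addr0; last by move=> t /andP[tc _]; apply: Pb; exact: ltW.
apply: le_trans PE _; rewrite (Hf1 F) sub0r normrN.
move: vE; move: (`|Hf F v1 - Hf F v0|) (`|Hf F v1|) (2 * (G F lo + G F hi) - _) => z1 z2 z3 h.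
by move: h; clear; rlra.
Qed.

Lemma profile_right (a b lo hi r e : R) (ab : a < b) : r < b - a -> 0 < r -> lo <= 1 -> 1 <= hi -> 0 < e ->
  exists2 e0 : R, 0 < e0 & forall eps : R, 0 < eps < e0 -> exists P,
    profile (Segment ab) b lo hi r eps (2 * (G F lo + G F hi) - Num.max (G F lo) (G F hi) + e) P.
Proof.
move=> rab r0 l1 h1 e0; have e2 : 0 < e / 2 by rewrite divr_gt0.
have [v0 [v1 [vv rv0 rv1 vE]]] := endpoint_order l1 h1.
have r1 : lo <= 1 <= hi by rewrite l1.
have [L1 L10 H1] := reachP F_cont F_ge0 rv1 rv0 e2.
have [L2 L20 H2] := reachP F_cont F_ge0 r1 rv1 e2.
exists (r / (L1 + L2)); first by rewrite divr_gt0// addr_gt0.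
move=> eps /andP[eps0]; rewrite ltr_pdivlMr ?addr_gt0// => epsr.
pose c := b - L1 * eps; pose d := c - L2 * eps.
have [f1 hf1] := H1 eps c eps0; have [f2 hf2] := H2 eps d eps0.
rewrite {2}/c subrK in hf1; rewrite {2}/d subrK in hf2.
have [P [hP P1 P2]] := path_cat F_cont eps0 hf2 hf1.
have Le1 : 0 < L1 * eps by rewrite mulr_gt0.
have Le2 : 0 < L2 * eps by rewrite mulr_gt0.
have Les : L1 * eps + L2 * eps < r by rewrite -!mulrDl mulrC.
have Pb' : P b = v0 by rewrite P2 /c; [case: hf1 => _ [_ _ -> //]|rlra].
have Pc : P c = v1 by rewrite P1//; case: hf2 => _ [_ _ -> //].
have cb : carrier (Segment ab) b by rewrite /= in_itv/= lexx ltW.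
have cc : carrier (Segment ab) c by rewrite /= in_itv/= /c; apply/andP; split; rlra.
have nb : `|b - b| < r by rewrite subrr normr0.
have nc : `|c - b| < r by rewrite /c addrAC subrr add0r normrN gtr0_norm//; rlra.
exists P; case: hP => cP [_ Pa Pb Pr PE]; split => //; split => //.
- have [rho rho0 [rh1 rh2]] := two_radii Les r0; exists rho => // t [y]; rewrite /= in_itv/= ltr_norml => /andP[_ yb] /andP[_ yt] tr.
  apply: Pa; rewrite /d /c; have [tb|tb] := leP t b.
    by move: tr; rewrite ler0_norm ?subr_le0//; rlra.
  by move: tr; rewrite gtr0_norm ?subr_gt0//; rlra.
- by rewrite /= in_itv/= ltxx andbF.
- by case: vv => [[e3 e4]|[e3 e4]] y yr; [apply: (between cP cb cc nb nc _ _ yr)|apply: (between cP cc cb nc nb _ _ yr)];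
    rewrite ?Pb' ?Pc ?e3 ?e4.
apply: (@le_trans _ _ (\int[mu]_(t in `[b - r, b]) edens F eps P t)).
  apply: Rintegral_sub_cc => //.
  - by apply: measurableI => //; exact: (@carrier_measurable R (Segment ab)).
  - by move=> t [] /=; rewrite !in_itv/= => /andP[/ltW -> _] /andP[_ ->].
  - exact: edens_int.
  - by move=> t; exact: edens_ge0.
rewrite (@Rintegral_cc_split R _ _ d); [|rewrite /d /c; rlra|rewrite /d /c; rlra|exact: edens_int].
rewrite edens_flat// ?add0r; last by move=> t /andP[_ tc]; apply: Pa; exact: ltW.
apply: le_trans PE _; rewrite (Hf1 F) subr0 (distrC (Hf F v0)).
move: vE; move: (`|Hf F v1 - Hf F v0|) (`|Hf F v1|) (2 * (G F lo + G F hi) - _) => z1 z2 z3 h.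
by move: h; clear; rlra.
Qed.

Lemma profile_exists M x (lo hi : R) : reps M x -> lo <= 1 -> 1 <= hi ->
  exists2 r0 : R, 0 < r0 & forall r e : R, 0 < r <= r0 -> 0 < e ->
    exists2 e0 : R, 0 < e0 & forall eps : R, 0 < eps < e0 -> exists P,
      profile M x lo hi r eps (cost F M x lo hi + e) P.
Proof.
move=> rx l1 h1.
have [ix|nix] := pselect (interior_dom M x).
  have [r0 r00 hr0] := window_exists ix; exists r0 => // r e rr e0.
  have ex : is_endpoint M x = false.
    case: (M) ix => //= a b ab; rewrite in_itv/= => /andP[xa xb].
    by rewrite gt_eqF// lt_eqF.
  rewrite /cost ex mul0r subr0; apply: profile_interior => //; first exact: hr0.
  by case/andP: rr.
move: rx nix; rewrite /cost; case: M => [a b ab|_ []//]; rewrite /= !in_itv/= => /andP[ax xb] nx.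
exists ((b - a) / 2) => [|r e /andP[r0 rr] e0]; first by rewrite divr_gt0// subr_gt0.
have rab : r < b - a by rlra.
have [->|xa] := eqVneq x a; first by rewrite mul1r; exact: profile_left.
have [->|xb'] := eqVneq x b; first by rewrite mul1r; exact: profile_right.
by exfalso; apply: nx; rewrite !lt_neqAle ax xb xb' eq_sym xa.
Qed.
End profiles.

(** * Energy of smooth functions *)

Section smooth.
Context {R : realType}.
Local Notation mu := (@lebesgue_measure R).
Local Notation intg D f := (mu.-integrable D (EFin \o f)).
Implicit Types (M : domain R) (f g h w phi : R -> R) (a b c d p q r s t x y z : R).

(** Integration by parts: the boundary terms vanish on a segment, where [phi] is zero at both ends,
    and cancel on the circle by periodicity. *)
Lemma C1_weak M w : C1 w -> on_domain M w -> H1 M w /\ weak_derivative M w (derive1 w).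
Proof.
move=> cw ow; have od := derive1_on_domain cw ow.
have [a [b [ce ab]]] := cell_bounded M.
have mc := @cell_measurable R M.
have l2 g : continuous g -> on_domain M g -> L2 M g.
  move=> cg og; split => //.
    by apply: measurable_funTS; exact: continuous_measurable_fun.
  have ig : intg (cell M) (fun x => g x ^+ 2).
    have -> : (fun x => g x ^+ 2) = (fun x => g x * g x) by apply/funext => x; rewrite expr2.
    by rewrite ce; apply: (@integrable_continuous R a b) => // x; apply: cvgM; exact: cg.
  apply: le_lt_trans (_ : \int[mu]_(x in cell M) `|(g x ^+ 2)%:E| < +oo)%E; last by case/integrableP : ig.
  by rewrite le_eqVlt; apply/orP; left; apply/eqP; apply: eq_integral => x _; rewrite /= ger0_norm ?sqr_ge0.
have wd : weak_derivative M w (derive1 w).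
  split; first by apply: l2 => //; exact: cw.2.
  move=> phi hphi; have cphi := C1c_C1 hphi.
  have [c1 e1] := C1M cw cphi.
  have i1 : intg (cell M) (fun x => derive1 w x * phi x).
    rewrite ce; apply: (@integrable_continuous R a b) => // x.
    by apply: cvgM; [exact: cw.2|exact: (C1_cont cphi)].
  have i2 : intg (cell M) (fun x => w x * derive1 phi x).
    rewrite ce; apply: (@integrable_continuous R a b) => // x.
    by apply: cvgM; [exact: (C1_cont cw)|exact: cphi.2].
  apply/eqP; rewrite -addr_eq0 addrC -RintegralD//.
  rewrite (_ : \int[mu]_(x in cell M) _ = \int[mu]_(x in `[a, b]) derive1 (fun x => w x * phi x) x).
    rewrite (FTC_C1 c1 (ltW ab)).
    have phi0 x : ~ interior_dom M x -> phi x = 0 by exact: C1c_supp hphi.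
    have [op _ _ _] := hphi.
    case: M ce ow op phi0 {od mc l2 hphi i1 i2} => [a' b' ab'|] /= ce ow op phi0.
      have aa : a' = a by have := congr1 inf ce; rewrite !inf_itvcc// ltW.
      have bb : b' = b by have := congr1 sup ce; rewrite !sup_itvcc// ltW.
      rewrite -aa -bb (phi0 a') ?(phi0 b') ?mulr0 ?subrr// in_itv/= ltxx ?andbF//.
    have aa : 0 = a by have := congr1 inf ce; rewrite !inf_itvcc// ltW.
    have bb : 1 = b by have := congr1 sup ce; rewrite !sup_itvcc// ltW.
    by rewrite -aa -bb -(add0r 1) ow op subrr.
  by rewrite ce; apply: eq_Rintegral => x _; rewrite e1.
split => //; split; [by apply: l2 => //; exact: C1_cont|exact: continuous_subspaceT (C1_cont cw)|].
by exists (derive1 w).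
Qed.

(** At a Lebesgue point the value is the limit of means over short intervals, and these are 0. *)
Lemma null_ae f a b : intg `[a, b] f ->
  (forall x y, a < x -> x <= y -> y < b -> \int[mu]_(t in `[x, y]) f t = 0) ->
  \forall t \ae mu, a < t < b -> f t = 0.
Proof.
move=> if_ h; pose g := f \_ `[a, b].
have ig : intg setT g.
  by rewrite /g -restrict_EFin; apply/integrable_restrict => //; rewrite setTI.
have mg : measurable_fun [set: R] g by apply/measurable_EFinP; case/integrableP : ig.
have locg : locally_integrable setT g.
  split => //; first exact: openT.
  move=> K _ cK; have iK : intg K g.
    by apply: integrableS ig => //; exact: compact_measurable.
  by case/integrableP : iK.
move: (lebesgue_differentiation locg); apply: filterS; first exact: (ae_filter_ringOfSetsType mu).
move=> t lt /andP[at_ tb].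
have gf s : a <= s <= b -> g s = f s by move=> sab; rewrite /g patchE mem_set//= in_itv.
suff : `|g t| <= 0 by rewrite normr_le0 gf ?ltW// => /eqP.
apply/ler_addgt0Pr => e e0; rewrite add0r.
have [h0 h00 H] := lebesgue_pt_mean ig lt e0.
pose k := Num.min (h0 / 2) ((b - t) / 2).
have k0 : 0 < k by rewrite lt_min !divr_gt0// subr_gt0.
have kh : k < h0 by rewrite (@le_lt_trans _ _ (h0 / 2))// ?ge_min ?lexx//; rlra.
have kb : t + k < b.
  have : k <= (b - t) / 2 by rewrite ge_min lexx orbT.
  by move: k {k0 kh} => k kk; rlra.
have igk : intg `[t, t + k] g by apply: integrableS ig.
have E : \int[mu]_(s in `[t, t + k]) g s = 0.
  rewrite -(h t (t + k))//; last by rewrite lerDl ltW.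
  apply: eq_Rintegral => s; rewrite inE /= in_itv/= => /andP[ts sk]; apply: gf.
  by apply/andP; split; rlra.
have ic : intg `[t, t + k] (fun=> g t).
  by apply: (@integrable_continuous R t (t + k)) => // ?; exact: cvg_cst.
have h1 : `|\int[mu]_(s in `[t, t + k]) (g s - g t)| <= e * k.
  apply: le_trans (H k _); last by rewrite k0.
  by apply: le_normr_Rintegral => //; exact: intgB.
have tk : t <= t + k by rewrite lerDl ltW.
move: h1; rewrite RintegralB// E sub0r normrN (Rintegral_cc_cst _ tk).
by rewrite [t + k]addrC addrK normrM (gtr0_norm k0) ler_pM2r.
Qed.

Variables (F : R -> R).
Hypotheses (F_cont : continuous F) (F_ge0 : forall t, 0 <= F t)
  (F_eq0 : forall t, F t = 0 <-> t = 1).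

(** [wderiv] is an arbitrarily chosen weak derivative. It and the classical derivative have the same
    integrals over subintervals, namely the increments of [w], so they agree almost everywhere. *)
Lemma density_edens M (eps : R) w : C1 w -> on_domain M w ->
  \int[mu]_(t in cell M) density F M eps w t = \int[mu]_(t in cell M) edens F eps w t.
Proof.
move=> cw ow; have [hw wd] := C1_weak cw ow.
have [p [r [r0 wp ce]]] := cell_window M.
have hD := density_L1 F_cont eps hw.
have wg := wderivP hw.
have [L2g _] := wg; have [hg _] := L2_L1 L2g.
have [[L2d _] _] := (wd, tt); have [hd _] := L2_L1 L2d.
have ig := L1_window hg wp; have id := L1_window hd wp.
have ae0 : \forall t \ae mu, p - r < t < p + r -> wderiv M w t - derive1 w t = 0.
  apply: null_ae; first exact: intgB.
  move=> x y px xy yp; have sub : `[x, y]%classic `<=` `[p - r, p + r]%classic.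
    by move=> s /=; rewrite !in_itv/= => /andP[h1 h2]; apply/andP; split; rlra.
  rewrite RintegralB//; [|exact: integrableS ig|exact: integrableS id].
  by rewrite -(H1_ftc hw wg wp px xy yp) -(H1_ftc hw wd wp px xy yp) subrr.
have iD := hD.2; rewrite ce in iD.
have iE : intg `[p - r, p + r] (edens F eps w) by exact: edens_int.
rewrite ce -!Rintegral_oo_cc// /Rintegral; congr fine.
apply: ae_eq_integral => //.
- by apply: measurable_funS (measurable_int _ iD) => //; exact: subset_itv_oo_cc.
- by apply: measurable_funS (measurable_int _ iE) => //; exact: subset_itv_oo_cc.
move: ae0; apply: filterS; first exact: (ae_filter_ringOfSetsType mu).
move=> t h; rewrite /= in_itv/= => /h /eqP; rewrite subr_eq0 => /eqP e.
by rewrite /density /edens e.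
Qed.
End smooth.

(** * Gluing finitely many profiles *)

Section recovery.
Context {R : realType}.
Local Notation mu := (@lebesgue_measure R).
Local Notation intg D f := (mu.-integrable D (EFin \o f)).
Implicit Types (M : domain R) (f g h w phi : R -> R) (a b c d p q r s t x y z : R) (K : seq R).
Variables (F : R -> R).
Hypotheses (F_cont : continuous F) (F_ge0 : forall t, 0 <= F t)
  (F_eq0 : forall t, F t = 0 <-> t = 1).

Lemma fat_rep M r x t : 0 < r -> fat M r t -> fat M r (rep M x t).
Proof. by case: M => //= r0 _; exists (rep Torus x t); rewrite ?subrr ?normr0. Qed.

Lemma carrier_fat M r t : 0 < r -> carrier M t -> fat M r t.
Proof. by move=> r0 ct; exists t => //; rewrite subrr normr0. Qed.

(** A derivative at an endpoint of a segment also sees points beyond it, so profiles have to be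
    controlled on a neighbourhood of the carrier. *)
Lemma near_fat M r t : 0 < r -> carrier M t -> \forall s \near t, fat M r s.
Proof.
by move=> r0 ct; apply: filterS (near_dist t r0) => s ts; exists t => //; rewrite distrC.
Qed.

Section assembly.
Variables (M : domain R) (K : seq R) (lo hi E : R -> R) (r rho eps : R) (P : R -> R -> R).
Hypotheses (uK : uniq K) (r0 : 0 < r) (rho0 : 0 < rho) (r2 : r < 1 / 2) (eps0 : 0 < eps)
  (sep : forall x y, x \in K -> y \in K -> x != y -> 2 * r <= dist_dom M x y)
  (CP : forall x, C1 (P x))
  (P1 : forall x t, fat M rho t -> r - rho <= `|t - x| -> P x t = 1)
  (hP : forall x, x \in K -> profile F M x (lo x) (hi x) r eps (E x) (P x)).

(** Near the carrier at most one summand differs from 0, and a sum is C1 without any matching at the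
    boundaries of the balls. *)
Definition glue t : R := 1 + \sum_(x <- K) (P x (rep M x t) - 1).

Lemma glue_C1 : C1 glue /\ on_domain M glue.
Proof.
split.
  apply: (C1D (C1_cst 1).1 _).1; apply: (C1_sum _ _).1 => x.
  have cQ : C1 (fun t => P x t - 1) by exact: (C1B (CP x) (C1_cst 1).1).1.
  apply: (@C1_lift R M x (fun t => P x t - 1) r cQ _).1 => eM; split => // s rs.
  rewrite P1 ?subrr//; first by rewrite eM; exact: carrier_fat.
  by have h0 := rho0; move: rs; lra.
have h x := @rep_on_domain R M R (P x) x.
rewrite /glue; case: (M) h => //= h t; congr (_ + _); apply: eq_bigr => x _.
by have := h x t; rewrite /= => ->.
Qed.

Lemma P_far x t : fat M rho t -> r - rho <= dist_dom M x t -> P x (rep M x t) = 1.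
Proof. by move=> ft; rewrite dist_domE => d; apply: P1 => //; exact: fat_rep. Qed.

Lemma glue_far t : fat M rho t -> (forall x, x \in K -> r - rho <= dist_dom M x t) -> glue t = 1.
Proof.
move=> ft h; rewrite /glue big_seq big1 ?addr0// => x xK.
by rewrite P_far ?subrr//; exact: h.
Qed.

Lemma glue_near x t : fat M rho t -> x \in K -> dist_dom M x t < r -> glue t = P x (rep M x t).
Proof.
move=> ft xK xt; rewrite /glue (bigD1_seq x)//= big_seq_cond big1 ?addr0; first by rewrite addrC subrK.
move=> y /andP[yK yx]; rewrite P_far ?subrr//.
have xy : x != y by rewrite eq_sym.
have := sep xK yK xy; have := dist_dom_triangle M x t y.
by rewrite (dist_dom_sym M t y) => h1 h2; have h0 := rho0; have h3 := r0; move: xt; lra.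
Qed.

Lemma glue_edens_far t : carrier M t -> (forall x, x \in K -> r <= dist_dom M x t) ->
  edens F eps glue t = 0.
Proof.
move=> ct h; have nearg : \forall s \near t, glue s = 1.
  apply: filterS (filterI (near_fat rho0 ct) (near_dist t rho0)) => s [fs ts].
  apply: glue_far => // x xK; have := h x xK; have := dist_dom_lip M x t s; lra.
by rewrite (edens_cst F eps nearg) (F_eq0 1).2// mulr0.
Qed.

Lemma glue_edens_near x t : carrier M t -> x \in K -> `|t - x| < r ->
  edens F eps glue t = edens F eps (P x) t.
Proof.
move=> ct xK tx; apply: edens_near.
have d0 : 0 < r - `|t - x| by rewrite subr_gt0.
apply: filterS (filterI (near_fat rho0 ct) (near_dist t d0)) => s [fs ts].
have sx : `|s - x| < r.
  have -> : s - x = - (t - s) + (t - x) by ring.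
  by apply: le_lt_trans (ler_normD _ _) _; rewrite normrN; lra.
have e : rep M x s = s by apply: near_rep; exact: lt_trans sx r2.
by rewrite (glue_near fs xK) ?e// dist_domE e.
Qed.

Lemma glue_energy : \int[mu]_(t in cell M) edens F eps glue t <= \sum_(x <- K) E x.
Proof.
have [cw ow] := glue_C1.
have [a [b [ce ab]]] := cell_bounded M.
have iE : intg (cell M) (edens F eps glue) by rewrite ce; exact: edens_int.
have hE : L1 M (edens F eps glue).
  split => //; have := derive1_on_domain cw ow; rewrite /edens.
  by move: ow; case: (M) => //= h1 h2 t; rewrite h1 h2.
have E0 t : 0 <= edens F eps glue t by exact: edens_ge0.
have -> : \int[mu]_(t in cell M) edens F eps glue t =
    \int[mu]_(t in cell M `&` US M K r) edens F eps glue t.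
  rewrite [RHS]Rintegral_mkcondr; apply: eq_Rintegral => t; rewrite inE => ct.
  rewrite patchE; case: ifPn => // /negP nU; apply: glue_edens_far; first exact: cell_carrier.
  move=> x xK; rewrite leNgt; apply/negP => h; apply: nU; apply/mem_set/US_P.
  by exists x => //; exact/NbE.
rewrite -(sum_Nb hE E0 uK sep) !big_seq; apply: ler_sum => x xK.
have [_ [_ _ _ _ hEx]] := hP xK; apply: le_trans hEx.
have rs : small_radius M r by case: (M) => //=; exact: ltW.
rewrite /Rintegral (@integral_Nb R M x r (fun t => (edens F eps glue t)%:E))//; last first.
- by case/integrableP : iE.
- by case: (M) hE => //= -[h _] t; rewrite h.
rewrite le_eqVlt; apply/orP; left; apply/eqP; congr fine.
apply: eq_integral => t; rewrite inE => -[]; rewrite /= in_itv/= => /andP[t1 t2] ct.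
by congr EFin; apply: glue_edens_near => //; rewrite ltr_norml; apply/andP; split; lra.
Qed.

End assembly.

Lemma recovery_exists M K (lo hi : R -> R) (e : R) : uniq K ->
  (forall x, x \in K -> [/\ reps M x, lo x <= 1 & 1 <= hi x]) -> 0 < e ->
  exists2 r0 : R, 0 < r0 & forall r : R, 0 < r <= r0 -> exists2 e0 : R, 0 < e0 &
    forall eps : R, 0 < eps < e0 -> exists w, [/\ C1 w, on_domain M w,
      \int[mu]_(t in cell M) edens F eps w t <= \sum_(x <- K) cost F M x (lo x) (hi x) + e &
      [/\ forall t, carrier M t -> (forall x, x \in K -> r <= dist_dom M x t) -> w t = 1,
        forall x t, carrier M t -> x \in K -> dist_dom M x t < r -> lo x <= w t <= hi x,
        forall x, x \in K -> interior_dom M x -> w x = lo x &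
        forall x y, x \in K -> lo x <= y <= hi x ->
          exists t, [/\ carrier M t, dist_dom M x t < r & w t = y]]].
Proof.
move=> uK hK e0; pose d := e / ((size K)%:R + 1).
have d0 : 0 < d by rewrite divr_gt0// ltr_wpDl.
have [|r1 r10 H1] := @seq_radius R K (fun x r => exists2 e0 : R, 0 < e0 & forall eps : R, 0 < eps < e0 ->
    exists P, profile F M x (lo x) (hi x) r eps (cost F M x (lo x) (hi x) + d) P).
  move=> x xK; have [rx l1 h1] := hK x xK.
  have [r00 r000 h] := profile_exists F_cont F_ge0 F_eq0 rx l1 h1.
  by exists r00 => // r hr; exact: h.
have [|r2 r20 sep] := @sep_rho R M K; first by move=> x /hK[].
exists (Num.min (1 / 4) (Num.min r1 r2)); first by rewrite !lt_min r10 r20 divr_gt0.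
move=> r; rewrite !le_min => /and4P[r0 r4 rr1 rr2].
have rh : r < 1 / 2 by rlra.
have [|e1 e10 H2] := @seq_radius R K (fun x e0 => forall eps : R, 0 < eps < e0 ->
    exists P, profile F M x (lo x) (hi x) r eps (cost F M x (lo x) (hi x) + d) P).
  move=> x xK; have [|e2 e20 h] := H1 x xK r; first by rewrite r0.
  by exists e2 => // e3 /andP[_ e32] eps /andP[h1 h2]; apply: h; rewrite h1 (lt_le_trans h2 e32).
exists e1 => // eps he.
(* Outside [K] the profile is the constant 1, so that the regularity of [P x] holds for every
   [x]. *)
have /choice[P hP] : forall x, exists P : R -> R, C1 P /\ (x \in K ->
    profile F M x (lo x) (hi x) r eps (cost F M x (lo x) (hi x) + d) P) /\ (x \notin K -> P = fun=> 1).
  move=> x; have [xK|nxK] := boolP (x \in K).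
    have [|P hP] := H2 x xK e1 _ eps he; first by rewrite e10 lexx.
    by exists P; split; [case: hP|].
  by exists (fun=> 1); split; [exact: (C1_cst 1).1|].
have CP x : C1 (P x) by case: (hP x).
have hP' x : x \in K -> profile F M x (lo x) (hi x) r eps (cost F M x (lo x) (hi x) + d) (P x).
  by case: (hP x) => _ [].
have [|rho rho0 hrho] := @seq_radius R K (fun x rho => forall t, fat M rho t -> r - rho <= `|t - x| -> P x t = 1).
  move=> x xK; have [_ [[rho rho0 h] _ _ _ _]] := hP' x xK.
  exists rho => // rho' /andP[_ rr] t [y cy ty] tx; apply: h; last by rlra.
  by exists y => //; exact: lt_le_trans ty rr.
have P1 x t : fat M rho t -> r - rho <= `|t - x| -> P x t = 1.
  have [xK|nxK] := boolP (x \in K); first by apply: hrho => //; rewrite rho0 lexx.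
  by case: (hP x) => _ [_ ->].
have sepr := sep r rr2; have /andP[eps0 _] := he.
have [cw ow] := glue_C1 K rho0 rh CP P1.
have near_ x t : carrier M t -> x \in K -> dist_dom M x t < r -> glue M K P t = P x (rep M x t).
  by move=> ct; apply: (glue_near uK r0 rho0 sepr P1); exact: carrier_fat.
exists (glue M K P); split => //.
- have h := glue_energy uK r0 rho0 rh eps0 sepr CP P1 hP'.
  apply: le_trans h _; rewrite big_split /= lerD2l big_const_seq count_predT iter_addr_0.
  rewrite -mulr_natl /d mulrA ler_pdivrMr ?ltr_wpDl//.
  by rewrite mulrC ler_pM2l// lerDl.
split.
- move=> t ct h; apply: (glue_far rho0 P1); first exact: carrier_fat.
  by move=> x xK; have := h x xK; rlra.
- by move=> x t ct xK xt; rewrite (near_ x)//; have [_ [_ h _ _ _]] := hP' x xK; exact: h.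
- move=> x xK ix; have cx := interior_carrier ix.
  have e3 : rep M x x = x by apply: near_rep; rewrite subrr normr0.
  rewrite (near_ x)//; last by rewrite dist_domE e3 subrr normr0.
  by rewrite e3; have [_ [_ _ h _ _]] := hP' x xK; exact: h.
- move=> x y xK yr; have [_ [_ _ _ h _]] := hP' x xK.
  have [t [ct tx e3]] := h y yr.
  have e4 : rep M x t = t by apply: near_rep; exact: lt_trans tx rh.
  have dt : dist_dom M x t < r by rewrite dist_domE e4.
  by exists t; split => //; rewrite (near_ x) ?e4.
Qed.
End recovery.

(** * The total variation as a measure *)

Section total_variation.
Context {R : realType}.
Local Notation mu := (@lebesgue_measure R).
Implicit Types (M : domain R) (f g h u w phi psi : R -> R) (a b c d p q r s t x y z : R) (U : set R)
  (K : seq R).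

Lemma esum_seq_le (S : set R) (f : R -> R) K : uniq K -> (forall x, x \in K -> S x) ->
  ((\sum_(x <- K) f x)%:E <= esum S (fun x => (f x)%:E))%E.
Proof.
move=> uK KS; apply: esum_ge; exists [set` K].
  by split; [exact: finite_seq|move=> x /= xK; exact: KS].
by rewrite -fsbig_seq// sumEFin.
Qed.

Lemma sum_half_powers (l : seq nat) : uniq l -> \sum_(i <- l) (2 : R) ^- i.+1 <= 1.
Proof.
move=> ul; pose N := (\max_(i <- l) i).+1.
have sub : {subset l <= iota 0 N}.
  by move=> i il; rewrite mem_iota /= add0n ltnS; exact: leq_bigmax_seq.
have p0 (i : nat) : 0 <= (2 : R) ^- i.+1 by rewrite invr_ge0 exprn_ge0.
apply: le_trans (sum_subset_le ul (iota_uniq _ _) sub p0) _.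
have -> : \sum_(i <- iota 0 N) (2 : R) ^- i.+1 = 1 - 2 ^- N.
  rewrite -{1}[N]subn0 -/(index_iota 0 N); elim: N {sub} => [|n ih].
    by rewrite big_geq// expr0 invr1 subrr.
  rewrite big_nat_recr//= ih exprS invfM.
  have : (2 : R) ^+ n != 0 by rewrite expf_neq0.
  by move: ((2 : R) ^+ n) => z z0; field; rewrite z0.
by rewrite gerBl invr_ge0 exprn_ge0.
Qed.

Lemma closureP_dist (A : set R) t :
  closure A t <-> forall e : R, 0 < e -> exists2 s, A s & `|t - s| < e.
Proof.
split=> [cA e e0|h B /nbhs_ballP[e /= e0 he]].
  have [s [As ts]] := cA _ (nbhsx_ballx t e e0); exists s => //.
have [s As ts] := h e e0; exists s; split => //; exact: he.
Qed.

Lemma closure_on_domain M (A : set R) : on_domain M A -> on_domain M (closure A).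
Proof.
case: M => //= oA x; apply/propext.
have oA' t (k : int) : A (t + k%:~R) <-> A t.
  by rewrite -(@on_domain_eqM R Torus _ A t (t + k%:~R))//; exists k.
split => /closureP_dist h; apply/closureP_dist => e e0; have [s As xs] := h e e0.
- exists (s + (- 1)%:~R); first exact/oA'.
  by rewrite intrN opprD opprK addrA (addrAC x).
- exists (s + 1%:~R); first exact/oA'.
  by have -> : x + 1 - (s + 1%:~R) = x - s by ring.
Qed.

Lemma BV_UK_fin M K u : BV M u -> (weighted_tv M (UK M K) (fun=> 1%R) u < +oo)%E.
Proof.
move=> [hu V]; apply: le_lt_trans V; apply: weighted_tv_mono => //; exact: UK_interior.
Qed.

(** Near [x] the variation is the jump at [x] plus the variation in a punctured neighbourhood, which
    [small_tv] makes small. *)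
Lemma local_tv M u x (e : R) : BV M u -> interior_dom M x -> 0 < e -> exists2 r0 : R, 0 < r0 &
  forall phi, C1c M (interior_dom M) phi -> (forall t, `|phi t| <= 1) ->
    (forall t, phi t != 0 -> dist_dom M x t <= r0) -> pair M u phi <= jump M u x + e.
Proof.
move=> bv ix e0; have [hu _] := bv.
have [|r0 r00 hr0] := @small_tv R M [:: x] u hu (BV_UK_fin [:: x] bv) _ e e0.
  by move=> y; rewrite inE => /eqP ->; exact: interior_carrier.
exists (r0 / 2) => [|phi hphi phi1 sphi]; first by rewrite divr_gt0.
pose U := interior_dom M `&` [set t | dist_dom M x t < r0].
have Ui : U `<=` interior_dom M by move=> t [].
have hU : C1c M U phi.
  have [op d1 c1 sp] := hphi; split => // t ct; split; first exact: sp.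
  have : closed [set t | 0 <= dist_dom M x t <= r0 / 2] by exact: closed_dist_itv.
  move=> cl; have : [set t | 0 <= dist_dom M x t <= r0 / 2] t.
    apply: cl; move: ct; apply: closure_subset => s /= sp'.
    by rewrite dist_dom_ge0 sphi.
  by rewrite /= => /andP[_]; rlra.
rewrite -lee_fin; apply: le_trans (weighted_tv_ge (w := fun=> 1) hu hU _) _ => //.
apply: le_trans (weighted_tv_point_le (w := fun=> 1) hu ix (BV_traces bv ix) _ Ui) _ => //.
rewrite mul1r (addrC (jump M u x)) EFinD leeD2r//.
apply: weighted_tv_le => // psi hpsi psi1; rewrite lee_fin.
have sub : U `&` [set t | 0 < dist_dom M x t] `<=` UK M [:: x].
  by move=> t [[it _] dt]; apply/UK_cons; split => //; rewrite UK_nil.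
apply: hr0; first exact: C1c_sub sub hpsi.
- move=> t; have [Ut|nU] := pselect ((U `&` [set t | 0 < dist_dom M x t]) t); first exact: psi1.
  by rewrite (C1c_supp hpsi nU) normr0.
- move=> t pt; exists x; first exact: mem_head.
  apply: contrapT => h; move/eqP: pt; apply; apply: (C1c_supp hpsi) => -[[_ h1] _]; exact: h.
Qed.

(* [phi] is cut off around the points of [s] one after the other. *)
Lemma peel M u (s : seq R) (rad E : R -> R) : BV M u ->
  (forall x, x \in s -> [/\ 0 < rad x, M = Torus -> 2 * rad x < 1 / 2 &
    forall phi, C1c M (interior_dom M) phi -> (forall t, `|phi t| <= 1) ->
    (forall t, phi t != 0 -> dist_dom M x t <= 2 * rad x) -> pair M u phi <= E x]) ->
  forall phi, C1c M (interior_dom M) phi -> (forall t, `|phi t| <= 1) ->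
  exists phi', [/\ C1c M (interior_dom M) phi', forall t, `|phi' t| <= 1,
    forall t, phi' t != 0 -> phi t != 0 /\ forall x, x \in s -> rad x <= dist_dom M x t &
    pair M u phi <= pair M u phi' + \sum_(x <- s) E x].
Proof.
move=> [hu _]; elim: s => [_ phi hphi phi1|x s ih hs phi hphi phi1].
  by exists phi; split => //; rewrite big_nil addr0.
have [|phi' [h1 h2 h3 h4]] := ih _ phi hphi phi1; first by move=> y ys; apply: hs; rewrite inE ys orbT.
have [r0 rT hx] := hs x (mem_head _ _).
have [[cb ob] b1 b2 b01 _] := bumpP x r0 rT.
have [c2 e2] := C1B (C1_cst 1).1 cb.
have hq : C1c M (interior_dom M) (fun t => phi' t * (1 - bump M x (rad x) t)).
  by apply: C1cM => //; move: ob; case: (M) => //= h t; rewrite h.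
have hb : C1c M (interior_dom M) (fun t => phi' t * bump M x (rad x) t) by exact: C1cM.
exists (fun t => phi' t * (1 - bump M x (rad x) t)); split => //.
- move=> t; rewrite normrM mulr_ile1//; have /andP[k1 k2] := b01 t.
  by rewrite ger0_norm ?subr_ge0// gerBl.
- move=> t; rewrite mulf_eq0 negb_or => /andP[pt bt]; have [k1 k2] := h3 t pt; split => // y.
  rewrite inE => /predU1P[->|/k2//]; rewrite leNgt; apply/negP => h.
  by move: bt; rewrite b1 ?subrr ?eqxx// ltW.
- rewrite big_cons addrA; apply: le_trans h4 _; rewrite lerD2r.
  have -> : phi' = (fun t => phi' t * (1 - bump M x (rad x) t) + phi' t * bump M x (rad x) t).
    by apply/funext => t; ring.
  rewrite pairD//; [|exact: C1c_C1 hq|exact: C1c_C1 hb].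
  rewrite (_ : (fun t => (_ + _) * (1 - _)) = (fun t => phi' t * (1 - bump M x (rad x) t))); last first.
    by apply/funext => t; ring.
  rewrite lerD2l; apply: hx => //.
    move=> t; rewrite normrM mulr_ile1//; have /andP[k1 k2] := b01 t.
    by rewrite ger0_norm.
  move=> t; rewrite mulf_eq0 negb_or => /andP[_ bt]; rewrite leNgt; apply/negP => h.
  by move: bt; rewrite (b2 t (ltW h)).1 eqxx.
Qed.

(** Let [U] be any competitor in the infimum. The part of the support of [phi] outside [U] lies in
    [A], and by compactness finitely many small balls around points of [A] cover it. Cutting [phi]
    off on these balls leaves a test function supported in [U], and each ball costs little more than
    the jump at its centre. *)
Lemma weighted_tv_cover M u (A : set R) : BV M u -> on_domain M A -> A `<=` interior_dom M ->
  countable (A `&` reps M) ->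
  (weighted_tv M (interior_dom M) (fun=> 1%R) u <=
   tv_measure M u (interior_dom M `\` A) + esum (A `&` reps M) (fun x => (jump M u x)%:E))%E.
Proof.
move=> bv oA Ai cA; have [hu V] := bv.
set D := esum _ _.
have D0 : (0 <= D)%E by apply: esum_ge0 => x _; rewrite lee_fin jump_ge0.
have T0 : (0 <= tv_measure M u (interior_dom M `\` A))%E.
  by apply: le_ereal_inf_tmp => _ [U _ <-]; exact: weighted_tv_ge0.
have [Dfin|] := boolP (D \is a fin_num); last first.
  by rewrite ge0_fin_numE// -leNgt leye_eq => /eqP ->; rewrite addey ?leey// gt_eqF// (lt_le_trans _ T0)// ltNy0.
rewrite -leeBlDr//; apply: le_ereal_inf_tmp => _ [U [oU dU AU Ui] <-]; rewrite leeBlDr//.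
apply: weighted_tv_le => // phi hphi phi1.
have phi1' t : `|phi t| <= 1.
  by have [it|nt] := pselect (interior_dom M t); [exact: phi1|rewrite (C1c_supp hphi nt) normr0].
apply/lee_addgt0Pr => e e0.
(* The enumeration allots the error e 2^-(n+1) to the n-th point: whatever finite subcover
   compactness returns, the errors sum to at most [e]. *)
have /countable_injP[f finj] := cA.
have /choice[rad hrad] : forall x, exists r : R, (A `&` reps M) x -> [/\ 0 < r, M = Torus -> 2 * r < 1 / 2 &
    forall phi, C1c M (interior_dom M) phi -> (forall t, `|phi t| <= 1) ->
    (forall t, phi t != 0 -> dist_dom M x t <= 2 * r) -> pair M u phi <= jump M u x + e * 2 ^- (f x).+1].
  move=> x; have [[Ax rx]|nA] := pselect ((A `&` reps M) x); last by exists 1 => /nA.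
  have d0 : 0 < e * 2 ^- (f x).+1 by rewrite mulr_gt0// invr_gt0 exprn_gt0.
  have [r r0 hr] := local_tv bv (Ai x Ax) d0.
  exists (Num.min (1 / 8) (r / 2)) => _; split.
  - by rewrite lt_min !divr_gt0.
  - have : Num.min (1 / 8) (r / 2) <= 1 / 8 by rewrite ge_min lexx.
    by move: (Num.min _ _) => m hm _; rlra.
  - move=> psi hpsi psi1 sp; apply: hr => // t pt; apply: le_trans (sp t pt) _.
    have : Num.min (1 / 8) (r / 2) <= r / 2 by rewrite ge_min lexx orbT.
    by move: (Num.min _ _) => m hm; rlra.
have [op _ _ supp] := hphi.
pose S := closure [set x | phi x != 0].
have oS : on_domain M S.
  by apply: closure_on_domain; case: (M) op => //= h x; rewrite h.
have [a [b [ce ab]]] := cell_bounded M.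
(* On the circle the support is periodic; its part in one cell is compact and represents all of
   it. *)
pose C := S `&` ~` U `&` cell M.
have cC : compact C.
  rewrite /C ce setIC; apply: compact_closedI; first exact: segment_compact.
  by apply: closedI; [exact: closed_closure|exact: open_closedC].
have CA : C `<=` A.
  by move=> t [[St nU] _]; apply: contrapT => nA; apply: nU; apply: AU; split => //; exact: supp.
have op_ x : (A `&` reps M) x -> open [set t | dist_dom M x t < rad x].
  move=> _; rewrite (_ : [set t | _] = dist_dom M x @^-1` [set s | s < rad x])//.
  by apply: open_comp; [move=> t _; exact: dist_dom_cont|exact: open_lt].
have cover_ : C `<=` \bigcup_(x in A `&` reps M) [set t | dist_dom M x t < rad x].
  move=> t /[dup] Ct /CA At; have [x [rx tx]] := carrier_reps (interior_carrier (Ai t At)).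
  have Ax : A x by rewrite -(on_domain_eqM oA tx).
  exists x => //=; rewrite (dist_dom_eqM _ tx) dist_domE near_rep ?subrr ?normr0//.
  by have [] := hrad x (conj Ax rx).
move: cC; rewrite compact_cover => /(_ _ _ _ op_ cover_)[s' ss' Cs].
pose s : seq R := finmap.enum_fset s'.
have sA x : x \in s -> (A `&` reps M) x by move=> xs; apply/set_mem; exact: ss'.
have us : uniq s by exact: finmap.fset_uniq.
have [|psi [h1 h2 h3 h4]] := @peel M u s rad (fun x => jump M u x + e * 2 ^- (f x).+1) bv _ phi hphi phi1'.
  by move=> x /sA/hrad.
have hU : C1c M U psi.
  pose Z := S `&` [set t | forall x, x \in s -> rad x <= dist_dom M x t].
  have cZ : closed Z.
    apply: closedI; first exact: closed_closure.
    rewrite (_ : [set t | _] = \bigcap_(x in [set x | x \in s]) (dist_dom M x @^-1` [set t | rad x <= t])).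
      apply: closed_bigI => x _; apply: closed_comp; last exact: closed_ge.
      by move=> t _; exact: dist_dom_cont.
    by apply/seteqP; split => t /= h x xs; exact: h.
  have [opsi d1 c1 _] := h1; split => // t ct.
  have [St hs] : Z t.
    apply: cZ; move: ct; apply: closure_subset => y /= /h3[py hy]; split => //.
    exact: subset_closure.
  apply: contrapT => nU; have it := supp t St.
  have [t' [ct' tt']] := carrier_cell (interior_carrier it).
  have Ct : C t'.
    split => //; split; first by rewrite -(on_domain_eqM oS tt').
    by move=> Ut'; apply: nU; rewrite (on_domain_eqM dU tt').
  have [x xs] := Cs t' Ct; rewrite /= -(dist_dom_eqM _ tt') ltNge => /negP; apply.
  exact: hs.
have hV : ((pair M u psi)%:E <= weighted_tv M U (fun=> 1%R) u)%E.
  by apply: (weighted_tv_ge (w := fun=> 1) hu hU) => t _; exact: h2.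
apply: le_trans (_ : (pair M u psi + (\sum_(x <- s) jump M u x + e))%:E <= _)%E.
  rewrite lee_fin; apply: le_trans h4 _; rewrite lerD2l big_split/= lerD2l.
  rewrite -mulr_sumr ger_pMr//.
  have -> : \sum_(x <- s) (2 : R) ^- (f x).+1 = \sum_(i <- map f s) 2 ^- i.+1 by rewrite big_map.
  apply: sum_half_powers; rewrite map_inj_in_uniq// => x y xs ys.
  by apply: finj; apply/mem_set; exact: sA.
rewrite EFinD EFinD addeA leeD2r// leeD//.
exact: esum_seq_le.
Qed.
End total_variation.

(** * Estimates for weights equal to 1 off small balls *)

Section weighted_estimates.
Context {R : realType}.
Local Notation mu := (@lebesgue_measure R).
Implicit Types (M : domain R) (f g h u w phi psi : R -> R) (a b c d p q r s t x y z : R) (U : set R)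
  (K : seq R).

Lemma cutoff M K r : 0 < r -> (M = Torus -> 2 * r < 1 / 2) -> exists chi : R -> R,
  [/\ C1 chi, on_domain M chi, forall t, 0 <= chi t <= 1,
    forall t, chi t != 0 -> forall x, x \in K -> r < dist_dom M x t &
    forall t, chi t != 1 -> exists2 x, x \in K & dist_dom M x t < 2 * r].
Proof.
move=> r0 rT; elim: K => [|x K [chi [c1 oc c01 c0 cn1]]].
  exists (fun=> 1); split => //; first exact: (C1_cst 1).1.
  - by case: M {rT}.
  - by move=> t; rewrite ler01 lexx.
  - by move=> t; rewrite eqxx.
have [[cb ob] b1 b2 b01 _] := bumpP x r0 rT.
exists (fun t => chi t * (1 - bump M x r t)); split.
- by apply: (C1M c1 _).1; exact: (C1B (C1_cst 1).1 cb).1.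
- by move: oc ob; case: (M) => //= h1 h2 t; rewrite h1 h2.
- move=> t; have /andP[h1 h2] := c01 t; have /andP[h3 h4] := b01 t.
  by rewrite mulr_ge0 ?subr_ge0//= mulr_ile1// ?subr_ge0// gerBl.
- move=> t; rewrite mulf_eq0 negb_or => /andP[h1 h2] y; rewrite inE => /predU1P[->|yK]; last exact: c0.
  by rewrite ltNge; apply/negP => h; move: h2; rewrite b1// subrr eqxx.
- move=> t h; have [e|ne] := eqVneq (chi t) 1; last first.
    by have [y yK yt] := cn1 t ne; exists y => //; rewrite inE yK orbT.
  exists x; first exact: mem_head.
  by rewrite ltNge; apply/negP => h1; move: h; rewrite e (b2 t h1).1 subr0 mulr1 eqxx.
Qed.

(** A cutoff splits a test function off [K]. Away from [K] the weight is 1, so that part is an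
    ordinary test function; the part near [K] is at most [B ^+ 2], and dividing by [B2] lets
    [small_tv] apply. The radius depends on [B] but not on [w]. *)
Lemma weighted_tv_upper M u K (B d : R) : BV M u -> (forall x, x \in K -> carrier M x) ->
  0 < d -> exists2 r0 : R, 0 < r0 & forall r w, 0 < r <= r0 ->
    (forall t, interior_dom M t -> (forall x, x \in K -> r <= dist_dom M x t) -> w t = 1) ->
    (forall t, interior_dom M t -> `|w t| <= B) ->
    (weighted_tv M (interior_dom M) (fun x => (w x ^+ 2)%R) u <=
     weighted_tv M (UK M K) (fun=> 1%R) u + (\sum_(x <- K) w x ^+ 2 * jump M u x + d)%:E)%E.
Proof.
move=> bv cK d0; have [hu _] := bv.
pose B2 := B ^+ 2 + 1.
have B0 : 0 < B2 by rewrite /B2 ltr_wpDl ?sqr_ge0.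
have dB : 0 < d / B2 by rewrite divr_gt0.
have [r0 r00 hr0] := small_tv hu (BV_UK_fin K bv) cK dB.
exists (Num.min (1 / 8) (r0 / 2)) => [|r w /andP[rp]]; first by rewrite lt_min !divr_gt0.
rewrite le_min => /andP[r8 rr0] w1 wB.
have tK x : x \in K -> interior_dom M x -> has_traces u x by move=> _; exact: BV_traces.
apply: le_trans (weighted_tv_UK_le (w := fun x => w x ^+ 2) hu cK tK _) _ => [t|]; first exact: sqr_ge0.
rewrite EFinD [((\sum_(x <- K) _)%:E + _)%E]addeC addeA leeD2r//.
apply: weighted_tv_le => // phi hphi phiw.
have [|chi [c1 oc c01 c0 cn1]] := @cutoff M K r rp; first by move=> _; rlra.
have h1 : C1c M (UK M K) (fun t => phi t * chi t) by exact: C1cM.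
have h2 : C1c M (UK M K) (fun t => phi t * (1 - chi t)).
  apply: C1cM => //; first exact: (C1B (C1_cst 1).1 c1).1.
  by move: oc; case: (M) => //= h t; rewrite h.
have phi0 t : ~ UK M K t -> phi t = 0 by exact: C1c_supp hphi.
have e1 : ((pair M u (fun t => phi t * chi t))%:E <= weighted_tv M (UK M K) (fun=> 1%R) u)%E.
  apply: (weighted_tv_ge (w := fun=> 1) hu h1) => t Ut.
  have [->|ct] := eqVneq (chi t) 0; first by rewrite mulr0 normr0.
  have it := UK_interior Ut.
  have := phiw t Ut; rewrite w1//; last by move=> x xK; apply: ltW; exact: c0 ct x xK.
  rewrite expr1n => p1; have /andP[k1 k2] := c01 t.
  by rewrite normrM mulr_ile1// ger0_norm.
have e2 : pair M u (fun t => phi t * (1 - chi t)) <= d.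
  have := hr0 (fun t => B2^-1 * (phi t * (1 - chi t))) (C1cZ _ h2).
  rewrite pairZ//; last exact: C1c_C1 h2.
  rewrite mulrC ler_pdivrMr// divfK ?gt_eqF// => -> // t.
    have [Ut|nU] := pselect (UK M K t); last by rewrite (phi0 t nU) mul0r mulr0 normr0.
    have it := UK_interior Ut; have /andP[k1 k2] := c01 t.
    rewrite normrM gtr0_norm ?invr_gt0// mulrC ler_pdivrMr// mul1r.
    apply: (@le_trans _ _ `|phi t|).
      by rewrite normrM ler_piMr// ger0_norm ?subr_ge0// gerBl.
    apply: le_trans (phiw t Ut) _; rewrite /B2.
    rewrite (@le_trans _ _ (B ^+ 2))// ?lerDl//.
    by rewrite -[w t ^+ 2]real_normK ?num_real// ler_sqr ?nnegrE ?wB//; apply: le_trans (wB t it).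
  rewrite mulf_eq0 negb_or => /andP[_]; rewrite mulf_eq0 negb_or subr_eq0 => /andP[_ hc].
  have [|x xK xt] := cn1 t; first by rewrite eq_sym.
  by exists x => //; rlra.
have -> : phi = (fun t => phi t * chi t + phi t * (1 - chi t)) by apply/funext => t; ring.
rewrite pairD//; [|exact: C1c_C1 h1|exact: C1c_C1 h2].
by rewrite EFinD leeD// lee_fin.
Qed.

(** An almost maximizing test function off [K] vanishes near [K]; for small [r] it only meets points
    where [w = 1]. By continuity of [w] bumps of height almost [w x ^+ 2] can be added at the
    points. The radius is fixed before [w]. *)
Lemma weighted_tv_lower M u K (d : R) : BV M u -> uniq K -> (forall x, x \in K -> reps M x) ->
  0 < d -> exists2 r0 : R, 0 < r0 & forall r w, 0 < r <= r0 -> continuous w ->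
    (forall t, interior_dom M t -> (forall x, x \in K -> r <= dist_dom M x t) -> w t = 1) ->
    on_domain M w ->
    (weighted_tv M (UK M K) (fun=> 1%R) u + (\sum_(x <- K) w x ^+ 2 * jump M u x - d)%:E <=
     weighted_tv M (interior_dom M) (fun x => (w x ^+ 2)%R) u)%E.
Proof.
move=> bv uK rK d0; have [hu _] := bv.
have Vfin := BV_UK_fin K bv.
have V0 : (0 <= weighted_tv M (UK M K) (fun=> 1%R) u)%E by exact: weighted_tv_ge0.
have [V Ve] : exists V : R, weighted_tv M (UK M K) (fun=> 1%R) u = V%:E.
  by exists (fine (weighted_tv M (UK M K) (fun=> 1%R) u)); rewrite fineK// ge0_fin_numE.
have d2 : 0 < d / 2 by rewrite divr_gt0.
have : ((V - d / 2)%:E < weighted_tv M (UK M K) (fun=> 1%R) u)%E.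
  by rewrite Ve lte_fin; rlra.
move=> /(weighted_tv_gtP hu)[psi [hpsi psi1 hp]].
have [r0 r00 hr0] := C1c_UK_gap hpsi.
exists r0 => // r w /andP[rp rr0] cw w1 ow.
pose Ki := [seq x <- K | x \in interior_dom M].
have iKi x : x \in Ki -> x \in K /\ interior_dom M x.
  by rewrite mem_filter => /andP[/set_mem k1 k2].
pose J := \sum_(x <- K) jump M u x.
have J0 : 0 <= J by apply: sumr_ge0 => x _; exact: jump_ge0.
pose e := d / 2 / (J + 1).
have J1 : 0 < J + 1 by rewrite ltr_wpDl.
have e0 : 0 < e by rewrite divr_gt0.
pose h x := Num.max 0 (w x ^+ 2 - e).
have h0 x : 0 <= h x by rewrite le_max lexx.
have h1 x : w x ^+ 2 - e <= h x by rewrite le_max lexx orbT.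
have sKi : separated M Ki.
  by apply: separated_reps; [exact: filter_uniq|move=> x /iKi[/rK]].
have W0 t : 0 <= w t ^+ 2 by exact: sqr_ge0.
have W2 : (weighted_tv M (UK M Ki) (fun x => (w x ^+ 2)%R) u + (\sum_(x <- Ki) h x * jump M u x)%:E <=
    weighted_tv M (interior_dom M) (fun x => (w x ^+ 2)%R) u)%E.
  apply: (weighted_tv_UK_ge hu sKi _ W0) => x /iKi[xK ix].
  split; [exact: ix|exact: (BV_traces bv ix)|exact: h0|].
  have cw2 : {for x, continuous (fun t => w t ^+ 2)}.
    have -> : (fun t => w t ^+ 2) = (fun t => w t * w t) by apply/funext => t; rewrite expr2.
    by apply: cvgM; exact: cw.
  have [rho rho0 hrho] := cvg_point cw2 e0.
  exists rho => // t; rewrite dist_domE => xt; rewrite (on_domain_eqM ow (eqM_rep M x t)).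
  have := hrho _ xt; rewrite ler_norml => /andP[k _].
  by rewrite /h ge_max sqr_ge0/=; rlra.
have W1 : ((pair M u psi)%:E <= weighted_tv M (UK M Ki) (fun x => (w x ^+ 2)%R) u)%E.
  have hpsi' : C1c M (UK M Ki) psi by apply: C1c_sub hpsi; apply: UK_sub => x /iKi[].
  apply: (weighted_tv_ge (w := fun x => w x ^+ 2) hu hpsi') => t Ut.
  have [Ut'|nU] := pselect (UK M K t); last by rewrite (C1c_supp hpsi nU) normr0.
  have [hx|] := pselect (forall x, x \in K -> r <= dist_dom M x t).
    by rewrite w1 ?expr1n; [exact: psi1|exact: UK_interior Ut|].
  move=> /existsNP[x /not_implyP[xK /negP]]; rewrite -ltNge => xt.
  by rewrite (hr0 x t xK (lt_le_trans xt rr0)) normr0.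
have E1 : \sum_(x <- Ki) h x * jump M u x = \sum_(x <- K) h x * jump M u x.
  rewrite big_filter big_mkcond /=; apply: eq_bigr => x _; case: ifP => // nx.
  by rewrite /jump nx mulr0.
have E2 : \sum_(x <- K) w x ^+ 2 * jump M u x - d / 2 <= \sum_(x <- K) h x * jump M u x.
  apply: (@le_trans _ _ (\sum_(x <- K) (w x ^+ 2 - e) * jump M u x)); last first.
    by apply: ler_sum => x _; rewrite ler_wpM2r// jump_ge0.
  under [leRHS]eq_bigr do rewrite mulrBl.
  rewrite sumrB -mulr_sumr lerD2l lerN2 -/J /e mulrAC ler_pdivrMr//.
  by rewrite ler_wpM2l ?lerDl// ltW.
apply: le_trans W2; rewrite E1 Ve -EFinD.
apply: (@le_trans _ _ (pair M u psi + \sum_(x <- K) h x * jump M u x)%:E); last by rewrite EFinD leeD2r.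
rewrite lee_fin; move: hp E2; move: (pair _ _ _) (\sum_(x <- K) h x * _) (\sum_(x <- K) _) => z1 z2 z3; rlra.
Qed.
End weighted_estimates.

(** * The recovery sequence *)

Section recovery_sequence.
Context {R : realType}.
Local Notation mu := (@lebesgue_measure R).
Implicit Types (M : domain R) (w u : R -> R) (d e r s t x y : R) (K : seq R) (Xi : R -> set R).

Lemma dist_domxx M x : dist_dom M x x = 0.
Proof. by rewrite dist_domE near_rep subrr ?normr0. Qed.

Lemma dist_dom_eqM2 M x y t : eqM M x y -> dist_dom M x t = dist_dom M y t.
Proof. by move=> h; rewrite dist_dom_sym (dist_dom_eqM _ h) dist_dom_sym. Qed.

(** Total boundedness, with net points on the graph itself. The near-covering form of compactness is
    applied to the filter of finite lists directed by inclusion. *)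
Lemma graph_net M Xi d : compact_graph M Xi -> 0 < d -> exists Z : seq (R * R),
  (forall z, z \in Z -> graph M Xi z) /\
  forall x y, cell M x -> Xi x y -> exists z, [/\ z \in Z, dist_dom M x z.1 < d & `|y - z.2| < d].
Proof.
move=> [_ _ /compact_near_coveringP cG] d0.
pose Fl : set_system (seq (R * R)) := fun P => exists2 s0 : seq (R * R),
  (forall z : R * R, z \in s0 -> graph M Xi z) &
  forall s : seq (R * R), (forall z : R * R, z \in s -> graph M Xi z) -> {subset s0 <= s} -> P s.
have FF : Filter Fl.
  split.
  - by exists [::].
  - move=> P Q [s1 g1 h1] [s2 g2 h2]; exists (s1 ++ s2).
      by move=> z; rewrite mem_cat => /orP[/g1|/g2].
    by move=> s hs sub; split; [apply: h1 => // z zs|apply: h2 => // z zs]; apply: sub; rewrite mem_cat zs ?orbT.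
  - by move=> P Q PQ [s0 g0 h0]; exists s0 => // s hs /h0 h; apply: PQ; exact: h.
have [|s0 g0 h0] := cG _ Fl (fun Z p => exists2 z, z \in Z & ball z d p) FF.
  move=> p gp; exists (ball p d, [set s : seq (R * R) | p \in s]); first split => /=.
  - exact: nbhsx_ballx.
  - exists [:: p]; first by move=> z; rewrite inE => /eqP ->.
    by move=> s _ sub; apply: sub; rewrite inE.
  - by move=> [q s] [/= h1 h2]; exists p.
exists s0; split => // x y cx Xy.
have [z zs [h1 h2]] := h0 s0 g0 (fun _ h => h) (x, y) (conj cx Xy).
exists z; split => //; last by rewrite distrC.
exact: le_lt_trans (dist_dom_le x (eqM_refl M z.1)) h1.
Qed.

Lemma dist_graph_le M w Xi d :
  (forall x, cell M x -> exists x' y', [/\ cell M x', Xi x' y' & dist_dom M x x' + `|w x - y'| <= d]) ->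
  (forall x y, cell M x -> Xi x y -> exists x', cell M x' /\ dist_dom M x' x + `|w x' - y| <= d) ->
  (dist_graph M (graph_of w) Xi <= d%:E)%E.
Proof.
move=> h1 h2; rewrite /dist_graph /hausdorff_dist ge_max; apply/andP; split; apply: ge_ereal_sup.
- move=> _ [[x y] [/= cx ->] <-]; have [x' [y' [cx' Xy h]]] := h1 x cx.
  apply: ge_ereal_inf; exists (dist_prod M (x, w x) (x', y'))%:E; first by exists (x', y').
  by rewrite lee_fin; exact: (le_trans (dist_prod_le M (x, w x) (x', y')) h).
- move=> _ [[x y] [/= cx Xy] <-]; have [x' [cx' h]] := h2 x y cx Xy.
  apply: ge_ereal_inf; exists (dist_prod M (x', w x') (x, y))%:E; first by exists (x', w x').
  by rewrite lee_fin; exact: (le_trans (dist_prod_le M (x', w x') (x, y)) h).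
Qed.

Lemma dist_graph_ge0 M w Xi : (0 <= dist_graph M (graph_of w) Xi)%E.
Proof.
rewrite /dist_graph /hausdorff_dist le_max; apply/orP; left.
have [a [b [E ab]]] := cell_bounded M.
apply: (@le_trans _ _ (ereal_inf [set (dist_prod M (a, w a) y)%:E | y in graph M Xi])).
  by apply: le_ereal_inf_tmp => _ [y _ <-]; rewrite lee_fin sqrtr_ge0.
apply: ereal_sup_ubound; exists (a, w a) => //; split => //=.
by rewrite E /= in_itv /= lexx ltW.
Qed.

Lemma graph_cvg_le M (w : R -> R -> R) Xi :
  (forall d, 0 < d -> \forall eps \near (0 : R)^'+, (dist_graph M (graph_of (w eps)) Xi <= d%:E)%E) ->
  graph_cvg M w Xi.
Proof.
move=> h; have fn eps d : (dist_graph M (graph_of (w eps)) Xi <= d%:E)%E ->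
    dist_graph M (graph_of (w eps)) Xi \is a fin_num.
  by move=> hd; rewrite ge0_fin_numE ?dist_graph_ge0//; apply: le_lt_trans hd (ltry _).
apply/fine_cvgP; split; first by apply: filterS (h 1 ltr01) => eps; exact: fn.
apply/cvgrPdist_le => /= d d0; apply: filterS (h d d0) => eps hd.
rewrite sub0r normrN ger0_norm ?fine_ge0 ?dist_graph_ge0//.
by rewrite -lee_fin fineK// (fn _ _ hd).
Qed.

Lemma esum_le_seq (S : set R) (f : R -> R) (b : \bar R) :
  (forall s : seq R, uniq s -> (forall x, x \in s -> S x) -> ((\sum_(x <- s) f x)%:E <= b)%E) ->
  (esum S (fun x => (f x)%:E) <= b)%E.
Proof.
move=> h; rewrite leNgt; apply/negP => /esum_gt[s [us hs]].
by rewrite ltNge h.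
Qed.

Lemma jumps_le M K u : BV M u -> uniq K -> (forall x, x \in K -> reps M x) ->
  (weighted_tv M (UK M K) (fun=> 1%R) u + (\sum_(x <- K) jump M u x)%:E <=
   weighted_tv M (interior_dom M) (fun=> 1%R) u)%E.
Proof.
move=> bv uK rK; have [hu _] := bv.
pose Ki := [seq x <- K | x \in interior_dom M].
have iKi x : x \in Ki -> x \in K /\ interior_dom M x.
  by rewrite mem_filter => /andP[/set_mem k1 k2].
have sKi : separated M Ki.
  by apply: separated_reps; [exact: filter_uniq|move=> x /iKi[/rK]].
have := @weighted_tv_UK_ge R M Ki (fun=> 1) u (fun=> 1) hu sKi _ (fun _ => ler01).
move=> /(_ _) h; apply: le_trans (h _); last first.
  move=> x /iKi[xK ix]; split; [exact: ix|exact: (BV_traces bv ix)|exact: ler01|].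
  by exists 1.
apply: leeD.
  by apply: weighted_tv_mono => //; apply: UK_sub => x /iKi[].
rewrite lee_fin big_filter [leRHS]big_mkcond /=; apply: ler_sum => x _.
by case: ifPn => [_|nx]; [rewrite mul1r|rewrite /jump (negbTE nx)].
Qed.

(* The best quality [d] reachable at scale [eps] tends to 0, and [w eps] is chosen to be within
   [eps] of it. *)
Lemma diagonal (T : Type) (t0 : T) (P : R -> R -> T -> Prop) :
  (forall d d' eps (w : T), d <= d' -> P d eps w -> P d' eps w) ->
  (forall d, 0 < d -> \forall eps \near (0 : R)^'+, exists w : T, P d eps w) ->
  exists w : R -> T, (forall eps, w eps = t0 \/ exists d, P d eps (w eps)) /\
    forall d, 0 < d -> \forall eps \near (0 : R)^'+, P d eps (w eps).
Proof.
move=> mono h.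
pose I eps := [set d | 0 < d /\ exists w : T, P d eps w].
have hI eps : I eps !=set0 -> has_inf (I eps).
  by move=> I0; split => //; exists 0 => d [/ltW].
(* Where no quality is reachable, or [eps] is not positive, the default [t0] is taken. *)
have /choice[w hw] : forall eps : R, exists w : T, (I eps !=set0 -> 0 < eps -> P (inf (I eps) + eps) eps w) /\
    (w = t0 \/ exists d, P d eps w).
  move=> eps; have [[I0 e0]|] := pselect (I eps !=set0 /\ 0 < eps); last first.
    by move=> n; exists t0; split; [move=> a b; exfalso; apply: n|left].
  have [d [d0 [w hw]] hd] := inf_adherent e0 (hI eps I0).
  by exists w; split; [move=> _ _; apply: mono hw; exact: ltW|right; exists d].
exists w; split; first by move=> eps; case: (hw eps).
move=> d d0; have d2 : 0 < d / 2 by rewrite divr_gt0.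
have near1 : \forall eps \near (0 : R)^'+, 0 < eps < d / 2 by apply/near_rightP; exists (d / 2).
apply: filterS (filterI near1 (h _ d2)) => eps [/andP[e0 e1] [w' hw']].
have I0 : I eps (d / 2) by split => //; exists w'.
apply: mono ((hw eps).1 (ex_intro _ _ I0) e0).
have : inf (I eps) <= d / 2 by apply: ge_inf => //; exists 0 => z [/ltW].
lra.
Qed.

Variables (M : domain R) (F : R -> R).
Hypotheses (F_cont : continuous F) (F_ge0 : forall t, 0 <= F t)
  (F_eq0 : forall t, F t = 0 <-> t = 1).
Variables (Xi : R -> set R) (u : R -> R).
Hypotheses (a0 : A0 M Xi) (bv : BV M u).

Let cG : compact_graph M Xi. Proof. by case: a0. Qed.
Let oXi : on_domain M Xi. Proof. by case: cG. Qed.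
Let iv : interval_valued M Xi. Proof. exact: A0_interval. Qed.

Definition tv_off : \bar R :=
  tv_measure M u (interior_dom M `\` (jump_set M u `&` exceptional M Xi)).
Definition jump_cost : \bar R :=
  esum (exceptional M Xi `&` reps M) (fun x => (jump M u x * xi_minus Xi x ^+ 2)%:E).

(** The gradient energy is bounded from above only: once the graphs converge, the lower bound comes
    from [sMM_liminf]. The last clause is void when [E0_sMM] is infinite. *)
Definition good (ts d eps : R) w : Prop := [/\ C1 w, on_domain M w,
  (dist_graph M (graph_of w) Xi <= d%:E)%E,
  exists2 om : R, weighted_tv M (interior_dom M) (fun x => (w x ^+ 2)%R) u = om%:E & `|om - ts| <= d &
  ((\int[mu]_(t in cell M) edens F eps w t)%:E <= E0_sMM M F Xi + d%:E)%E].

Lemma values_bounded : exists2 B : R, 1 <= B & forall x y, carrier M x -> Xi x y -> `|y| <= B.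
Proof.
have [Z [_ hZ]] := graph_net cG ltr01.
exists (1 + \sum_(z <- Z) `|z.2|); first by rewrite lerDl sumr_ge0.
move=> x y cx Xy; have [x' [cx' xx']] := carrier_cell cx.
have [|z [zZ _ h]] := hZ x' y cx'; first by rewrite -(on_domain_eqM oXi xx').
have -> : y = (y - z.2) + z.2 by ring.
apply: le_trans (ler_normD _ _) _; apply: lerD; first exact: ltW.
by rewrite (big_rem z)//= lerDl sumr_ge0.
Qed.

(** The values of [Xi] are bounded and the jumps sum to at most the total variation, so the terms
    involving [u] are finite; only [E0_sMM] can be infinite. *)
Lemma ts_fin : exists ts : R, exists tau S : R,
  [/\ tv_off = tau%:E, jump_cost = S%:E & ts = tau + S].
Proof.
have [hu V] := bv; have [B B1 hB] := values_bounded.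
have Vge0 : (0 <= weighted_tv M (interior_dom M) (fun=> 1%R) u)%E by exact: weighted_tv_ge0.
have [v Ve] : exists v : R, weighted_tv M (interior_dom M) (fun=> 1%R) u = v%:E.
  by exists (fine (weighted_tv M (interior_dom M) (fun=> 1%R) u)); rewrite fineK// ge0_fin_numE.
have T0 : (0 <= tv_off)%E by apply: le_ereal_inf_tmp => _ [U _ <-]; exact: weighted_tv_ge0.
have T1 : (tv_off <= v%:E)%E.
  rewrite -Ve -(UK_nil M); apply: tv_measure_le => //; by move=> t _ [].
have S0 : (0 <= jump_cost)%E.
  by apply: esum_ge0 => x _; rewrite lee_fin mulr_ge0 ?sqr_ge0// jump_ge0.
have S1 : (jump_cost <= (B ^+ 2 * v)%:E)%E.
  apply: esum_le_seq => s us hs; rewrite lee_fin.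
  have : \sum_(x <- s) jump M u x <= v.
    rewrite -lee_fin -Ve; apply: le_trans (jumps_le bv us _); last by move=> x /hs[].
    by rewrite leeDr// weighted_tv_ge0.
  move=> h; apply: (@le_trans _ _ (\sum_(x <- s) B ^+ 2 * jump M u x)); last first.
    by rewrite -mulr_sumr ler_wpM2l ?sqr_ge0.
  rewrite !big_seq; apply: ler_sum => x /hs[[cx _] _]; rewrite mulrC ler_wpM2r ?jump_ge0//.
  have [e /andP[h1 h2]] := iv cx; have h3 := le_trans h1 h2.
  have Xx : Xi x (xi_minus Xi x) by rewrite e /= in_itv/= lexx.
  rewrite -[xi_minus _ _ ^+ 2]real_normK ?num_real// ler_sqr ?nnegrE// ?(hB x)//.
  exact: le_trans ler01 B1.
exists (fine tv_off + fine jump_cost), (fine tv_off), (fine jump_cost); split => //.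
- by rewrite fineK// ge0_fin_numE// (le_lt_trans T1)// ltry.
- by rewrite fineK// ge0_fin_numE// (le_lt_trans S1)// ltry.
Qed.

(* [s1] carries almost all of the jumps on exceptional points, [s2] almost all of their cost, and
   [s3] the exceptional points of a net of the graph. *)
Lemma good_exists tau S d : tv_off = tau%:E -> jump_cost = S%:E -> 0 < d ->
  \forall eps \near (0 : R)^'+, exists w, good (tau + S) d eps w.
Proof.
move=> Te Se d0; have [hu V] := bv; have [B B1 hB] := values_bounded.
have d4 : 0 < d / 4 by rewrite divr_gt0.
have Vge0 : (0 <= weighted_tv M (interior_dom M) (fun=> 1%R) u)%E by exact: weighted_tv_ge0.
pose A := jump_set M u `&` exceptional M Xi.
have oA : on_domain M A.
  have jE x y : eqM M x y -> jump_set M u x = jump_set M u y.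
    by move=> h; rewrite /jump_set /= (jump_eqM hu h).
  have := exceptional_on_domain oXi; rewrite /A; case: (M) jE => //= jE oE x.
  by rewrite /setI /= oE (jE x (x + 1))//; exists 1.
have Ai : A `<=` interior_dom M.
  move=> x [jx _]; apply: contrapT => nx; move: jx.
  by rewrite /jump_set /jump /= memNset// ltxx.
have cA : countable (A `&` reps M).
  apply: sub_countable (A0_countable a0); apply: subset_card_le.
  by move=> x [[_ ex] rx].
have cov := weighted_tv_cover bv oA Ai cA.
set D := esum _ _ in cov.
have D0 : (0 <= D)%E by apply: esum_ge0 => x _; rewrite lee_fin jump_ge0.
have DV : (D <= weighted_tv M (interior_dom M) (fun=> 1%R) u)%E.
  apply: esum_le_seq => s us hs; apply: le_trans (jumps_le bv us _); last by move=> x /hs[].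
  by rewrite leeDr// weighted_tv_ge0.
have [dd De] : exists dd : R, D = dd%:E by exists (fine D); rewrite fineK// ge0_fin_numE// (le_lt_trans DV).
have [s1 [us1 hs1]] : exists s : seq R, [/\ uniq s, forall x, x \in s -> (A `&` reps M) x &
    ((dd - d / 4)%:E < (\sum_(x <- s) jump M u x)%:E)%E].
  by apply: esum_gt; rewrite -/D De lte_fin; lra.
rewrite lte_fin => Ds1.
have [s2 [us2 hs2]] : exists s : seq R, [/\ uniq s, forall x, x \in s -> (exceptional M Xi `&` reps M) x &
    ((S - d / 4)%:E < (\sum_(x <- s) jump M u x * xi_minus Xi x ^+ 2)%:E)%E].
  by apply: esum_gt; rewrite -/jump_cost Se lte_fin; lra.
rewrite lte_fin => Ss2.
have [Z [hZ netZ]] := graph_net cG d4.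
have /choice[xr hxr] : forall x, exists x', carrier M x -> reps M x' /\ eqM M x x'.
  move=> x; have [cx|nc] := pselect (carrier M x); last by exists x.
  by have [x' h] := carrier_reps cx; exists x'.
have hz z : z \in Z -> [/\ reps M (xr z.1), eqM M z.1 (xr z.1) & Xi (xr z.1) z.2].
  move=> /hZ[cz Xz]; have [r1 r2] := hxr z.1 (cell_carrier cz); split => //.
  by rewrite -(on_domain_eqM oXi r2).
pose L := [seq xr z.1 | z <- Z].
pose s3 := [seq x <- L | x \in exceptional M Xi].
pose K := undup (s1 ++ s2 ++ s3).
have uK : uniq K by exact: undup_uniq.
have hL x : x \in L -> reps M x by move=> /mapP[z zZ ->]; case: (hz z zZ).
have hK x : x \in K -> (exceptional M Xi `&` reps M) x.
  rewrite mem_undup !mem_cat => /or3P[/hs1[[_ ?] ?]//|/hs2//|].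
  by rewrite mem_filter => /andP[/set_mem ? /hL].
have sK1 : {subset s1 <= K} by move=> x xs; rewrite mem_undup !mem_cat xs.
have sK2 : {subset s2 <= K} by move=> x xs; rewrite mem_undup !mem_cat xs orbT.
have sK3 : {subset s3 <= K} by move=> x xs; rewrite mem_undup !mem_cat xs !orbT.
have rK x : x \in K -> reps M x by case/hK.
have cK x : x \in K -> carrier M x by move/rK/carrier_of_reps.
clearbody K.
have KX x : x \in K -> Xi x = `[xi_minus Xi x, xi_plus Xi x]%classic /\ xi_minus Xi x <= 1 <= xi_plus Xi x.
  by move=> /cK/iv.
have [|r1 r10 H1] := @recovery_exists R F F_cont F_ge0 F_eq0 M K (xi_minus Xi) (xi_plus Xi) d uK _ d0.
  by move=> x xK; have [_ /andP[]] := KX x xK; split => //; exact: rK.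
have [r2 r20 H2] := @weighted_tv_upper R M u K B (d / 4) bv cK d4.
have [r3 r30 H3] := @weighted_tv_lower R M u K (d / 4) bv uK rK d4.
have [|r4 r40 H4] := @sep_radius R M (K ++ L).
  by move=> x; rewrite mem_cat => /orP[/rK|/hL].
pose r := Num.min (Num.min r1 r2) (Num.min (Num.min r3 r4) (d / 4)).
have rp : 0 < r by rewrite !lt_min r10 r20 r30 r40.
have : r <= r by []. rewrite {2}/r !le_min => /andP[/andP[rr1 rr2] /andP[/andP[rr3 rr4] rd]].
clearbody r.
have [|e0 e00 He] := H1 r; first by rewrite rp.
apply/near_rightP; exists e0 => // eps heps.
have [w [cw ow wE [w1 w2 w3 w4]]] := He eps heps.
have wB t : interior_dom M t -> `|w t| <= B.
  move=> /interior_carrier ct; have [hx|] := pselect (forall x, x \in K -> r <= dist_dom M x t).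
    by rewrite (w1 t ct hx) normr1.
  move=> /existsNP[x /not_implyP[xK /negP]]; rewrite -ltNge => xt.
  by apply: (hB x) (cK x xK) _; rewrite (KX x xK).1 /= in_itv/=; exact: w2.
have w1i t : interior_dom M t -> (forall x, x \in K -> r <= dist_dom M x t) -> w t = 1.
  by move=> /interior_carrier; exact: w1.
(* At an endpoint [w] need not equal [xi_minus], but the jump is 0 there by convention. *)
have sumE : \sum_(x <- K) w x ^+ 2 * jump M u x = \sum_(x <- K) jump M u x * xi_minus Xi x ^+ 2.
  rewrite !big_seq; apply: eq_bigr => x xK; rewrite mulrC.
  have [ix|nx] := pselect (interior_dom M x); first by rewrite w3.
  by rewrite /jump memNset// !mul0r.
have h2 : 0 < r <= r2 by rewrite rp.
have h3 : 0 < r <= r3 by rewrite rp.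
have U1 := H2 r w h2 w1i wB; have L1 := H3 r w h3 (C1_cont cw) w1i ow.
move: U1 L1; rewrite sumE.
set W := weighted_tv M (interior_dom M) (fun x => (w x ^+ 2)%R) u; set VK := weighted_tv M (UK M K) _ _.
move=> U1 L1.
have VK0 : (0 <= VK)%E by exact: weighted_tv_ge0.
have [vk Vke] : exists vk : R, VK = vk%:E.
  by exists (fine VK); rewrite fineK// ge0_fin_numE//; exact: BV_UK_fin.
have W0 : (0 <= W)%E by apply: weighted_tv_ge0 => // t _; exact: sqr_ge0.
have [om We] : exists om : R, W = om%:E.
  exists (fine W); rewrite fineK// ge0_fin_numE//; apply: le_lt_trans U1 _.
  by rewrite Vke -EFinD ltry.
have TV : tau <= vk.
  rewrite -lee_fin -Te -Vke.
  apply: (tv_measure_le_UK hu cK (fun x _ ix => BV_traces bv ix)).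
  move=> x t xK jx it e; have xt : eqM M x t.
    by have := eqM_rep M x t; move: e; rewrite dist_domE => /eqP; rewrite normr_eq0 subr_eq0 => /eqP ->; exact: eqM_sym.
  by rewrite -/A -(on_domain_eqM oA xt); split; [|case: (hK x xK)].
(* The variation off [K] plus the jumps on [K] is at most the total variation, which the covering
   inequality bounds by [tau + dd]; and [K] carries all of [dd] but d/4. *)
have VT : vk <= tau + d / 4.
  have h1 := le_trans (jumps_le bv uK rK) cov; rewrite -/VK Vke -/tv_off Te De -!EFinD lee_fin in h1.
  have k2 := sum_subset_le us1 uK sK1 (jump_ge0 M u).
  by move: h1 k2 Ds1; move: (\sum_(x <- K) _) (\sum_(x <- s1) _) => z1 z2; lra.
have SK1 : \sum_(x <- K) jump M u x * xi_minus Xi x ^+ 2 <= S.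
  by rewrite -lee_fin -Se; exact: esum_seq_le.
have SK2 : S - d / 4 <= \sum_(x <- K) jump M u x * xi_minus Xi x ^+ 2.
  apply: le_trans (ltW Ss2) _; apply: sum_subset_le => // x.
  by rewrite mulr_ge0 ?sqr_ge0// jump_ge0.
rewrite We Vke -!EFinD !lee_fin in U1 L1.
exists w; split => //; last first.
- apply: le_trans (_ : (\sum_(x <- K) xcost F M Xi x + d)%:E <= _)%E; first by rewrite lee_fin.
  by rewrite EFinD leeD2r// E0_sMM_esum; exact: esum_seq_le.
- exists om => //; move: U1 L1 SK1 SK2 TV VT; move: (\sum_(x <- K) _) => z.
  by rewrite ler_norml => *; apply/andP; split; lra.
apply: dist_graph_le.
- move=> x cx; have [hx|] := pselect (forall x', x' \in K -> r <= dist_dom M x' x).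
    exists x, 1; split => //; last by rewrite (w1 x (cell_carrier cx) hx) subrr normr0 addr0 dist_domxx ltW.
    by have [-> h] := iv (cell_carrier cx); rewrite /= in_itv.
  move=> /existsNP[x' /not_implyP[xK /negP]]; rewrite -ltNge => xt.
  exists x', (w x); split; first exact: reps_cell (rK x' xK).
    by rewrite (KX x' xK).1 /= in_itv/=; apply: w2 => //; exact: cell_carrier.
  by rewrite subrr normr0 addr0 dist_dom_sym; lra.
- move=> x y cx Xy; have [z [zZ xz yz]] := netZ x y cx Xy.
  have [rz ez Xz] := hz z zZ; set q := xr z.1 in rz ez Xz.
  have qL : q \in L by apply/mapP; exists z.
  have qx : dist_dom M q x < d / 4 by rewrite -(dist_dom_eqM2 _ ez) dist_dom_sym.
  have [qK|nqK] := boolP (q \in K).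
    have [|t [ct qt wt]] := w4 q z.2 qK; first by move: Xz; rewrite {1}(KX q qK).1 /= in_itv.
    have [t' [ct' tt']] := carrier_cell ct; exists t'; split => //.
    rewrite -(on_domain_eqM ow tt') wt -(dist_dom_eqM2 _ tt').
    have := dist_dom_triangle M t q x; rewrite (dist_dom_sym M t q) (distrC z.2).
    by move: qt qx yz; lra.
  (* Exceptional points of the net were put into [K]. Above any other net point the only value is 1,
     which [w] takes there because [r] is below the distance from that point to [K]. *)
  have nq : ~ exceptional M Xi q.
    move=> eq; move/negP: nqK; apply; apply: sK3; rewrite mem_filter qL andbT.
    exact/mem_set.
  have Xq1 : Xi q = [set 1].
    by apply: contrapT => ne; apply: nq; split => //; exact: carrier_of_reps.
  have z1 : z.2 = 1 by move: Xz; rewrite Xq1.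
  exists q; split; first exact: reps_cell.
  rewrite (w1 q (carrier_of_reps rz)).
    by move: yz; rewrite z1 distrC; lra.
  move=> x' xK; apply: le_trans rr4 _; apply: H4; rewrite ?mem_cat ?xK ?qL ?orbT//.
  by apply: contraNneq nqK => <-.
Qed.

Lemma good_mono ts d d' eps w : d <= d' -> good ts d eps w -> good ts d' eps w.
Proof.
move=> dd [h1 h2 h3 [om h4 h5] h6]; split => //.
- by apply: le_trans h3 _; rewrite lee_fin.
- by exists om => //; exact: le_trans h5 dd.
- by apply: le_trans h6 _; rewrite leeD2l// lee_fin.
Qed.

Hypothesis F_infty : (0 < limf_einf (fun t => (F t)%:E) norm_infty)%E.
Variable sigma : R.
Hypothesis sigma_ge0 : 0 <= sigma.

Lemma limsup_inequality : exists w us : R -> R -> R,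
  [/\ forall eps, 0 < eps < 1 -> H1 M (w eps), forall eps, 0 < eps < 1 -> L1 M (us eps),
    graph_cvg M w Xi, L1_cvg M us u &
    E_KWC M sigma F eps (us eps) (w eps) @[eps --> 0^'+] --> E0_KWC M sigma F u Xi].
Proof.
have [hu V] := bv; have [ts [tau [S [Te Se _]]]] := ts_fin.
have [w [w1 w2]] := @diagonal (R -> R) (fun=> 1) (good (tau + S)) (@good_mono (tau + S))
  (fun d (d0 : 0 < d) => @good_exists _ _ d Te Se d0).
have smooth eps : C1 (w eps) /\ on_domain M (w eps).
  case: (w1 eps) => [->|[d []]//]; split; first exact: (C1_cst 1).1.
  by case: (M).
have hw eps : 0 < eps < 1 -> H1 M (w eps).
  by move=> _; have [h1 h2] := smooth eps; exact: (C1_weak h1 h2).1.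
have near1 : \forall eps \near (0 : R)^'+, 0 < eps < 1 by apply/near_rightP; exists 1.
have gcw : graph_cvg M w Xi.
  by apply: graph_cvg_le => d d0; apply: filterS (w2 d d0) => eps [].
exists w, (fun=> u); split => //.
  rewrite /L1_cvg; under eq_fun do under eq_integral do rewrite subrr normr0.
  by under eq_fun do rewrite integral0; exact: cvg_cst.
pose D eps := \int[mu]_(t in cell M) edens F eps (w eps) t.
have DE eps : \int[mu]_(t in cell M) density F M eps (w eps) t = D eps.
  by have [h1 h2] := smooth eps; exact: density_edens.
(* The lower bound of the first part applies to the recovery sequence itself, since its graphs
   converge. *)
have D_ge (l : R) : (l%:E < E0_sMM M F Xi)%E -> \forall eps \near (0 : R)^'+, l <= D eps.
  rewrite E0_sMM_esum => hl.
  apply: filterS (sMM_liminf F_cont F_ge0 F_eq0 F_infty hw cG gcw iv hl) => eps.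
  by rewrite DE.
pose om eps := fine (weighted_tv M (interior_dom M) (fun x => (w eps x ^+ 2)%R) u).
have EE : \forall eps \near (0 : R)^'+, E_KWC M sigma F eps u (w eps) = (sigma * om eps + D eps)%:E.
  apply: filterS (filterI near1 (w2 1 ltr01)) => eps [he]; case=> _ _ _ [q ho h] _.
  have e0 : 0 < eps by case/andP: he.
  rewrite /E_KWC (E_sMM_density F_cont (hw eps he) e0).
  by rewrite DE /om ho -EFinM -EFinD.
have om_near d : 0 < d -> \forall eps \near (0 : R)^'+, `|om eps - (tau + S)| <= d.
  by move=> /w2; apply: filterS => eps; case=> _ _ _ [q ho h] _; rewrite /om ho.
have D_le d : 0 < d -> \forall eps \near (0 : R)^'+, ((D eps)%:E <= E0_sMM M F Xi + d%:E)%E.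
  by move=> /w2; apply: filterS => eps; case.
have -> : E0_KWC M sigma F u Xi = ((sigma * (tau + S))%:E + E0_sMM M F Xi)%E.
  rewrite /E0_KWC asboolT//; move: Te Se; rewrite /tv_off /jump_cost => -> ->.
  by rewrite -!EFinM -EFinD mulrDr.
have E00 : (0 <= E0_sMM M F Xi)%E.
  by rewrite E0_sMM_esum; apply: esum_ge0 => x _; rewrite lee_fin cost_ge0.
(* With an infinite limit the upper bound is void, and [D_ge] at every level gives divergence. *)
case: (E0_sMM M F Xi) E00 D_ge D_le => [e| |]// E00 D_ge D_le.
- rewrite -EFinD; apply: cvg_trans (_ : (sigma * om eps + D eps)%:E @[eps --> 0^'+] --> (sigma * (tau + S) + e)%:E).
    by apply: near_eq_cvg; apply: filterS EE => eps ->.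
  apply: cvg_EFin; first exact: nearW.
  apply/cvgrPdist_le => /= d d0.
  have d1 : 0 < d / (2 * (sigma + 1)) by rewrite divr_gt0// mulr_gt0// ltr_wpDl.
  have d2 : 0 < d / 2 by rewrite divr_gt0.
  have he : ((e - d / 2)%:E < e%:E)%E by rewrite lte_fin; lra.
  apply: filterS (filterI (om_near _ d1) (filterI (D_ge _ he) (D_le _ d2))) => eps [h1 [h2]].
  rewrite -EFinD lee_fin => h3.
  have -> : sigma * (tau + S) + e - (sigma * om eps + D eps) =
      - (sigma * (om eps - (tau + S))) + (e - D eps) by ring.
  apply: le_trans (ler_normD _ _) _; rewrite normrN normrM (ger0_norm sigma_ge0).
  have -> : d = d / 2 + d / 2 by field.
  apply: lerD.
    apply: le_trans (ler_wpM2l sigma_ge0 h1) _.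
    have s1 : 0 < sigma + 1 by rewrite ltr_wpDl.
    have -> : sigma * (d / (2 * (sigma + 1))) = (sigma / (sigma + 1)) * (d / 2).
      by field; rewrite gt_eqF.
    by rewrite ler_piMl ?ltW// ltr_pdivrMr// mul1r ltrDl.
  by rewrite ler_norml; apply/andP; split; lra.
- rewrite addey//; apply: cvg_trans (_ : (sigma * om eps + D eps)%:E @[eps --> 0^'+] --> +oo%E).
    by apply: near_eq_cvg; apply: filterS EE => eps ->.
  apply/cvgeyPge => A.
  have hA : ((A - sigma * (tau + S - 1))%:E < +oo)%E by rewrite ltry.
  apply: filterS (filterI (om_near _ ltr01) (D_ge _ hA)) => eps [h1 h2].
  rewrite lee_fin.
  have : sigma * (tau + S - 1) <= sigma * om eps.
    by apply: ler_wpM2l => //; move: h1; rewrite ler_norml => /andP[h _]; lra.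
  by move: h2; move: (sigma * (tau + S - 1)) (sigma * om eps) => z1 z2; lra.
Qed.
End recovery_sequence.

Theorem theorem2p3 (R : realType) (M : domain R) (sigma : R) (F : R -> R)
    (sigma_ge0 : 0 <= sigma)
    (F_cont : continuous F)
    (F_ge0 : forall t, 0 <= F t)
    (F_eq0 : forall t, F t = 0 <-> t = 1)
    (F_infty : (0 < limf_einf (fun t => (F t)%:E) norm_infty)%E) :
  (forall (v us : R -> R -> R) (Xi : R -> set R) (u : R -> R),
     (forall eps, 0 < eps < 1 -> H1 M (v eps)) ->
     compact_graph M Xi ->
     graph_cvg M v Xi ->
     (forall eps, 0 < eps < 1 -> L1 M (us eps)) ->
     L1 M u ->
     L1_cvg M us u ->
     (* Both conditions are needed: E0_KWC is +oo for sigma = 0 and u not in BV,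
        although E_KWC does not then see u; and a v crossing 0 on its way to
        xi_minus < 0 lets u jump at no cost, whereas E0_KWC charges
        jump * xi_minus ^ 2 *)
     (sigma = 0 -> BV M u) ->
     (0 < sigma -> BV M u -> A0 M Xi ->
        forall x, jump_set M u x -> exceptional M Xi x ->
          0 <= xi_minus Xi x) ->
     (E0_KWC M sigma F u Xi <=
        limf_einf (fun eps => E_KWC M sigma F eps (us eps) (v eps)) 0^'+)%E)
  /\
  (forall (Xi : R -> set R) (u : R -> R),
     A0 M Xi -> BV M u ->
     exists w us : R -> R -> R,
       [/\ forall eps, 0 < eps < 1 -> H1 M (w eps),
           forall eps, 0 < eps < 1 -> L1 M (us eps),
           graph_cvg M w Xi,
           L1_cvg M us u &
           E_KWC M sigma F eps (us eps) (w eps) @[eps --> 0^'+] -->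
             E0_KWC M sigma F u Xi]).
Proof.
split.
- move=> v us Xi u hv cG gc hus hu cu s0 xi0; exact: liminf_inequality.
- move=> Xi u a0 bv; exact: limsup_inequality.
Qed.
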